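(* Let $\beta>0$ and let $-A$ be the generator of a polynomially stable $C_0$-semigroup with parameter $\beta$ on a Hilbert space $H$. Then, for all $\alpha>0$, $$\|e^{-tA^{-1}}A^{-\alpha}\| = O\left(\frac{(\log t)^{k+1}}{t^{\alpha/(2+\beta)}}\right)\quad(t\to\infty),\qquad\text{where } k := \left\lfloor\frac{2\alpha}{2+\beta}\right\rfloor.$$
   Context: Hilbert spaces are complex. A $C_0$-semigroup $(e^{-tA})_{t\ge 0}$ with generator $-A$ is called polynomially stable with parameter $\beta>0$ if $\sup_{t\ge 0}\|e^{-tA}\|<\infty$ and $\|e^{-tA}(I+A)^{-1}\| = O(t^{-1/\beta})$ as $t\to\infty$. It is known that in this case $A$ has a bounded inverse, so the bounded operators $A^{-\alpha}$, $\alpha>0$, are defined as fractional powers (via the sectorial functional calculus), and $e^{-tA^{-1}}$ is the exponential of the bounded operator $-tA^{-1}$. The notation $f(t)=O(g(t))$ as $t\to\infty$ means that $f(t)\le Mg(t)$ for all $t\ge t_1$, for some constants $M>0$ and $t_1$. For real $\xi$, $\lfloor \xi\rfloor := \max\{k\in\mathbb{Z}: k\le \xi\}$. *)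

(* Defs.v *)
From Stdlib Require Import Reals Factorial.
From Coquelicot Require Import Coquelicot.

Open Scope R_scope.

(** * Complex Hilbert spaces *)

(* The inner product is linear in its first argument. *)
Record HilbertSpace := {
  hilbert_space :> CompleteNormedModule C_AbsRing;
  inner : hilbert_space -> hilbert_space -> C;
  inner_plus_l : forall x y z,
    inner (plus x y) z = Cplus (inner x z) (inner y z);
  inner_scal_l : forall (c : C) x y,
    inner (scal c x) y = Cmult c (inner x y);
  inner_conj : forall x y, inner y x = Cconj (inner x y);
  inner_norm : forall x, inner x x = RtoC (norm x ^ 2)
}.

(* Coquelicot's vector-valued integral is defined on real modules only, hence
   the restriction of scalars from [C] to [R].  It is deliberately not
   canonical: it would compete with the complex structure of the same type. *)
Section RestrictionOfScalars.
Variable V : CompleteNormedModule C_AbsRing.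

Let rscal (r : R) (x : V) : V := scal (RtoC r) x.

Lemma rscal_assoc (r s : R) (x : V) : rscal r (rscal s x) = rscal (mult r s) x.
Proof.
unfold rscal; rewrite scal_assoc; f_equal.
symmetry; apply RtoC_mult.
Qed.

Lemma rscal_one (x : V) : rscal one x = x.
Proof. unfold rscal; apply (@scal_one C_Ring V). Qed.

Lemma rscal_distr_l (r : R) (x y : V) :
  rscal r (plus x y) = plus (rscal r x) (rscal r y).
Proof. unfold rscal; apply (@scal_distr_l C_Ring V). Qed.

Lemma rscal_distr_r (r s : R) (x : V) :
  rscal (plus r s) x = plus (rscal r x) (rscal s x).
Proof.
unfold rscal.
rewrite <- (@scal_distr_r C_Ring V); f_equal.
apply RtoC_plus.
Qed.

Lemma rscal_norm (r : R) (x : V) : norm (rscal r x) <= abs r * norm x.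
Proof.
unfold rscal.
apply Rle_trans with (1 := norm_scal (RtoC r) x).
change (Cmod (RtoC r) * norm x <= Rabs r * norm x).
rewrite Cmod_R; apply Rle_refl.
Qed.

Definition real_ModuleSpace : ModuleSpace R_Ring :=
  ModuleSpace.Pack R_Ring V
    (ModuleSpace.Class R_Ring V (AbelianGroup.class V)
      (ModuleSpace.Mixin R_Ring V rscal
         rscal_assoc rscal_one rscal_distr_l rscal_distr_r)) V.

Definition real_NormedModuleAux : NormedModuleAux R_AbsRing :=
  NormedModuleAux.Pack R_AbsRing V
    (NormedModuleAux.Class R_AbsRing V
       (ModuleSpace.class R_Ring real_ModuleSpace) (UniformSpace.class V)) V.

Definition real_NormedModule : NormedModule R_AbsRing :=
  NormedModule.Pack R_AbsRing V
    (NormedModule.Class R_AbsRing V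
       (NormedModuleAux.class R_AbsRing real_NormedModuleAux)
       (NormedModule.Mixin R_AbsRing real_NormedModuleAux
          (@norm C_AbsRing V) (@norm_factor C_AbsRing V)
          (@norm_triangle C_AbsRing V) rscal_norm
          (@norm_compat1 C_AbsRing V) (@norm_compat2 C_AbsRing V)
          (@norm_eq_zero C_AbsRing V))) V.

Definition real_CompleteNormedModule : CompleteNormedModule R_AbsRing :=
  CompleteNormedModule.Pack R_AbsRing V
    (CompleteNormedModule.Class R_AbsRing V
       (NormedModule.class R_AbsRing real_NormedModule)
       (CompleteNormedModule.mixin C_AbsRing V
          (CompleteNormedModule.class C_AbsRing V))) V.

End RestrictionOfScalars.

(** * Operators *)

Section Operators.
Variable H : HilbertSpace.

Definition op_norm (B : H -> H) : Rbar :=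
  Lub_Rbar (fun r => exists x : H, norm x <= 1 /\ r = norm (B x)).

(* An unbounded operator is given by its graph: [A x y] means that [x] is in
   the domain of [A] and [A x = y]. *)
Definition operator := H -> H -> Prop.

Definition op_opp (A : operator) : operator := fun x y => A x (opp y).

(* [I + A] *)
Definition op_one_plus (A : operator) : operator :=
  fun x y => exists w, A x w /\ y = plus x w.

(* [z - A] *)
Definition op_scalar_minus (z : C) (A : operator) : operator :=
  fun x y => exists w, A x w /\ y = minus (scal z x) w.

(* The everywhere defined inverse; [iota] returns the unique solution [x] of
   [A x = y], and a junk value if [A] is not bijective. *)
Definition op_inv (A : operator) : H -> H := fun y => iota (fun x => A x y).

(* [(z - A)^{-1}] *)
Definition resolvent (A : operator) (z : C) : H -> H :=
  op_inv (op_scalar_minus z A).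

Definition exp_op (B : H -> H) : H -> H := fun x =>
  iota (is_series (fun n => scal (RtoC (/ INR (fact n))) (Nat.iter n B x))).

(** * C_0-semigroups *)

Record C0_semigroup (T : R -> H -> H) : Prop := {
  C0_linear : forall t, 0 <= t -> is_linear (T t); (* includes boundedness *)
  C0_zero : forall x, T 0 x = x;
  C0_plus : forall s t x, 0 <= s -> 0 <= t -> T (s + t) x = T s (T t x);
  C0_continuous : forall x, filterlim (fun t => T t x) (at_right 0) (locally x)
}.

Definition is_generator (T : R -> H -> H) (G : operator) : Prop :=
  forall x y, G x y <->
    filterlim (fun t => scal (RtoC (/ t)) (minus (T t x) x))
              (at_right 0) (locally y).

End Operators.

Arguments op_norm {H} B.
Arguments op_opp {H} A.
Arguments op_one_plus {H} A.
Arguments op_scalar_minus {H} z A.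
Arguments op_inv {H} A.
Arguments resolvent {H} A z.
Arguments exp_op {H} B.
Arguments C0_semigroup {H} T.
Arguments is_generator {H} T G.

(* [f] is [Rbar]-valued because operator norms are. *)
Definition bigO (f : R -> Rbar) (g : R -> R) : Prop :=
  exists M t1 : R, 0 < M /\ forall t, t1 <= t -> Rbar_le (f t) (M * g t).

(* [T t] is the operator [e^{-tA}]. *)
Definition polynomially_stable {H : HilbertSpace} (T : R -> H -> H)
    (A : operator H) (beta : R) : Prop :=
  (exists M : R, forall t, 0 <= t -> Rbar_le (op_norm (T t)) M) /\
  bigO (fun t => op_norm (fun x => T t (op_inv (op_one_plus A) x)))
       (fun t => Rpower t (- (1 / beta))).

(** * Sectorial functional calculus and fractional powers *)

Definition cis (theta : R) : C := (cos theta, sin theta).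

(* Half-angle formula for the principal argument on C \ (-oo, 0]. *)
Definition arg (z : C) : R := 2 * atan (snd z / (Cmod z + fst z)).

(* Principal branch of [z^a] on C \ (-oo, 0]. *)
Definition cpower (z : C) (a : R) : C :=
  Cmult (RtoC (Rpower (Cmod z) a)) (cis (a * arg z)).

Section FunctionalCalculus.
Variable H : HilbertSpace.
Variable A : operator H.

(* Integral of [f(z) (z - A)^{-1} x] along the ray [{r e^{i theta} : r > 0}],
   oriented from 0 to infinity. *)
Definition ray_integral (f : C -> C) (theta : R) (x : H) : H :=
  RInt_gen (V := real_CompleteNormedModule H)
    (fun r => let z := Cmult (RtoC r) (cis theta) in
       scal (Cmult (f z) (cis theta)) (resolvent A z x) : H)
    (at_right 0) (Rbar_locally p_infty).

(* [f(A) = (2 pi i)^{-1} \int_Gamma f(z) (z - A)^{-1} dz] for [f] holomorphic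
   on a sector and decaying polynomially at 0 and at infinity, [Gamma] being
   the boundary of the sector [|arg z| < 3 pi / 4] with the sector on its
   left.  The negative generator of a bounded semigroup is sectorial of angle
   (at most) [pi / 2], and by Cauchy's theorem every half-opening in
   [(pi / 2, pi)] gives the same operator. *)
Definition sectorial_integral (f : C -> C) (x : H) : H :=
  scal (Cinv (Cmult (RtoC (2 * PI)) Ci))
       (minus (ray_integral f (- (3 * PI / 4)) x)
              (ray_integral f (3 * PI / 4) x)).

(* [(z / (1 + z)^2)^n]; for [n > alpha] both this function and its product
   with [z^{-alpha}] decay polynomially at 0 and at infinity. *)
Definition regularizer (n : nat) (z : C) : C :=
  pow_n (Cdiv z (Cmult (Cplus 1 z) (Cplus 1 z))) n.

(* [A^{-alpha} = e(A)^{-1} (e f)(A)], with [f(z) = z^{-alpha}], [e] the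
   regularizer above and [n = floor(alpha) + 1]: the extension of the calculus
   by regularization, [e(A)] being injective when [A] is. *)
Definition neg_frac_power (alpha : R) (x : H) : H :=
  let e := regularizer (Z.to_nat (up alpha)) in
  iota (fun y : H => sectorial_integral e y =
          sectorial_integral (fun z => Cmult (e z) (cpower z (- alpha))) x).

End FunctionalCalculus.

Arguments ray_integral {H} A f theta x.
Arguments sectorial_integral {H} A f x.
Arguments neg_frac_power {H} A alpha x.

(* Main.v *)
(* Write [B = A^{-1}] and [K_r = (1 + r A)^{-1}].  Up to a nonzero constant,
   [A^{-alpha} x] is the absolutely convergent integral of
   [e^{alpha v} K_{e^v}^m x] over the real line ([m > alpha]), so the decay of
   [e^{-tB} A^{-alpha}] follows from bounds of [e^{-tB} K_r^m] uniform in [r].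

   These come from an energy argument.  Put [F_e = (e + A)^{-1}].  For [K]
   commuting with the semigroup, the integral over [[0, N]] of
   [|e^{-es} T(s) K x|^2] is a Lyapunov form for [y' = - F_e y], and the same
   holds for the adjoints.  Pairing both dissipations along
   [e^{-(t-s) F_b} e^{-s F_a}] bounds [K^2 (e^{-t F_a} - e^{-t F_b})] by
   [|a - b| Q] and, similarly, [t K^2 F_e^2 e^{-t F_e}] by [Q], where [Q] is the
   size of the forms.  With [K = K_r] one has [Q ~ 1/e], and summing over
   dyadic [e] between [1/t] and [t] gives [|e^{-tB} K_r^2| <= C (1 + log t)].
   With [K = K_r^j], [j >= beta], polynomial stability gives [Q ~ r^{-beta}]
   uniformly in [e], whence [|e^{-tB} K_r^{2j+2}| <= C / (r^{2+beta} t)].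
   Splitting the integral at [r = t^{-1/(2+beta)}] yields the bound
   [C (1 + log t) t^{-alpha/(2+beta)}], which is at least as good as the one
   claimed.

   The contour integrals of the functional calculus are handled in the
   coordinate [z = e^{u + i t}], where Cauchy's theorem is the independence
   of integrals over horizontal lines of [t]. *)

Require Import Defs.
From Stdlib Require FunctionalExtensionality.
From Stdlib Require Import Reals Lra Lia List Factorial ZArith.
From Coquelicot Require Import Coquelicot.

Open Scope R_scope.

(** The orbit T(s) K_r x may decay too slowly to be square integrable, whence the damping [e]. Even
    the damped integral is cut at a finite horizon [N], where the damped semigroup has norm at most
    1/2; the cut costs only the factor 1/2 in [lyap_ge]. The endpoints of the dyadic sum are the
    places where [e] becomes harmless: for e = 1/t the difference B - F_e has norm of order 1/t, and
    for e >= t the norm of t F_e is bounded. The exponent 2 + beta collects r^{-beta} from Q and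
    r^{-2} from writing each of two factors K_r as r^{-1} times a bounded operator times F_e. A
    bound of order r^{-(2+beta)} / t is not integrable against e^{alpha v} near infinity when alpha
    >= 2 + beta; writing e^{-tB} as the mu-th power of e^{-(t/mu)B} with mu > alpha raises the bound
    to the power mu. For vector-valued functions, differentiability is carried as a quadratic bound
    on increments, from which monotonicity, Lipschitz bounds and constancy follow by subdivision.
    Adjoints are taken for the real inner product only. *)

Notation cmodule := (CompleteNormedModule C_AbsRing).

(* Coquelicot elaborates [plus], [norm] etc. with several convertible but
   syntactically different structures; these wrappers fix one of them. *)
Section Wrappers.
Variable V : cmodule.
Definition vadd (x y : V) : V := plus x y.
Definition vsub (x y : V) : V := minus x y.
Definition vneg (x : V) : V := opp x.
Definition vscal (c : C) (x : V) : V := scal c x.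
Definition vzero : V := zero.
Definition vnorm (x : V) : R := norm x.
End Wrappers.
Arguments vadd {V} x y.
Arguments vsub {V} x y.
Arguments vneg {V} x.
Arguments vscal {V} c%_C x.
Arguments vzero {V}.
Arguments vnorm {V} x.

Declare Scope vec_scope.
Delimit Scope vec_scope with V.
Notation "x + y" := (vadd x y) : vec_scope.
Notation "x - y" := (vsub x y) : vec_scope.
Notation "- x" := (vneg x) : vec_scope.
Notation "c * x" := (vscal c x) : vec_scope.
Notation "|{ x }|" := (vnorm x%V) (at level 0, x at level 99, format "|{ x }|") : R_scope.

(** * Linear identities in complex modules, by reflection *)

Inductive mexp :=
  | MVar (n : nat) | MZero | MPlus (a b : mexp) | MMinus (a b : mexp)
  | MOpp (a : mexp) | MScal (c : C) (a : mexp).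

Section Reflection.
Variable V : ModuleSpace C_Ring.

Fixpoint mdenote (l : list V) (e : mexp) : V :=
  match e with
  | MVar n => nth n l zero
  | MZero => zero
  | MPlus a b => plus (mdenote l a) (mdenote l b)
  | MMinus a b => minus (mdenote l a) (mdenote l b)
  | MOpp a => opp (mdenote l a)
  | MScal c a => scal c (mdenote l a)
  end.

Fixpoint mcoef (e : mexp) (i : nat) : C :=
  match e with
  | MVar n => if Nat.eqb i n then RtoC 1 else RtoC 0
  | MZero => RtoC 0
  | MPlus a b => Cplus (mcoef a i) (mcoef b i)
  | MMinus a b => Cminus (mcoef a i) (mcoef b i)
  | MOpp a => Copp (mcoef a i)
  | MScal c a => Cmult c (mcoef a i)
  end.

Fixpoint mcomb (l : list V) (c : nat -> C) : V :=
  match l with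
  | nil => zero
  | cons x l => plus (scal (c 0%nat) x) (mcomb l (fun i => c (S i)))
  end.

Lemma mcomb_zero l c : (forall i, c i = RtoC 0) -> mcomb l c = zero.
Proof.
revert c; induction l as [|x l IH]; intros c Hc; simpl; [reflexivity|].
rewrite (IH _ (fun i => Hc (S i))), Hc.
change (RtoC 0) with (@zero C_Ring).
now rewrite scal_zero_l, plus_zero_l.
Qed.

Lemma mcomb_plus l c d :
  mcomb l (fun i => Cplus (c i) (d i)) = plus (mcomb l c) (mcomb l d).
Proof.
revert c d; induction l as [|x l IH]; intros c d; simpl.
- now rewrite plus_zero_l.
- rewrite (IH (fun i => c (S i)) (fun i => d (S i))).
  change (Cplus (c 0%nat) (d 0%nat)) with (@plus C_Ring (c 0%nat) (d 0%nat)).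
  rewrite scal_distr_r, <- !plus_assoc; f_equal.
  rewrite !plus_assoc; f_equal; apply plus_comm.
Qed.

Lemma mcomb_scal l a c :
  mcomb l (fun i => Cmult a (c i)) = scal a (mcomb l c).
Proof.
revert c; induction l as [|x l IH]; intros c; simpl.
- now rewrite scal_zero_r.
- rewrite (IH (fun i => c (S i))), scal_distr_l, scal_assoc; reflexivity.
Qed.

Lemma mcomb_ext l c d : (forall i, c i = d i) -> mcomb l c = mcomb l d.
Proof.
revert c d; induction l as [|x l IH]; intros c d Hc; simpl; [reflexivity|].
now rewrite Hc, (IH _ _ (fun i => Hc (S i))).
Qed.

Lemma mcomb_var l n :
  mcomb l (fun i => if Nat.eqb i n then RtoC 1 else RtoC 0) = nth n l zero.
Proof.
revert n; induction l as [|x l IH]; intros [|n]; simpl; try reflexivity.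
- rewrite mcomb_zero by reflexivity.
  change (RtoC 1) with (@one C_Ring).
  now rewrite scal_one, plus_zero_r.
- change (RtoC 0) with (@zero C_Ring) at 1.
  now rewrite scal_zero_l, plus_zero_l.
Qed.

Lemma mdenote_mcomb l e : mdenote l e = mcomb l (mcoef e).
Proof.
induction e as [n| |a IHa b IHb|a IHa b IHb|a IHa|c a IHa]; simpl.
- symmetry; apply mcomb_var.
- now rewrite mcomb_zero.
- rewrite IHa, IHb; symmetry; apply mcomb_plus.
- unfold minus; rewrite IHa, IHb, <- scal_opp_one.
  change (@opp C_Ring one) with (Copp (RtoC 1)).
  rewrite <- mcomb_scal, <- mcomb_plus; apply mcomb_ext; intros i; ring.
- rewrite IHa, <- scal_opp_one.
  change (@opp C_Ring one) with (Copp (RtoC 1)).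
  rewrite <- mcomb_scal; apply mcomb_ext; intros i; ring.
- rewrite IHa; symmetry; apply mcomb_scal.
Qed.

Fixpoint coef_eq (n : nat) (c d : nat -> C) : Prop :=
  match n with
  | O => True
  | S n => c O = d O /\ coef_eq n (fun i => c (S i)) (fun i => d (S i))
  end.

(** An expression is determined by its coefficients in the listed vectors, so an identity between
    vectors reduces to one scalar identity per vector. *)
Lemma mexp_eq l e1 e2 :
  coef_eq (length l) (mcoef e1) (mcoef e2) -> mdenote l e1 = mdenote l e2.
Proof.
rewrite !mdenote_mcomb; generalize (mcoef e1) (mcoef e2).
induction l as [|x l IH]; intros c d Hc; simpl in *; [reflexivity|].
destruct Hc as [-> Hc]; f_equal; now apply IH.
Qed.

End Reflection.

Ltac m_in x l :=
  match l with
  | nil => constr:(false)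
  | cons x _ => constr:(true)
  | cons _ ?t => m_in x t
  end.
Ltac m_index x l :=
  match l with
  | cons x _ => constr:(O)
  | cons _ ?t => let n := m_index x t in constr:(S n)
  end.
Ltac m_vars e l :=
  match e with
  | vzero => l
  | vadd ?a ?b => let l1 := m_vars a l in m_vars b l1
  | vsub ?a ?b => let l1 := m_vars a l in m_vars b l1
  | vneg ?a => m_vars a l
  | vscal ?c ?a => m_vars a l
  | _ => match m_in e l with true => l | false => constr:(cons e l) end
  end.
Ltac m_reify e l :=
  match e with
  | vzero => constr:(MZero)
  | vadd ?a ?b => let x := m_reify a l in let y := m_reify b l in constr:(MPlus x y)
  | vsub ?a ?b => let x := m_reify a l in let y := m_reify b l in constr:(MMinus x y)
  | vneg ?a => let x := m_reify a l in constr:(MOpp x)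
  | vscal ?c ?a => let x := m_reify a l in constr:(MScal c x)
  | _ => let n := m_index e l in constr:(MVar n)
  end.

Ltac m_space :=
  match goal with
  | |- @eq (CompleteNormedModule.sort _ ?V) _ _ => V
  | |- context [@vadd ?V] => V
  | |- context [@vsub ?V] => V
  | |- context [@vneg ?V] => V
  | |- context [@vscal ?V] => V
  end.

Ltac m_setup :=
  let V := m_space in
  match goal with
  | |- @eq _ ?a ?b =>
    let l0 := constr:(@nil (CompleteNormedModule.sort C_AbsRing V)) in
    let l1 := m_vars a l0 in
    let l := m_vars b l1 in
    let x := m_reify a l in
    let y := m_reify b l in
    refine (mexp_eq (CompleteNormedModule.ModuleSpace C_AbsRing V) l x y _);
    cbv [coef_eq mcoef length Nat.eqb];
    repeat split;
    try match goal with |- @eq _ ?a ?b => change (@eq C a b) end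
  end.

(** The second alternative passes to real and imaginary parts, for coefficients in which real
    arithmetic sits under [RtoC]. *)
Ltac c_eq := first [ ring | apply injective_projections; simpl; ring ].
Ltac module := m_setup; try c_eq.

(** * Quadratic increments *)

Lemma le_of_le_plus_inv (x y C : R) :
  (forall n, x <= y + C / INR (S n)) -> x <= y.
Proof.
intros Hx; apply Rnot_lt_le; intros Hlt.
destruct (nfloor_ex (Rmax 0 (C / (x - y))) (Rmax_l _ _)) as [n [_ Hn]].
specialize (Hx n).
assert (Hp : 0 < INR (S n)) by (apply lt_0_INR; lia).
assert (H1 : C / (x - y) < INR (S n)).
{ rewrite S_INR; apply Rle_lt_trans with (2 := Hn), Rmax_r. }
apply Rlt_div_l in H1; [|lra].
assert (C / INR (S n) < x - y) by (apply Rlt_div_l; [exact Hp|lra]).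
lra.
Qed.

(** Substitute for the sign of a derivative: over n + 1 equal pieces of [a, b] the increments add up
    to at most C (b - a)^2 / (n + 1), which tends to 0. *)
Lemma quad_mono (f : R -> R) (a b C : R) :
  a <= b ->
  (forall u v, a <= u -> u <= v -> v <= b -> f v - f u <= C * (v - u) ^ 2) ->
  f b <= f a.
Proof.
intros Hab Hf.
apply (le_of_le_plus_inv _ _ (C * (b - a) ^ 2)); intros n.
set (N := INR (S n)).
assert (HN : 0 < N) by (apply lt_0_INR; lia).
assert (Hk : forall k, (k <= S n)%nat ->
  f (a + (b - a) / N * INR k) <= f a + C * ((b - a) / N) ^ 2 * INR k).
{ set (h := (b - a) / N).
  assert (Hh : 0 <= h) by (apply Rdiv_le_0_compat; lra).
  assert (HhN : h * N = b - a) by (unfold h; field; lra).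
  induction k as [|k IH]; intros Hk.
  - simpl INR; rewrite !Rmult_0_r, !Rplus_0_r; lra.
  - specialize (IH ltac:(lia)).
    assert (Hkn : INR (S k) <= N) by (apply le_INR; lia).
    assert (0 <= INR k) by apply pos_INR.
    rewrite S_INR in *.
    specialize (Hf (a + h * INR k) (a + h * (INR k + 1))).
    assert (h * (INR k + 1) <= h * N) by (apply Rmult_le_compat_l; lra).
    assert (0 <= h * INR k) by (apply Rmult_le_pos; lra).
    replace (a + h * (INR k + 1) - (a + h * INR k)) with h in Hf by ring.
    specialize (Hf ltac:(lra) ltac:(lra) ltac:(lra)). lra. }
specialize (Hk (S n) (le_n _)); fold N in Hk.
replace (a + (b - a) / N * N) with b in Hk by (field; lra).
replace (C * ((b - a) / N) ^ 2 * N) with (C * (b - a) ^ 2 / N) in Hk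
  by (field; lra).
exact Hk.
Qed.

Lemma vnorm_ge_0 {V : cmodule} (x : V) : 0 <= |{x}|.
Proof. exact (@norm_ge_0 C_AbsRing V x). Qed.

Lemma norm_tri {V : cmodule} (x y : V) : |{x + y}| <= |{x}| + |{y}|.
Proof. exact (@norm_triangle C_AbsRing V x y). Qed.

Lemma norm_oppV {V : cmodule} (x : V) : |{- x}| = |{x}|.
Proof. exact (@norm_opp C_AbsRing V x). Qed.

Lemma norm_minus_diag {V : cmodule} (x : V) : |{x - x}| = 0.
Proof. unfold vnorm, vsub; rewrite minus_eq_zero; exact (@norm_zero C_AbsRing V). Qed.

Lemma quad_lip {V : cmodule} (f : R -> V) (a b K C : R) :
  a <= b ->
  (forall u v, a <= u -> u <= v -> v <= b ->
     |{f v - f u}| <= K * (v - u) + C * (v - u) ^ 2) ->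
  |{f b - f a}| <= K * (b - a).
Proof.
intros Hab Hf.
generalize (quad_mono (fun v => |{f v - f a}| - K * (v - a)) a b C Hab).
intros Hm.
cut (|{f b - f a}| - K * (b - a) <= |{f a - f a}| - K * (a - a)).
{ rewrite norm_minus_diag; lra. }
apply Hm; intros u v Hu Huv Hv.
specialize (Hf u v Hu Huv Hv).
replace (f v - f a)%V with ((f v - f u) + (f u - f a))%V
  by module.
assert (H := norm_tri (f v - f u)%V (f u - f a)%V).
lra.
Qed.

Lemma norm_le_0 {V : cmodule} (x : V) : |{x}| <= 0 -> x = vzero.
Proof.
intros Hx; apply (@norm_eq_zero C_AbsRing V).
apply Rle_antisym; [exact Hx|apply (@norm_ge_0 C_AbsRing V)].
Qed.

Lemma minus_zero_eq {V : cmodule} (x y : V) : (x - y)%V = vzero -> x = y.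
Proof.
intros Hxy.
replace x with ((x - y) + y)%V by module.
rewrite Hxy; module.
Qed.

Lemma quad_const {V : cmodule} (f : R -> V) (a b C : R) :
  a <= b ->
  (forall u v, a <= u -> u <= v -> v <= b -> |{f v - f u}| <= C * (v - u) ^ 2) ->
  f b = f a.
Proof.
intros Hab Hf; apply minus_zero_eq, norm_le_0.
replace 0 with (0 * (b - a)) by ring.
apply quad_lip with C; [exact Hab|].
intros u v Hu Huv Hv; rewrite Rmult_0_l, Rplus_0_l; now apply Hf.
Qed.

(** * Norms *)

Lemma norm_scal_C {V : cmodule} (c : C) (x : V) : |{c * x}| <= Cmod c * |{x}|.
Proof. exact (@norm_scal C_AbsRing V c x). Qed.

Lemma norm_scal_R {V : cmodule} (r : R) (x : V) :
  |{RtoC r * x}| <= Rabs r * |{x}|.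
Proof. rewrite <- Cmod_R; apply norm_scal_C. Qed.

(** The reverse inequality is [norm_scal_C] applied to the factor [Cinv c]. *)
Lemma norm_scal_C_eq {V : cmodule} (c : C) (x : V) : |{c * x}| = Cmod c * |{x}|.
Proof.
apply Rle_antisym; [apply norm_scal_C|].
destruct (Ceq_dec c 0) as [->|Hc].
- rewrite Cmod_0, Rmult_0_l; apply vnorm_ge_0.
- assert (Hx : x = (Cinv c * (c * x))%V).
  { replace (Cinv c * (c * x))%V with ((Cinv c * c)%C * x)%V by module.
    rewrite Cinv_l by exact Hc; module. }
  assert (Hm : 0 < Cmod c) by now apply Cmod_gt_0.
  rewrite Hx at 1.
  apply Rle_trans with (Cmod c * (Cmod (Cinv c) * |{c * x}|)).
  + apply Rmult_le_compat_l; [lra|apply norm_scal_C].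
  + rewrite Cmod_inv by exact Hc.
    right; field; lra.
Qed.

Lemma norm_scal_R_eq {V : cmodule} (r : R) (x : V) :
  |{RtoC r * x}| = Rabs r * |{x}|.
Proof. rewrite <- Cmod_R; apply norm_scal_C_eq. Qed.

Lemma norm_minus_sym {V : cmodule} (x y : V) : |{x - y}| = |{y - x}|.
Proof. rewrite <- norm_oppV; f_equal; module. Qed.

Lemma norm_minus_le {V : cmodule} (x y : V) : |{x - y}| <= |{x}| + |{y}|.
Proof.
replace (x - y)%V with (x + - y)%V by module.
rewrite <- (norm_oppV y); apply norm_tri.
Qed.

Lemma norm_le_minus {V : cmodule} (x y : V) : |{x}| <= |{x - y}| + |{y}|.
Proof.
replace x with ((x - y) + y)%V at 1 by module; apply norm_tri.
Qed.

Lemma norm_plus3 {V : cmodule} (x y z : V) :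
  |{x + y + z}| <= |{x}| + |{y}| + |{z}|.
Proof.
assert (H1 := norm_tri (x + y)%V z).
assert (H2 := norm_tri x y); lra.
Qed.

Lemma le_of_le_eps (x y : R) : (forall e, 0 < e -> x <= y + e) -> x <= y.
Proof.
intros Hx; apply Rnot_lt_le; intros Hlt.
specialize (Hx ((x - y) / 2) ltac:(lra)); lra.
Qed.

Lemma norm_unique_eps {V : cmodule} (x y : V) :
  (forall e, 0 < e -> |{x - y}| <= e) -> x = y.
Proof.
intros Hx; apply minus_zero_eq, norm_le_0, le_of_le_eps.
intros e He; rewrite Rplus_0_l; now apply Hx.
Qed.

(** * Bounded operators *)

Definition bdd {V W : cmodule} (L : V -> W) (c : R) : Prop :=
  forall x, |{L x}| <= c * |{x}|.

Record lin {V W : cmodule} (L : V -> W) : Prop := {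
  lin_add : forall x y, L (x + y)%V = (L x + L y)%V;
  lin_scal : forall c x, L (c * x)%V = (c * L x)%V;
  lin_bdd : exists c, 0 < c /\ bdd L c
}.

Lemma is_linear_lin {V W : cmodule} (L : V -> W) : is_linear L <-> lin L.
Proof. split; intros [H1 H2 H3]; split; assumption. Qed.

Section LinearMaps.
Context {V W : cmodule}.
Implicit Types L : V -> W.

Lemma lin_zero L : lin L -> L vzero = vzero.
Proof.
intros HL; replace (vzero : V) with (RtoC 0 * (@vzero V))%V by module.
rewrite (lin_scal L HL); module.
Qed.

Lemma lin_neg L x : lin L -> L (- x)%V = (- L x)%V.
Proof.
intros HL; replace (- x)%V with (RtoC (-1) * x)%V by module.
rewrite (lin_scal L HL); module.
Qed.

Lemma lin_sub L x y : lin L -> L (x - y)%V = (L x - L y)%V.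
Proof.
intros HL; replace (x - y)%V with (x + - y)%V by module.
rewrite (lin_add L HL), lin_neg by exact HL; module.
Qed.

Lemma bdd_lin L (c : R) :
  (forall x y, L (x + y)%V = (L x + L y)%V) ->
  (forall c x, L (c * x)%V = (c * L x)%V) -> bdd L c -> lin L.
Proof.
intros H1 H2 H3; split; [exact H1|exact H2|].
exists (Rmax 1 c); split; [apply Rlt_le_trans with 1, Rmax_l; lra|].
intros x; apply Rle_trans with (1 := H3 x).
apply Rmult_le_compat_r; [apply vnorm_ge_0|apply Rmax_r].
Qed.

Lemma bdd_ge L (c d : R) : c <= d -> bdd L c -> bdd L d.
Proof.
intros Hc HK x; apply Rle_trans with (1 := HK _).
apply Rmult_le_compat_r; [apply vnorm_ge_0|exact Hc].
Qed.

Lemma lin_ext L L' : (forall x, L x = L' x) -> lin L -> lin L'.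
Proof.
intros He [H1 H2 [c [Hc H3]]]; split.
- intros x y; rewrite <- !He; apply H1.
- intros a x; rewrite <- !He; apply H2.
- exists c; split; [exact Hc|]; intros x; rewrite <- He; apply H3.
Qed.

End LinearMaps.

Lemma lin_comp {U V W : cmodule} (K : V -> W) (L : U -> V) :
  lin K -> lin L -> lin (fun x => K (L x)).
Proof.
intros [K1 K2 [c [Hc K3]]] [L1 L2 [d [Hd L3]]]; apply (bdd_lin _ (c * d)).
- intros x y; now rewrite L1, K1.
- intros a x; now rewrite L2, K2.
- intros x; apply Rle_trans with (1 := K3 _).
  rewrite Rmult_assoc; apply Rmult_le_compat_l; [lra|apply L3].
Qed.

Section Operations.
Context {V : cmodule}.
Implicit Types K L : V -> V.

Lemma bdd_comp K L (c d : R) :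
  0 <= c -> bdd K c -> bdd L d -> bdd (fun x => K (L x)) (c * d).
Proof.
intros Hc HK HL x; apply Rle_trans with (1 := HK _).
rewrite Rmult_assoc; apply Rmult_le_compat_l; auto.
Qed.

Lemma bdd_iter K (c : R) n :
  0 <= c -> bdd K c -> bdd (Nat.iter n K) (c ^ n).
Proof.
intros Hc HK; induction n as [|n IH]; simpl.
- intros x; simpl; lra.
- now apply (bdd_comp K).
Qed.

Lemma lin_id : lin (fun x : V => x).
Proof. apply (bdd_lin _ 1); [reflexivity|reflexivity|intros x; lra]. Qed.

Lemma lin_vscal (c : C) : lin (fun x : V => c * x)%V.
Proof.
apply (bdd_lin _ (Cmod c)); [intros; module|intros; module|].
intros x; apply norm_scal_C.
Qed.

Lemma lin_vadd K L : lin K -> lin L -> lin (fun x => K x + L x)%V.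
Proof.
intros [K1 K2 [c [Hc K3]]] [L1 L2 [d [Hd L3]]]; apply (bdd_lin _ (c + d)).
- intros x y; rewrite L1, K1; module.
- intros a x; rewrite L2, K2; module.
- intros x; apply Rle_trans with (1 := norm_tri _ _).
  specialize (K3 x); specialize (L3 x); lra.
Qed.

Lemma lin_vsub K L : lin K -> lin L -> lin (fun x => K x - L x)%V.
Proof.
intros HK HL; apply lin_ext with (fun x => K x + RtoC (-1) * L x)%V.
- intros x; module.
- apply lin_vadd; [exact HK|]; apply lin_comp; [apply lin_vscal|exact HL].
Qed.

Lemma lin_iter K n : lin K -> lin (Nat.iter n K).
Proof.
intros HK; induction n as [|n IH]; simpl.
- apply lin_id.
- exact (lin_comp K (Nat.iter n K) HK IH).
Qed.

End Operations.

Lemma iter_comm {V : Type} (K L : V -> V) n x :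
  (forall y, K (L y) = L (K y)) -> Nat.iter n K (L x) = L (Nat.iter n K x).
Proof.
intros HKL; induction n as [|n IH]; simpl; [reflexivity|].
now rewrite IH, HKL.
Qed.

(** * Integrals of continuous functions with values in a complex space *)

(** A linear map commutes with every Riemann sum, and its continuity carries this to the limit. *)
Lemma is_RInt_linear {U W : NormedModule R_AbsRing} (L : U -> W) (f : R -> U)
    (a b : R) (l : U) :
  is_linear L -> is_RInt f a b l -> is_RInt (fun t => L (f t)) a b (L l).
Proof.
intros HL Hf; unfold is_RInt in *.
apply filterlim_ext with
  (fun ptd => L (scal (sign (b - a)) (Riemann_sum f ptd))).
- intros ptd; rewrite (linear_scal L HL); f_equal.
  induction ptd as [x0|h s IH] using SF_cons_ind.
  + change (L (@zero U) = @zero W).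
    transitivity (L (@scal R_Ring U (@zero R_Ring) (@zero U))).
    * f_equal; symmetry; apply (@scal_zero_l R_Ring U).
    * rewrite (linear_scal L HL); apply (@scal_zero_l R_Ring W).
  + rewrite !Riemann_sum_cons, (linear_plus L HL), (linear_scal L HL).
    now f_equal.
- apply filterlim_comp with (1 := Hf), (linear_cont L l HL).
Qed.

Section Integral.
Variable V : cmodule.
Notation RV := (real_CompleteNormedModule V).

Definition RI (f : R -> V) (a b : R) : V := @RInt RV f a b.

Lemma cont_eps (f : R -> V) (x : R) :
  continuous f x <->
  forall e, 0 < e -> exists d, 0 < d /\
    forall y, Rabs (y - x) < d -> |{f y - f x}| < e.
Proof.
unfold continuous; split.
- intros Hf e He.
  destruct (proj1 (@filterlim_locally_ball_norm C_AbsRing _ V _ _ f (f x)) Hf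
    (mkposreal e He)) as [d Hd].
  exists d; split; [apply cond_pos|]; exact Hd.
- intros Hf.
  apply (@filterlim_locally_ball_norm C_AbsRing _ V); [apply locally_filter|].
  intros [e He]; destruct (Hf e He) as [d [Hd1 Hd2]].
  exists (mkposreal d Hd1); exact Hd2.
Qed.

Lemma lip_cont (f : R -> V) (K x : R) :
  (forall y, Rabs (y - x) < 1 -> |{f y - f x}| <= K * Rabs (y - x)) ->
  continuous f x.
Proof.
intros Hf; apply cont_eps; intros e He.
assert (HK : 0 < Rmax 1 K) by (apply Rlt_le_trans with (2 := Rmax_l _ _); lra).
assert (He' : 0 < e / Rmax 1 K) by now apply Rdiv_lt_0_compat.
exists (Rmin 1 (e / Rmax 1 K)); split; [apply Rmin_glb_lt; lra|].
intros y Hy.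
assert (Hy1 : Rabs (y - x) < 1) by (eapply Rlt_le_trans; [exact Hy|apply Rmin_l]).
assert (Hy2 : Rabs (y - x) < e / Rmax 1 K)
  by (eapply Rlt_le_trans; [exact Hy|apply Rmin_r]).
apply Rle_lt_trans with (1 := Hf y Hy1).
apply Rlt_div_r in Hy2; [|exact HK].
apply Rle_lt_trans with (2 := Hy2).
rewrite Rmult_comm; apply Rmult_le_compat_l; [apply Rabs_pos|apply Rmax_r].
Qed.

Lemma RI_correct (f : R -> V) (a b : R) :
  (forall x, continuous f x) -> @is_RInt RV f a b (RI f a b).
Proof.
intros Hf; apply RInt_correct, ex_RInt_continuous; intros x _; apply Hf.
Qed.

Lemma RI_unique (f : R -> V) (a b : R) (l : V) :
  @is_RInt RV f a b l -> RI f a b = l.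
Proof. apply (@is_RInt_unique RV). Qed.

Lemma RI_ext (f g : R -> V) (a b : R) :
  (forall x, Rmin a b < x < Rmax a b -> f x = g x) -> RI f a b = RI g a b.
Proof. apply (@RInt_ext RV). Qed.

Lemma RI_Chasles (f : R -> V) (a b c : R) :
  (forall x, continuous f x) -> (RI f a b + RI f b c)%V = RI f a c.
Proof.
intros Hf; apply (@RInt_Chasles RV); apply ex_RInt_continuous; intros x _;
apply Hf.
Qed.

Lemma RI_plus (f g : R -> V) (a b : R) :
  (forall x, continuous f x) -> (forall x, continuous g x) ->
  RI (fun x => f x + g x)%V a b = (RI f a b + RI g a b)%V.
Proof.
intros Hf Hg; apply RI_unique, (@is_RInt_plus RV); now apply RI_correct.
Qed.

Lemma RI_minus (f g : R -> V) (a b : R) :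
  (forall x, continuous f x) -> (forall x, continuous g x) ->
  RI (fun x => f x - g x)%V a b = (RI f a b - RI g a b)%V.
Proof.
intros Hf Hg; apply RI_unique, (@is_RInt_minus RV); now apply RI_correct.
Qed.

Lemma RI_const (v : V) (a b : R) : RI (fun _ => v) a b = (RtoC (b - a) * v)%V.
Proof. apply RI_unique, (@is_RInt_const RV). Qed.

Lemma RI_point (f : R -> V) (a : R) : RI f a a = vzero.
Proof. apply RI_unique, (@is_RInt_point RV). Qed.

Lemma RI_norm_le (f : R -> V) (g : R -> R) (a b lg : R) :
  a <= b -> (forall x, continuous f x) ->
  (forall x, a <= x <= b -> |{f x}| <= g x) ->
  is_RInt g a b lg -> |{RI f a b}| <= lg.
Proof.
intros Hab Hf Hg Hlg.
exact (@norm_RInt_le RV f g a b _ lg Hab Hg (RI_correct f a b Hf) Hlg).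
Qed.

Lemma RI_norm_const (f : R -> V) (a b K : R) :
  a <= b -> (forall x, continuous f x) ->
  (forall x, a <= x <= b -> |{f x}| <= K) ->
  |{RI f a b}| <= K * (b - a).
Proof.
intros Hab Hf HK; apply (RI_norm_le f (fun _ => K) a b); auto.
rewrite Rmult_comm; apply (@is_RInt_const R_NormedModule).
Qed.

Lemma RI_quad (f : R -> V) (a b K : R) :
  a <= b -> (forall x, continuous f x) ->
  (forall x, a <= x <= b -> |{f x - f a}| <= K) ->
  |{RI f a b - RtoC (b - a) * f a}| <= K * (b - a).
Proof.
intros Hab Hf HK.
rewrite <- RI_const.
rewrite <- RI_minus; [|exact Hf|intros x; apply continuous_const].
apply RI_norm_const; auto.
intros x; apply (@continuous_minus _ C_AbsRing V); [apply Hf|apply continuous_const].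
Qed.

End Integral.
Arguments RI {V} f a b.

Lemma real_linear {V W : cmodule} (L : V -> W) (c : R) :
  (forall x y, L (x + y)%V = (L x + L y)%V) ->
  (forall (r : R) x, L (RtoC r * x)%V = (RtoC r * L x)%V) -> bdd L c ->
  @is_linear R_AbsRing (real_NormedModule V) (real_NormedModule W) L.
Proof.
intros H1 H2 H3; split; [exact H1|exact H2|].
exists (Rmax 1 c); split; [apply Rlt_le_trans with 1, Rmax_l; lra|].
intros x; apply Rle_trans with (1 := H3 x).
apply Rmult_le_compat_r; [apply vnorm_ge_0|apply Rmax_r].
Qed.

Lemma lin_cont_comp {V W : cmodule} (L : V -> W) (f : R -> V) x :
  lin L -> continuous f x -> continuous (fun t => L (f t)) x.
Proof.
intros HL Hf; apply (continuous_comp f L); [exact Hf|].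
exact (@linear_cont C_AbsRing V W L (f x) (proj2 (is_linear_lin L) HL)).
Qed.

Lemma RI_linear {V W : cmodule} (L : V -> W) (f : R -> V) (a b : R) :
  lin L -> (forall x, continuous f x) ->
  RI (fun x => L (f x)) a b = L (RI f a b).
Proof.
intros HL Hf; apply RI_unique.
destruct (lin_bdd L HL) as [c [_ Hc]].
apply (@is_RInt_linear (real_NormedModule V) (real_NormedModule W)).
- apply (real_linear L c); [apply (lin_add L HL)| |exact Hc].
  intros r x; apply (lin_scal L HL).
- now apply RI_correct.
Qed.

Lemma RI_scal {V : cmodule} (c : C) (f : R -> V) (a b : R) :
  (forall x, continuous f x) ->
  RI (fun x => c * f x)%V a b = (c * RI f a b)%V.
Proof.
intros Hf; apply (RI_linear (fun y => c * y)%V); [apply lin_vscal|exact Hf].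
Qed.

Lemma RI_real_scal {V : cmodule} (g : R -> R) (v : V) (a b : R) :
  (forall x, continuous g x) ->
  RI (fun x => RtoC (g x) * v)%V a b = (RtoC (RInt g a b) * v)%V.
Proof.
intros Hg; apply RI_unique.
apply (@is_RInt_linear R_NormedModule (real_NormedModule V)
  (fun s : R => RtoC s * v)%V).
- split.
  + intros x y; change (RtoC (x + y) * v = RtoC x * v + RtoC y * v)%V; module.
  + intros k x; change (RtoC (k * x) * v = RtoC k * (RtoC x * v))%V.
    module.
  + exists (|{v}| + 1); split; [assert (H := vnorm_ge_0 v); lra|].
    intros x; change (|{RtoC x * v}| <= (|{v}| + 1) * Rabs x).
    apply Rle_trans with (1 := norm_scal_R _ _).
    rewrite Rmult_comm; apply Rmult_le_compat_r; [apply Rabs_pos|lra].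
- apply (@RInt_correct R_CompleteNormedModule).
  apply (@ex_RInt_continuous R_CompleteNormedModule); intros x _; apply Hg.
Qed.

Lemma RI_shift {V : cmodule} (f : R -> V) (a b c : R) :
  (forall x, continuous f x) ->
  RI (fun x => f (x + c)) a b = RI f (a + c) (b + c).
Proof.
intros Hf; apply RI_unique.
generalize (@is_RInt_comp_lin (real_CompleteNormedModule V) f 1 c a b
  (RI f (a + c) (b + c))); intros H.
apply (@is_RInt_ext (real_CompleteNormedModule V)
  (fun y => @scal R_Ring (real_CompleteNormedModule V) 1 (f (1 * y + c)))).
- intros x _; rewrite Rmult_1_l.
  exact (@scal_one R_Ring (real_CompleteNormedModule V) _).
- apply H; rewrite !Rmult_1_l; now apply RI_correct.
Qed.

(** * The underlying real Hilbert space *)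

Section RealHilbert.
Variable H : HilbertSpace.
Implicit Types x y z : H.

Definition rin x y : R := fst (inner H x y).

Lemma rin_add_l x y z : rin (x + y)%V z = rin x z + rin y z.
Proof. unfold rin, vadd; now rewrite inner_plus_l. Qed.

Lemma rin_scal_l (r : R) x y : rin (RtoC r * x)%V y = r * rin x y.
Proof. unfold rin, vscal; rewrite inner_scal_l; simpl; ring. Qed.

Lemma rin_sym x y : rin x y = rin y x.
Proof. unfold rin; rewrite (inner_conj H x y); reflexivity. Qed.

Lemma rin_diag x : rin x x = |{x}| ^ 2.
Proof. unfold rin; rewrite inner_norm; reflexivity. Qed.

Lemma rin_add_r x y z : rin x (y + z)%V = rin x y + rin x z.
Proof. rewrite rin_sym, rin_add_l, (rin_sym y), (rin_sym z); ring. Qed.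

Lemma rin_scal_r (r : R) x y : rin x (RtoC r * y)%V = r * rin x y.
Proof. now rewrite rin_sym, rin_scal_l, rin_sym. Qed.

Lemma rin_sub_l x y z : rin (x - y)%V z = rin x z - rin y z.
Proof.
replace (x - y)%V with (x + RtoC (-1) * y)%V by module.
rewrite rin_add_l, rin_scal_l; ring.
Qed.

Lemma rin_sub_r x y z : rin x (y - z)%V = rin x y - rin x z.
Proof. rewrite rin_sym, rin_sub_l, (rin_sym y), (rin_sym z); ring. Qed.

Lemma rin_zero_r x : rin x vzero = 0.
Proof.
replace (vzero : H) with (RtoC 0 * (vzero : H))%V by module.
rewrite rin_scal_r; ring.
Qed.

Lemma norm_sq_add x y : |{x + y}| ^ 2 = |{x}| ^ 2 + 2 * rin x y + |{y}| ^ 2.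
Proof.
rewrite <- !rin_diag, !rin_add_l, !rin_add_r, (rin_sym y x); ring.
Qed.

Lemma rin_le_quad x y : 2 * rin x y <= |{x}| ^ 2 + |{y}| ^ 2.
Proof.
assert (Hq : 0 <= |{x - y}| ^ 2) by apply pow2_ge_0.
rewrite <- rin_diag, rin_sub_l, !rin_sub_r, !rin_diag, (rin_sym y x) in Hq; lra.
Qed.

Lemma rin_le x y : rin x y <= |{x}| * |{y}|.
Proof.
assert (Hx := vnorm_ge_0 x); assert (Hy := vnorm_ge_0 y).
destruct (Req_dec (|{y}|) 0) as [Hy0|Hy0].
{ assert (y = vzero) as -> by (apply norm_le_0; lra).
  rewrite rin_zero_r; apply Rmult_le_pos; apply vnorm_ge_0. }
destruct (Req_dec (|{x}|) 0) as [Hx0|Hx0].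
{ assert (x = vzero) as -> by (apply norm_le_0; lra).
  rewrite rin_sym, rin_zero_r; apply Rmult_le_pos; apply vnorm_ge_0. }
generalize (rin_le_quad (RtoC (|{y}|) * x)%V (RtoC (|{x}|) * y)%V).
rewrite rin_scal_l, rin_scal_r, !norm_scal_R_eq, !Rabs_pos_eq by assumption.
intros Hq.
apply Rmult_le_reg_l with (|{y}| * |{x}|); [apply Rmult_lt_0_compat; lra|].
nra.
Qed.

Lemma rin_abs x y : Rabs (rin x y) <= |{x}| * |{y}|.
Proof.
apply Rabs_le; split; [|apply rin_le].
assert (Hx := rin_le (- x)%V y).
replace (- x)%V with (RtoC (-1) * x)%V in Hx by module.
rewrite rin_scal_l, norm_scal_R_eq, Rabs_left in Hx by lra; lra.
Qed.

Lemma norm_le_rin z (c : R) :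
  0 <= c -> (forall x, rin x z <= c * |{x}|) -> |{z}| <= c.
Proof.
intros H0 Hc; assert (Hz := vnorm_ge_0 z); specialize (Hc z).
rewrite rin_diag in Hc.
destruct (Req_dec (|{z}|) 0) as [Hz0|Hz0]; [lra|].
apply Rmult_le_reg_r with (|{z}|); nra.
Qed.

Lemma rin_ext z z' : (forall x, rin x z = rin x z') -> z = z'.
Proof.
intros Hz; apply minus_zero_eq, norm_le_0, norm_le_rin; [lra|].
intros x; rewrite rin_sub_r, Hz; lra.
Qed.

(** Variational proof: minimise J x = |x|^2 / 2 - f x. By the parallelogram law ([Jpar])
    near-minimisers are close to each other, so completeness yields a minimiser z, and the vanishing
    first variation of J at z reads f x = <x, z>. *)
Lemma Riesz (f : H -> R) (c : R) :
  (forall x y, f (x + y)%V = f x + f y) ->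
  (forall (r : R) x, f (RtoC r * x)%V = r * f x) ->
  (forall x, Rabs (f x) <= c * |{x}|) ->
  exists z, forall x, f x = rin x z.
Proof.
intros f_add f_scal f_bdd.
set (J := fun x => |{x}| ^ 2 / 2 - f x).
assert (Jlow : forall x, - (c ^ 2 / 2) <= J x).
{ intros x; unfold J.
  specialize (f_bdd x); assert (0 <= (|{x}| - c) ^ 2) by apply pow2_ge_0.
  assert (H1 := Rle_abs (f x)); nra. }
destruct (completeness (fun r => exists x, r = - J x)) as [m [Hm1 Hm2]].
{ exists (c ^ 2 / 2); intros r [x ->]; specialize (Jlow x); lra. }
{ exists (- J vzero), vzero; reflexivity. }
(* The filter generated by the sublevel sets of [J] just above its infimum [- m]; convergence along
   it replaces the choice of a minimising sequence. *)
set (F := fun P : H -> Prop => exists e, 0 < e /\ forall x, J x < - m + e -> P x).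
assert (Jm : forall x, - m <= J x).
{ intros x; specialize (Hm1 (- J x) (ex_intro _ x eq_refl)); lra. }
assert (HF : ProperFilter F).
{ split.
  - intros P [e [He HP]].
    apply Classical_Prop.NNPP; intros Hn.
    assert (Hub : is_upper_bound (fun r => exists x, r = - J x) (m - e)).
    { intros r [x ->]; apply Rnot_lt_le; intros Hlt; apply Hn.
      exists x; apply HP; lra. }
    specialize (Hm2 _ Hub); lra.
  - split.
    + exists 1; split; [lra|]; auto.
    + intros P Q [e [He HP]] [d [Hd HQ]]; exists (Rmin e d).
      split; [now apply Rmin_glb_lt|]; intros x Hx.
      assert (H1 := Rmin_l e d); assert (H2 := Rmin_r e d).
      split; [apply HP|apply HQ]; lra.
    + intros P Q HPQ [e [He HP]]; exists e; auto. }
assert (Jpar : forall x y, |{x - y}| ^ 2 / 4 =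
   J x + J y - 2 * J (RtoC (/ 2) * (x + y))%V).
{ intros x y; unfold J; rewrite f_scal, f_add.
  rewrite <- !rin_diag, rin_scal_l, rin_scal_r, rin_add_l, !rin_add_r, rin_sub_l,
    !rin_sub_r, (rin_sym y x); field. }
destruct (proj1 (@filterlim_locally_cauchy H H F HF (fun x => x))) as [z Hz].
{ intros [e He]; simpl.
  assert (He2 : 0 < e ^ 2 / 16) by (assert (0 < e ^ 2) by (apply pow_lt; lra); lra).
  exists (fun x => J x < - m + e ^ 2 / 16); split; [exists (e ^ 2 / 16); auto|].
  intros u v Hu Hv; apply (@norm_compat1 C_AbsRing H).
  change (|{v - u}| < e).
  assert (Hp := Jpar v u); assert (Hj := Jm (RtoC (/ 2) * (v + u))%V).
  apply Rsqr_incrst_0; [|apply vnorm_ge_0|lra].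
  unfold Rsqr; nra. }
assert (Hz' : forall e, 0 < e -> exists x, J x < - m + e /\ |{x - z}| < e).
{ intros e He.
  assert (H1 : F (fun x => |{x - z}| < e)).
  { exact (proj1 (@filterlim_locally_ball_norm C_AbsRing _ H F _ (fun x => x) z) Hz
      (mkposreal e He)). }
  assert (H2 : F (fun x => J x < - m + e)) by (exists e; auto).
  destruct (filter_ex _ (filter_and _ _ H1 H2)) as [x [Hx1 Hx2]].
  now exists x. }
assert (c0 : 0 <= Rabs c) by apply Rabs_pos.
assert (Jz : J z <= - m).
{ apply le_of_le_eps; intros e He.
  (* [K] dominates the Lipschitz constant of [J] on the unit ball around z, so moving from x to z
     costs at most e / 2. *)
  set (K := 1 + |{z}| + 1 + Rabs c).
  assert (HK : 1 <= K) by (unfold K; assert (Hq := vnorm_ge_0 z); lra).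
  assert (Hd : 0 < Rmin 1 (e / (2 * K))).
  { apply Rmin_glb_lt; [lra|apply Rdiv_lt_0_compat; lra]. }
  destruct (Hz' _ Hd) as [x [Hx1 Hx2]].
  set (d := Rmin 1 (e / (2 * K))) in *.
  assert (Hd1 : d <= 1) by apply Rmin_l.
  assert (Hd2 : K * d <= e / 2).
  { apply Rle_trans with (K * (e / (2 * K))); [|right; field; lra].
    apply Rmult_le_compat_l; [lra|apply Rmin_r]. }
  assert (Hx3 : |{z}| <= |{x}| + d).
  { assert (Hq := norm_le_minus z x); rewrite norm_minus_sym in Hq; lra. }
  assert (Hx4 : |{x}| <= |{z}| + d).
  { assert (Hq := norm_le_minus x z); lra. }
  assert (Hf : f x - f z <= Rabs c * d).
  { replace (f x - f z) with (f (x - z)%V).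
    - apply Rle_trans with (1 := Rle_abs _), Rle_trans with (1 := f_bdd _).
      apply Rle_trans with (Rabs c * |{x - z}|).
      + apply Rmult_le_compat_r; [apply vnorm_ge_0|apply Rle_abs].
      + apply Rmult_le_compat_l; lra.
    - replace (x - z)%V with (x + RtoC (-1) * z)%V by module.
      rewrite f_add, f_scal; ring. }
  assert (Hzz := vnorm_ge_0 z); assert (Hxx := vnorm_ge_0 x).
  assert (Hsq : |{z}| ^ 2 / 2 <= |{x}| ^ 2 / 2 + (|{z}| + 1) * d).
  { assert (|{z}| ^ 2 <= (|{x}| + d) ^ 2) by (apply pow_incr; lra). nra. }
  unfold J in *; unfold K in *; nra. }
exists z; intros x.
assert (Hq : forall t, 0 <= t ^ 2 * (|{x}| ^ 2 / 2) + t * (rin x z - f x)).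
{ intros t; assert (Hj := Jm (z + RtoC t * x)%V); unfold J in Hj, Jz.
  rewrite norm_sq_add, rin_scal_r, (rin_sym z x) in Hj.
  rewrite norm_scal_R_eq, Rpow_mult_distr, pow2_abs, f_add, f_scal in Hj; lra. }
set (a := rin x z - f x) in *; set (n := |{x}| ^ 2 / 2) in *.
assert (Hn : 0 <= n) by (unfold n; assert (0 <= |{x}| ^ 2) by apply pow2_ge_0; lra).
cut (a = 0); [unfold a; lra|].
(* Nearly the minimiser - a / (2 n) of the quadratic in t; the shift by 1 keeps the denominator
   positive when x = 0, and the value becomes - a^2 / (n + 1)^2. *)
specialize (Hq (- a / (n + 1))).
assert (Hq2 : 0 <= ((- a / (n + 1)) ^ 2 * n + - a / (n + 1) * a) * (n + 1) ^ 2).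
{ apply Rmult_le_pos; [exact Hq|apply pow2_ge_0]. }
replace (((- a / (n + 1)) ^ 2 * n + - a / (n + 1) * a) * (n + 1) ^ 2)
  with (- a ^ 2) in Hq2 by (field; lra).
assert (0 <= a ^ 2) by apply pow2_ge_0.
apply Rsqr_0_uniq; unfold Rsqr; lra.
Qed.

Definition adj (L : H -> H) y : H := iota (fun z => forall x, rin (L x) y = rin x z).

(* Only real linearity matters below, so that [adj] need not be shown to be
   complex linear. *)
Record rlin (L : H -> H) : Prop := {
  rlin_add : forall x y, L (x + y)%V = (L x + L y)%V;
  rlin_scal : forall (r : R) x, L (RtoC r * x)%V = (RtoC r * L x)%V;
  rlin_bdd : exists c, 0 < c /\ bdd L c
}.

Lemma lin_rlin L : lin L -> rlin L.
Proof.
intros [H1 H2 H3]; split; [exact H1|intros r x; apply H2|exact H3].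
Qed.

Lemma adj_spec L x y : rlin L -> rin (L x) y = rin x (adj L y).
Proof.
intros HL; unfold adj; revert x; apply (@iota_correct C_AbsRing H).
destruct (rlin_bdd L HL) as [c [Hc Lc]].
destruct (Riesz (fun x => rin (L x) y) (c * |{y}|)) as [z Hz].
- intros x x'; rewrite (rlin_add L HL); apply rin_add_l.
- intros r x; rewrite (rlin_scal L HL); apply rin_scal_l.
- intros x; apply Rle_trans with (1 := rin_abs _ _).
  specialize (Lc x); assert (Hy := vnorm_ge_0 y); nra.
- exists z; split; [exact Hz|].
  intros z' Hz'; apply rin_ext; intros x; rewrite <- Hz; apply Hz'.
Qed.

Lemma adj_bdd L c : 0 <= c -> rlin L -> bdd L c -> bdd (adj L) c.
Proof.
intros Hc HL Lc y; apply norm_le_rin.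
- apply Rmult_le_pos; [exact Hc|apply vnorm_ge_0].
- intros x; rewrite <- adj_spec by exact HL.
  apply Rle_trans with (1 := rin_le _ _).
  specialize (Lc x); assert (Hy := vnorm_ge_0 y); nra.
Qed.

Lemma adj_rlin L : rlin L -> rlin (adj L).
Proof.
intros HL; destruct (rlin_bdd L HL) as [c [Hc Lc]]; split.
- intros y z; apply rin_ext; intros x.
  rewrite rin_add_r, <- !adj_spec by exact HL; apply rin_add_r.
- intros r y; apply rin_ext; intros x.
  rewrite rin_scal_r, <- !adj_spec by exact HL; apply rin_scal_r.
- exists c; split; [exact Hc|]; apply adj_bdd; [lra|exact HL|exact Lc].
Qed.

End RealHilbert.
Arguments rin {H} x y.
Arguments adj {H} L y.
Arguments rlin {H} L.
Arguments rlin_add {H} L _ x y.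
Arguments rlin_scal {H} L _ r x.
Arguments rlin_bdd {H} L _.

(** * Exponentials of bounded operators *)

Lemma is_series_lin {V W : cmodule} (L : V -> W) (a : nat -> V) (l : V) :
  lin L -> is_series a l -> is_series (fun n => L (a n)) (L l).
Proof.
intros HL Ha; unfold is_series in *.
apply filterlim_ext with (fun n => L (sum_n a n)).
- intros n; induction n as [|n IH].
  + now rewrite !sum_O.
  + rewrite !sum_Sn, <- IH; apply (lin_add L HL).
- apply filterlim_comp with (1 := Ha).
  exact (@linear_cont C_AbsRing V W L l (proj2 (is_linear_lin L) HL)).
Qed.

Lemma is_series_norm_le {V : cmodule} (a : nat -> V) (b : nat -> R) (l : V) (s : R) :
  is_series a l -> is_series b s -> (forall n, |{a n}| <= b n) -> |{l}| <= s.
Proof.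
intros Ha Hb Hab.
apply (@filterlim_le nat eventually _
  (fun n => |{sum_n a n}|) (sum_n b) (|{l}|) s).
- exists 0%nat; intros n _; induction n as [|n IH].
  + rewrite !sum_O; apply Hab.
  + rewrite !sum_Sn; apply Rle_trans with (1 := norm_tri _ _).
    apply Rplus_le_compat; [exact IH|apply Hab].
- apply filterlim_comp with (1 := Ha).
  exact (@filterlim_norm C_AbsRing V l).
- exact Hb.
Qed.

Lemma is_series_unique_vec {V : cmodule} (a : nat -> V) (l l' : V) :
  is_series a l -> is_series a l' -> l = l'.
Proof. exact (@filterlim_locally_unique _ C_AbsRing V _ _ _ l l'). Qed.

Lemma exp_series (x : R) : is_series (fun n => x ^ n / INR (fact n)) (exp x).
Proof.
generalize (is_exp_Reals x); unfold is_pseries.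
apply is_series_ext; intros n.
rewrite pow_n_pow; reflexivity.
Qed.

Lemma exp_series_scal (y k : R) :
  is_series (fun n => y ^ n / INR (fact n) * k) (exp y * k).
Proof.
rewrite Rmult_comm.
apply is_series_ext with (fun n => scal k (y ^ n / INR (fact n))).
- intros n; apply Rmult_comm.
- exact (@is_series_scal R_AbsRing R_NormedModule k _ _ (exp_series y)).
Qed.

(** The constant is geometric in n so that, divided by the factorial, these remainders sum to an
    exponential in [opexp_taylor]. *)
Lemma pow_taylor (u v tau : R) (n : nat) :
  1 <= tau -> Rabs u <= tau -> Rabs v <= tau ->
  Rabs (u ^ S n - v ^ S n - INR (S n) * v ^ n * (u - v)) <=
    (u - v) ^ 2 * (4 * tau) ^ S n.
Proof.
intros Ht Hu Hv; induction n as [|n IH].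
- replace (u ^ 1 - v ^ 1 - INR 1 * v ^ 0 * (u - v)) with 0 by (simpl; ring).
  rewrite Rabs_R0; apply Rmult_le_pos; [apply pow2_ge_0|apply pow_le; lra].
- replace (u ^ S (S n) - v ^ S (S n) - INR (S (S n)) * v ^ S n * (u - v))
    with (u * (u ^ S n - v ^ S n - INR (S n) * v ^ n * (u - v)) +
          INR (S n) * v ^ n * (u - v) ^ 2)
    by (rewrite (S_INR (S n)); simpl; ring).
  apply Rle_trans with (1 := Rabs_triang _ _).
  set (X := u ^ S n - v ^ S n - INR (S n) * v ^ n * (u - v)) in *.
  assert (Hh : 0 <= (u - v) ^ 2) by apply pow2_ge_0.
  rewrite Rabs_mult, !Rabs_mult, (Rabs_pos_eq ((u - v) ^ 2)) by exact Hh.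
  rewrite (Rabs_pos_eq (INR (S n))) by apply pos_INR.
  assert (H1 : Rabs u * Rabs X <= tau * ((u - v) ^ 2 * (4 * tau) ^ S n)).
  { apply Rmult_le_compat; auto using Rabs_pos. }
  assert (H2 : Rabs (v ^ n) <= tau ^ S n).
  { rewrite <- RPow_abs; apply Rle_trans with (tau ^ n).
    - apply pow_incr; split; [apply Rabs_pos|exact Hv].
    - apply Rle_pow; [exact Ht|lia]. }
  assert (H3 : INR (S n) <= 4 ^ S n).
  { clear; induction n as [|n IH]; [simpl; lra|].
    rewrite S_INR; change (4 ^ S (S n)) with (4 * 4 ^ S n).
    assert (1 <= 4 ^ S n) by (apply pow_R1_Rle; lra); lra. }
  assert (H4 : INR (S n) * Rabs (v ^ n) <= (4 * tau) ^ S n).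
  { rewrite Rpow_mult_distr; apply Rmult_le_compat; auto using Rabs_pos, pos_INR. }
  assert (H5 : 0 <= (4 * tau) ^ S n) by (apply pow_le; lra).
  change ((4 * tau) ^ S (S n)) with (4 * tau * (4 * tau) ^ S n).
  assert (H6 : INR (S n) * Rabs (v ^ n) * (u - v) ^ 2 <=
    (4 * tau) ^ S n * (u - v) ^ 2) by (apply Rmult_le_compat_r; assumption).
  assert (H7 : 0 <= (u - v) ^ 2 * (4 * tau) ^ S n) by (apply Rmult_le_pos; assumption).
  nra.
Qed.

Section Exponential.
Variable H : HilbertSpace.
Implicit Types F G D L : H -> H.

(** e^{-tF}: the sign is built in, as in the theorem. *)
Definition opexp F (t : R) : H -> H := exp_op (fun y => scal (RtoC (- t)) (F y)).

Lemma iter_vscal F (k : C) n x :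
  lin F -> Nat.iter n (fun y => scal k (F y)) x = (Cpow k n * Nat.iter n F x)%V.
Proof.
intros HF; induction n as [|n IH]; simpl Nat.iter.
- simpl; module.
- rewrite IH, (lin_scal F HF).
  change (k * (Cpow k n * F (Nat.iter n F x)) = Cpow k (S n) * F (Nat.iter n F x))%V.
  simpl Cpow; module.
Qed.

Lemma opexp_series F t x :
  lin F ->
  is_series (fun n => RtoC ((- t) ^ n / INR (fact n)) * Nat.iter n F x)%V
    (opexp F t x).
Proof.
intros HF.
set (a := fun n => (RtoC ((- t) ^ n / INR (fact n)) * Nat.iter n F x)%V).
assert (Hext : forall n, scal (RtoC (/ INR (fact n)))
    (Nat.iter n (fun y => scal (RtoC (- t)) (F y)) x) = a n).
{ intros n; rewrite iter_vscal by exact HF; unfold a.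
  change (RtoC (/ INR (fact n)) * (Cpow (RtoC (- t)) n * Nat.iter n F x) =
    RtoC ((- t) ^ n / INR (fact n)) * Nat.iter n F x)%V.
  unfold Rdiv; rewrite RtoC_mult, RtoC_pow; module. }
assert (Hex : ex_series a).
{ destruct (lin_bdd F HF) as [c [Hc Fc]].
  apply (@ex_series_le C_AbsRing H) with
    (fun n => (Rabs t * c) ^ n / INR (fact n) * |{x}|).
  - intros n; change (|{a n}| <= (Rabs t * c) ^ n / INR (fact n) * |{x}|); unfold a.
    apply Rle_trans with (1 := norm_scal_R _ _).
    unfold Rdiv; rewrite Rabs_mult, <- RPow_abs, Rabs_Ropp, Rpow_mult_distr.
    assert (Hf : 0 < / INR (fact n)) by apply Rinv_0_lt_compat, INR_fact_lt_0.
    rewrite (Rabs_pos_eq (/ INR (fact n))) by lra.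
    assert (Hi := bdd_iter F c n (Rlt_le _ _ Hc) Fc x).
    assert (0 <= Rabs t ^ n) by (apply pow_le, Rabs_pos).
    replace (Rabs t ^ n * c ^ n * / INR (fact n) * |{x}|) with
      (Rabs t ^ n * / INR (fact n) * (c ^ n * |{x}|)) by ring.
    apply Rmult_le_compat_l; [apply Rmult_le_pos; lra|exact Hi].
  - exists (exp (Rabs t * c) * |{x}|); apply exp_series_scal. }
destruct Hex as [l Hl].
apply is_series_ext with (1 := Hext).
unfold opexp, exp_op; apply (@iota_correct C_AbsRing H).
exists l; split.
- apply is_series_ext with a; [intros n; now rewrite Hext|exact Hl].
- intros l' Hl'; apply is_series_unique_vec with (1 := Hl).
  apply is_series_ext with (1 := Hext); exact Hl'.
Qed.

Lemma opexp_bdd F c t :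
  lin F -> 0 <= c -> bdd F c -> bdd (opexp F t) (exp (Rabs t * c)).
Proof.
intros HF Hc Fc x.
apply (is_series_norm_le _ _ _ _ (opexp_series F t x HF) (exp_series_scal _ _)).
intros n.
apply Rle_trans with (1 := norm_scal_R _ _).
unfold Rdiv; rewrite Rabs_mult, <- RPow_abs, Rabs_Ropp, Rpow_mult_distr.
assert (Hf : 0 < / INR (fact n)) by apply Rinv_0_lt_compat, INR_fact_lt_0.
rewrite (Rabs_pos_eq (/ INR (fact n))) by lra.
assert (Hi := bdd_iter F c n Hc Fc x).
assert (0 <= Rabs t ^ n) by (apply pow_le, Rabs_pos).
replace (Rabs t ^ n * c ^ n * / INR (fact n) * |{x}|) with
  (Rabs t ^ n * / INR (fact n) * (c ^ n * |{x}|)) by ring.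
apply Rmult_le_compat_l; [apply Rmult_le_pos; lra|exact Hi].
Qed.

Lemma opexp_ext F G t x :
  lin F -> (forall y, F y = G y) -> opexp F t x = opexp G t x.
Proof.
intros HF HFG.
assert (HG : lin G) by now apply lin_ext with F.
apply is_series_unique_vec with (1 := opexp_series F t x HF).
apply is_series_ext with (2 := opexp_series G t x HG).
intros n; f_equal; induction n as [|n IH]; simpl; [reflexivity|].
now rewrite IH, HFG.
Qed.

Lemma opexp_time F (r : R) x :
  lin F -> opexp F r x = opexp (fun y => RtoC r * F y)%V 1 x.
Proof.
intros HF.
assert (HG : lin (fun y => RtoC r * F y)%V)
  by (apply (lin_comp (fun y => RtoC r * y)%V F); [apply lin_vscal|exact HF]).
apply is_series_unique_vec with (1 := opexp_series F r x HF).
apply is_series_ext with (2 := opexp_series _ 1 x HG).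
intros n.
change (fun y => (RtoC r * F y)%V) with (fun y => scal (RtoC r) (F y)).
rewrite iter_vscal by exact HF.
replace (- r) with (- (1) * r) by ring.
unfold Rdiv; rewrite Rpow_mult_distr, !RtoC_mult, RtoC_pow.
rewrite (RtoC_pow r); module.
Qed.

Lemma opexp_comm F L t x :
  lin F -> lin L -> (forall y, F (L y) = L (F y)) ->
  L (opexp F t x) = opexp F t (L x).
Proof.
intros HF HL HFL.
apply is_series_unique_vec with
  (1 := is_series_lin L _ _ HL (opexp_series F t x HF)).
apply is_series_ext with (2 := opexp_series F t (L x) HF).
intros n; rewrite (lin_scal L HL).
now rewrite (iter_comm F L n x HFL).
Qed.

Lemma opexp_lin F t : lin F -> lin (opexp F t).
Proof.
intros HF; destruct (lin_bdd F HF) as [c [Hc Fc]].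
apply (bdd_lin _ (exp (Rabs t * c))).
- intros x y.
  apply is_series_unique_vec with (1 := opexp_series F t (x + y)%V HF).
  apply is_series_ext with
    (2 := is_series_plus _ _ _ _ (opexp_series F t x HF) (opexp_series F t y HF)).
  intros n; rewrite (lin_add _ (lin_iter F n HF)).
  change (RtoC ((- t) ^ n / INR (fact n)) * Nat.iter n F x +
    RtoC ((- t) ^ n / INR (fact n)) * Nat.iter n F y =
    RtoC ((- t) ^ n / INR (fact n)) * (Nat.iter n F x + Nat.iter n F y))%V.
  module.
- intros k x; symmetry; apply opexp_comm; [exact HF|apply lin_vscal|].
  intros y; apply (lin_scal F HF).
- apply opexp_bdd; [exact HF|lra|exact Fc].
Qed.

Lemma opexp_0 F x : lin F -> opexp F 0 x = x.
Proof.
intros HF.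
apply is_series_unique_vec with (1 := opexp_series F 0 x HF).
apply is_series_ext with (fun n => match n with O => x | S _ => vzero end).
- intros [|n].
  + simpl; replace (1 / 1) with 1 by field; module.
  + simpl pow; replace (- 0 * (- 0) ^ n / INR (fact (S n))) with 0.
    * module.
    * unfold Rdiv; ring.
- apply is_series_decr_1.
  change (is_series (fun _ : nat => vzero : H) (x + - x)%V).
  replace (x + - x)%V with (vzero : H) by module.
  unfold is_series.
  apply filterlim_ext with (fun _ => vzero : H); [|apply filterlim_const].
  intros n; induction n as [|n IH]; [now rewrite sum_O|].
  rewrite sum_Sn, <- IH; change (vzero = vzero + vzero :> H)%V; module.
Qed.

Lemma opexp_taylor F c tau t t' x :
  lin F -> 0 <= c -> bdd F c -> 1 <= tau -> Rabs t <= tau -> Rabs t' <= tau ->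
  |{opexp F t' x - opexp F t x + RtoC (t' - t) * F (opexp F t x)}| <=
    exp (4 * tau * c) * (t' - t) ^ 2 * |{x}|.
Proof.
intros HF Hc Fc Htau Ht Ht'.
(* The series of F e^{-tF} x shifted by one index, so that its term of index n + 1 carries the same
   iterate F^{n+1} x as the exponential series and the three series can be compared termwise. *)
set (b := fun n => match n with O => vzero
  | S n => RtoC ((- t) ^ n / INR (fact n)) * Nat.iter (S n) F x end%V).
assert (Hb : is_series b (F (opexp F t x))).
{ apply is_series_decr_1.
  change (is_series (fun k => b (S k)) (F (opexp F t x) + - vzero)%V).
  replace (F (opexp F t x) + - vzero)%V with (F (opexp F t x)) by module.
  apply is_series_ext with (2 := is_series_lin F _ _ HF (opexp_series F t x HF)).
  intros n; apply (lin_scal F HF). }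
assert (Hs := is_series_plus _ _ _ _
  (is_series_minus _ _ _ _ (opexp_series F t' x HF) (opexp_series F t x HF))
  (is_series_scal (RtoC (t' - t)) _ _ Hb)).
replace (exp (4 * tau * c) * (t' - t) ^ 2 * |{x}|) with
  (exp (4 * tau * c) * ((t' - t) ^ 2 * |{x}|)) by ring.
apply (is_series_norm_le _ _ _ _ Hs (exp_series_scal _ _)).
intros n.
assert (Hh : 0 <= (t' - t) ^ 2) by apply pow2_ge_0.
assert (Hx := vnorm_ge_0 x).
destruct n as [|n].
- match goal with |- |{?X}| <= _ => replace X with (vzero : H) end.
  + apply Rle_trans with (1 := Req_le _ _ (@norm_zero C_AbsRing H)).
    simpl; nra.
  + change (vzero = RtoC ((- t') ^ 0 / INR (fact 0)) * x
     - RtoC ((- t) ^ 0 / INR (fact 0)) * x + RtoC (t' - t) * vzero)%V.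
    simpl pow; module.
- match goal with |- |{?X}| <= _ => replace X with
   (RtoC (((- t') ^ S n - (- t) ^ S n - INR (S n) * (- t) ^ n * (- t' - - t)) /
       INR (fact (S n))) * Nat.iter (S n) F x)%V end.
  + apply Rle_trans with (1 := norm_scal_R _ _).
    unfold Rdiv; rewrite Rabs_mult.
    assert (Hf : 0 < / INR (fact (S n))) by apply Rinv_0_lt_compat, INR_fact_lt_0.
    rewrite (Rabs_pos_eq (/ INR (fact (S n)))) by lra.
    assert (Hp := pow_taylor (- t') (- t) tau n Htau).
    rewrite !Rabs_Ropp in Hp; specialize (Hp Ht' Ht).
    assert (Hi := bdd_iter F c (S n) Hc Fc x).
    replace ((- t' - - t) ^ 2) with ((t' - t) ^ 2) in Hp by ring.
    rewrite Rpow_mult_distr.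
    replace ((4 * tau) ^ S n * c ^ S n * / INR (fact (S n)) * ((t' - t) ^ 2 * |{x}|))
     with (((t' - t) ^ 2 * (4 * tau) ^ S n) * / INR (fact (S n)) * (c ^ S n * |{x}|))
     by ring.
    apply Rmult_le_compat; [|apply vnorm_ge_0| |exact Hi].
    * apply Rmult_le_pos; [apply Rabs_pos|lra].
    * apply Rmult_le_compat_r; [lra|exact Hp].
  + change (RtoC (((- t') ^ S n - (- t) ^ S n - INR (S n) * (- t) ^ n * (- t' - - t)) /
       INR (fact (S n))) * Nat.iter (S n) F x =
     RtoC ((- t') ^ S n / INR (fact (S n))) * Nat.iter (S n) F x
     - RtoC ((- t) ^ S n / INR (fact (S n))) * Nat.iter (S n) F x
     + RtoC (t' - t) * (RtoC ((- t) ^ n / INR (fact n)) * Nat.iter (S n) F x))%V.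
    replace ((- t) ^ n / INR (fact n)) with (INR (S n) * (- t) ^ n / INR (fact (S n))).
    * unfold Rdiv; module.
    * change (fact (S n)) with (S n * fact n)%nat; rewrite mult_INR.
      field; split; [apply INR_fact_neq_0|apply not_0_INR; lia].
Qed.

(* [y'] is the derivative of [y] on [a, b], with a quadratic remainder. *)
Definition tayl (y y' : R -> H) (a b C : R) : Prop :=
  forall u v, a <= u <= b -> a <= v <= b ->
    |{y v - y u - RtoC (v - u) * y' u}| <= C * (v - u) ^ 2 /\
    |{y u}| <= C /\ |{y' u}| <= C.

Definition taylop (P P' : R -> H -> H) (a b C : R) : Prop :=
  0 <= C /\ forall u v x, a <= u <= b -> a <= v <= b ->
    |{P v x - P u x - RtoC (v - u) * P' u x}| <= C * (v - u) ^ 2 * |{x}| /\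
    |{P u x}| <= C * |{x}| /\ |{P' u x}| <= C * |{x}|.

Lemma tayl_of_op P P' a b C x :
  taylop P P' a b C -> tayl (fun u => P u x) (fun u => P' u x) a b (C * |{x}|).
Proof.
intros [_ HP] u v Hu Hv; destruct (HP u v x Hu Hv) as [H1 [H2 H3]].
split; [|split]; assumption || (replace (C * |{x}| * (v - u) ^ 2) with
  (C * (v - u) ^ 2 * |{x}|) by ring; exact H1).
Qed.

Lemma opexp_taylop F a b :
  lin F -> exists C, taylop (opexp F) (fun u x => - F (opexp F u x))%V a b C.
Proof.
intros HF; destruct (lin_bdd F HF) as [c [Hc Fc]].
set (tau := Rmax 1 (Rmax (Rabs a) (Rabs b))).
assert (Htau : 1 <= tau) by apply Rmax_l.
assert (Htc : 0 <= tau * c) by (apply Rmult_le_pos; lra).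
exists (Rmax 1 c * exp (4 * tau * c)).
split; [apply Rmult_le_pos; [apply Rle_trans with (2 := Rmax_l 1 c); lra|
  apply Rlt_le, exp_pos] |].
intros u v x Hu Hv.
assert (Hin : forall w, a <= w <= b -> Rabs w <= tau).
{ intros w Hw; apply Rle_trans with (Rmax (Rabs a) (Rabs b)); [|apply Rmax_r].
  unfold Rmax; destruct (Rle_dec (Rabs a) (Rabs b)) as [Hab|Hab];
  unfold Rabs in *; repeat destruct Rcase_abs; lra. }
assert (Hx := vnorm_ge_0 x).
assert (Hm1 : 1 <= Rmax 1 c) by apply Rmax_l.
assert (Hmc : c <= Rmax 1 c) by apply Rmax_r.
set (m := Rmax 1 c) in *; set (e := exp (4 * tau * c)).
assert (He : 0 < e) by apply exp_pos.
assert (HE : |{opexp F u x}| <= e * |{x}|).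
{ apply Rle_trans with (1 := opexp_bdd F c u HF (Rlt_le _ _ Hc) Fc x).
  apply Rmult_le_compat_r; [exact Hx|].
  assert (Hle : Rabs u * c <= 4 * tau * c).
  { specialize (Hin u Hu); apply Rle_trans with (tau * c); [|lra].
    apply Rmult_le_compat_r; lra. }
  destruct Hle as [Hlt| ->]; [left; now apply exp_increasing|right; reflexivity]. }
assert (Hem : e <= m * e) by nra.
split; [|split].
- replace (opexp F v x - opexp F u x - RtoC (v - u) * - F (opexp F u x))%V
    with (opexp F v x - opexp F u x + RtoC (v - u) * F (opexp F u x))%V by module.
  apply Rle_trans with (e * (v - u) ^ 2 * |{x}|).
  + unfold e; apply opexp_taylor; auto; lra.
  + apply Rmult_le_compat_r; [exact Hx|].
    apply Rmult_le_compat_r; [apply pow2_ge_0|exact Hem].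
- apply Rle_trans with (1 := HE), Rmult_le_compat_r; assumption.
- rewrite norm_oppV; apply Rle_trans with (1 := Fc _).
  rewrite Rmult_assoc; apply Rmult_le_compat; try lra; apply vnorm_ge_0.
Qed.

(** Product rule. Besides the remainders of [P] and [y], the mixed term h P'(h y' + r) appears; it
    is quadratic up to a cubic part. This gives three terms C D h^2 and one C D |h|^3, hence the
    constant 3 + |b - a|. *)
Lemma tayl_prod P P' y y' a b C (D : R) :
  (forall u, lin (P u)) -> (forall u, lin (P' u)) ->
  taylop P P' a b C -> tayl y y' a b D ->
  tayl (fun u => P u (y u)) (fun u => P' u (y u) + P u (y' u))%V a b
    (C * D * (3 + Rabs (b - a))).
Proof.
intros LP LP' [HC HP] Hy u v Hu Hv.
destruct (Hy u v Hu Hv) as [Y1 [Y2 Y3]].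
destruct (Hy v u Hv Hu) as [_ [Y4 _]].
assert (HD : 0 <= D) by (apply Rle_trans with (2 := Y2), vnorm_ge_0).
set (h := v - u) in *.
assert (Hh : Rabs h <= Rabs (b - a)).
{ rewrite (Rabs_pos_eq (b - a)) by lra; apply Rabs_le; unfold h; lra. }
assert (Hh2 : 0 <= h ^ 2) by apply pow2_ge_0.
assert (HhR : Rabs h * Rabs h = h ^ 2) by (rewrite <- Rabs_mult, Rabs_pos_eq; nra).
assert (Ha := Rabs_pos h).
assert (HCD : 0 <= C * D) by now apply Rmult_le_pos.
destruct (HP u v (y v) Hu Hv) as [P1 _]; fold h in P1.
destruct (HP u v (y u) Hu Hv) as [_ [P2 P3]].
destruct (HP u v (y' u) Hu Hv) as [_ [P4 _]].
set (r := (y v - y u - RtoC h * y' u)%V) in *.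
destruct (HP u v (RtoC h * y' u + r)%V Hu Hv) as [_ [_ P5]].
destruct (HP u v r Hu Hv) as [_ [P6 _]].
assert (C1 : C * |{y u}| <= C * D) by now apply Rmult_le_compat_l.
assert (C2 : C * |{y' u}| <= C * D) by now apply Rmult_le_compat_l.
assert (C3 : C * |{y v}| <= C * D) by now apply Rmult_le_compat_l.
assert (C4 : C * |{r}| <= C * D * h ^ 2)
  by (rewrite Rmult_assoc; now apply Rmult_le_compat_l).
assert (HB : 0 <= C * D * Rabs (b - a)) by (apply Rmult_le_pos; [exact HCD|apply Rabs_pos]).
split; [|split].
- replace (P v (y v) - P u (y u) - RtoC h * (P' u (y u) + P u (y' u)))%V with
   ((P v (y v) - P u (y v) - RtoC h * P' u (y v)) +
    RtoC h * (P' u (RtoC h * y' u + r)) + P u r)%V.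
  + apply Rle_trans with (1 := norm_plus3 _ _ _).
    assert (N1 : C * h ^ 2 * |{y v}| <= C * D * h ^ 2) by nra.
    assert (N2 : |{RtoC h * P' u (RtoC h * y' u + r)%V}| <=
       C * D * h ^ 2 + C * D * h ^ 2 * Rabs (b - a)).
    { apply Rle_trans with (1 := norm_scal_R _ _).
      assert (Hr : |{RtoC h * y' u + r}| <= Rabs h * D + D * h ^ 2).
      { apply Rle_trans with (1 := norm_tri _ _), Rplus_le_compat; [|exact Y1].
        apply Rle_trans with (1 := norm_scal_R _ _).
        now apply Rmult_le_compat_l. }
      apply Rle_trans with (Rabs h * (C * (Rabs h * D + D * h ^ 2))).
      - apply Rmult_le_compat_l; [exact Ha|].
        apply Rle_trans with (1 := P5); now apply Rmult_le_compat_l.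
      - replace (Rabs h * (C * (Rabs h * D + D * h ^ 2))) with
          (C * D * (Rabs h * Rabs h) + C * D * h ^ 2 * Rabs h) by ring.
        rewrite HhR; apply Rplus_le_compat_l, Rmult_le_compat_l; [nra|exact Hh]. }
    nra.
  + assert (E1 : P' u (y v) = (P' u (y u) + P' u (RtoC h * y' u + r))%V).
    { rewrite <- (lin_add _ (LP' u)); f_equal; unfold r; module. }
    assert (E2 : P u (y v) = (P u (y u) + RtoC h * P u (y' u) + P u r)%V).
    { rewrite <- (lin_scal _ (LP u)), <- !(lin_add _ (LP u)); f_equal.
      unfold r; module. }
    rewrite E1, E2; module.
- apply Rle_trans with (1 := P2); nra.
- apply Rle_trans with (1 := norm_tri _ _); nra.
Qed.

Lemma taylop_rev P P' a b C t :
  taylop P P' a b C ->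
  taylop (fun u => P (t - u)%R) (fun u x => - P' (t - u)%R x)%V (t - b) (t - a) C.
Proof.
intros [HC HP]; split; [exact HC|]; intros u v x Hu Hv.
destruct (HP (t - u)%R (t - v) x ltac:(lra) ltac:(lra)) as [Y1 [Y2 Y3]].
replace (t - v - (t - u)) with (- (v - u)) in Y1 by ring.
split; [|split; [exact Y2|now rewrite norm_oppV]].
replace ((v - u) ^ 2) with ((- (v - u)) ^ 2) by ring.
replace (P (t - v)%R x - P (t - u)%R x - RtoC (v - u) * - P' (t - u)%R x)%V with
  (P (t - v)%R x - P (t - u)%R x - RtoC (- (v - u)) * P' (t - u)%R x)%V by module.
exact Y1.
Qed.

Lemma tayl_const y y' a b C :
  a <= b -> (forall u, y' u = vzero) -> tayl y y' a b C -> y b = y a.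
Proof.
intros Hab H0 Hy; apply quad_const with C; [exact Hab|]; intros u v Hu Huv Hv.
destruct (Hy u v ltac:(lra) ltac:(lra)) as [H1 _].
rewrite H0 in H1.
replace (y v - y u)%V with (y v - y u - RtoC (v - u) * vzero)%V by module.
exact H1.
Qed.

(** With G = F + D, the curve u |-> e^{-(t-u)G} e^{-uF} e^{-uD} x has zero derivative; its values at
    u = 0 and u = t are the two sides. *)
Lemma opexp_add_gen F D t x :
  lin F -> lin D -> (forall y, F (D y) = D (F y)) -> 0 <= t ->
  opexp (fun y => F y + D y)%V t x = opexp F t (opexp D t x).
Proof.
intros HF HD HFD Ht.
set (G := fun y => (F y + D y)%V).
assert (HG : lin G) by now apply lin_vadd.
assert (lneg : forall K : H -> H, lin K -> lin (fun y => - K y)%V).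
{ intros K HK; apply lin_ext with (fun y => RtoC (-1) * K y)%V; [intros y; module|].
  apply (lin_comp (fun y => RtoC (-1) * y)%V K); [apply lin_vscal|exact HK]. }
destruct (opexp_taylop F 0 t HF) as [CF TF].
destruct (opexp_taylop D 0 t HD) as [CD TD].
destruct (opexp_taylop G 0 t HG) as [CG TG].
assert (lexp : forall K u, lin K -> lin (fun x => - K (opexp K u x))%V).
{ intros K u HK; apply (lneg (fun x => K (opexp K u x))), lin_comp;
  [exact HK|now apply opexp_lin]. }
apply tayl_of_op with (x := x) in TD.
generalize (tayl_prod _ _ _ _ _ _ _ _ (fun u => opexp_lin F u HF)
  (fun u => lexp F u HF) TF TD); intros T1.
apply taylop_rev with (t := t) in TG; rewrite Rminus_diag, Rminus_0_r in TG.
assert (T2 := tayl_prod _ _ _ _ _ _ _ _ (fun u => opexp_lin G (t - u) HG)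
  (fun u => lneg _ (lexp G (t - u) HG)) TG T1).
apply tayl_const in T2; [|exact Ht|].
- rewrite Rminus_diag, Rminus_0_r, !opexp_0 in T2 by assumption.
  symmetry; exact T2.
- intros u; cbn beta.
  rewrite (opexp_comm G G) by (exact HG || reflexivity).
  rewrite (lin_neg _ _ (opexp_lin F u HF)).
  rewrite <- (opexp_comm F D) by (exact HF || exact HD || exact HFD).
  set (z := opexp F u (opexp D u x)).
  rewrite (lin_add _ (opexp_lin G (t - u) HG)), !(lin_neg _ _ (opexp_lin G (t - u) HG)).
  unfold G at 2; rewrite (lin_add _ (opexp_lin G (t - u) HG)); module.
Qed.

Lemma opexp_plus F s t x :
  lin F -> opexp F (s + t) x = opexp F s (opexp F t x).
Proof.
intros HF.
rewrite (opexp_time F (s + t)), (opexp_time F s), (opexp_time F t) by exact HF.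
assert (Hl : forall r : R, lin (fun y => RtoC r * F y)%V).
{ intros r; apply (lin_comp (fun y => RtoC r * y)%V F); [apply lin_vscal|exact HF]. }
rewrite <- opexp_add_gen; [|apply Hl|apply Hl| |lra].
- apply opexp_ext; [apply Hl|]; intros y; module.
- intros y; rewrite !(lin_scal F HF); module.
Qed.

Lemma opexp_mult F (n : nat) t x :
  lin F -> opexp F (INR n * t) x = Nat.iter n (opexp F t) x.
Proof.
intros HF; induction n as [|n IH]; simpl Nat.iter.
- rewrite Rmult_0_l; now apply opexp_0.
- rewrite S_INR, Rmult_plus_distr_r, Rmult_1_l, Rplus_comm, opexp_plus by exact HF.
  now rewrite IH.
Qed.

End Exponential.
Arguments opexp {H} F t x.
Arguments tayl {H} y y' a b C.
Arguments taylop {H} P P' a b C.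

(** * Lyapunov forms *)

Section Lyapunov.
Variable H : HilbertSpace.
Implicit Types x y z w : H.

Record sform (p : H -> H -> R) (B : R) : Prop := {
  sform_add : forall x y z, p (x + y)%V z = p x z + p y z;
  sform_scal : forall (r : R) x y, p (RtoC r * x)%V y = r * p x y;
  sform_sym : forall x y, p x y = p y x;
  sform_bdd : forall x y, Rabs (p x y) <= B * (|{x}| * |{y}|)
}.

Lemma sform_tayl p B (y y' : R -> H) a b C :
  0 <= B -> sform p B -> tayl y y' a b C ->
  exists K, forall u v, a <= u <= b -> a <= v <= b ->
    Rabs (p (y v) (y v) - p (y u) (y u) - (v - u) * (2 * p (y' u) (y u))) <=
      K * (v - u) ^ 2.
Proof.
intros HB Hp Hy.
exists (2 * B * C * C + B * (C + C * Rabs (b - a)) ^ 2).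
intros u v Hu Hv; destruct (Hy u v Hu Hv) as [Y1 [Y2 Y3]].
assert (HC : 0 <= C) by (apply Rle_trans with (2 := Y2), vnorm_ge_0).
set (h := v - u) in *.
assert (Hh : Rabs h <= Rabs (b - a)).
{ rewrite (Rabs_pos_eq (b - a)) by lra; apply Rabs_le; unfold h; lra. }
assert (HhR : h ^ 2 = Rabs h * Rabs h) by (rewrite <- Rabs_mult, Rabs_pos_eq; nra).
assert (Ha := Rabs_pos h).
set (r := (y v - y u - RtoC h * y' u)%V) in *.
set (d := (RtoC h * y' u + r)%V).
assert (Hd : |{d}| <= Rabs h * (C + C * Rabs (b - a))).
{ apply Rle_trans with (1 := norm_tri _ _).
  assert (|{RtoC h * y' u}| <= Rabs h * C).
  { apply Rle_trans with (1 := norm_scal_R _ _); now apply Rmult_le_compat_l. }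
  assert (C * h ^ 2 <= C * (Rabs h * Rabs (b - a))).
  { rewrite HhR; apply Rmult_le_compat_l, Rmult_le_compat_l; assumption. }
  lra. }
assert (E : y v = (y u + d)%V) by (unfold d, r; module).
replace (p (y v) (y v) - p (y u) (y u) - h * (2 * p (y' u) (y u))) with
  (2 * p r (y u) + p d d).
- apply Rle_trans with (1 := Rabs_triang _ _).
  rewrite Rabs_mult, (Rabs_pos_eq 2) by lra.
  assert (Hr := sform_bdd p B Hp r (y u)); assert (Hdd := sform_bdd p B Hp d d).
  assert (H1 : B * (|{r}| * |{y u}|) <= B * (C * h ^ 2 * C)).
  { apply Rmult_le_compat_l, Rmult_le_compat; auto using vnorm_ge_0. }
  assert (H2 : B * (|{d}| * |{d}|) <= B * (h ^ 2 * (C + C * Rabs (b - a)) ^ 2)).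
  { apply Rmult_le_compat_l; [exact HB|]; rewrite HhR.
    replace (Rabs h * Rabs h * (C + C * Rabs (b - a)) ^ 2) with
     (Rabs h * (C + C * Rabs (b - a)) * (Rabs h * (C + C * Rabs (b - a)))) by ring.
    apply Rmult_le_compat; auto using vnorm_ge_0. }
  nra.
- assert (E2 : p (y u + d)%V (y u + d)%V = p (y u) (y u) + 2 * p d (y u) + p d d).
  { rewrite (sform_add p B Hp), (sform_sym p B Hp (y u)), (sform_sym p B Hp d (y u + d)%V).
    rewrite !(sform_add p B Hp), (sform_sym p B Hp (y u) d); ring. }
  assert (E3 : p d (y u) = h * p (y' u) (y u) + p r (y u)).
  { unfold d; rewrite (sform_add p B Hp), (sform_scal p B Hp); reflexivity. }
  rewrite E, E2, E3; ring.
Qed.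

(* [2 p (F x) x >= |G x|^2 / 2] makes [p] a Lyapunov form for [y' = - F y]. *)
Record lyap (p : H -> H -> R) (F G : H -> H) (B Q : R) : Prop := {
  lyap_B : 0 <= B;
  lyap_form : sform p B;
  lyap_pos : forall x, 0 <= p x x;
  lyap_le : forall x, p x x <= Q * |{x}| ^ 2;
  lyap_ge : forall x, |{G x}| ^ 2 / 2 <= 2 * p (F x) x
}.

(** Along y' = - F1 y the form p1 loses at least |G1 y|^2 / 2 per unit time, and along z' = F2 z the
    form p2 gains at least |G2 z|^2 / 2. Since <G1 y, G2 z> is at most the sum of these rates, Gam +
    kap (p1(y) - p2(z)) does not increase. Its end values then bound the growth of Gam by p1 at the
    start of y and p2 at the end of z. *)
Lemma two_sided_energy p1 p2 (F1 F2 G1 G2 : H -> H) B1 B2 Q1 Q2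
    (y z : R -> H) (Gam : R -> R) C1 C2 t kap :
  0 <= t -> 0 <= kap ->
  lyap p1 F1 G1 B1 Q1 -> lyap p2 F2 G2 B2 Q2 ->
  tayl y (fun u => - F1 (y u))%V 0 t C1 ->
  tayl z (fun u => F2 (z u)) 0 t C2 ->
  (exists C, forall u v, 0 <= u -> u <= v -> v <= t ->
     Gam v - Gam u <= (v - u) * (kap * rin (G1 (y u)) (G2 (z u))) + C * (v - u) ^ 2) ->
  Gam t - Gam 0 <= kap * (Q1 * |{y 0}| ^ 2 + Q2 * |{z t}| ^ 2).
Proof.
intros Ht Hk L1 L2 Ty Tz [C HG].
destruct (sform_tayl _ _ _ _ _ _ _ (lyap_B _ _ _ _ _ L1) (lyap_form _ _ _ _ _ L1) Ty)
  as [K1 S1].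
destruct (sform_tayl _ _ _ _ _ _ _ (lyap_B _ _ _ _ _ L2) (lyap_form _ _ _ _ _ L2) Tz)
  as [K2 S2].
assert (Hm := quad_mono (fun s => Gam s + kap * (p1 (y s) (y s) - p2 (z s) (z s)))
  0 t (C + kap * (K1 + K2)) Ht).
cbn beta in Hm.
assert (Hm' := Hm ltac:(
  intros u v Hu Huv Hv;
  specialize (HG u v Hu Huv Hv);
  specialize (S1 u v ltac:(lra) ltac:(lra));
  specialize (S2 u v ltac:(lra) ltac:(lra));
  assert (A1 := Rle_trans _ _ _ (Rle_abs _) S1);
  rewrite <- Rabs_Ropp in S2;
  assert (A2 := Rle_trans _ _ _ (Rle_abs _) S2);
  assert (D1 := lyap_ge _ _ _ _ _ L1 (y u));
  assert (D2 := lyap_ge _ _ _ _ _ L2 (z u));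
  assert (D3 := rin_le_quad H (G1 (y u)) (G2 (z u)));
  replace (- F1 (y u))%V with (RtoC (-1) * F1 (y u))%V in A1 by module;
  rewrite (sform_scal _ _ (lyap_form _ _ _ _ _ L1)) in A1;
  set (h := v - u) in *;
  assert (Hh : 0 <= h) by (unfold h; lra);
  assert (Hin : h * (kap * rin (G1 (y u)) (G2 (z u))) +
     kap * (h * (2 * (-1 * p1 (F1 (y u)) (y u))) - h * (2 * p2 (F2 (z u)) (z u))) <= 0)
   by (replace (h * (kap * rin (G1 (y u)) (G2 (z u))) +
     kap * (h * (2 * (-1 * p1 (F1 (y u)) (y u))) - h * (2 * p2 (F2 (z u)) (z u))))
     with (- (h * kap * (2 * p1 (F1 (y u)) (y u) + 2 * p2 (F2 (z u)) (z u) -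
        rin (G1 (y u)) (G2 (z u))))) by ring;
     assert (0 <= h * kap) by (now apply Rmult_le_pos); 
     assert (0 <= h * kap * (2 * p1 (F1 (y u)) (y u) + 2 * p2 (F2 (z u)) (z u) -
        rin (G1 (y u)) (G2 (z u)))) by (apply Rmult_le_pos; [assumption|lra]); lra);
  nra)).
assert (P1 := lyap_pos _ _ _ _ _ L1 (y t)); assert (P2 := lyap_pos _ _ _ _ _ L2 (z 0)).
assert (P3 := lyap_le _ _ _ _ _ L1 (y 0)); assert (P4 := lyap_le _ _ _ _ _ L2 (z t)).
nra.
Qed.

(* The values of an evolution family on [0, N], with [F] the inverse of its
   negative generator and [S] the evolution over the whole interval. *)
Record evolution (U : R -> H -> H) (F S : H -> H) (N C : R) (q : R -> R) : Prop := {
  ev_N : 0 <= N;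
  ev_C : 0 <= C;
  ev_rlin : forall s, 0 <= s <= N -> rlin (U s);
  ev_F : rlin F;
  ev_S : rlin S;
  ev_bdd : forall s, 0 <= s <= N -> bdd (U s) C;
  ev_lip : forall s s' x, 0 <= s <= N -> 0 <= s' <= N ->
    |{U s' x - U s x}| <= C * Rabs (s' - s) * |{x}|;
  ev_tayl : forall s s' x, 0 <= s <= N -> 0 <= s' <= N ->
    |{U s' (F x) - U s (F x) + RtoC (s' - s) * U s x}| <= C * (s' - s) ^ 2 * |{x}|;
  ev_q : forall s, 0 <= s <= N -> 0 <= q s /\ bdd (U s) (q s);
  ev_comm : forall s x, 0 <= s <= N -> U s (F x) = F (U s x);
  ev_end : forall x, U N x = S (U 0 x);
  ev_end' : forall x, U N x = U 0 (S x);
  ev_half : forall x, |{S x}| <= / 2 * |{x}|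
}.

(** Each clause is a norm bound uniform in x or an algebraic identity, and both pass through [rin];
    [ev_end] and [ev_end'] trade places. Commutation restores the order of the factors in [ev_tayl]
    after taking adjoints. *)
Lemma evolution_adj U F S N C q :
  evolution U F S N C q ->
  evolution (fun s => adj (U s)) (adj F) (adj S) N C q.
Proof.
intros HE.
assert (HN := ev_N _ _ _ _ _ _ HE).
assert (HC := ev_C _ _ _ _ _ _ HE).
assert (HU := ev_rlin _ _ _ _ _ _ HE).
assert (HF := ev_F _ _ _ _ _ _ HE).
assert (HS := ev_S _ _ _ _ _ _ HE).
assert (comm : forall s x, 0 <= s <= N -> adj (U s) (adj F x) = adj F (adj (U s) x)).
{ intros s x Hs; apply rin_ext; intros w.
  rewrite <- !adj_spec by auto; f_equal; symmetry; now apply (ev_comm _ _ _ _ _ _ HE). }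
assert (rhs : forall (c : R) w, 0 <= c -> 0 <= c * |{w}|).
{ intros c w Hc; apply Rmult_le_pos; [exact Hc|apply vnorm_ge_0]. }
assert (pos0 : 0 <= 0 <= N) by lra; assert (posN : 0 <= N <= N) by lra.
split; auto.
- intros s Hs; apply adj_rlin; auto.
- apply adj_rlin; auto.
- apply adj_rlin; auto.
- intros s Hs; apply adj_bdd; auto; apply (ev_bdd _ _ _ _ _ _ HE); auto.
- intros s s' x Hs Hs'; apply norm_le_rin.
  + apply rhs, Rmult_le_pos; [exact HC|apply Rabs_pos].
  + intros w; rewrite rin_sub_r, <- !adj_spec, <- rin_sub_l by auto.
    apply Rle_trans with (1 := rin_le _ _ _).
    assert (Hl := ev_lip _ _ _ _ _ _ HE s s' w Hs Hs').
    assert (Hx := vnorm_ge_0 x); nra.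
- intros s s' x Hs Hs'; apply norm_le_rin.
  + apply rhs, Rmult_le_pos; [exact HC|apply pow2_ge_0].
  + intros w; rewrite !comm by auto.
    rewrite rin_add_r, rin_sub_r, rin_scal_r, <- !adj_spec by auto.
    rewrite <- rin_scal_l, <- rin_sub_l, <- rin_add_l.
    apply Rle_trans with (1 := rin_le _ _ _).
    assert (Hl := ev_tayl _ _ _ _ _ _ HE s s' w Hs Hs').
    assert (Hx := vnorm_ge_0 x); nra.
- intros s Hs; destruct (ev_q _ _ _ _ _ _ HE s Hs) as [Hq1 Hq2].
  split; [exact Hq1|]; apply adj_bdd; auto.
- intros x; apply rin_ext; intros w.
  rewrite <- !adj_spec by auto; f_equal; apply (ev_end' _ _ _ _ _ _ HE).
- intros x; apply rin_ext; intros w.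
  rewrite <- !adj_spec by auto; f_equal; apply (ev_end _ _ _ _ _ _ HE).
- intros x; apply (adj_bdd H S (/ 2)); [lra|exact HS|].
  intros w; apply (ev_half _ _ _ _ _ _ HE).
Qed.

Lemma lip_continuous_R (g : R -> R) L :
  (forall s s', Rabs (g s' - g s) <= L * Rabs (s' - s)) -> forall s, continuous g s.
Proof.
intros Hg s; apply filterlim_locally; intros [e He].
assert (HK : 0 < Rmax 1 L) by (apply Rlt_le_trans with (2 := Rmax_l _ _); lra).
assert (Hd : 0 < e / Rmax 1 L) by now apply Rdiv_lt_0_compat.
exists (mkposreal _ Hd); intros s' Hs'.
change (Rabs (g s' - g s) < e).
apply Rle_lt_trans with (1 := Hg s s').
assert (H1 : Rabs (s' - s) < e / Rmax 1 L) by exact Hs'.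
apply Rlt_div_r in H1; [|exact HK].
apply Rle_lt_trans with (2 := H1).
rewrite Rmult_comm; apply Rmult_le_compat_l; [apply Rabs_pos|apply Rmax_r].
Qed.

(** The form is p(x, y) = int_0^N <U_s x, U_s y> ds. As U_s F x has derivative - U_s x, the value 2
    p(F x, x) is at least |U_0 F x|^2 - |U_N F x|^2, and U_N = S U_0 with |S| <= 1/2 leaves at least
    3/4 of |U_0 F x|^2. *)
Lemma lyap_of_evolution U F S N C q Q :
  evolution U F S N C q ->
  is_RInt (fun s => q s ^ 2) 0 N Q ->
  exists p B, lyap p F (fun x => U 0 (F x)) B Q.
Proof.
intros HE HQ.
assert (HN := ev_N _ _ _ _ _ _ HE).
assert (HC := ev_C _ _ _ _ _ _ HE).
assert (HU := ev_rlin _ _ _ _ _ _ HE).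
assert (Hbd := ev_bdd _ _ _ _ _ _ HE).
(* Clamping time to [0, N] makes the integrand continuous on the whole line. *)
set (cl := fun s => Rmax 0 (Rmin N s)).
assert (Hcl : forall s, 0 <= cl s <= N).
{ intros s; unfold cl, Rmax, Rmin; repeat destruct Rle_dec; lra. }
assert (Hcl1 : forall s, 0 <= s <= N -> cl s = s).
{ intros s Hs; unfold cl, Rmax, Rmin; repeat destruct Rle_dec; lra. }
assert (Hcl2 : forall s s', Rabs (cl s' - cl s) <= Rabs (s' - s)).
{ intros s s'; unfold cl, Rmax, Rmin, Rabs; repeat destruct Rle_dec;
  repeat destruct Rcase_abs; lra. }
set (g := fun x y s => rin (U (cl s) x) (U (cl s) y)).
assert (glip : forall x y s s', Rabs (g x y s' - g x y s) <=
   2 * C * C * (|{x}| * |{y}|) * Rabs (s' - s)).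
{ intros x y s s'; unfold g.
  replace (rin (U (cl s') x) (U (cl s') y) - rin (U (cl s) x) (U (cl s) y)) with
    (rin (U (cl s') x - U (cl s) x)%V (U (cl s') y) +
     rin (U (cl s) x) (U (cl s') y - U (cl s) y)%V)
    by (rewrite rin_sub_l, rin_sub_r; ring).
  apply Rle_trans with (1 := Rabs_triang _ _).
  assert (A1 := rin_abs H (U (cl s') x - U (cl s) x)%V (U (cl s') y)).
  assert (A2 := rin_abs H (U (cl s) x) (U (cl s') y - U (cl s) y)%V).
  assert (L1 := ev_lip _ _ _ _ _ _ HE (cl s) (cl s') x (Hcl _) (Hcl _)).
  assert (L2 := ev_lip _ _ _ _ _ _ HE (cl s) (cl s') y (Hcl _) (Hcl _)).
  assert (B1 := Hbd (cl s') (Hcl _) y); assert (B2 := Hbd (cl s) (Hcl _) x).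
  assert (Hc := Hcl2 s s').
  set (k := Rabs (s' - s)) in *; set (k' := Rabs (cl s' - cl s)) in *.
  assert (0 <= k') by apply Rabs_pos.
  assert (Hx := vnorm_ge_0 x); assert (Hy := vnorm_ge_0 y).
  assert (L1' : |{U (cl s') x - U (cl s) x}| <= C * k * |{x}|).
  { apply Rle_trans with (1 := L1), Rmult_le_compat_r; [exact Hx|].
    now apply Rmult_le_compat_l. }
  assert (L2' : |{U (cl s') y - U (cl s) y}| <= C * k * |{y}|).
  { apply Rle_trans with (1 := L2), Rmult_le_compat_r; [exact Hy|].
    now apply Rmult_le_compat_l. }
  assert (M1 : |{U (cl s') x - U (cl s) x}| * |{U (cl s') y}| <=
    C * k * |{x}| * (C * |{y}|)) by (apply Rmult_le_compat; auto using vnorm_ge_0).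
  assert (M2 : |{U (cl s) x}| * |{U (cl s') y - U (cl s) y}| <=
    C * |{x}| * (C * k * |{y}|)) by (apply Rmult_le_compat; auto using vnorm_ge_0).
  nra. }
assert (gcont : forall x y s, continuous (g x y) s).
{ intros x y; exact (lip_continuous_R _ _ (glip x y)). }
assert (gint : forall x y a b, is_RInt (g x y) a b (RInt (g x y) a b)).
{ intros x y a b; apply (@RInt_correct R_CompleteNormedModule).
  apply (@ex_RInt_continuous R_CompleteNormedModule); intros s _; apply gcont. }
set (p := fun x y => RInt (g x y) 0 N).
exists p, (C * C * N).
assert (gb : forall x y s, Rabs (g x y s) <= C * C * (|{x}| * |{y}|)).
{ intros x y s; unfold g; apply Rle_trans with (1 := rin_abs H _ _).
  replace (C * C * (|{x}| * |{y}|)) with ((C * |{x}|) * (C * |{y}|)) by ring.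
  apply Rmult_le_compat; auto using vnorm_ge_0; apply Hbd, Hcl. }
split.
- repeat apply Rmult_le_pos; assumption.
- split.
  + intros x y z; unfold p.
    apply (@is_RInt_unique R_CompleteNormedModule).
    apply (is_RInt_ext (fun s => plus (g x z s) (g y z s))).
    * intros s _; unfold g; rewrite (rlin_add _ (HU _ (Hcl s))), rin_add_l; reflexivity.
    * apply (@is_RInt_plus R_NormedModule); apply gint.
  + intros r x y; unfold p.
    apply (@is_RInt_unique R_CompleteNormedModule).
    apply (is_RInt_ext (fun s => scal r (g x y s))).
    * intros s _; unfold g; rewrite (rlin_scal _ (HU _ (Hcl s))), rin_scal_l; reflexivity.
    * apply (@is_RInt_scal R_NormedModule); apply gint.
  + intros x y; unfold p; apply (@RInt_ext R_CompleteNormedModule).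
    intros s _; apply rin_sym.
  + intros x y; unfold p.
    replace (C * C * N * (|{x}| * |{y}|)) with ((N - 0) * (C * C * (|{x}| * |{y}|)))
      by ring.
    apply (@norm_RInt_le R_NormedModule (g x y) (fun _ => C * C * (|{x}| * |{y}|)) 0 N
      (RInt (g x y) 0 N) ((N - 0) * (C * C * (|{x}| * |{y}|))) HN).
    * intros s _; apply gb.
    * apply gint.
    * apply (@is_RInt_const R_NormedModule).
- intros x; unfold p.
  apply (is_RInt_ge_0 (g x x) 0 N); [exact HN|apply gint|].
  intros s _; unfold g; rewrite rin_diag; apply pow2_ge_0.
- intros x; unfold p.
  apply (is_RInt_le (g x x) (fun s => scal (|{x}| ^ 2) (q s ^ 2)) 0 N); [exact HN|apply gint| |].
  + rewrite Rmult_comm; apply (@is_RInt_scal R_NormedModule); exact HQ.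
  + intros s Hs; unfold g; rewrite rin_diag, Hcl1 by lra.
    destruct (ev_q _ _ _ _ _ _ HE s ltac:(lra)) as [Hq1 Hq2].
    change (|{U s x}| ^ 2 <= |{x}| ^ 2 * q s ^ 2).
    rewrite <- Rpow_mult_distr, (Rmult_comm (|{x}|)).
    apply pow_incr; split; [apply vnorm_ge_0|apply Hq2].
- intros x.
  set (I := fun s => RInt (g (F x) x) 0 s).
  (* The quantity 2 I(s) + |U_s F x|^2 has zero derivative; one inequality suffices. *)
  assert (Hmono : - (2 * I N + |{U N (F x)}| ^ 2) <= - (2 * I 0 + |{U 0 (F x)}| ^ 2)).
  { apply (quad_mono (fun s => - (2 * I s + |{U s (F x)}| ^ 2)) 0 N
      (2 * (2 * C * C * (|{F x}| * |{x}|)) + 2 * C * C * |{F x}| * |{x}|)); [exact HN|].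
    intros u v Hu Huv Hv.
    assert (Hu' : 0 <= u <= N) by lra; assert (Hv' : 0 <= v <= N) by lra.
    set (h := v - u).
    assert (Hh : 0 <= h) by (unfold h; lra).
    assert (HI : I v - I u = RInt (g (F x) x) u v).
    { unfold I; rewrite <- (@RInt_Chasles R_CompleteNormedModule (g (F x) x) 0 u v)
        by (apply (@ex_RInt_continuous R_CompleteNormedModule); intros s _; apply gcont).
      unfold plus; simpl; ring. }
    set (L := 2 * C * C * (|{F x}| * |{x}|)) in *.
    assert (HL : 0 <= L) by (unfold L; repeat apply Rmult_le_pos; auto using vnorm_ge_0; lra).
    assert (HI2 : h * (g (F x) x u - L * h) <= RInt (g (F x) x) u v).
    { apply (is_RInt_le (fun _ => g (F x) x u - L * h) (g (F x) x) u v);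
        [exact Huv|apply (@is_RInt_const R_NormedModule)|apply gint|].
      intros s Hs; assert (Hg := glip (F x) x u s); fold L in Hg.
      apply Rabs_le_between in Hg; rewrite (Rabs_pos_eq (s - u)) in Hg by lra.
      assert (L * (s - u) <= L * h) by (apply Rmult_le_compat_l; unfold h; lra); lra. }
    assert (Ht := ev_tayl _ _ _ _ _ _ HE u v x Hu' Hv'); fold h in Ht.
    set (d := (U v (F x) - U u (F x) + RtoC h * U u x)%V) in *.
    assert (E : U v (F x) = (U u (F x) + (d - RtoC h * U u x))%V) by (unfold d; module).
    assert (Hsq : |{U v (F x)}| ^ 2 - |{U u (F x)}| ^ 2 >=
       2 * rin (U u (F x)) d - 2 * h * g (F x) x u).
    { rewrite E, norm_sq_add, rin_sub_r, rin_scal_r; unfold g; rewrite Hcl1 by exact Hu'.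
      assert (0 <= |{d - RtoC h * U u x}| ^ 2) by apply pow2_ge_0; lra. }
    assert (Hd : - rin (U u (F x)) d <= C * |{F x}| * (C * h ^ 2 * |{x}|)).
    { assert (Hr := rin_abs H (U u (F x)) d).
      apply Rabs_le_between in Hr.
      assert (|{U u (F x)}| * |{d}| <= C * |{F x}| * (C * h ^ 2 * |{x}|)).
      { apply Rmult_le_compat; auto using vnorm_ge_0; apply (Hbd u Hu'). }
      lra. }
    nra. }
  change (p (F x) x) with (I N).
  assert (I0 : I 0 = 0) by apply (@RInt_point R_CompleteNormedModule).
  rewrite I0, (ev_end _ _ _ _ _ _ HE) in Hmono.
  assert (Hhalf := ev_half _ _ _ _ _ _ HE (U 0 (F x))).
  assert (Hp1 := vnorm_ge_0 (S (U 0 (F x)))); assert (Hp2 := vnorm_ge_0 (U 0 (F x))).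
  nra.
Qed.

(** The energy method yields quadratic bounds in the initial datum r x and the test vector w;
    choosing their relative size turns them into a norm bound. *)
Lemma norm_of_form (d : H) x (c : R) :
  0 <= c ->
  (forall (r : R) w, r * rin d w <= c * (r ^ 2 * |{x}| ^ 2 + |{w}| ^ 2)) ->
  |{d}| <= 2 * c * |{x}|.
Proof.
intros Hc Hd.
assert (Hx := vnorm_ge_0 x); assert (Hn := vnorm_ge_0 d).
destruct (Req_dec (|{d}|) 0) as [Hd0|Hd0].
- rewrite Hd0; repeat apply Rmult_le_pos; lra.
- destruct (Req_dec (|{x}|) 0) as [Hx0|Hx0].
  (* For x = 0 any r > c contradicts d <> 0. *)
  + specialize (Hd (c + 1) d); rewrite rin_diag, Hx0 in Hd.
    assert (0 < |{d}| ^ 2) by (apply pow_lt; lra); nra.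
  (* This choice makes r x and w of equal norm, which balances the two terms on the right. *)
  + specialize (Hd (|{d}|) (RtoC (|{x}|) * d)%V).
    rewrite rin_scal_r, rin_diag, norm_scal_R_eq, Rabs_pos_eq in Hd by exact Hx.
    assert (0 < |{d}| * |{d}|) by (apply Rmult_lt_0_compat; lra).
    apply Rmult_le_reg_r with (|{d}| * |{d}|); [assumption|].
    apply Rmult_le_reg_r with (|{x}|); [lra|]; nra.
Qed.

End Lyapunov.
Arguments evolution {H} U F S N C q.

(** * The complex exponential *)

Definition cexp (z : C) : C := (exp (fst z) * cos (snd z), exp (fst z) * sin (snd z)).

Lemma cexp_0 : cexp 0 = 1.
Proof.
unfold cexp; simpl; rewrite exp_0, cos_0, sin_0.
apply injective_projections; simpl; ring.
Qed.

Lemma cexp_plus z w : cexp (z + w) = (cexp z * cexp w)%C.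
Proof.
unfold cexp, Cmult; simpl; rewrite exp_plus, cos_plus, sin_plus; f_equal; ring.
Qed.

Lemma Cmod_cexp z : Cmod (cexp z) = exp (fst z).
Proof.
unfold Cmod, cexp; simpl.
replace (_ + _) with ((exp (fst z)) ^ 2 * (Rsqr (sin (snd z)) + Rsqr (cos (snd z))))
  by (unfold Rsqr; ring).
rewrite sin2_cos2, Rmult_1_r; apply sqrt_pow2, Rlt_le, exp_pos.
Qed.

Lemma sin_mvt x : exists c, sin x = x * cos c /\ Rabs c <= Rabs x.
Proof.
destruct (MVT_gen sin 0 x cos) as [c [Hc Hs]].
- intros y _; apply is_derive_Reals, derivable_pt_lim_sin.
- intros y _; apply continuity_sin.
- exists c; rewrite sin_0, !Rminus_0_r in Hs; split; [lra|].
  unfold Rmin, Rmax, Rabs in *; repeat destruct Rle_dec; repeat destruct Rcase_abs; lra.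
Qed.

Lemma abs_sin_le x : Rabs (sin x) <= Rabs x.
Proof.
destruct (sin_mvt x) as [c [-> _]]; rewrite Rabs_mult.
assert (Rabs (cos c) <= 1) by (apply Rabs_le; destruct (COS_bound c); lra).
assert (0 <= Rabs x) by apply Rabs_pos; nra.
Qed.

Lemma cos_lower x : 1 - cos x <= x ^ 2 / 2.
Proof.
replace x with (2 * (x / 2)) at 1 by field; rewrite cos_2a_sin.
assert (Hs := abs_sin_le (x / 2)).
apply Rsqr_le_abs_1 in Hs; unfold Rsqr in Hs; nra.
Qed.

Lemma abs_sin_minus_le x : Rabs (sin x - x) <= x ^ 2.
Proof.
destruct (sin_mvt x) as [c [-> Hc]].
replace (x * cos c - x) with (- (x * (1 - cos c))) by ring.
rewrite Rabs_Ropp, Rabs_mult.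
assert (H0 : 0 <= 1 - cos c) by (destruct (COS_bound c); lra).
rewrite (Rabs_pos_eq _ H0).
assert (H1 := cos_lower c).
assert (H2 : 1 - cos c <= 2) by (destruct (COS_bound c); lra).
rewrite <- (pow2_abs x); rewrite <- (pow2_abs c) in H1.
assert (Hp := Rabs_pos c); assert (Hx := Rabs_pos x).
assert (H3 : 1 - cos c <= Rabs c) by (destruct (Rle_dec (Rabs c) 2); nra).
simpl; rewrite Rmult_1_r; apply Rmult_le_compat_l; lra.
Qed.

Lemma exp_taylor1 u : Rabs (exp u - 1) <= Rabs u * exp (Rabs u).
Proof.
assert (H1 := exp_ineq1_le u); assert (H2 := exp_ineq1_le (- u)).
assert (Hp := exp_pos u).
rewrite exp_Ropp in H2.
assert (H3 : exp u - 1 <= u * exp u).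
{ apply Rmult_le_compat_r with (r := exp u) in H2; [|lra].
  rewrite Rinv_l in H2 by lra; lra. }
unfold Rabs at 2 3; destruct (Rcase_abs u) as [Hu|Hu].
- assert (exp u <= 1) by (rewrite <- exp_0; left; now apply exp_increasing).
  assert (1 <= exp (- u)) by (rewrite <- exp_0; left; apply exp_increasing; lra).
  rewrite Rabs_left1 by lra; nra.
- rewrite Rabs_pos_eq; lra.
Qed.

(** From e^{-u} >= 1 - u one gets 0 <= e^u - 1 - u <= u (e^u - 1), and [exp_taylor1] bounds the last
    factor. *)
Lemma exp_taylor2 u : Rabs (exp u - 1 - u) <= u ^ 2 * exp (Rabs u).
Proof.
assert (H1 := exp_ineq1_le u); assert (H2 := exp_ineq1_le (- u)).
assert (Hp := exp_pos u).
rewrite exp_Ropp in H2.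
assert (H3 : exp u - 1 <= u * exp u).
{ apply Rmult_le_compat_r with (r := exp u) in H2; [|lra].
  rewrite Rinv_l in H2 by lra; lra. }
rewrite Rabs_pos_eq by lra.
apply Rle_trans with (Rabs u * Rabs (exp u - 1)).
- rewrite <- Rabs_mult; apply Rle_trans with (2 := Rle_abs _); lra.
- assert (H4 := exp_taylor1 u); rewrite <- (pow2_abs u).
  assert (Hu := Rabs_pos u).
  replace (Rabs u ^ 2 * exp (Rabs u)) with (Rabs u * (Rabs u * exp (Rabs u))) by ring.
  now apply Rmult_le_compat_l.
Qed.

Lemma Cmod_le_sum (z : C) : Cmod z <= Rabs (fst z) + Rabs (snd z).
Proof.
unfold Cmod; rewrite <- sqrt_Rsqr by (assert (H1 := Rabs_pos (fst z));
  assert (H2 := Rabs_pos (snd z)); lra).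
apply sqrt_le_1_alt; unfold Rsqr.
rewrite <- (pow2_abs (fst z)), <- (pow2_abs (snd z)).
assert (H1 := Rabs_pos (fst z)); assert (H2 := Rabs_pos (snd z)); nra.
Qed.

Lemma Cmod_sqr (z : C) : Cmod z ^ 2 = fst z ^ 2 + snd z ^ 2.
Proof.
unfold Cmod; rewrite pow2_sqrt; [reflexivity|].
assert (0 <= fst z ^ 2) by apply pow2_ge_0; assert (0 <= snd z ^ 2) by apply pow2_ge_0; lra.
Qed.

Lemma abs_fst_le (z : C) : Rabs (fst z) <= Cmod z.
Proof.
rewrite <- (Rabs_pos_eq (Cmod z)) by apply Cmod_ge_0.
apply Rsqr_le_abs_0; rewrite !Rsqr_pow2, Cmod_sqr.
assert (0 <= snd z ^ 2) by apply pow2_ge_0; lra.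
Qed.

(** Only the real part has to be bounded, since cosine and sine obey their quadratic bounds on the
    whole line. *)
Lemma cexp_taylor (z : C) (R0 : R) :
  Rabs (fst z) <= R0 ->
  Cmod (cexp z - 1 - z) <= 5 * exp R0 * Cmod z ^ 2.
Proof.
intros HR; destruct z as [u t]; simpl fst in *.
assert (He : exp (Rabs u) <= exp R0).
{ destruct HR as [HR|<-]; [left; now apply exp_increasing|right; reflexivity]. }
assert (Hu : exp u <= exp R0).
{ apply Rle_trans with (2 := He); assert (Hl := Rle_abs u).
  destruct Hl as [Hl|Hl]; [left; now apply exp_increasing|right; now rewrite <- Hl]. }
assert (Hp := exp_pos u).
rewrite Cmod_sqr; simpl fst; simpl snd.
replace (cexp (u, t) - 1 - (u, t))%C with
 (exp u - 1 - u - exp u * (1 - cos t), exp u * (sin t - t) + (exp u - 1) * t)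
 by (unfold cexp, Cminus, Cplus, Copp; simpl; f_equal; ring).
apply Rle_trans with (1 := Cmod_le_sum _); simpl fst; simpl snd.
assert (H1 := exp_taylor2 u); assert (H2 := exp_taylor1 u).
assert (H3 := cos_lower t); assert (H4 := abs_sin_minus_le t).
assert (H5 : 0 <= 1 - cos t) by (destruct (COS_bound t); lra).
assert (A1 : Rabs (exp u - 1 - u - exp u * (1 - cos t)) <=
   u ^ 2 * exp R0 + exp R0 * t ^ 2).
{ unfold Rminus at 1; apply Rle_trans with (1 := Rabs_triang _ _).
  rewrite Rabs_Ropp, Rabs_mult, (Rabs_pos_eq (exp u)), (Rabs_pos_eq (1 - cos t)) by lra.
  assert (0 <= u ^ 2) by apply pow2_ge_0; assert (0 <= t ^ 2) by apply pow2_ge_0.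
  assert (u ^ 2 * exp (Rabs u) <= u ^ 2 * exp R0) by now apply Rmult_le_compat_l.
  assert (exp u * (1 - cos t) <= exp R0 * t ^ 2) by (apply Rmult_le_compat; lra).
  lra. }
assert (A2 : Rabs (exp u * (sin t - t) + (exp u - 1) * t) <=
   exp R0 * t ^ 2 + exp R0 * (u ^ 2 + t ^ 2)).
{ apply Rle_trans with (1 := Rabs_triang _ _).
  rewrite !Rabs_mult, (Rabs_pos_eq (exp u)) by lra.
  apply Rplus_le_compat.
  - apply Rmult_le_compat; try lra; apply Rabs_pos.
  - apply Rle_trans with (Rabs u * exp R0 * Rabs t).
    + apply Rmult_le_compat_r; [apply Rabs_pos|].
      apply Rle_trans with (1 := H2), Rmult_le_compat_l; [apply Rabs_pos|exact He].
    + rewrite <- (pow2_abs u), <- (pow2_abs t).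
      assert (0 <= exp R0) by apply Rlt_le, exp_pos.
      assert (0 <= (Rabs u - Rabs t) ^ 2) by apply pow2_ge_0.
      replace (Rabs u * exp R0 * Rabs t) with (exp R0 * (Rabs u * Rabs t)) by ring.
      apply Rmult_le_compat_l; nra. }
assert (0 <= u ^ 2) by apply pow2_ge_0; assert (0 <= t ^ 2) by apply pow2_ge_0.
assert (0 < exp R0) by apply exp_pos.
nra.
Qed.

Lemma cexp_lip (z : C) (R0 : R) :
  Cmod z <= R0 -> Cmod (cexp z - 1) <= (1 + 5 * R0 * exp R0) * Cmod z.
Proof.
intros HR.
assert (Ht := cexp_taylor z R0 (Rle_trans _ _ _ (abs_fst_le z) HR)).
replace (cexp z - 1)%C with ((cexp z - 1 - z) + z)%C by ring.
apply Rle_trans with (1 := Cmod_triangle _ _).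
assert (Hz := Cmod_ge_0 z); assert (0 < exp R0) by apply exp_pos.
assert (5 * exp R0 * Cmod z ^ 2 <= 5 * exp R0 * (R0 * Cmod z)).
{ apply Rmult_le_compat_l; nra. }
lra.
Qed.

(** * Bounded semigroups and the inverse of the generator *)

Record bsg {H : HilbertSpace} (S : R -> H -> H) (M : R) : Prop := {
  bsg_M : 1 <= M;
  bsg_lin : forall t, 0 <= t -> lin (S t);
  bsg_0 : forall x, S 0 x = x;
  bsg_plus : forall s t x, 0 <= s -> 0 <= t -> S (s + t) x = S s (S t x);
  bsg_bdd : forall t, 0 <= t -> bdd (S t) M;
  bsg_cont : forall x e, 0 < e ->
    exists d, 0 < d /\ forall h, 0 < h < d -> |{S h x - x}| < e
}.

Section Semigroup.
Variable H : HilbertSpace.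
Variables (S : R -> H -> H) (M : R).
Hypothesis HS : bsg S M.

(** Clamped at 0, so that the orbit is continuous on the whole line. *)
Definition orbit (x : H) (s : R) : H := S (Rmax 0 s) x.

(** Right continuity at 0 is enough: |S(a + h) x - S(a) x| <= M |S(h) x - x| is uniform in the base
    point a, so it also controls increments to the left. *)
Lemma orbit_cont x s : continuous (orbit x) s.
Proof.
assert (HM := bsg_M S M HS).
assert (Hinc : forall a h, 0 <= a -> 0 <= h -> |{S (a + h) x - S a x}| <= M * |{S h x - x}|).
{ intros a h Ha Hh; rewrite (bsg_plus S M HS) by assumption.
  rewrite <- (lin_sub _ _ _ (bsg_lin S M HS a Ha)); now apply (bsg_bdd S M HS). }
apply cont_eps; intros e He.
destruct (bsg_cont S M HS x (e / M)) as [d [Hd Hx]]; [apply Rdiv_lt_0_compat; lra|].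
exists d; split; [exact Hd|]; intros y Hy; unfold orbit.
assert (Hx' : forall h, 0 <= h < d -> M * |{S h x - x}| < e).
{ intros h Hh; destruct (Req_dec h 0) as [->|Hh0].
  - rewrite (bsg_0 S M HS), norm_minus_diag; lra.
  - specialize (Hx h ltac:(lra)); apply Rlt_div_r in Hx; [|lra]; lra. }
set (a := Rmax 0 y); set (b := Rmax 0 s).
assert (Hab : Rabs (a - b) < d).
{ unfold a, b, Rmax, Rabs in *; repeat destruct Rle_dec; repeat destruct Rcase_abs; lra. }
assert (Ha : 0 <= a) by apply Rmax_l; assert (Hb : 0 <= b) by apply Rmax_l.
destruct (Rle_dec a b) as [Hle|Hle].
- rewrite Rabs_left1 in Hab by lra.
  rewrite norm_minus_sym; replace b with (a + (b - a)) by ring.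
  apply Rle_lt_trans with (1 := Hinc a (b - a) Ha ltac:(lra)), Hx'; lra.
- rewrite Rabs_pos_eq in Hab by lra.
  replace a with (b + (a - b)) by ring.
  apply Rle_lt_trans with (1 := Hinc b (a - b) Hb ltac:(lra)), Hx'; lra.
Qed.

Lemma orbit_eq x s : 0 <= s -> orbit x s = S s x.
Proof. intros Hs; unfold orbit; now rewrite Rmax_right. Qed.

Definition orbit_int (N : R) (x : H) : H := RI (orbit x) 0 N.

Lemma orbit_int_lin N : 0 <= N -> lin (orbit_int N).
Proof.
intros HN; apply (bdd_lin _ (M * N)).
- intros x y; unfold orbit_int; rewrite <- RI_plus by apply orbit_cont.
  apply RI_ext; intros s _; apply (lin_add _ (bsg_lin S M HS _ (Rmax_l _ _))).
- intros c x; unfold orbit_int; rewrite <- RI_scal by apply orbit_cont.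
  apply RI_ext; intros s _; apply (lin_scal _ (bsg_lin S M HS _ (Rmax_l _ _))).
- intros x; unfold orbit_int.
  apply Rle_trans with (M * |{x}| * (N - 0)); [|right; ring].
  apply RI_norm_const; [exact HN|apply orbit_cont|].
  intros s _; apply (bsg_bdd S M HS), Rmax_l.
Qed.

Lemma orbit_int_S N h x :
  0 <= N -> 0 <= h -> S h (orbit_int N x) = RI (orbit x) h (N + h).
Proof.
intros HN Hh; unfold orbit_int.
rewrite <- RI_linear by (apply (bsg_lin S M HS); exact Hh) || apply orbit_cont.
replace (RI (orbit x) h (N + h)) with (RI (orbit x) (0 + h) (N + h)) by (f_equal; ring).
rewrite <- RI_shift by apply orbit_cont.
apply RI_ext; intros s Hs.
rewrite Rmin_left, Rmax_right in Hs by exact HN.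
rewrite !orbit_eq by lra; rewrite <- (bsg_plus S M HS) by lra.
f_equal; ring.
Qed.

Lemma orbit_int_comm N L x :
  0 <= N -> lin L -> (forall t y, 0 <= t -> S t (L y) = L (S t y)) ->
  L (orbit_int N x) = orbit_int N (L x).
Proof.
intros HN HL HLS; unfold orbit_int.
rewrite <- RI_linear by exact HL || apply orbit_cont.
apply RI_ext; intros s _; unfold orbit; symmetry; apply HLS, Rmax_l.
Qed.

Lemma RI_avg (f : R -> H) a e :
  (forall s, continuous f s) -> 0 < e ->
  exists d, 0 < d /\ forall h, 0 < h < d ->
    |{RtoC (/ h) * RI f a (a + h) - f a}| <= e.
Proof.
intros Hf He; destruct (proj1 (cont_eps _ f a) (Hf a) e He) as [d [Hd Hd']].
exists d; split; [exact Hd|]; intros h Hh.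
replace (RtoC (/ h) * RI f a (a + h) - f a)%V with
  (RtoC (/ h) * (RI f a (a + h) - RtoC (a + h - a) * f a))%V.
- apply Rle_trans with (1 := norm_scal_R _ _).
  assert (Hi : 0 < / h) by (apply Rinv_0_lt_compat; lra).
  rewrite Rabs_pos_eq by lra.
  apply Rle_trans with (/ h * (e * (a + h - a))); [|right; field; lra].
  apply Rmult_le_compat_l; [lra|]; apply RI_quad; [lra|exact Hf|].
  intros s Hs; apply Rlt_le, Hd'; rewrite Rabs_pos_eq; lra.
- replace (a + h - a) with h by ring.
  replace (RtoC (/ h) * (RI f a (a + h) - RtoC h * f a))%V with
   (RtoC (/ h) * RI f a (a + h) - RtoC (/ h * h) * f a)%V by module.
  rewrite Rinv_l by lra; module.
Qed.

(* The negative of the generator. *)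
Definition ngen (x y : H) : Prop :=
  forall e, 0 < e -> exists d, 0 < d /\ forall h, 0 < h < d ->
    |{RtoC (/ h) * (x - S h x) - y}| <= e.

Lemma ngen_unique x y y' : ngen x y -> ngen x y' -> y = y'.
Proof.
intros H1 H2; apply norm_unique_eps; intros e He.
destruct (H1 (e / 2)) as [d1 [Hd1 H1']]; [lra|].
destruct (H2 (e / 2)) as [d2 [Hd2 H2']]; [lra|].
set (h := Rmin d1 d2 / 2).
assert (Hm : 0 < Rmin d1 d2) by now apply Rmin_glb_lt.
assert (Hm1 := Rmin_l d1 d2); assert (Hm2 := Rmin_r d1 d2).
specialize (H1' h ltac:(unfold h; lra)); specialize (H2' h ltac:(unfold h; lra)).
set (q := (RtoC (/ h) * (x - S h x))%V) in *.
replace (y - y')%V with ((q - y') - (q - y))%V by module.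
apply Rle_trans with (1 := norm_minus_le _ _); lra.
Qed.

Lemma ngen_lin L x y :
  lin L -> (forall t z, 0 <= t -> S t (L z) = L (S t z)) -> ngen x y -> ngen (L x) (L y).
Proof.
intros HL HLS Hxy e He; destruct (lin_bdd L HL) as [c [Hc Lc]].
destruct (Hxy (e / c)) as [d [Hd Hd']]; [now apply Rdiv_lt_0_compat|].
exists d; split; [exact Hd|]; intros h Hh.
rewrite HLS, <- (lin_sub L), <- (lin_scal L), <- (lin_sub L) by lra || exact HL.
apply Rle_trans with (1 := Lc _).
apply Rle_trans with (c * (e / c)); [|right; field; lra].
apply Rmult_le_compat_l; [lra|now apply Hd'].
Qed.

Lemma ngen_add x y x' y' : ngen x y -> ngen x' y' -> ngen (x + x')%V (y + y')%V.
Proof.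
intros H1 H2 e He.
destruct (H1 (e / 2)) as [d1 [Hd1 H1']]; [lra|].
destruct (H2 (e / 2)) as [d2 [Hd2 H2']]; [lra|].
exists (Rmin d1 d2); split; [now apply Rmin_glb_lt|]; intros h Hh.
assert (Hm1 := Rmin_l d1 d2); assert (Hm2 := Rmin_r d1 d2).
specialize (H1' h ltac:(lra)); specialize (H2' h ltac:(lra)).
rewrite (lin_add _ (bsg_lin S M HS h ltac:(lra))).
replace (RtoC (/ h) * (x + x' - (S h x + S h x')) - (y + y'))%V with
 ((RtoC (/ h) * (x - S h x) - y) + (RtoC (/ h) * (x' - S h x') - y'))%V by module.
apply Rle_trans with (1 := norm_tri _ _); lra.
Qed.

Lemma ngen_scal c x y : ngen x y -> ngen (c * x)%V (c * y)%V.
Proof.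
apply (ngen_lin (fun x => c * x)%V); [apply lin_vscal|].
intros t z Ht; apply (lin_scal _ (bsg_lin S M HS t Ht)).
Qed.

Lemma orbit_int_ends N h x :
  0 <= N -> 0 <= h ->
  (RI (orbit x) 0 N - RI (orbit x) h (N + h))%V =
  (RI (orbit x) 0 (0 + h) - RI (orbit x) N (N + h))%V.
Proof.
intros HN Hh; assert (Hc := orbit_cont x).
assert (E1 := RI_Chasles _ (orbit x) 0 h (N + h) Hc).
assert (E2 := RI_Chasles _ (orbit x) 0 N (N + h) Hc).
rewrite Rplus_0_l.
replace (RI (orbit x) h (N + h)) with (RI (orbit x) 0 (N + h) - RI (orbit x) 0 h)%V
  by (rewrite <- E1; module).
rewrite <- E2; module.
Qed.

Lemma ends_limit N x e :
  0 <= N -> 0 < e -> exists d, 0 < d /\ forall h, 0 < h < d ->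
  |{RtoC (/ h) * (RI (orbit x) 0 (0 + h) - RI (orbit x) N (N + h)) - (x - S N x)}| <= e.
Proof.
intros HN He; assert (Hc := orbit_cont x).
destruct (RI_avg (orbit x) 0 (e / 2) Hc) as [d1 [Hd1 H1]]; [lra|].
destruct (RI_avg (orbit x) N (e / 2) Hc) as [d2 [Hd2 H2]]; [lra|].
exists (Rmin d1 d2); split; [now apply Rmin_glb_lt|]; intros h Hh.
assert (Hm1 := Rmin_l d1 d2); assert (Hm2 := Rmin_r d1 d2).
specialize (H1 h ltac:(lra)); specialize (H2 h ltac:(lra)).
rewrite orbit_eq, (bsg_0 S M HS) in H1 by lra; rewrite orbit_eq in H2 by lra.
set (a := RI (orbit x) 0 (0 + h)) in *; set (b := RI (orbit x) N (N + h)) in *.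
replace (RtoC (/ h) * (a - b) - (x - S N x))%V with
 ((RtoC (/ h) * a - x) - (RtoC (/ h) * b - S N x))%V by module.
apply Rle_trans with (1 := norm_minus_le _ _); lra.
Qed.

Lemma ngen_orbit_int N z : 0 <= N -> ngen (orbit_int N z) (z - S N z)%V.
Proof.
intros HN e He; destruct (ends_limit N z e HN He) as [d [Hd H1]].
exists d; split; [exact Hd|]; intros h Hh.
rewrite orbit_int_S by lra; unfold orbit_int; rewrite orbit_int_ends by lra.
now apply H1.
Qed.

(** Fundamental theorem of calculus along an orbit. The difference quotient of [orbit_int N x] is
    the integral of the quotients of x, which tends to [orbit_int N y]; by the shift of the interval
    it also tends to x - S(N) x. *)
Lemma orbit_int_ngen N x y : 0 <= N -> ngen x y -> orbit_int N y = (x - S N x)%V.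
Proof.
intros HN Hxy; assert (HM := bsg_M S M HS).
assert (LJ := orbit_int_lin N HN); destruct (lin_bdd _ LJ) as [c [Hc Jc]].
apply norm_unique_eps; intros e He.
destruct (ends_limit N x (e / 2) HN) as [d1 [Hd1 H1]]; [lra|].
destruct (Hxy (e / (2 * c))) as [d2 [Hd2 H2]]; [apply Rdiv_lt_0_compat; lra|].
set (h := Rmin d1 d2 / 2).
assert (Hm : 0 < Rmin d1 d2) by now apply Rmin_glb_lt.
assert (Hm1 := Rmin_l d1 d2); assert (Hm2 := Rmin_r d1 d2).
assert (Hh : 0 < h) by (unfold h; lra).
specialize (H1 h ltac:(unfold h; lra)); specialize (H2 h ltac:(unfold h; lra)).
rewrite <- orbit_int_ends, <- orbit_int_S in H1 by lra; fold (orbit_int N x) in H1.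
rewrite orbit_int_comm in H1; [|exact HN|apply (bsg_lin S M HS); lra|].
2:{ intros t y' Ht'; rewrite <- !(bsg_plus S M HS) by lra; f_equal; ring. }
rewrite <- (lin_sub _ _ _ LJ), <- (lin_scal _ LJ) in H1.
set (q := (RtoC (/ h) * (x - S h x))%V) in *.
replace (orbit_int N y - (x - S N x))%V with
  ((orbit_int N q - (x - S N x)) - (orbit_int N q - orbit_int N y))%V by module.
apply Rle_trans with (1 := norm_minus_le _ _).
rewrite <- (lin_sub _ _ _ LJ).
assert (H3 := Jc (q - y)%V).
assert (c * |{q - y}| <= c * (e / (2 * c))) by (apply Rmult_le_compat_l; lra).
replace (c * (e / (2 * c))) with (e / 2) in * by (field; lra).
lra.
Qed.

End Semigroup.
Arguments orbit {H} S x s.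
Arguments orbit_int {H} S N x.
Arguments ngen {H} S x y.

(** * Neumann series, adjoint exponentials and iterates *)

Lemma neumann {H : HilbertSpace} (L : H -> H) y :
  lin L -> bdd L (/ 2) -> exists x, (x - L x)%V = y /\ |{x}| <= 2 * |{y}|.
Proof.
intros HL Lb.
set (a := fun n => Nat.iter n L y).
assert (Ha : forall n, |{a n}| <= (/ 2) ^ n * |{y}|).
{ intros n; apply (bdd_iter L (/ 2) n); [lra|exact Lb]. }
assert (Hg : is_series (fun n => (/ 2) ^ n * |{y}|) (2 * |{y}|)).
{ rewrite Rmult_comm.
  apply is_series_ext with (fun n => scal (|{y}|) ((/ 2) ^ n)).
  - intros n; apply Rmult_comm.
  - apply (@is_series_scal R_AbsRing R_NormedModule).
    assert (G := is_series_geom (/ 2) ltac:(rewrite Rabs_pos_eq; lra)).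
    replace (/ (1 - / 2)) with 2 in G by field; exact G. }
assert (Hex : ex_series a).
{ apply (@ex_series_le C_AbsRing H) with (fun n => (/ 2) ^ n * |{y}|); [exact Ha|].
  eexists; exact Hg. }
destruct Hex as [x Hx]; exists x; split.
- assert (Hs := is_series_lin L a x HL Hx).
  assert (Hx' : is_series a (L x + y)%V).
  { apply is_series_decr_1.
    change (is_series (fun k => a (S k)) (L x + y + - y)%V).
    replace (L x + y + - y)%V with (L x) by module; exact Hs. }
  rewrite (is_series_unique_vec _ _ _ Hx Hx') at 1; module.
- exact (is_series_norm_le a _ x _ Hx Hg Ha).
Qed.

Lemma exp_neg_le_1 u : u <= 0 -> exp u <= 1.
Proof.
intros [Hu| ->]; [|rewrite exp_0; lra].
rewrite <- exp_0; left; now apply exp_increasing.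
Qed.

Lemma adj_ext {H : HilbertSpace} (L L' : H -> H) y :
  rlin L -> (forall x, L x = L' x) -> adj L y = adj L' y.
Proof.
intros HL HLL; apply rin_ext; intros x.
assert (HL' : rlin L').
{ destruct HL as [H1 H2 [c [Hc H3]]]; split.
  - intros; rewrite <- !HLL; apply H1.
  - intros; rewrite <- !HLL; apply H2.
  - exists c; split; [exact Hc|]; intros z; rewrite <- HLL; apply H3. }
now rewrite <- !adj_spec, HLL.
Qed.

(** The backward adjoint orbit z(s), the adjoint of e^{-(t-s)F} applied to w, solves z' = F' z with
    F' the adjoint of F: this is the second curve of [two_sided_energy]. The bounds follow by
    duality from those of the exponential. *)
Lemma adj_opexp_tayl {H : HilbertSpace} (F : H -> H) t w :
  lin F -> exists C, tayl (fun s => adj (opexp F (t - s)) w)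
    (fun s => adj F (adj (opexp F (t - s)) w)) 0 t C.
Proof.
intros HF; destruct (opexp_taylop H F 0 t HF) as [C TF].
apply (taylop_rev H) with (t := t) in TF; rewrite Rminus_diag, Rminus_0_r in TF.
destruct TF as [HC TF].
exists (C * |{w}|); intros u v Hu Hv.
assert (HE : forall s, rlin (opexp F s)) by (intros s; now apply lin_rlin, opexp_lin).
assert (HF' := lin_rlin H F HF).
assert (Hw := vnorm_ge_0 w).
assert (Hcw : 0 <= C * |{w}|) by now apply Rmult_le_pos.
assert (Hh : 0 <= C * |{w}| * (v - u) ^ 2)
  by (apply Rmult_le_pos; [exact Hcw|apply pow2_ge_0]).
split; [|split]; apply norm_le_rin; try assumption; intros x;
destruct (TF u v x Hu Hv) as [T1 [T2 T3]];
rewrite ?rin_sub_r, ?rin_scal_r, <- ?adj_spec by auto.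
- rewrite <- rin_sub_l, <- rin_scal_l, <- rin_sub_l.
  apply Rle_trans with (1 := rin_le _ _ _).
  rewrite (opexp_comm H F F) in T1 by (assumption || reflexivity).
  replace (- - opexp F (t - u) (F x))%V with (opexp F (t - u) (F x)) in T1 by module.
  nra.
- apply Rle_trans with (1 := rin_le _ _ _); nra.
- apply Rle_trans with (1 := rin_le _ _ _).
  rewrite (opexp_comm H F F) in T3 by (assumption || reflexivity).
  replace (- - opexp F (t - u) (F x))%V with (opexp F (t - u) (F x)) in T3 by module.
  nra.
Qed.

Lemma rin_tayl {H : HilbertSpace} (L : H -> H) (y y' z z' : R -> H) a b (C D : R) :
  lin L -> tayl y y' a b C -> tayl z z' a b D ->
  exists K, forall u v, a <= u <= b -> a <= v <= b ->
    rin (L (y v)) (z v) - rin (L (y u)) (z u) <=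
    (v - u) * (rin (L (y' u)) (z u) + rin (L (y u)) (z' u)) + K * (v - u) ^ 2.
Proof.
intros HL Hy Hz; destruct (lin_bdd L HL) as [c [Hc Lc]].
exists (c * C * D * (3 + Rabs (b - a))); intros u v Hu Hv.
destruct (Hy u v Hu Hv) as [Y1 [Y2 Y3]]; destruct (Hz u v Hu Hv) as [Z1 [Z2 Z3]].
destruct (Hz v u Hv Hu) as [_ [Z4 _]].
assert (HC : 0 <= C) by (apply Rle_trans with (2 := Y2), vnorm_ge_0).
assert (HD : 0 <= D) by (apply Rle_trans with (2 := Z2), vnorm_ge_0).
set (h := v - u) in *.
assert (Hh : Rabs h <= Rabs (b - a)).
{ rewrite (Rabs_pos_eq (b - a)) by lra; apply Rabs_le; unfold h; lra. }
assert (HhR : Rabs h * Rabs h = h ^ 2) by (rewrite <- Rabs_mult, Rabs_pos_eq; nra).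
assert (Ha := Rabs_pos h).
set (r1 := (y v - y u - RtoC h * y' u)%V) in *.
set (r2 := (z v - z u - RtoC h * z' u)%V) in *.
assert (E : rin (L (y v)) (z v) - rin (L (y u)) (z u) -
    h * (rin (L (y' u)) (z u) + rin (L (y u)) (z' u)) =
  rin (L r1) (z v) + rin (L (RtoC h * y' u)%V) (RtoC h * z' u + r2)%V +
  rin (L (y u)) r2).
{ replace (RtoC h * z' u + r2)%V with (z v - z u)%V by (unfold r2; module).
  unfold r1, r2; rewrite !(lin_sub L) by exact HL; rewrite !(lin_scal L HL).
  rewrite !rin_sub_l, !rin_sub_r, !rin_scal_r, !rin_scal_l; ring. }
assert (N1 : rin (L r1) (z v) <= c * (C * h ^ 2) * D).
{ apply Rle_trans with (1 := rin_le _ _ _).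
  apply Rmult_le_compat; auto using vnorm_ge_0.
  apply Rle_trans with (1 := Lc _), Rmult_le_compat_l; lra. }
assert (N3 : rin (L (y u)) r2 <= c * C * (D * h ^ 2)).
{ apply Rle_trans with (1 := rin_le _ _ _).
  apply Rmult_le_compat; auto using vnorm_ge_0.
  apply Rle_trans with (1 := Lc _), Rmult_le_compat_l; lra. }
assert (N2 : rin (L (RtoC h * y' u)%V) (RtoC h * z' u + r2)%V <=
  c * (Rabs h * C) * (Rabs h * D + D * h ^ 2)).
{ apply Rle_trans with (1 := rin_le _ _ _).
  apply Rmult_le_compat; auto using vnorm_ge_0.
  - apply Rle_trans with (1 := Lc _), Rmult_le_compat_l; [lra|].
    apply Rle_trans with (1 := norm_scal_R _ _); now apply Rmult_le_compat_l.
  - apply Rle_trans with (1 := norm_tri _ _), Rplus_le_compat; [|exact Z1].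
    apply Rle_trans with (1 := norm_scal_R _ _); now apply Rmult_le_compat_l. }
replace (c * (Rabs h * C) * (Rabs h * D + D * h ^ 2)) with
  (c * C * D * h ^ 2 + c * C * D * h ^ 2 * Rabs h) in N2
  by (rewrite <- HhR at 1; ring).
assert (Hq : 0 <= c * C * D * h ^ 2).
{ apply Rmult_le_pos; [|apply pow2_ge_0].
  apply Rmult_le_pos; [apply Rmult_le_pos; lra|exact HD]. }
assert (c * C * D * h ^ 2 * Rabs h <= c * C * D * h ^ 2 * Rabs (b - a))
  by now apply Rmult_le_compat_l.
nra.
Qed.

Lemma iter_comm2 {X : Type} (K L : X -> X) n x :
  (forall y, K (L y) = L (K y)) -> Nat.iter n (fun y => K (L y)) x =
  Nat.iter n K (Nat.iter n L x).
Proof.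
intros HKL; induction n as [|n IH]; simpl; [reflexivity|].
rewrite IH; f_equal; symmetry; apply iter_comm; auto.
Qed.

Lemma iter_add {X : Type} (K : X -> X) m n x :
  Nat.iter (m + n) K x = Nat.iter m K (Nat.iter n K x).
Proof. induction m as [|m IH]; simpl; [reflexivity|now rewrite IH]. Qed.

Lemma iter_mult {X : Type} (K : X -> X) m n x :
  Nat.iter (m * n) K x = Nat.iter m (Nat.iter n K) x.
Proof.
induction m as [|m IH]; simpl; [reflexivity|].
now rewrite iter_add, IH.
Qed.

(** * Absolutely convergent integrals over the line *)

(** In the variable u = ln r this is the majorant expressing power decay of order d both at r = 0
    and at infinity, peaked at r = e^c. *)
Definition dexp (d c u : R) : R := exp (- (d * Rabs (u - c))).

Lemma exp_le a b : a <= b -> exp a <= exp b.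
Proof. intros [Hab| ->]; [left; now apply exp_increasing|lra]. Qed.

Lemma exp_small d e : 0 < d -> 0 < e -> exists N, 0 <= N /\ forall x, N <= x -> exp (- (d * x)) <= e.
Proof.
intros Hd He; exists (Rmax 0 (- ln e / d)); split; [apply Rmax_l|]; intros x Hx.
rewrite <- (exp_ln e) by exact He; apply exp_le.
assert (H1 : - ln e / d <= x) by (apply Rle_trans with (2 := Hx), Rmax_r).
apply Rmult_le_compat_l with (r := d) in H1; [|lra].
replace (d * (- ln e / d)) with (- ln e) in H1 by (field; lra); lra.
Qed.

Section LineIntegral.
Variable V : cmodule.
Implicit Types f g : R -> V.

(* Improper integral over the real line. *)
Definition LI f (l : V) : Prop :=
  forall e, 0 < e -> exists N, forall a b, a <= - N -> N <= b -> |{RI f a b - l}| <= e.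

Lemma LI_unique f l l' : LI f l -> LI f l' -> l = l'.
Proof.
intros H1 H2; apply norm_unique_eps; intros e He.
destruct (H1 (e / 2)) as [N1 H1']; [lra|]; destruct (H2 (e / 2)) as [N2 H2']; [lra|].
set (N := Rmax N1 N2); assert (HN1 : N1 <= N) by apply Rmax_l.
assert (HN2 : N2 <= N) by apply Rmax_r.
specialize (H1' (- N) N ltac:(lra) HN1); specialize (H2' (- N) N ltac:(lra) HN2).
replace (l - l')%V with ((RI f (- N) N - l') - (RI f (- N) N - l))%V by module.
apply Rle_trans with (1 := norm_minus_le _ _); lra.
Qed.

Lemma LI_ext f g l : (forall u, f u = g u) -> LI f l -> LI g l.
Proof.
intros Hfg Hf e He; destruct (Hf e He) as [N HN]; exists N; intros a b Ha Hb.
rewrite <- (RI_ext V f g) by (intros u _; apply Hfg); auto.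
Qed.

Lemma LI_sub f g l l' :
  (forall u, continuous f u) -> (forall u, continuous g u) ->
  LI f l -> LI g l' -> LI (fun u => f u - g u)%V (l - l')%V.
Proof.
intros Hf Hg H1 H2 e He.
destruct (H1 (e / 2)) as [N1 H1']; [lra|]; destruct (H2 (e / 2)) as [N2 H2']; [lra|].
exists (Rmax N1 N2); intros a b Ha Hb.
assert (HN1 : N1 <= Rmax N1 N2) by apply Rmax_l.
assert (HN2 : N2 <= Rmax N1 N2) by apply Rmax_r.
specialize (H1' a b ltac:(lra) ltac:(lra)); specialize (H2' a b ltac:(lra) ltac:(lra)).
rewrite RI_minus by assumption.
replace (RI f a b - RI g a b - (l - l'))%V with ((RI f a b - l) - (RI g a b - l'))%V by module.
apply Rle_trans with (1 := norm_minus_le _ _); lra.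
Qed.

Lemma LI_shift f l c : (forall u, continuous f u) -> LI f l -> LI (fun u => f (u + c)) l.
Proof.
intros Hf H1 e He; destruct (H1 e He) as [N HN].
exists (N + Rabs c); intros a b Ha Hb; rewrite RI_shift by exact Hf.
assert (H2 := Rle_abs c); assert (H3 := Rle_abs (- c)); rewrite Rabs_Ropp in H3.
apply HN; lra.
Qed.

Lemma is_RInt_exp_right d c p b : 0 < d ->
  is_RInt (fun u => exp (- (d * (u - c)))) p b
    ((exp (- (d * (p - c))) - exp (- (d * (b - c)))) / d).
Proof.
intros Hd.
replace ((exp (- (d * (p - c))) - exp (- (d * (b - c)))) / d) with
  (minus (- exp (- (d * (b - c))) / d) (- exp (- (d * (p - c))) / d))
  by (unfold minus, plus, opp; simpl; field; lra).
apply (@is_RInt_derive R_CompleteNormedModule (fun u => - exp (- (d * (u - c))) / d)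
  (fun u => exp (- (d * (u - c))))).
- intros u _; auto_derive; [trivial|unfold Rminus; field; lra].
- intros u _; apply (@ex_derive_continuous R_AbsRing R_NormedModule); auto_derive; trivial.
Qed.

Lemma is_RInt_exp_left d c a p : 0 < d ->
  is_RInt (fun u => exp (d * (u - c))) a p
    ((exp (d * (p - c)) - exp (d * (a - c))) / d).
Proof.
intros Hd.
replace ((exp (d * (p - c)) - exp (d * (a - c))) / d) with
  (minus (exp (d * (p - c)) / d) (exp (d * (a - c)) / d))
  by (unfold minus, plus, opp; simpl; field; lra).
apply (@is_RInt_derive R_CompleteNormedModule (fun u => exp (d * (u - c)) / d)
  (fun u => exp (d * (u - c)))).
- intros u _; auto_derive; [trivial|unfold Rminus; field; lra].
- intros u _; apply (@ex_derive_continuous R_AbsRing R_NormedModule); auto_derive; trivial.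
Qed.

Section Dominated.
Variables (f : R -> V) (K d c : R).
Hypothesis Hf : forall u, continuous f u.
Hypothesis HK : 0 <= K.
Hypothesis Hd : 0 < d.
Hypothesis fdom : forall u, |{f u}| <= K * dexp d c u.

Lemma RI_right p b : c <= p -> p <= b -> |{RI f p b}| <= K / d * exp (- (d * (p - c))).
Proof.
intros Hp Hb.
apply Rle_trans with (K * ((exp (- (d * (p - c))) - exp (- (d * (b - c)))) / d)).
- apply (RI_norm_le V f (fun u => scal K (exp (- (d * (u - c))))) p b); auto.
  + intros u Hu; apply Rle_trans with (1 := fdom u); unfold dexp.
    rewrite Rabs_pos_eq by lra; right; reflexivity.
  + apply (@is_RInt_scal R_NormedModule), is_RInt_exp_right, Hd.
- assert (He := exp_pos (- (d * (b - c)))).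
  replace (K / d * exp (- (d * (p - c)))) with (K * (exp (- (d * (p - c))) / d)) by (field; lra).
  apply Rmult_le_compat_l; [exact HK|].
  apply Rmult_le_compat_r; [apply Rlt_le, Rinv_0_lt_compat, Hd|lra].
Qed.

Lemma RI_left a p : p <= c -> a <= p -> |{RI f a p}| <= K / d * exp (- (d * (c - p))).
Proof.
intros Hp Hb.
apply Rle_trans with (K * ((exp (d * (p - c)) - exp (d * (a - c))) / d)).
- apply (RI_norm_le V f (fun u => scal K (exp (d * (u - c)))) a p); auto.
  + intros u Hu; apply Rle_trans with (1 := fdom u); unfold dexp.
    rewrite Rabs_left1 by lra; change (K * exp (- (d * - (u - c))) <= K * exp (d * (u - c))).
    right; do 2 f_equal; ring.
  + apply (@is_RInt_scal R_NormedModule), is_RInt_exp_left, Hd.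
- assert (He := exp_pos (d * (a - c))).
  replace (- (d * (c - p))) with (d * (p - c)) by ring.
  replace (K / d * exp (d * (p - c))) with (K * (exp (d * (p - c)) / d)) by (field; lra).
  apply Rmult_le_compat_l; [exact HK|].
  apply Rmult_le_compat_r; [apply Rlt_le, Rinv_0_lt_compat, Hd|lra].
Qed.

Lemma RI_tails N a b a' b' :
  0 <= N -> a <= c - N -> a' <= c - N -> c + N <= b -> c + N <= b' ->
  |{RI f a b - RI f a' b'}| <= 4 * (K / d * exp (- (d * N))).
Proof.
intros HN Ha Ha' Hb Hb'.
assert (L1 := RI_left a (c - N) ltac:(lra) Ha).
assert (L2 := RI_left a' (c - N) ltac:(lra) Ha').
assert (R1 := RI_right (c + N) b ltac:(lra) Hb).
assert (R2 := RI_right (c + N) b' ltac:(lra) Hb').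
replace (c - (c - N)) with N in * by ring; replace (c + N - c) with N in * by ring.
rewrite <- (RI_Chasles V f a (c - N) b), <- (RI_Chasles V f (c - N) (c + N) b) by exact Hf.
rewrite <- (RI_Chasles V f a' (c - N) b'), <- (RI_Chasles V f (c - N) (c + N) b') by exact Hf.
set (m := RI f (c - N) (c + N)).
replace (RI f a (c - N) + (m + RI f (c + N) b) - (RI f a' (c - N) + (m + RI f (c + N) b')))%V
 with ((RI f a (c - N)%R - RI f a' (c - N)%R) + (RI f (c + N)%R b - RI f (c + N)%R b'))%V by module.
apply Rle_trans with (1 := norm_tri _ _).
assert (T1 := norm_minus_le (RI f a (c - N)) (RI f a' (c - N))).
assert (T2 := norm_minus_le (RI f (c + N) b) (RI f (c + N) b')).
lra.
Qed.

Lemma RI_dom_bound a b : a <= c -> c <= b -> |{RI f a b}| <= 2 * K / d.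
Proof.
intros Ha Hb; rewrite <- (RI_Chasles V f a c b) by exact Hf.
apply Rle_trans with (1 := norm_tri _ _).
assert (L := RI_left a c ltac:(lra) Ha); assert (R := RI_right c b ltac:(lra) Hb).
rewrite Rminus_diag, Rmult_0_r, Ropp_0, exp_0 in L, R; lra.
Qed.

(** The integrals over windows centred at [c] form a Cauchy sequence by [RI_tails]; 2 K / d is the
    integral of the majorant. *)
Lemma LI_ex : exists l, LI f l /\ |{l}| <= 2 * K / d.
Proof.
set (s := fun n : nat => RI f (c - INR n) (c + INR n)).
assert (tail : forall e, 0 < e -> exists N, 0 <= N /\ 4 * (K / d * exp (- (d * N))) <= e).
{ intros e He; assert (HKd : 0 <= K / d) by (apply Rdiv_le_0_compat; lra).
  destruct (exp_small d (e / (4 * (K / d + 1)))) as [N [HN HNe]];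
    [exact Hd|apply Rdiv_lt_0_compat; lra|].
  exists N; split; [exact HN|]; specialize (HNe N (Rle_refl N)).
  apply Rle_trans with (4 * ((K / d + 1) * (e / (4 * (K / d + 1))))); [|right; field; lra].
  apply Rmult_le_compat_l; [lra|].
  assert (Hp := exp_pos (- (d * N))).
  apply Rmult_le_compat; lra. }
destruct (proj1 (@filterlim_locally_cauchy nat V eventually _ s)) as [l Hl].
{ intros [e He]; destruct (tail (e / 2)) as [N [HN HNe]]; [lra|].
  destruct (nfloor_ex N HN) as [n [_ Hn]].
  exists (fun k => (S n <= k)%nat); split; [exists (S n); auto|].
  intros u v Hu Hv; apply (@norm_compat1 C_AbsRing V).
  apply le_INR in Hu; apply le_INR in Hv; rewrite S_INR in Hu, Hv.
  apply Rle_lt_trans with (e / 2); [|simpl; lra].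
  apply Rle_trans with (2 := HNe); apply (RI_tails N); lra. }
assert (HLI : forall e, 0 < e -> exists N, 0 <= N /\ forall a b, a <= c - N -> c + N <= b ->
  |{RI f a b - l}| <= e).
{ intros e He; destruct (tail (e / 2)) as [N [HN HNe]]; [lra|].
  exists N; split; [exact HN|]; intros a b Ha Hb.
  assert (Hl' : eventually (fun n => |{s n - l}| < e / 2)).
  { exact (proj1 (@filterlim_locally_ball_norm C_AbsRing _ V eventually _ s l) Hl
      (mkposreal (e / 2) ltac:(lra))). }
  destruct (nfloor_ex N HN) as [n [_ Hn]].
  assert (Hn' : eventually (fun k => (S n <= k)%nat)) by (exists (S n); auto).
  destruct (filter_ex _ (filter_and _ _ Hl' Hn')) as [k [Hk1 Hk2]].
  apply le_INR in Hk2; rewrite S_INR in Hk2.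
  replace (RI f a b - l)%V with ((RI f a b - s k) + (s k - l))%V by module.
  apply Rle_trans with (1 := norm_tri _ _).
  assert (Ht := RI_tails N a b (c - INR k) (c + INR k) HN Ha ltac:(lra) Hb ltac:(lra)).
  fold (s k) in Ht; lra. }
exists l; split.
- intros e He; destruct (HLI e He) as [N [HN HN']].
  (* A window around 0 enlarged by |c| contains the window of half-width N around c. *)
  exists (N + Rabs c); intros a b Ha Hb.
  assert (H2 := Rle_abs c); assert (H3 := Rle_abs (- c)); rewrite Rabs_Ropp in H3.
  apply HN'; lra.
- apply le_of_le_eps; intros e He; destruct (HLI e He) as [N [HN HN']].
  specialize (HN' (c - N) (c + N) ltac:(lra) ltac:(lra)).
  assert (Hb := RI_dom_bound (c - N) (c + N) ltac:(lra) ltac:(lra)).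
  assert (Hm := norm_le_minus l (RI f (c - N) (c + N))); rewrite norm_minus_sym in Hm; lra.
Qed.

End Dominated.

Lemma LI_norm_le f l K d c :
  (forall u, continuous f u) -> 0 <= K -> 0 < d ->
  (forall u, |{f u}| <= K * dexp d c u) -> LI f l -> |{l}| <= 2 * K / d.
Proof.
intros Hf HK Hd Hdom Hl; destruct (LI_ex f K d c Hf HK Hd Hdom) as [l' [H1 H2]].
now rewrite (LI_unique f l l' Hl H1).
Qed.

End LineIntegral.
Arguments LI {V} f l.

Lemma LI_lin {V W : cmodule} (L : V -> W) (f : R -> V) l :
  lin L -> (forall u, continuous f u) -> LI f l -> LI (fun u => L (f u)) (L l).
Proof.
intros HL Hf H1 e He; destruct (lin_bdd L HL) as [c [Hc Lc]].
destruct (H1 (e / c)) as [N HN]; [now apply Rdiv_lt_0_compat|].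
exists N; intros a b Ha Hb; rewrite RI_linear, <- (lin_sub L) by assumption.
apply Rle_trans with (1 := Lc _).
apply Rle_trans with (c * (e / c)); [|right; field; lra].
apply Rmult_le_compat_l; [lra|auto].
Qed.

(** * Complex differentiability with a quadratic remainder *)

Definition CQ {V : cmodule} (D : C -> Prop) (f f' : C -> V) : Prop :=
  exists K, 0 <= K /\ forall z z', D z -> D z' ->
    |{f z}| <= K /\ |{f' z}| <= K /\
    |{f z' - f z - (z' - z)%C * f' z}| <= K * Cmod (z' - z) ^ 2.

Notation CQs := (CQ (V := C_CompleteNormedModule)).

Section ComplexDiff.
Variable V : cmodule.
Variable D : C -> Prop.
Implicit Types f g : C -> V.

Lemma CQ_lip f f' : CQ D f f' -> exists K, 0 <= K /\ forall z z', D z -> D z' ->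
  |{f z' - f z}| <= K * Cmod (z' - z).
Proof.
intros [K [HK Hf]]; exists (2 * K); split; [lra|]; intros z z' Hz Hz'.
destruct (Hf z z' Hz Hz') as [F1 [F2 F3]]; destruct (Hf z' z Hz' Hz) as [F4 _].
set (h := (z' - z)%C) in *; assert (Hh := Cmod_ge_0 h).
destruct (Rle_dec (Cmod h) 1) as [H1|H1].
- replace (f z' - f z)%V with ((f z' - f z - h * f' z) + h * f' z)%V by module.
  apply Rle_trans with (1 := norm_tri _ _).
  assert (H2 := norm_scal_C h (f' z)).
  assert (H3 : Cmod h * |{f' z}| <= Cmod h * K) by now apply Rmult_le_compat_l.
  assert (H4 : K * Cmod h ^ 2 <= K * Cmod h) by (apply Rmult_le_compat_l; nra).
  lra.
- apply Rle_trans with (1 := norm_minus_le _ _).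
  assert (H2 : K * 1 <= K * Cmod h) by (apply Rmult_le_compat_l; lra); lra.
Qed.

Lemma CQ_ext f f' g g' :
  (forall z, D z -> f z = g z) -> (forall z, D z -> f' z = g' z) -> CQ D f f' -> CQ D g g'.
Proof.
intros H1 H2 [K [HK Hf]]; exists K; split; [exact HK|]; intros z z' Hz Hz'.
rewrite <- (H1 z Hz), <- (H1 z' Hz'), <- (H2 z Hz); auto.
Qed.

Lemma CQ_const (v : V) : CQ D (fun _ => v) (fun _ => vzero).
Proof.
exists (|{v}|); split; [apply vnorm_ge_0|]; intros z z' _ _.
assert (Hv := vnorm_ge_0 v).
assert (Hz : |{(vzero : V)}| = 0) by apply (@norm_zero C_AbsRing V).
replace (v - v - (z' - z)%C * vzero)%V with (vzero : V) by module.
rewrite Hz; repeat split; try lra.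
apply Rmult_le_pos; [exact Hv|apply pow2_ge_0].
Qed.

Lemma CQ_sub f f' g g' :
  CQ D f f' -> CQ D g g' -> CQ D (fun z => f z - g z)%V (fun z => f' z - g' z)%V.
Proof.
intros [K [HK Hf]] [L [HL Hg]]; exists (K + L); split; [lra|]; intros z z' Hz Hz'.
destruct (Hf z z' Hz Hz') as [F1 [F2 F3]]; destruct (Hg z z' Hz Hz') as [G1 [G2 G3]].
repeat split.
- apply Rle_trans with (1 := norm_minus_le _ _); lra.
- apply Rle_trans with (1 := norm_minus_le _ _); lra.
- replace (f z' - g z' - (f z - g z) - (z' - z)%C * (f' z - g' z))%V with
   ((f z' - f z - (z' - z)%C * f' z) - (g z' - g z - (z' - z)%C * g' z))%V by module.
  apply Rle_trans with (1 := norm_minus_le _ _); lra.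
Qed.

Lemma CQ_mult (a a' : C -> C) f f' :
  CQs D a a' -> CQ D f f' ->
  CQ D (fun z => a z * f z)%V (fun z => a' z * f z + a z * f' z)%V.
Proof.
intros Ha Hf; destruct (CQ_lip f f' Hf) as [P [HP Pf]].
destruct Ha as [K [HK Ha]]; destruct Hf as [L [HL Hf]].
exists (2 * K * L + K * P); split; [nra|]; intros z z' Hz Hz'.
destruct (Hf z z' Hz Hz') as [F1 [F2 F3]]; destruct (Hf z' z Hz' Hz) as [F4 _].
specialize (Pf z z' Hz Hz').
destruct (Ha z z' Hz Hz') as [A1 [A2 A3]].
change (Cmod (a z) <= K) in A1; change (Cmod (a' z) <= K) in A2.
change (Cmod (a z' - a z - (z' - z) * a' z)%C <= K * Cmod (z' - z) ^ 2) in A3.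
set (h := (z' - z)%C) in *; assert (Hh := Cmod_ge_0 h).
assert (Hh2 : 0 <= Cmod h ^ 2) by apply pow2_ge_0.
assert (prod : forall c v p q, Cmod c <= p -> |{v}| <= q -> |{(c * v : V)%V}| <= p * q).
{ intros c v p q Hc Hv; apply Rle_trans with (1 := norm_scal_C _ _).
  apply Rmult_le_compat; auto using Cmod_ge_0, vnorm_ge_0. }
assert (KP : 0 <= K * P) by nra; assert (KL : 0 <= K * L) by nra.
repeat split.
- assert (Q := prod _ _ _ _ A1 F1); nra.
- apply Rle_trans with (1 := norm_tri _ _).
  assert (Q1 := prod _ _ _ _ A1 F2); assert (Q2 := prod _ _ _ _ A2 F1); nra.
- replace (a z' * f z' - a z * f z - h * (a' z * f z + a z * f' z))%V with
   ((a z' - a z - h * a' z)%C * f z' + (h * a' z)%C * (f z' - f z) +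
    a z * (f z' - f z - h * f' z))%V by module.
  apply Rle_trans with (1 := norm_plus3 _ _ _).
  assert (Q1 := prod _ _ _ _ A3 F4).
  assert (Q2 := prod (h * a' z)%C _ (Cmod h * K) _ ltac:(rewrite Cmod_mult;
    apply Rmult_le_compat_l; [exact Hh|exact A2]) Pf).
  assert (Q3 := prod _ _ _ _ A1 F3).
  nra.
Qed.

End ComplexDiff.

Lemma CQs_intro D (a a' : C -> C) K : 0 <= K ->
  (forall z z', D z -> D z' -> Cmod (a z) <= K /\ Cmod (a' z) <= K /\
    Cmod (a z' - a z - (z' - z) * a' z)%C <= K * Cmod (z' - z) ^ 2) -> CQs D a a'.
Proof. intros HK Ha; exists K; split; [exact HK|exact Ha]. Qed.

Lemma CQs_mult D (a a' b b' : C -> C) : CQs D a a' -> CQs D b b' ->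
  CQs D (fun z => a z * b z)%C (fun z => a' z * b z + a z * b' z)%C.
Proof. exact (CQ_mult C_CompleteNormedModule D a a' b b'). Qed.

Lemma CQs_inv D (g g' : C -> C) m : 0 < m -> (forall z, D z -> m <= Cmod (g z)) ->
  CQs D g g' -> CQs D (fun z => / g z)%C (fun z => - g' z / (g z * g z))%C.
Proof.
intros Hm Hg Hq; destruct (CQ_lip _ _ _ _ Hq) as [P [HP Pg]].
destruct Hq as [K [HK Hq]].
assert (Hi : 0 < / m) by now apply Rinv_0_lt_compat.
apply (CQs_intro D _ _ (/ m + K * (/ m * / m) + K * P * (/ m * / m * / m))).
{ assert (0 <= K * P) by nra; assert (0 < / m * / m) by nra.
  assert (0 < / m * / m * / m) by nra; nra. }
intros z z' Hz Hz'.
assert (gz := Hg z Hz); assert (gz' := Hg z' Hz').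
assert (nz : g z <> 0) by (intros E; rewrite E, Cmod_0 in gz; lra).
assert (nz' : g z' <> 0) by (intros E; rewrite E, Cmod_0 in gz'; lra).
assert (I1 : Cmod (/ g z) <= / m) by (rewrite Cmod_inv by exact nz; now apply Rinv_le_contravar).
assert (I2 : Cmod (/ g z') <= / m) by (rewrite Cmod_inv by exact nz'; now apply Rinv_le_contravar).
destruct (Hq z z' Hz Hz') as [_ [G2 G3]].
change (Cmod (g' z) <= K) in G2.
change (Cmod (g z' - g z - (z' - z) * g' z)%C <= K * Cmod (z' - z) ^ 2) in G3.
specialize (Pg z z' Hz Hz'); change (Cmod (g z' - g z) <= P * Cmod (z' - z)) in Pg.
set (h := (z' - z)%C) in *; assert (Hh := Cmod_ge_0 h).
assert (Hh2 : 0 <= Cmod h ^ 2) by apply pow2_ge_0.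
assert (P1 : 0 < / m * / m) by nra.
assert (P2 : 0 <= K * (/ m * / m)) by nra.
assert (P3 : 0 <= K * P * (/ m * / m * / m)) by (apply Rmult_le_pos; nra).
assert (M2 : forall p q, Cmod p <= / m -> Cmod q <= / m -> Cmod (p * q) <= / m * / m).
{ intros p q Hp Hq'; rewrite Cmod_mult; apply Rmult_le_compat; auto using Cmod_ge_0. }
repeat split.
- lra.
- replace (- g' z / (g z * g z))%C with (- (g' z * (/ g z * / g z)))%C by (field; exact nz).
  rewrite Cmod_opp, Cmod_mult.
  assert (Cmod (g' z) * Cmod (/ g z * / g z) <= K * (/ m * / m)).
  { apply Rmult_le_compat; auto using Cmod_ge_0. }
  lra.
- replace (/ g z' - / g z - h * (- g' z / (g z * g z)))%C with
   (- ((g z' - g z - h * g' z) * (/ g z' * / g z)) +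
     h * g' z * (g z' - g z) * (/ g z * / g z * / g z'))%C by (field; auto).
  apply Rle_trans with (1 := Cmod_triangle _ _).
  rewrite Cmod_opp, !Cmod_mult.
  rewrite <- (Cmod_mult (/ g z') (/ g z)), <- (Cmod_mult (/ g z) (/ g z)).
  assert (N1 : Cmod (g z' - g z - h * g' z) * Cmod (/ g z' * / g z) <=
    K * Cmod h ^ 2 * (/ m * / m)).
  { apply Rmult_le_compat; auto using Cmod_ge_0. }
  assert (N2 : Cmod h * Cmod (g' z) * Cmod (g z' - g z) * (Cmod (/ g z * / g z) * Cmod (/ g z'))
     <= Cmod h * K * (P * Cmod h) * (/ m * / m * / m)).
  { repeat apply Rmult_le_compat; auto using Cmod_ge_0, Rmult_le_pos; lra. }
  nra.
Qed.

Definition box (N t0 t1 : R) (w : C) : Prop := Rabs (fst w) <= N /\ t0 <= snd w <= t1.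

Lemma CQs_cexp (a N t0 t1 : R) :
  CQs (box N t0 t1) (fun w => cexp (a * w)) (fun w => a * cexp (a * w))%C.
Proof.
set (E := exp (Rabs a * N)); set (E2 := exp (2 * (Rabs a * N))).
assert (HE : 0 < E) by apply exp_pos; assert (HE2 : 0 < E2) by apply exp_pos.
assert (Ha := Rabs_pos a); assert (Ha2 : 0 <= Rabs a ^ 2) by apply pow2_ge_0.
apply (CQs_intro _ _ _ (E + Rabs a * E + E * (5 * E2 * Rabs a ^ 2))).
{ assert (0 <= 5 * E2 * Rabs a ^ 2) by nra; nra. }
intros z z' [Hz _] [Hz' _].
assert (Hb : Cmod (cexp (a * z)) <= E).
{ rewrite Cmod_cexp; apply exp_le; simpl.
  apply Rle_trans with (1 := Rle_abs _).
  replace (a * fst z - 0 * snd z) with (a * fst z) by ring.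
  rewrite Rabs_mult; now apply Rmult_le_compat_l. }
assert (P1 : 0 <= 5 * E2 * Rabs a ^ 2) by nra.
assert (P2 : 0 <= E * (5 * E2 * Rabs a ^ 2)) by nra.
assert (P3 : 0 <= Rabs a * E) by nra.
set (h := (z' - z)%C).
assert (Hh2 : 0 <= Cmod h ^ 2) by apply pow2_ge_0.
repeat split.
- lra.
- rewrite Cmod_mult, Cmod_R.
  assert (Rabs a * Cmod (cexp (a * z)) <= Rabs a * E) by now apply Rmult_le_compat_l.
  lra.
- replace (cexp (a * z') - cexp (a * z) - h * (a * cexp (a * z)))%C with
    (cexp (a * z) * (cexp (a * h) - 1 - a * h))%C.
  + rewrite Cmod_mult.
    assert (Ht := cexp_taylor (a * h) (2 * (Rabs a * N))).
    rewrite Cmod_mult, Cmod_R, Rpow_mult_distr in Ht.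
    assert (Ht' : Rabs (fst (a * h)%C) <= 2 * (Rabs a * N)).
    { simpl; replace (a * (fst z' + - fst z) - 0 * (snd z' + - snd z)) with
        (a * (fst z' - fst z)) by ring.
      rewrite Rabs_mult; replace (2 * (Rabs a * N)) with (Rabs a * (N + N)) by ring.
      apply Rmult_le_compat_l; [exact Ha|].
      unfold Rminus; apply Rle_trans with (1 := Rabs_triang _ _).
      rewrite Rabs_Ropp; lra. }
    specialize (Ht Ht'); fold E2 in Ht.
    apply Rle_trans with (E * (5 * E2 * (Rabs a ^ 2 * Cmod h ^ 2))).
    * apply Rmult_le_compat; auto using Cmod_ge_0.
    * nra.
  + replace (a * z')%C with (a * z + a * h)%C by (unfold h; ring).
    rewrite cexp_plus; ring.
Qed.

(** * Rotating the path of integration *)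

Section Rotation.
Variable V : cmodule.
Variables (f f' : C -> V) (t0 t1 : R).
Hypothesis Hq : forall N, CQ (box N t0 t1) f f'.

Lemma box_in N u t : Rabs u <= N -> t0 <= t <= t1 -> box N t0 t1 (u, t).
Proof. intros H1 H2; split; assumption. Qed.

Lemma CQ_line_cont t u : t0 <= t <= t1 -> continuous (fun u => f (u, t)) u.
Proof.
intros Ht; destruct (CQ_lip V _ f f' (Hq (Rabs u + 1))) as [K [HK Kf]].
apply (lip_cont V _ K); intros y Hy.
assert (Hy' : Rabs y <= Rabs u + 1).
{ replace y with (u + (y - u)) by ring.
  apply Rle_trans with (1 := Rabs_triang _ _); lra. }
assert (E := Kf (u, t) (y, t) (box_in (Rabs u + 1) u t ltac:(lra) Ht) (box_in _ _ _ Hy' Ht)).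
replace ((y, t) - (u, t))%C with (RtoC (y - u)) in E
  by (apply injective_projections; simpl; ring).
now rewrite Cmod_R in E.
Qed.

(** Adding the expansions at z and at z' cancels the values of f and leaves h (f'(z') - f'(z)) =
    O(|h|^2). The quadratic remainder therefore already contains the regularity of f' needed to
    integrate it. *)
Lemma CQ_deriv_lip N : exists K, 0 <= K /\ forall z z', box N t0 t1 z -> box N t0 t1 z' ->
  |{f' z' - f' z}| <= K * Cmod (z' - z).
Proof.
destruct (Hq N) as [K [HK Kf]]; exists (2 * K); split; [lra|].
intros z z' Hz Hz'; destruct (Ceq_dec z' z) as [->|Hne].
{ rewrite norm_minus_diag; apply Rmult_le_pos; [lra|apply Cmod_ge_0]. }
destruct (Kf z z' Hz Hz') as [_ [_ F1]]; destruct (Kf z' z Hz' Hz) as [_ [_ F2]].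
set (h := (z' - z)%C) in *.
assert (Hh : 0 < Cmod h).
{ apply Cmod_gt_0; intros E; apply Hne.
  replace z' with (h + z)%C by (unfold h; ring); rewrite E; ring. }
replace (z - z')%C with (- h)%C in F2 by (unfold h; ring); rewrite Cmod_opp in F2.
apply Rmult_le_reg_l with (Cmod h); [exact Hh|].
rewrite <- norm_scal_C_eq.
replace (h * (f' z' - f' z))%V with
  ((f z' - f z - h * f' z) + (f z - f z' - (- h)%C * f' z'))%V by module.
apply Rle_trans with (1 := norm_tri _ _); nra.
Qed.

Lemma CQ_deriv_cont t u : t0 <= t <= t1 -> continuous (fun u => f' (u, t)) u.
Proof.
intros Ht; destruct (CQ_deriv_lip (Rabs u + 1)) as [K [HK Kf]].
apply (lip_cont V _ K); intros y Hy.
assert (Hy' : Rabs y <= Rabs u + 1).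
{ replace y with (u + (y - u)) by ring.
  apply Rle_trans with (1 := Rabs_triang _ _); lra. }
assert (E := Kf (u, t) (y, t) (box_in (Rabs u + 1) u t ltac:(lra) Ht) (box_in _ _ _ Hy' Ht)).
replace ((y, t) - (u, t))%C with (RtoC (y - u)) in E
  by (apply injective_projections; simpl; ring).
now rewrite Cmod_R in E.
Qed.

Lemma CQ_primitive t a b : t0 <= t <= t1 -> a <= b ->
  RI (fun u => f' (u, t)) a b = (f (b, t) - f (a, t))%V.
Proof.
intros Ht Hab.
set (N := Rmax (Rabs a) (Rabs b)).
assert (HN : forall u, a <= u <= b -> Rabs u <= N).
{ intros u Hu; unfold N, Rmax; destruct (Rle_dec (Rabs a) (Rabs b)); unfold Rabs in *;
  repeat destruct Rcase_abs; lra. }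
destruct (CQ_deriv_lip N) as [K [HK Kf]]; destruct (Hq N) as [L [HL Lf]].
assert (Hc : forall u, continuous (fun u => f' (u, t)) u) by (intros u; now apply CQ_deriv_cont).
assert (E : (RI (fun u => f' (u, t)) a b - f (b, t))%V = (RI (fun u => f' (u, t)) a a - f (a, t))%V).
{ apply (quad_const (fun s => RI (fun u => f' (u, t)) a s - f (s, t))%V a b (K + L) Hab).
  intros u v Hu Huv Hv.
  assert (Bu := box_in N u t (HN u ltac:(lra)) Ht); assert (Bv := box_in N v t (HN v ltac:(lra)) Ht).
  destruct (Lf (u, t) (v, t) Bu Bv) as [_ [_ F3]].
  replace ((v, t) - (u, t))%C with (RtoC (v - u)) in F3
    by (apply injective_projections; simpl; ring).
  rewrite Cmod_R, pow2_abs in F3.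
  rewrite <- (RI_Chasles V _ a u v) by exact Hc.
  assert (Hr := RI_quad V (fun u => f' (u, t)) u v (K * (v - u)) Huv Hc).
  replace (RI (fun u => f' (u, t)) a u + RI (fun u => f' (u, t)) u v - f (v, t) -
     (RI (fun u => f' (u, t)) a u - f (u, t)))%V with
   ((RI (fun u => f' (u, t)) u v - RtoC (v - u) * f' (u, t)) -
    (f (v, t) - f (u, t) - RtoC (v - u) * f' (u, t)))%V by module.
  apply Rle_trans with (1 := norm_minus_le _ _).
  assert (Hr' : |{RI (fun u => f' (u, t)) u v - RtoC (v - u) * f' (u, t)}| <= K * (v - u) * (v - u)).
  { apply Hr; intros s Hs.
    assert (Bs := box_in N s t (HN s ltac:(lra)) Ht).
    apply Rle_trans with (1 := Kf _ _ Bu Bs).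
    replace ((s, t) - (u, t))%C with (RtoC (s - u))
      by (apply injective_projections; simpl; ring).
    rewrite Cmod_R, Rabs_pos_eq by lra; apply Rmult_le_compat_l; lra. }
  lra. }
rewrite RI_point in E.
replace (RI (fun u => f' (u, t)) a b) with
  ((RI (fun u => f' (u, t)) a b - f (b, t)) + f (b, t))%V by module.
rewrite E; module.
Qed.

(** Cauchy's theorem on a rectangle: the derivative in t of the integral of f(u, t) over [a, b] is i
    times the integral of f', that is i (f(b, t) - f(a, t)), so only the values on the vertical
    sides matter. *)
Lemma rotation_finite a b w : t0 <= t1 -> a <= b ->
  (forall t, t0 <= t <= t1 -> |{f (a, t)}| + |{f (b, t)}| <= w) ->
  |{RI (fun u => f (u, t1)) a b - RI (fun u => f (u, t0)) a b}| <= w * (t1 - t0).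
Proof.
intros Ht Hab Hw.
set (N := Rmax (Rabs a) (Rabs b)).
assert (HN : forall u, a <= u <= b -> Rabs u <= N).
{ intros u Hu; unfold N, Rmax; destruct (Rle_dec (Rabs a) (Rabs b)); unfold Rabs in *;
  repeat destruct Rcase_abs; lra. }
destruct (Hq N) as [L [HL Lf]].
apply (quad_lip (fun t => RI (fun u => f (u, t)) a b) t0 t1 w (L * (b - a)) Ht).
intros p q Hp Hpq Hq'.
assert (Hp' : t0 <= p <= t1) by lra; assert (Hq2 : t0 <= q <= t1) by lra.
assert (C1 : forall u, continuous (fun u => f (u, p)) u) by (intros u; now apply CQ_line_cont).
assert (C2 : forall u, continuous (fun u => f (u, q)) u) by (intros u; now apply CQ_line_cont).
assert (C3 : forall u, continuous (fun u => f' (u, p)) u) by (intros u; now apply CQ_deriv_cont).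
set (h := (0, q - p) : C).
assert (C4 : forall u, continuous (fun u => h * f' (u, p))%V u).
{ intros u; apply (lin_cont_comp (fun v => h * v)%V); [apply lin_vscal|apply C3]. }
assert (C5 : forall u, continuous (fun u => f (u, q) - f (u, p))%V u).
{ intros u; apply (@continuous_minus _ C_AbsRing V); auto. }
assert (E : (RI (fun u => f (u, q)) a b - RI (fun u => f (u, p)) a b)%V =
  (RI (fun u => f (u, q) - f (u, p) - h * f' (u, p))%V a b + h * (f (b, p) - f (a, p)))%V).
{ rewrite (RI_minus V (fun u => f (u, q) - f (u, p))%V (fun u => h * f' (u, p))%V) by assumption.
  rewrite (RI_minus V (fun u => f (u, q))) by assumption.
  rewrite (RI_scal h) by assumption.
  rewrite CQ_primitive by assumption; module. }
rewrite E; apply Rle_trans with (1 := norm_tri _ _).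
assert (Hh : Cmod h = q - p).
{ unfold Cmod, h; simpl fst; simpl snd.
  replace (0 ^ 2 + (q - p) ^ 2) with ((q - p) ^ 2) by ring; apply sqrt_pow2; lra. }
assert (N2 : |{h * (f (b, p) - f (a, p))}| <= w * (q - p)).
{ apply Rle_trans with (1 := norm_scal_C _ _); rewrite Hh, Rmult_comm.
  apply Rmult_le_compat_r; [lra|]; apply Rle_trans with (1 := norm_minus_le _ _).
  specialize (Hw p Hp'); lra. }
assert (N1 : |{RI (fun u => f (u, q) - f (u, p) - h * f' (u, p))%V a b}| <=
  L * (q - p) ^ 2 * (b - a)).
{ apply RI_norm_const; [exact Hab| |].
  - intros u; apply (@continuous_minus _ C_AbsRing V); auto.
  - intros u Hu.
    assert (Bu := box_in N u p (HN u Hu) Hp'); assert (Bv := box_in N u q (HN u Hu) Hq2).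
    destruct (Lf _ _ Bu Bv) as [_ [_ F3]].
    replace ((u, q) - (u, p))%C with h in F3
      by (unfold h; apply injective_projections; simpl; ring).
    now rewrite Hh in F3. }
lra.
Qed.

Lemma rotation K d l0 l1 : t0 <= t1 -> 0 <= K -> 0 < d ->
  (forall u t, t0 <= t <= t1 -> |{f (u, t)}| <= K * dexp d 0 u) ->
  LI (fun u => f (u, t0)) l0 -> LI (fun u => f (u, t1)) l1 -> l0 = l1.
Proof.
intros Ht HK Hd Hdom L0 L1; apply norm_unique_eps; intros e He.
destruct (L0 (e / 3)) as [N0 H0]; [lra|]; destruct (L1 (e / 3)) as [N1 H1]; [lra|].
destruct (exp_small d (e / (6 * (K + 1) * (t1 - t0 + 1)))) as [N2 [HN2 H2]]; [exact Hd| |].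
{ apply Rdiv_lt_0_compat; [lra|]; apply Rmult_lt_0_compat; lra. }
set (N := Rmax N2 (Rmax N0 N1)).
assert (M1 : N2 <= N) by apply Rmax_l.
assert (M2 : N0 <= N) by (apply Rle_trans with (2 := Rmax_r _ _), Rmax_l).
assert (M3 : N1 <= N) by (apply Rle_trans with (2 := Rmax_r _ _), Rmax_r).
specialize (H0 (- N) N ltac:(lra) M2); specialize (H1 (- N) N ltac:(lra) M3).
specialize (H2 N M1).
set (x := exp (- (d * N))) in *; assert (Hx : 0 < x) by apply exp_pos.
assert (Hr := rotation_finite (- N) N (2 * (K * x)) Ht ltac:(lra)).
assert (Hr' : |{RI (fun u => f (u, t1)) (- N) N - RI (fun u => f (u, t0)) (- N) N}| <= e / 3).
{ apply Rle_trans with (2 * (K * x) * (t1 - t0)).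
  - apply Hr; intros t Ht'.
    assert (D1 := Hdom (- N) t Ht'); assert (D2 := Hdom N t Ht').
    unfold dexp in D1, D2; rewrite Rminus_0_r in D1, D2.
    rewrite Rabs_Ropp, Rabs_pos_eq in D1 by lra; rewrite Rabs_pos_eq in D2 by lra.
    fold x in D1, D2; lra.
  - apply Rle_trans with (2 * ((K + 1) * (e / (6 * (K + 1) * (t1 - t0 + 1)))) * (t1 - t0 + 1)).
    + apply Rmult_le_compat; try lra.
      * apply Rmult_le_pos; [lra|]; apply Rmult_le_pos; lra.
      * apply Rmult_le_compat_l; [lra|]; apply Rmult_le_compat; lra.
    + right; field; lra. }
set (a := RI (fun u => f (u, t0)) (- N) N) in *; set (b := RI (fun u => f (u, t1)) (- N) N) in *.
replace (l0 - l1)%V with ((b - l1) - (a - l0) - (b - a))%V by module.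
apply Rle_trans with (1 := norm_minus_le _ _).
assert (Hm := norm_minus_le (b - l1)%V (a - l0)%V); lra.
Qed.

End Rotation.

(** * Scalar estimates on the sector *)

(* Half the opening of the sector bounded by the contour. *)
Definition tp : R := 3 * PI / 4.

Lemma tp_pos : 0 < tp.
Proof. unfold tp; assert (H := PI_RGT_0); lra. Qed.

Lemma sqrt2_bounds : 4 / 3 <= sqrt 2.
Proof.
rewrite <- (sqrt_Rsqr (4 / 3)) by lra; apply sqrt_le_1_alt; unfold Rsqr; lra.
Qed.

Lemma cos_tp : cos tp = - / sqrt 2.
Proof.
unfold tp; replace (3 * PI / 4) with (3 * (PI / 4)) by field.
rewrite cos_3PI4; unfold Rdiv; ring.
Qed.

(** The sharp bound is - 1 / sqrt 2; any constant above - 1 keeps 1 + z away from 0 on the sector,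
    and this one is rational. *)
Lemma cos_sector t : - tp <= t <= tp -> - (3 / 4) <= cos t.
Proof.
assert (HPI := PI_RGT_0).
assert (key : forall t, 0 <= t <= tp -> - (3 / 4) <= cos t).
{ clear t; intros t Ht.
  apply Rle_trans with (cos tp).
  - rewrite cos_tp; assert (Hs := sqrt2_bounds).
    assert (/ sqrt 2 <= / (4 / 3)) by (apply Rinv_le_contravar; lra); lra.
  - apply cos_decr_1; unfold tp in *; lra. }
intros Ht; destruct (Rle_dec 0 t) as [H0|H0]; [apply key; lra|].
rewrite <- cos_neg; apply key; lra.
Qed.

(** With rho = e^a, |1 + z|^2 = 1 + 2 rho cos t + rho^2 is at least 1 - (3/2) rho + rho^2, which
    exceeds (1 + rho)^2 / 16. *)
Lemma one_plus_bound a t : - tp <= t <= tp -> (1 + exp a) / 4 <= Cmod (1 + cexp (a, t)).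
Proof.
intros Ht; assert (Hc := cos_sector t Ht).
assert (He := exp_pos a).
rewrite <- (sqrt_pow2 ((1 + exp a) / 4)) by lra.
unfold Cmod; apply sqrt_le_1_alt; unfold cexp; simpl fst; simpl snd.
assert (Hsc := sin2_cos2 t); unfold Rsqr in Hsc.
replace ((1 + exp a * cos t) ^ 2 + (0 + exp a * sin t) ^ 2) with
  (1 + 2 * exp a * cos t + exp a ^ 2 * (sin t * sin t + cos t * cos t)) by ring.
rewrite Hsc.
assert (exp a * - (3 / 4) <= exp a * cos t) by (apply Rmult_le_compat_l; lra).
assert (0 <= (1 - exp a) ^ 2) by apply pow2_ge_0.
nra.
Qed.

(* [1 / (1 + z)] for [z = exp w] *)
Definition sig (w : C) : C := (/ (1 + cexp w))%C.

Lemma sig_nz a t : - tp <= t <= tp -> (1 + cexp (a, t))%C <> 0.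
Proof.
intros Ht E; assert (Hb := one_plus_bound a t Ht); rewrite E, Cmod_0 in Hb.
assert (He := exp_pos a); lra.
Qed.

Lemma sig_bound a t : - tp <= t <= tp -> Cmod (sig (a, t)) <= 4 / (1 + exp a).
Proof.
intros Ht; unfold sig; rewrite Cmod_inv by now apply sig_nz.
assert (He := exp_pos a).
replace (4 / (1 + exp a)) with (/ ((1 + exp a) / 4)) by (field; lra).
apply Rinv_le_contravar; [lra|now apply one_plus_bound].
Qed.

Lemma sig_bound4 a t : - tp <= t <= tp -> Cmod (sig (a, t)) <= 4.
Proof.
intros Ht; apply Rle_trans with (1 := sig_bound a t Ht).
assert (He := exp_pos a).
apply Rmult_le_reg_r with (1 + exp a); [lra|].
replace (4 / (1 + exp a) * (1 + exp a)) with 4 by (field; lra); lra.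
Qed.

Lemma cexp_sig a t : - tp <= t <= tp -> (cexp (a, t) * sig (a, t))%C = (1 - sig (a, t))%C.
Proof.
intros Ht; unfold sig; field; now apply sig_nz.
Qed.

Lemma cexp_sig_bound a t : - tp <= t <= tp ->
  Cmod (cexp (a, t) * sig (a, t)) <= 4 * (exp a / (1 + exp a)).
Proof.
intros Ht; rewrite Cmod_mult, Cmod_cexp; simpl fst.
assert (He := exp_pos a).
replace (4 * (exp a / (1 + exp a))) with (exp a * (4 / (1 + exp a))) by (field; lra).
apply Rmult_le_compat_l; [lra|now apply sig_bound].
Qed.

Lemma ratio_le_1 a : 0 <= exp a / (1 + exp a) <= 1.
Proof.
assert (He := exp_pos a); split; [apply Rdiv_le_0_compat; lra|].
apply Rmult_le_reg_r with (1 + exp a); [lra|].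
replace (exp a / (1 + exp a) * (1 + exp a)) with (exp a) by (field; lra); lra.
Qed.

Lemma sig_lip a a' t : - tp <= t <= tp -> Rabs (a' - a) <= 1 ->
  Cmod (sig (a', t) - sig (a, t)) <= 16 * exp 1 * Rabs (a' - a).
Proof.
intros Ht Ha.
assert (E : (sig (a', t) - sig (a, t))%C =
  ((1 - cexp (RtoC (a' - a))) * (cexp (a, t) * sig (a, t)) * sig (a', t))%C).
{ assert (E1 : cexp (a', t) = (cexp (RtoC (a' - a)) * cexp (a, t))%C).
  { rewrite <- cexp_plus; f_equal; apply injective_projections; simpl; ring. }
  unfold sig; rewrite E1.
  assert (N1 := sig_nz a t Ht); assert (N2 := sig_nz a' t Ht); rewrite E1 in N2.
  field; auto. }
rewrite E, !Cmod_mult, <- Cmod_mult.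
assert (B1 := cexp_sig_bound a t Ht); assert (R1 := ratio_le_1 a).
assert (B2 := sig_bound4 a' t Ht).
assert (B3 : Cmod (1 - cexp (RtoC (a' - a))) <= Rabs (a' - a) * exp 1).
{ replace (1 - cexp (RtoC (a' - a)))%C with (RtoC (- (exp (a' - a) - 1))).
  - rewrite Cmod_R, Rabs_Ropp; apply Rle_trans with (1 := exp_taylor1 _).
    apply Rmult_le_compat_l; [apply Rabs_pos|now apply exp_le].
  - unfold cexp; simpl; rewrite cos_0, sin_0; apply injective_projections; simpl; ring. }
apply Rle_trans with (Rabs (a' - a) * exp 1 * 4 * 4); [|lra].
repeat apply Rmult_le_compat; auto using Cmod_ge_0, Rmult_le_pos.
lra.
Qed.

Lemma Cpow_diff_le (x y : C) (B : R) n : Cmod x <= B -> Cmod y <= B -> 1 <= B ->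
  Cmod (Cpow x n - Cpow y n) <= INR n * B ^ n * Cmod (x - y).
Proof.
intros Hx Hy HB; induction n as [|n IH].
- simpl; replace (1 - 1)%C with (RtoC 0) by ring; rewrite Cmod_0; lra.
- simpl Cpow.
  replace (x * Cpow x n - y * Cpow y n)%C with
    ((x - y) * Cpow x n + y * (Cpow x n - Cpow y n))%C by ring.
  apply Rle_trans with (1 := Cmod_triangle _ _); rewrite !Cmod_mult.
  assert (H1 : Cmod (Cpow x n) <= B ^ S n).
  { rewrite Cmod_pow; apply Rle_trans with (B ^ n).
    - apply pow_incr; split; [apply Cmod_ge_0|exact Hx].
    - apply Rle_pow; [exact HB|lia]. }
  assert (Hd := Cmod_ge_0 (x - y)).
  assert (H2 : Cmod (x - y) * Cmod (Cpow x n) <= Cmod (x - y) * B ^ S n)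
    by now apply Rmult_le_compat_l.
  assert (H3 : Cmod y * Cmod (Cpow x n - Cpow y n) <= B * (INR n * B ^ n * Cmod (x - y))).
  { apply Rmult_le_compat; auto using Cmod_ge_0. }
  rewrite S_INR; simpl pow in *; lra.
Qed.

(* [z / (1 + z)^2] for [z = exp w] *)
Definition qq (w : C) : C := (cexp w * sig w * sig w)%C.

Lemma ratio_dexp u : exp u / (1 + exp u) ^ 2 <= dexp 1 0 u.
Proof.
unfold dexp; rewrite Rminus_0_r, Rmult_1_l; assert (He := exp_pos u).
apply Rmult_le_reg_r with ((1 + exp u) ^ 2); [apply pow_lt; lra|].
replace (exp u / (1 + exp u) ^ 2 * (1 + exp u) ^ 2) with (exp u) by (field; lra).
unfold Rabs; destruct (Rcase_abs u) as [Hu|Hu].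
- rewrite Ropp_involutive; nra.
- rewrite exp_Ropp; apply Rmult_le_reg_l with (exp u); [lra|].
  rewrite <- Rmult_assoc, Rinv_r, Rmult_1_l by lra; nra.
Qed.

Lemma dexp_le_1 d c u : 0 <= d -> dexp d c u <= 1.
Proof.
intros Hd; apply exp_neg_le_1; assert (0 <= d * Rabs (u - c)); [|lra].
apply Rmult_le_pos; [exact Hd|apply Rabs_pos].
Qed.

Lemma dexp_pos d c u : 0 < dexp d c u.
Proof. apply exp_pos. Qed.

Lemma qq_bound u t : - tp <= t <= tp -> Cmod (qq (u, t)) <= 16 * dexp 1 0 u.
Proof.
intros Ht; unfold qq; rewrite Cmod_mult.
assert (B1 := cexp_sig_bound u t Ht); assert (B2 := sig_bound u t Ht).
assert (He := exp_pos u).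
apply Rle_trans with (4 * (exp u / (1 + exp u)) * (4 / (1 + exp u))).
- apply Rmult_le_compat; auto using Cmod_ge_0.
- replace (4 * (exp u / (1 + exp u)) * (4 / (1 + exp u))) with
    (16 * (exp u / (1 + exp u) ^ 2)) by (field; lra).
  apply Rmult_le_compat_l; [lra|apply ratio_dexp].
Qed.

Lemma qq_pow_bound n u t : (1 <= n)%nat -> - tp <= t <= tp ->
  Cmod (Cpow (qq (u, t)) n) <= 16 ^ n * dexp 1 0 u.
Proof.
intros Hn Ht; rewrite Cmod_pow; destruct n as [|n]; [lia|].
assert (Hq := qq_bound u t Ht); assert (Hd := dexp_pos 1 0 u).
assert (Hd1 := dexp_le_1 1 0 u ltac:(lra)).
simpl pow; replace (16 * 16 ^ n * dexp 1 0 u) with (16 * dexp 1 0 u * 16 ^ n) by ring.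
apply Rmult_le_compat; auto using Cmod_ge_0.
- apply pow_le, Cmod_ge_0.
- apply pow_incr; split; [apply Cmod_ge_0|lra].
Qed.

(** * Holomorphic multipliers on the sector *)

(** Holomorphy on the closed strip that the logarithm maps the sector onto. The constants may grow
    with [N], but one derivative serves all boxes, as [rotation] requires. *)
Definition holo (p : C -> C) : Prop := exists p', forall N, CQs (box N (- tp) tp) p p'.

Lemma holo_mult p r : holo p -> holo r -> holo (fun w => p w * r w)%C.
Proof.
intros [p' Hp] [r' Hr]; eexists; intros N; exact (CQs_mult _ p p' r r' (Hp N) (Hr N)).
Qed.

Lemma holo_const c : holo (fun _ => c).
Proof. eexists; intros N; exact (CQ_const C_CompleteNormedModule _ c). Qed.

Lemma holo_pow p n : holo p -> holo (fun w => Cpow (p w) n).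
Proof.
intros Hp; induction n as [|n IH]; simpl; [apply holo_const|now apply holo_mult].
Qed.

Lemma holo_ext p r : (forall u t, - tp <= t <= tp -> p (u, t) = r (u, t)) -> holo p -> holo r.
Proof.
intros He [p' Hp]; exists p'; intros N; specialize (Hp N).
apply (CQ_ext C_CompleteNormedModule _ p p'); auto.
intros [u t] [_ Ht]; now apply He.
Qed.

Lemma holo_cexp_scale (a : R) : holo (fun w => cexp (a * w)).
Proof. eexists; intros N; apply CQs_cexp. Qed.

Lemma holo_cexp : holo cexp.
Proof.
apply holo_ext with (fun w => cexp (1 * w)); [|apply holo_cexp_scale].
intros u t _; f_equal; ring.
Qed.

Lemma holo_sig_shift (v : R) : holo (fun w => sig (v + w)).
Proof.
assert (Hg : holo (fun w => cexp v * cexp w)%C) by (apply holo_mult; [apply holo_const|apply holo_cexp]).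
destruct Hg as [g' Hg].
eexists; intros N; destruct (Hg N) as [K [HK Hg']]; unfold sig.
apply (CQs_inv _ (fun w => 1 + cexp (v + w))%C g' (/ 4)); [lra| |].
- intros [u t] [_ Ht].
  replace (v + (u, t))%C with (v + u, t) by (apply injective_projections; simpl; ring).
  apply Rle_trans with (2 := one_plus_bound _ t Ht).
  assert (He := exp_pos (v + u)); lra.
- apply (CQs_intro _ _ _ (1 + K)); [lra|]; intros z z' Hz Hz'.
  destruct (Hg' z z' Hz Hz') as [G1 [G2 G3]].
  change (Cmod (cexp v * cexp z) <= K) in G1; change (Cmod (g' z) <= K) in G2.
  change (Cmod (cexp v * cexp z' - cexp v * cexp z - (z' - z) * g' z) <= K * Cmod (z' - z) ^ 2) in G3.
  rewrite !cexp_plus.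
  assert (0 <= Cmod (z' - z) ^ 2) by apply pow2_ge_0.
  repeat split.
  + apply Rle_trans with (1 := Cmod_triangle _ _); rewrite Cmod_1; lra.
  + lra.
  + replace (1 + cexp v * cexp z' - (1 + cexp v * cexp z) - (z' - z) * g' z)%C with
     (cexp v * cexp z' - cexp v * cexp z - (z' - z) * g' z)%C by ring.
    nra.
Qed.

Lemma holo_sig : holo sig.
Proof.
apply holo_ext with (fun w => sig (0 + w)); [|apply holo_sig_shift].
intros u t _; f_equal; ring.
Qed.

Lemma holo_qq : holo qq.
Proof.
apply holo_mult; [apply holo_mult; [apply holo_cexp|apply holo_sig]|apply holo_sig].
Qed.

Lemma holo_cont {V : cmodule} p t (v : V) (u : R) : - tp <= t <= tp -> holo p ->
  continuous (fun u => p (u, t) * v)%V u.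
Proof.
intros Ht [p' Hp]; specialize (Hp (Rabs u + 1)); rename Hp into Hp'.
destruct (CQ_lip C_CompleteNormedModule _ _ _ Hp') as [K [HK Kp]].
apply (lip_cont V _ (K * |{v}|)); intros y Hy.
assert (Hy' : Rabs y <= Rabs u + 1).
{ replace y with (u + (y - u)) by ring.
  apply Rle_trans with (1 := Rabs_triang _ _); lra. }
assert (E := Kp (u, t) (y, t) ltac:(split; simpl; lra) ltac:(split; simpl; lra)).
change (Cmod (p (y, t) - p (u, t)) <= K * Cmod ((y, t) - (u, t))) in E.
replace ((y, t) - (u, t))%C with (RtoC (y - u)) in E
  by (apply injective_projections; simpl; ring).
rewrite Cmod_R in E.
apply Rle_trans with (|{(p (y, t) - p (u, t))%C * v}|); [right; f_equal; module|].
apply Rle_trans with (1 := norm_scal_C _ _).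
replace (K * |{v}| * Rabs (y - u)) with (K * Rabs (y - u) * |{v}|) by ring.
apply Rmult_le_compat_r; [apply vnorm_ge_0|exact E].
Qed.

(* Scalar contour integrals vanish: the two boundary rays give the same value. *)
Lemma holo_rotation {V : cmodule} p (v : V) K d t0 t1 :
  - tp <= t0 -> t0 <= t1 -> t1 <= tp -> holo p -> 0 <= K -> 0 < d ->
  (forall u t, - tp <= t <= tp -> Cmod (p (u, t)) <= K * dexp d 0 u) ->
  exists l, LI (fun u => p (u, t0) * v)%V l /\ LI (fun u => p (u, t1) * v)%V l.
Proof.
intros Ht0 Ht Ht1 Hp HK Hd Hdom.
assert (Hv := vnorm_ge_0 v).
assert (Hdv : forall u t, - tp <= t <= tp -> |{p (u, t) * v}| <= K * |{v}| * dexp d 0 u).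
{ intros u t Ht'; apply Rle_trans with (1 := norm_scal_C _ _).
  replace (K * |{v}| * dexp d 0 u) with (K * dexp d 0 u * |{v}|) by ring.
  apply Rmult_le_compat_r; [exact Hv|now apply Hdom]. }
assert (HKv : 0 <= K * |{v}|) by now apply Rmult_le_pos.
destruct (LI_ex V (fun u => p (u, t0) * v)%V (K * |{v}|) d 0) as [l0 [L0 _]]; auto.
{ intros u; apply holo_cont; [lra|exact Hp]. }
{ intros u; apply Hdv; lra. }
destruct (LI_ex V (fun u => p (u, t1) * v)%V (K * |{v}|) d 0) as [l1 [L1 _]]; auto.
{ intros u; apply holo_cont; [lra|exact Hp]. }
{ intros u; apply Hdv; lra. }
exists l0; split; [exact L0|].
replace l0 with l1; [exact L1|symmetry].
destruct Hp as [p' Hp].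
refine (rotation V (fun w => p w * v)%V _ t0 t1 _ (K * |{v}|) d l0 l1 Ht HKv Hd _ L0 L1).
- intros N; apply CQ_mult; [|apply (CQ_const V)].
  destruct (Hp N) as [M [HM Hk]]; exists M; split; [exact HM|].
  intros z z' [Hz1 Hz2] [Hz1' Hz2']; apply Hk; split; lra.
- intros u t Ht'; apply Hdv; lra.
Qed.

(** For a positive weight the integral over any window containing [0, 1] is at least I, so a
    vanishing limit forces I |v| to be arbitrarily small. *)
Lemma LI_pos {V : cmodule} (g : R -> R) (v : V) :
  (forall u, continuous g u) -> (forall u, 0 < g u) ->
  LI (fun u => RtoC (g u) * v)%V vzero -> v = vzero.
Proof.
intros Hg Hpos Hl.
assert (Hex : forall a b, ex_RInt g a b).
{ intros a b; apply (@ex_RInt_continuous R_CompleteNormedModule); intros u _; apply Hg. }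
set (I := RInt g 0 1).
assert (HI : 0 < I).
{ unfold I; apply RInt_gt_0; [lra|intros; apply Hpos|intros u _; apply Hg]. }
apply norm_le_0, le_of_le_eps; intros e He; rewrite Rplus_0_l.
apply Rmult_le_reg_l with I; [exact HI|].
destruct (Hl (I * e)) as [N HN]; [now apply Rmult_lt_0_compat|].
specialize (HN (- Rmax N 0) (Rmax N 1) ltac:(assert (H := Rmax_l N 0); lra) (Rmax_l _ _)).
assert (H0 : 0 <= Rmax N 0) by apply Rmax_r; assert (H1 : 1 <= Rmax N 1) by apply Rmax_r.
rewrite RI_real_scal in HN by exact Hg.
replace (RtoC (RInt g (- Rmax N 0) (Rmax N 1)) * v - vzero)%V with
  (RtoC (RInt g (- Rmax N 0) (Rmax N 1)) * v)%V in HN by module.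
rewrite norm_scal_R_eq in HN.
apply Rle_trans with (2 := HN), Rmult_le_compat_r; [apply vnorm_ge_0|].
apply Rle_trans with (2 := Rle_abs _).
set (a := - Rmax N 0); set (b := Rmax N 1).
rewrite <- (@RInt_Chasles R_CompleteNormedModule g a 0 b) by apply Hex.
rewrite <- (@RInt_Chasles R_CompleteNormedModule g 0 1 b) by apply Hex.
assert (P1 : 0 <= RInt g a 0).
{ apply RInt_ge_0; [unfold a; lra|apply Hex|intros; left; apply Hpos]. }
assert (P2 : 0 <= RInt g 1 b).
{ apply RInt_ge_0; [exact H1|apply Hex|intros; left; apply Hpos]. }
change (I <= RInt g a 0 + (I + RInt g 1 b)); lra.
Qed.

(** * Lipschitz bounds, and passage between polar and logarithmic coordinates *)

Lemma CQ_mono {V : cmodule} (D D' : C -> Prop) (f f' : C -> V) :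
  (forall z, D z -> D' z) -> CQ D' f f' -> CQ D f f'.
Proof.
intros HD [K [HK Hf]]; exists K; split; [exact HK|]; intros z z' Hz Hz'; apply Hf; auto.
Qed.

Notation VC := C_CompleteNormedModule.

Lemma iter_diff {V : cmodule} (P Q : V -> V) c d m x :
  lin P -> 1 <= c -> 0 <= d -> bdd P c -> bdd Q c -> (forall y, |{P y - Q y}| <= d * |{y}|) ->
  |{Nat.iter m P x - Nat.iter m Q x}| <= INR m * c ^ m * d * |{x}|.
Proof.
intros HP Hc Hd HPc HQc Hpq; assert (Hx := vnorm_ge_0 x).
induction m as [|m IH]; [simpl; rewrite norm_minus_diag; lra|].
cbn [Nat.iter nat_rect].
change (|{P (Nat.iter m P x) - Q (Nat.iter m Q x)}| <= INR (S m) * c ^ S m * d * |{x}|).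
replace (P (Nat.iter m P x) - Q (Nat.iter m Q x))%V with
  (P (Nat.iter m P x - Nat.iter m Q x)%V + (P (Nat.iter m Q x) - Q (Nat.iter m Q x)))%V
  by (rewrite (lin_sub _ _ _ HP); module).
apply Rle_trans with (1 := norm_tri _ _).
assert (H1 := HPc (Nat.iter m P x - Nat.iter m Q x)%V).
assert (H2 := Hpq (Nat.iter m Q x)).
assert (H3 := bdd_iter Q c m ltac:(lra) HQc x).
assert (Hcm : 1 <= c ^ m) by now apply pow_R1_Rle.
assert (Hm := pos_INR m).
assert (H4 : c * |{Nat.iter m P x - Nat.iter m Q x}| <= c * (INR m * c ^ m * d * |{x}|))
  by (apply Rmult_le_compat_l; lra).
assert (H5 : d * |{Nat.iter m Q x}| <= d * (c ^ m * |{x}|)) by (apply Rmult_le_compat_l; lra).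
assert (H6 : 0 <= c ^ m * d * |{x}|) by (repeat apply Rmult_le_pos; lra).
rewrite S_INR; simpl pow.
replace ((INR m + 1) * (c * c ^ m) * d * |{x}|) with
  (c * (INR m * c ^ m * d * |{x}|) + c * (c ^ m * d * |{x}|)) by ring.
assert (H7 : c ^ m * d * |{x}| <= c * (c ^ m * d * |{x}|)) by nra.
lra.
Qed.

Lemma sig_lip_glob a a' t : - tp <= t <= tp ->
  Cmod (sig (a', t) - sig (a, t)) <= 16 * exp 1 * Rabs (a' - a).
Proof.
intros Ht; destruct (Rle_dec (Rabs (a' - a)) 1) as [H1|H1]; [now apply sig_lip|].
apply Rle_trans with (Cmod (sig (a', t)) + Cmod (sig (a, t))).
{ rewrite <- (Cmod_opp (sig (a, t))); apply Cmod_triangle. }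
assert (B1 := sig_bound4 a t Ht); assert (B2 := sig_bound4 a' t Ht).
assert (He := exp_ineq1_le 1); nra.
Qed.

Lemma exp_INR_mult x n : exp x ^ n = exp (INR n * x).
Proof.
induction n as [|n IH]; [simpl; now rewrite Rmult_0_l, exp_0|].
rewrite S_INR; simpl; rewrite IH, <- exp_plus; f_equal; ring.
Qed.

Lemma exp_scal_lip al N v v' : 0 <= al -> - N <= v <= N -> - N <= v' <= N ->
  Rabs (exp (al * v') - exp (al * v)) <= exp (al * N) * (al * exp (al * (2 * N))) * Rabs (v' - v).
Proof.
intros Hal Hv Hv'.
replace (exp (al * v') - exp (al * v)) with (exp (al * v) * (exp (al * (v' - v)) - 1)).
- rewrite Rabs_mult, (Rabs_pos_eq (exp _)) by apply Rlt_le, exp_pos.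
  rewrite Rmult_assoc; apply Rmult_le_compat; [apply Rlt_le, exp_pos|apply Rabs_pos| |].
  + apply exp_le; nra.
  + apply Rle_trans with (1 := exp_taylor1 _).
    rewrite Rabs_mult, (Rabs_pos_eq al) by lra.
    replace (al * exp (al * (2 * N)) * Rabs (v' - v)) with (al * Rabs (v' - v) * exp (al * (2 * N))) by ring.
    apply Rmult_le_compat_l; [assert (H := Rabs_pos (v' - v)); nra|].
    apply exp_le, Rmult_le_compat_l; [exact Hal|]; apply Rabs_le; lra.
- rewrite Rmult_minus_distr_l, <- exp_plus, Rmult_1_r; f_equal; f_equal; ring.
Qed.

Lemma sigpow_lip a a' t m : - tp <= t <= tp ->
  Cmod (Cpow (sig (a', t)) m - Cpow (sig (a, t)) m) <= INR m * 4 ^ m * (16 * exp 1) * Rabs (a' - a).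
Proof.
intros Ht; apply Rle_trans with (INR m * 4 ^ m * Cmod (sig (a', t) - sig (a, t))).
- apply Cpow_diff_le; [now apply sig_bound4|now apply sig_bound4|lra].
- rewrite (Rmult_assoc (INR m * 4 ^ m)); apply Rmult_le_compat_l; [|now apply sig_lip_glob].
  apply Rmult_le_pos; [apply pos_INR|apply pow_le; lra].
Qed.

Lemma LI_tail {V : cmodule} (f : R -> V) l K d N : (forall u, continuous f u) -> 0 <= K -> 0 < d ->
  (forall u, |{f u}| <= K * dexp d 0 u) -> 0 <= N -> LI f l ->
  |{RI f (- N) N - l}| <= 4 * K / d * exp (- (d * N)).
Proof.
intros Hf HK Hd Hb HN Hl; apply le_of_le_eps; intros e He.
destruct (Hl e He) as [N' HN']; assert (H1 := Rmax_l N N'); assert (H2 := Rmax_r N N').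
specialize (HN' (- Rmax N N') (Rmax N N') ltac:(lra) H2).
assert (Ht := RI_tails V f K d 0 Hf HK Hd Hb N (- N) N (- Rmax N N') (Rmax N N')
  HN ltac:(lra) ltac:(lra) ltac:(lra) ltac:(lra)).
set (r := RI f (- Rmax N N') (Rmax N N')) in *.
replace (RI f (- N) N - l)%V with ((RI f (- N)%R N - r) + (r - l))%V by module.
apply Rle_trans with (1 := norm_tri _ _); lra.
Qed.

Lemma cexp_ln r t : 0 < r -> cexp (ln r, t) = (RtoC r * cis t)%C.
Proof.
intros Hr; unfold cexp, cis; simpl; rewrite exp_ln by exact Hr.
apply injective_projections; simpl; ring.
Qed.

(** The half-angle formula sin t / (1 + cos t) = tan (t / 2), with |t / 2| < PI / 2. *)
Lemma arg_cexp u t : - PI < t < PI -> arg (cexp (u, t)) = t.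
Proof.
intros Ht; unfold arg; rewrite Cmod_cexp; unfold cexp; simpl.
assert (He := exp_pos u).
assert (Hc : 0 < cos (t / 2)) by (apply cos_gt_0; lra).
assert (E1 : cos t = 2 * (cos (t / 2) * cos (t / 2)) - 1).
{ replace t with (2 * (t / 2)) at 1 by field; rewrite cos_2a_cos; ring. }
assert (E2 : sin t = 2 * sin (t / 2) * cos (t / 2)).
{ replace t with (2 * (t / 2)) at 1 by field; now rewrite sin_2a. }
replace (exp u * sin t / (exp u + exp u * cos t)) with (tan (t / 2)).
- rewrite atan_tan by lra; field.
- unfold tan; rewrite E1, E2.
  set (c := cos (t / 2)) in *; set (s := sin (t / 2)).
  replace (exp u + exp u * (2 * (c * c) - 1)) with (exp u * (2 * (c * c))) by ring.
  field; lra.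
Qed.

Lemma cpower_cexp a u t : - PI < t < PI -> cpower (cexp (u, t)) (- a) = cexp (- a * (u, t)).
Proof.
intros Ht; unfold cpower; rewrite arg_cexp, Cmod_cexp by exact Ht; unfold Rpower, cis.
simpl fst; rewrite ln_exp; unfold cexp; simpl.
replace (- a * u - - 0 * t) with (- a * u) by ring.
replace (- a * t + - 0 * u) with (- a * t) by ring.
apply injective_projections; simpl; ring.
Qed.

Lemma pow_n_Cpow (z : C) n : @pow_n C_Ring z n = Cpow z n.
Proof. induction n as [|n IH]; [reflexivity|simpl; rewrite IH; reflexivity]. Qed.

Lemma regularizer_cexp n u t : - tp <= t <= tp -> regularizer n (cexp (u, t)) = Cpow (qq (u, t)) n.
Proof.
intros Ht; unfold regularizer; rewrite pow_n_Cpow; f_equal.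
assert (Hn := sig_nz u t Ht); unfold qq, sig; field; exact Hn.
Qed.

(** Substitution u = ln r, du = dr / r: neighbourhoods of 0 and of infinity in r become the
    half-lines u <= - N and u >= N. *)
Lemma LI_is_RInt_gen {V : cmodule} (f : R -> V) (g : R -> V) l :
  (forall u, continuous f u) -> LI f l ->
  (forall r, 0 < r -> g r = (RtoC (/ r) * f (ln r))%V) ->
  is_RInt_gen (V := real_NormedModule V) g (at_right 0) (Rbar_locally p_infty) l.
Proof.
intros Hf Hl Hg P [e HP].
destruct (Hl (e / 2)) as [N HN]; [assert (He := cond_pos e); lra|].
apply (Filter_prod _ _ _ (fun a => 0 < a /\ ln a <= - N) (fun b => 0 < b /\ N <= ln b)).
- exists (mkposreal (exp (- N)) (exp_pos _)); intros a Ha Ha0; split; [exact Ha0|].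
  assert (Ha' : Rabs (a - 0) < exp (- N)) by exact Ha.
  rewrite Rminus_0_r, Rabs_pos_eq in Ha' by lra.
  rewrite <- (ln_exp (- N)); now apply Rlt_le, ln_increasing.
- exists (exp N); intros b Hb; assert (HeN := exp_pos N); split; [lra|].
  rewrite <- (ln_exp N); now apply Rlt_le, ln_increasing.
- intros a b [Ha HaN] [Hb HbN]; exists (RI f (ln a) (ln b)); split.
  + apply (@is_RInt_ext (real_NormedModule V) (fun r => @scal R_Ring (real_NormedModule V) (/ r) (f (ln r)))).
    * intros r Hr; symmetry; apply Hg.
      assert (Hm : 0 < Rmin a b) by now apply Rmin_glb_lt.
      simpl in Hr; lra.
    * apply (@is_RInt_comp (real_CompleteNormedModule V) f ln (fun r => / r) a b).
      -- intros; apply Hf.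
      -- intros r Hr; assert (Hm : 0 < Rmin a b) by now apply Rmin_glb_lt.
         split; [apply is_derive_Reals, derivable_pt_lim_ln; lra|].
         apply (ex_derive_continuous (V := R_NormedModule)); auto_derive; lra.
  + apply HP, (@norm_compat1 C_AbsRing V).
    apply Rle_lt_trans with (1 := HN _ _ HaN HbN); assert (He := cond_pos e); lra.
Qed.

(** * Operator norms and limits *)

Lemma op_norm_bdd {H : HilbertSpace} (L : H -> H) (c : R) :
  lin L -> Rbar_le (op_norm L) c -> bdd L c.
Proof.
intros HL Hc x.
assert (Hu : forall y, |{y}| <= 1 -> |{L y}| <= c).
{ intros y Hy; unfold op_norm in Hc.
  destruct (Lub_Rbar_correct (fun r => exists x : H, norm x <= 1 /\ r = norm (L x))) as [Hub _].
  assert (Hl : Rbar_le (|{L y}|) c); [|exact Hl].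
  apply Rbar_le_trans with (2 := Hc), Hub; now exists y. }
assert (Hx := vnorm_ge_0 x).
destruct (Rle_lt_or_eq_dec _ _ Hx) as [H0|H0].
- specialize (Hu (RtoC (/ |{x}|) * x)%V).
  rewrite (lin_scal _ HL), !norm_scal_R_eq, Rabs_pos_eq in Hu by (apply Rlt_le, Rinv_0_lt_compat, H0).
  specialize (Hu ltac:(right; field; lra)).
  apply Rmult_le_reg_l with (/ |{x}|); [now apply Rinv_0_lt_compat|].
  replace (/ |{x}| * (c * |{x}|)) with c by (field; lra); exact Hu.
- rewrite (norm_le_0 x) by lra; rewrite (lin_zero _ HL).
  replace |{(vzero : H)}| with 0 by (symmetry; apply (@norm_zero C_AbsRing H)); lra.
Qed.

Lemma bdd_op_norm {H : HilbertSpace} (L : H -> H) (c : R) :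
  0 <= c -> bdd L c -> Rbar_le (op_norm L) c.
Proof.
intros Hc HL; unfold op_norm.
destruct (Lub_Rbar_correct (fun r => exists x : H, norm x <= 1 /\ r = norm (L x))) as [_ Hlub].
apply Hlub; intros r [x [Hx ->]].
apply Rle_trans with (1 := HL x), Rle_trans with (c * 1); [|rewrite Rmult_1_r; apply Rle_refl].
now apply Rmult_le_compat_l.
Qed.

Lemma filterlim_at_right_norm {V : cmodule} (f : R -> V) (y : V) :
  filterlim f (at_right 0) (locally y) <->
  forall e, 0 < e -> exists d, 0 < d /\ forall h, 0 < h < d -> |{f h - y}| < e.
Proof.
rewrite (filterlim_locally (F := at_right 0)); split.
- intros Hf e He; assert (Hn := @norm_factor_gt_0 C_AbsRing V).
  destruct (Hf (mkposreal (e / @norm_factor C_AbsRing V) (Rdiv_lt_0_compat _ _ He Hn))) as [d Hd].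
  exists d; split; [apply cond_pos|]; intros h Hh.
  assert (Hb : ball y (e / @norm_factor C_AbsRing V) (f h)).
  { apply Hd; [|apply Hh]; change (Rabs (h - 0) < d); rewrite Rminus_0_r, Rabs_pos_eq; lra. }
  assert (Hc := @norm_compat2 C_AbsRing V y (f h) (mkposreal _ (Rdiv_lt_0_compat _ _ He Hn)) Hb).
  apply Rlt_le_trans with (1 := Hc); right; simpl; field; apply Rgt_not_eq, Hn.
- intros Hf e; destruct (Hf e (cond_pos e)) as [d [Hd Hh]].
  exists (mkposreal d Hd); intros h Hb H0; apply (@norm_compat1 C_AbsRing V), Hh.
  assert (Hb' : Rabs (h - 0) < d) by exact Hb.
  rewrite Rminus_0_r, Rabs_pos_eq in Hb' by lra; lra.
Qed.

(** * Resolvents *)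

Section StableSemigroup.

Variable H : HilbertSpace.
Variables (T : R -> H -> H) (A : operator H) (M : R).
Hypothesis HT : bsg T M.
Hypothesis HA : forall x y, A x y <-> ngen T x y.

(** The semigroup generated by - (w + A), see [ngen_damped]. *)
Definition damped (w : C) (t : R) (x : H) : H := (cexp (- (t * w)) * T t x)%V.

Lemma fst_tw (t : R) (w : C) : fst (- (t * w))%C = - (t * fst w).
Proof. simpl; ring. Qed.

Lemma Cmod_damp (t : R) w : Cmod (cexp (- (t * w))) = exp (- (t * fst w)).
Proof. now rewrite Cmod_cexp, fst_tw. Qed.

Lemma damped_norm w t x :
  0 <= t -> |{damped w t x}| <= exp (- (t * fst w)) * (M * |{x}|).
Proof.
intros Ht; unfold damped; apply Rle_trans with (1 := norm_scal_C _ _).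
rewrite Cmod_damp; apply Rmult_le_compat_l; [apply Rlt_le, exp_pos|].
now apply (bsg_bdd T M HT).
Qed.

Lemma damp_small (w : C) (h : R) :
  0 < h -> h * Cmod w <= 1 ->
  Cmod (cexp (- (h * w)) - 1) <= (1 + 5 * exp 1) * (h * Cmod w).
Proof.
intros Hh Hw.
assert (E : Cmod (- (h * w)) = h * Cmod w).
{ rewrite Cmod_opp, Cmod_mult, Cmod_R, Rabs_pos_eq; lra. }
rewrite <- E in *.
replace (5 * exp 1) with (5 * 1 * exp 1) by ring.
now apply cexp_lip.
Qed.

Lemma damp_small2 (w : C) (h : R) :
  0 < h -> h * Cmod w <= 1 ->
  Cmod (cexp (- (h * w)) - 1 + h * w) <= 5 * exp 1 * (h * Cmod w) ^ 2.
Proof.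
intros Hh Hw.
assert (E : Cmod (- (h * w)) = h * Cmod w).
{ rewrite Cmod_opp, Cmod_mult, Cmod_R, Rabs_pos_eq; lra. }
replace (cexp (- (h * w)) - 1 + h * w)%C with (cexp (- (h * w)) - 1 - - (h * w))%C by ring.
rewrite <- E in *.
apply cexp_taylor.
apply Rle_trans with (2 := Hw), abs_fst_le.
Qed.

Lemma damped_bsg w : 0 <= fst w -> bsg (damped w) M.
Proof.
intros Hw; assert (HM := bsg_M T M HT); split.
- exact HM.
- intros t Ht; apply (lin_comp (fun x => cexp (- (t * w)) * x)%V (T t));
  [apply lin_vscal|now apply (bsg_lin T M HT)].
- intros x; unfold damped; rewrite (bsg_0 T M HT).
  replace (- (0 * w))%C with (RtoC 0) by ring.
  rewrite cexp_0; module.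
- intros s t x Hs Ht; unfold damped.
  rewrite (bsg_plus T M HT), (lin_scal _ (bsg_lin T M HT s Hs)) by assumption.
  replace (- ((s + t)%R * w))%C with (- (s * w) + - (t * w))%C
    by (rewrite RtoC_plus; ring).
  rewrite cexp_plus; module.
- intros t Ht x; apply Rle_trans with (1 := damped_norm w t x Ht).
  rewrite <- (Rmult_1_l (M * |{x}|)) at 2.
  apply Rmult_le_compat_r.
  + apply Rmult_le_pos; [lra|apply vnorm_ge_0].
  + apply exp_neg_le_1; assert (0 <= t * fst w) by now apply Rmult_le_pos. lra.
- intros x e He.
  destruct (bsg_cont T M HT x (e / 2)) as [d [Hd Hd']]; [lra|].
  set (k := (1 + 5 * exp 1) * Cmod w * (M * |{x}|)).
  assert (H5 : 0 < exp 1) by apply exp_pos.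
  assert (Hk : 0 <= k).
  { unfold k; repeat apply Rmult_le_pos; auto using Cmod_ge_0, vnorm_ge_0; lra. }
  assert (Hc := Cmod_ge_0 w).
  exists (Rmin d (Rmin (/ (Cmod w + 1)) (e / (2 * (k + 1))))); split.
  + repeat apply Rmin_glb_lt; [exact Hd|apply Rinv_0_lt_compat; lra|].
    apply Rdiv_lt_0_compat; lra.
  + intros h [Hh1 Hh2].
    assert (Hh3 : h < d) by (eapply Rlt_le_trans; [exact Hh2|apply Rmin_l]).
    assert (Hh4 : h < / (Cmod w + 1)).
    { eapply Rlt_le_trans; [exact Hh2|].
      eapply Rle_trans; [apply Rmin_r|apply Rmin_l]. }
    assert (Hh5 : h < e / (2 * (k + 1))).
    { eapply Rlt_le_trans; [exact Hh2|].
      eapply Rle_trans; [apply Rmin_r|apply Rmin_r]. }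
    assert (Hh6 : h * Cmod w <= 1).
    { apply Rmult_lt_compat_r with (r := Cmod w + 1) in Hh4; [|lra].
      rewrite Rinv_l in Hh4 by lra; nra. }
    apply Rlt_div_r in Hh5; [|lra].
    unfold damped.
    replace (cexp (- (h * w)) * T h x - x)%V with
      ((cexp (- (h * w)) - 1)%C * T h x + (T h x - x))%V by module.
    apply Rle_lt_trans with (1 := norm_tri _ _).
    specialize (Hd' h ltac:(lra)).
    assert (H1 : |{(cexp (- (h * w)) - 1)%C * T h x}| <= h * k).
    { apply Rle_trans with (1 := norm_scal_C _ _).
      replace (h * k) with ((1 + 5 * exp 1) * (h * Cmod w) * (M * |{x}|))
        by (unfold k; ring).
      apply Rmult_le_compat; auto using Cmod_ge_0, vnorm_ge_0.
      - now apply damp_small.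
      - apply (bsg_bdd T M HT); lra. }
    lra.
Qed.

Lemma damped_limit w x e :
  0 < e -> exists d, 0 < d /\ forall h, 0 < h < d ->
  |{RtoC (/ h) * (x - damped w h x) - (RtoC (/ h) * (x - T h x) + w * x)}| <= e.
Proof.
intros He; assert (HM := bsg_M T M HT); assert (Hc := Cmod_ge_0 w).
destruct (bsg_cont T M HT x (e / (2 * (Cmod w + 1)))) as [d [Hd Hd']].
{ apply Rdiv_lt_0_compat; lra. }
set (k := 5 * exp 1 * Cmod w ^ 2 * (M * |{x}|)).
assert (H5 : 0 < exp 1) by apply exp_pos.
assert (Hk : 0 <= k).
{ unfold k; repeat apply Rmult_le_pos; auto using pow2_ge_0, vnorm_ge_0; lra. }
exists (Rmin d (Rmin (/ (Cmod w + 1)) (e / (2 * (k + 1))))); split.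
{ repeat apply Rmin_glb_lt; [exact Hd|apply Rinv_0_lt_compat; lra|].
  apply Rdiv_lt_0_compat; lra. }
intros h [Hh1 Hh2].
assert (Hh3 : h < d) by (eapply Rlt_le_trans; [exact Hh2|apply Rmin_l]).
assert (Hh4 : h < / (Cmod w + 1)).
{ eapply Rlt_le_trans; [exact Hh2|].
  eapply Rle_trans; [apply Rmin_r|apply Rmin_l]. }
assert (Hh5 : h < e / (2 * (k + 1))).
{ eapply Rlt_le_trans; [exact Hh2|].
  eapply Rle_trans; [apply Rmin_r|apply Rmin_r]. }
assert (Hh6 : h * Cmod w <= 1).
{ apply Rmult_lt_compat_r with (r := Cmod w + 1) in Hh4; [|lra].
  rewrite Rinv_l in Hh4 by lra; nra. }
apply Rlt_div_r in Hh5; [|lra].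
specialize (Hd' h ltac:(lra)); apply Rlt_div_r in Hd'; [|lra].
unfold damped.
set (c := cexp (- (h * w))).
replace (RtoC (/ h) * (x - c * T h x) - (RtoC (/ h) * (x - T h x) + w * x))%V
 with (w * (T h x - x) - RtoC (/ h) * ((c - 1 + h * w)%C * T h x))%V.
- apply Rle_trans with (1 := norm_minus_le _ _).
  assert (H1 : |{w * (T h x - x)}| <= Cmod w * |{T h x - x}|) by apply norm_scal_C.
  assert (H2 : |{RtoC (/ h) * ((c - 1 + h * w)%C * T h x)}| <= h * k).
  { apply Rle_trans with (1 := norm_scal_R _ _).
    assert (Hi : 0 < / h) by (apply Rinv_0_lt_compat; lra).
    rewrite Rabs_pos_eq by lra.
    apply Rle_trans with (/ h * (5 * exp 1 * (h * Cmod w) ^ 2 * (M * |{x}|))).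
    - apply Rmult_le_compat_l; [lra|].
      apply Rle_trans with (1 := norm_scal_C _ _).
      apply Rmult_le_compat; auto using Cmod_ge_0, vnorm_ge_0.
      + now apply damp_small2.
      + apply (bsg_bdd T M HT); lra.
    - right; unfold k; field; lra. }
  assert (Hn := vnorm_ge_0 (T h x - x)%V).
  nra.
- module; rewrite !RtoC_inv by lra; field; intros E; apply RtoC_inj in E; lra.
Qed.

Lemma ngen_damped w x y : ngen T x y <-> ngen (damped w) x (y + w * x)%V.
Proof.
split; intros Hxy e He;
(destruct (Hxy (e / 2)) as [d1 [Hd1 H1]]; [lra|]);
(destruct (damped_limit w x (e / 2)) as [d2 [Hd2 H2]]; [lra|]);
(exists (Rmin d1 d2); split; [now apply Rmin_glb_lt|]); intros h Hh;
assert (Hm1 := Rmin_l d1 d2); assert (Hm2 := Rmin_r d1 d2);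
specialize (H1 h ltac:(lra)); specialize (H2 h ltac:(lra));
set (a := (RtoC (/ h) * (x - damped w h x))%V) in *;
set (b := (RtoC (/ h) * (x - T h x))%V) in *.
- replace (a - (y + w * x))%V with ((a - (b + w * x)) + (b - y))%V by module.
  apply Rle_trans with (1 := norm_tri _ _); lra.
- replace (b - y)%V with ((a - (y + w * x)) - (a - (b + w * x)))%V by module.
  apply Rle_trans with (1 := norm_minus_le _ _); lra.
Qed.

Lemma A_lin L x y :
  lin L -> (forall t z, 0 <= t -> T t (L z) = L (T t z)) -> A x y -> A (L x) (L y).
Proof. intros HL HLT; rewrite !HA; now apply ngen_lin. Qed.

Lemma A_add x y x' y' : A x y -> A x' y' -> A (x + x')%V (y + y')%V.
Proof. rewrite !HA; apply (ngen_add H T M HT). Qed.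

Lemma A_scal c x y : A x y -> A (c * x)%V (c * y)%V.
Proof. rewrite !HA; apply (ngen_scal H T M HT). Qed.

Lemma A_sub x y x' y' : A x y -> A x' y' -> A (x - x')%V (y - y')%V.
Proof.
intros H1 H2; assert (H3 := A_add _ _ _ _ H1 (A_scal (RtoC (-1)) _ _ H2)).
replace (x - x')%V with (x + RtoC (-1) * x')%V by module.
replace (y - y')%V with (y + RtoC (-1) * y')%V by module; exact H3.
Qed.

Lemma A_unique x y y' : A x y -> A x y' -> y = y'.
Proof. rewrite !HA; apply ngen_unique. Qed.

Lemma is_RInt_exp_neg a K N : 0 < a ->
  is_RInt (fun s => exp (- (s * a)) * K) 0 N (K / a * (1 - exp (- (N * a)))).
Proof.
intros Ha.
replace (K / a * (1 - exp (- (N * a)))) with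
  (minus (- (exp (- (N * a)) * K / a)) (- (exp (- (0 * a)) * K / a))).
- apply (@is_RInt_derive R_CompleteNormedModule (fun s => - (exp (- (s * a)) * K / a))
    (fun s => exp (- (s * a)) * K)).
  + intros s _; auto_derive; [trivial|field; lra].
  + intros s _; apply (@ex_derive_continuous R_AbsRing R_NormedModule).
    auto_derive; trivial.
- replace (- (0 * a)) with 0 by ring; rewrite exp_0.
  unfold minus, plus, opp; simpl; field; lra.
Qed.

(** Past this horizon the damped semigroup has norm at most 1/2. It lets finite integrals replace
    the Laplace transform, here for the resolvent and later in [ev_half]. *)
Lemma exp_horizon a : 0 < a -> exists N, 0 <= N /\ M * exp (- (N * a)) <= / 2.
Proof.
intros Ha; assert (HM := bsg_M T M HT).
exists (ln (2 * M) / a); split.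
- apply Rdiv_le_0_compat; [|exact Ha].
  rewrite <- ln_1; apply Rcomplements.ln_le; lra.
- replace (ln (2 * M) / a * a) with (ln (2 * M)) by (field; lra).
  rewrite exp_Ropp, exp_ln by lra; right; field; lra.
Qed.

(** Solve z - S(N) z = y by a Neumann series, S being the damped semigroup; then x = int_0^N S(s) z
    ds satisfies (w + A) x = z - S(N) z = y. The bound combines |z| <= 2 |y| with the exponential
    integral. *)
Lemma resolvent_exists w y :
  0 < fst w -> exists x, A x (y - w * x)%V /\ |{x}| <= 2 * M / fst w * |{y}|.
Proof.
intros Hw; assert (HM := bsg_M T M HT).
assert (HS := damped_bsg w (Rlt_le _ _ Hw)).
destruct (exp_horizon (fst w) Hw) as [N [HN HNe]].
assert (LN := bsg_lin _ _ HS N HN).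
destruct (neumann (damped w N) y LN) as [z [Hz1 Hz2]].
{ intros x; apply Rle_trans with (1 := damped_norm w N x HN).
  assert (Hx := vnorm_ge_0 x); nra. }
exists (orbit_int (damped w) N z); split.
- apply HA; apply (ngen_damped w).
  replace (y - w * orbit_int (damped w) N z + w * orbit_int (damped w) N z)%V
    with y by module.
  rewrite <- Hz1; now apply (ngen_orbit_int H (damped w) M HS).
- apply Rle_trans with (M * |{z}| / fst w).
  + apply Rle_trans with (M * |{z}| / fst w * (1 - exp (- (N * fst w)))).
    * apply (RI_norm_le H _ (fun s => exp (- (s * fst w)) * (M * |{z}|)) 0 N); [exact HN| | |].
      -- apply (orbit_cont H _ _ HS).
      -- intros s Hs; rewrite orbit_eq by lra; apply damped_norm; lra.
      -- now apply is_RInt_exp_neg.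
    * rewrite <- (Rmult_1_r (M * |{z}| / fst w)) at 2.
      apply Rmult_le_compat_l.
      -- apply Rdiv_le_0_compat; [|exact Hw].
         apply Rmult_le_pos; [lra|apply vnorm_ge_0].
      -- assert (He := exp_pos (- (N * fst w))); lra.
  + replace (2 * M / fst w * |{y}|) with (M * (2 * |{y}|) / fst w) by (field; lra).
    apply Rmult_le_compat_r; [apply Rlt_le, Rinv_0_lt_compat, Hw|].
    apply Rmult_le_compat_l; lra.
Qed.

(** A vector in the kernel of w + A is fixed by the damped semigroup, whose norm at the horizon is
    at most 1/2. *)
Lemma resolvent_inj w x : 0 < fst w -> A x (- (w * x))%V -> x = vzero.
Proof.
intros Hw Hx; assert (HM := bsg_M T M HT).
assert (HS := damped_bsg w (Rlt_le _ _ Hw)).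
destruct (exp_horizon (fst w) Hw) as [N [HN HNe]].
apply HA, (ngen_damped w) in Hx.
replace (- (w * x) + w * x)%V with (vzero : H) in Hx by module.
assert (E := orbit_int_ngen H _ _ HS N _ _ HN Hx).
rewrite (lin_zero _ (orbit_int_lin H _ _ HS N HN)) in E.
assert (E' : x = damped w N x) by (symmetry in E; now apply minus_zero_eq).
apply norm_le_0.
assert (Hd := damped_norm w N x HN); rewrite <- E' in Hd.
assert (Hn := vnorm_ge_0 x); nra.
Qed.

(* [(w + A)^{-1}]; with [w = 0] included, cf. [dom] below. *)
Definition Rs (w : C) (y : H) : H := iota (fun x => A x (y - w * x)%V).

(** One such time already makes A boundedly invertible; the rate of decay enters only later, through
    [Hpoly]. *)
Hypothesis decay : exists t, 0 <= t /\ bdd (fun x => T t (Rs (RtoC 1) x)) (/ 2).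

Lemma Rs_spec_pos w y : 0 < fst w -> A (Rs w y) (y - w * Rs w y)%V.
Proof.
intros Hw; unfold Rs; apply (@iota_correct C_AbsRing H).
destruct (resolvent_exists w y Hw) as [x [Hx _]].
exists x; split; [exact Hx|]; intros x' Hx'.
apply minus_zero_eq, (resolvent_inj w); [exact Hw|].
replace (- (w * (x - x')))%V with ((y - w * x) - (y - w * x'))%V by module.
now apply A_sub.
Qed.

(** A kernel vector is fixed both by T(t) and by (1 + A)^{-1}, so [decay] gives |x| <= |x| / 2. *)
Lemma A_inj x : A x vzero -> x = vzero.
Proof.
intros Hx; destruct decay as [t [Ht Hd]].
assert (E : T t x = x).
{ apply HA in Hx.
  assert (E := orbit_int_ngen H _ _ HT t _ _ Ht Hx).
  rewrite (lin_zero _ (orbit_int_lin H _ _ HT t Ht)) in E.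
  symmetry; symmetry in E; now apply minus_zero_eq. }
assert (E1 : Rs (RtoC 1) x = x).
{ apply minus_zero_eq, (resolvent_inj (RtoC 1)); [simpl; lra|].
  replace (- (RtoC 1 * (Rs (RtoC 1) x - x)))%V with ((x - RtoC 1 * Rs (RtoC 1) x) - vzero)%V by module.
  apply A_sub; [apply Rs_spec_pos; simpl; lra|exact Hx]. }
specialize (Hd x); cbn beta in Hd; rewrite E1, E in Hd.
apply norm_le_0; lra.
Qed.

Lemma Rs_unique_pos w x y : 0 < fst w -> A x (y - w * x)%V -> x = Rs w y.
Proof.
intros Hw Hx; apply minus_zero_eq, (resolvent_inj w); [exact Hw|].
replace (- (w * (x - Rs w y)))%V with ((y - w * x) - (y - w * Rs w y))%V by module.
apply A_sub; [exact Hx|now apply Rs_spec_pos].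
Qed.

Lemma Rs_bdd_pos w : 0 < fst w -> bdd (Rs w) (2 * M / fst w).
Proof.
intros Hw y; destruct (resolvent_exists w y Hw) as [x [Hx1 Hx2]].
now rewrite <- (Rs_unique_pos w x y Hw Hx1).
Qed.

Lemma Rs_lin_pos w : 0 < fst w -> lin (Rs w).
Proof.
intros Hw; apply (bdd_lin _ (2 * M / fst w)).
- intros x y; symmetry; apply Rs_unique_pos; [exact Hw|].
  replace (x + y - w * (Rs w x + Rs w y))%V with
    ((x - w * Rs w x) + (y - w * Rs w y))%V by module.
  apply A_add; now apply Rs_spec_pos.
- intros c x; symmetry; apply Rs_unique_pos; [exact Hw|].
  replace (c * x - w * (c * Rs w x))%V with (c * (x - w * Rs w x))%V by module.
  apply A_scal; now apply Rs_spec_pos.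
- now apply Rs_bdd_pos.
Qed.

Lemma T_comm s t x : 0 <= s -> 0 <= t -> T t (T s x) = T s (T t x).
Proof.
intros Hs Ht; rewrite <- !(bsg_plus T M HT) by assumption; f_equal; ring.
Qed.

(** Put R = (1 + A)^{-1} and solve z - T(t) R z = y by a Neumann series. Then x = int_0^t T(s) R z
    ds + R z works: A maps the integral to R z - T(t) R z and R z to z - R z. *)
Lemma A_surj : exists c, 0 < c /\ forall y, exists x, A x y /\ |{x}| <= c * |{y}|.
Proof.
destruct decay as [t [Ht Hd]]; assert (HM := bsg_M T M HT).
assert (H1 : 0 < fst (RtoC 1)) by (simpl; lra).
assert (LR := Rs_lin_pos (RtoC 1) H1); assert (LT := bsg_lin T M HT t Ht).
assert (LJ := orbit_int_lin H T M HT t Ht).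
destruct (lin_bdd _ LR) as [r [Hr Rb]]; destruct (lin_bdd _ LJ) as [j [Hj Jb]].
exists ((j + 1) * r * 2); split; [nra|]; intros y.
destruct (neumann (fun x => T t (Rs (RtoC 1) x)) y (lin_comp _ _ LT LR) Hd) as [z [Hz1 Hz2]].
assert (HR : A (Rs (RtoC 1) z) (z - Rs (RtoC 1) z)%V).
{ replace (z - Rs (RtoC 1) z)%V with (z - RtoC 1 * Rs (RtoC 1) z)%V by module; now apply Rs_spec_pos. }
assert (E := orbit_int_ngen H _ _ HT t _ _ Ht (proj1 (HA _ _) HR)).
exists (orbit_int T t (Rs (RtoC 1) z) + Rs (RtoC 1) z)%V; split.
- replace y with (orbit_int T t (z - Rs (RtoC 1) z) + (z - Rs (RtoC 1) z))%V.
  + apply A_add; [|exact HR].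
    apply (A_lin (orbit_int T t)); [exact LJ| |exact HR].
    intros s w Hs; apply (orbit_int_comm H T M HT t (T s)); [exact Ht|now apply (bsg_lin T M HT)|].
    intros s' w' Hs'; now apply T_comm.
  + rewrite E, <- Hz1; module.
- apply Rle_trans with (1 := norm_tri _ _).
  assert (B1 := Jb (Rs (RtoC 1) z)); assert (B2 := Rb z).
  assert (j * |{Rs (RtoC 1) z}| <= j * (r * |{z}|)) by (apply Rmult_le_compat_l; lra).
  assert ((j + 1) * r * |{z}| <= (j + 1) * r * (2 * |{y}|)) by
    (apply Rmult_le_compat_l; nra).
  lra.
Qed.

Definition dom (w : C) : Prop := w = 0 \/ 0 < fst w.

Lemma Rs_spec w y : dom w -> A (Rs w y) (y - w * Rs w y)%V.
Proof.
intros [->|Hw]; [|now apply Rs_spec_pos].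
unfold Rs; apply (@iota_correct C_AbsRing H).
destruct A_surj as [c [_ Hc]]; destruct (Hc y) as [x [Hx _]].
exists x; split.
- replace (y - RtoC 0 * x)%V with y by module; exact Hx.
- intros x' Hx'; apply minus_zero_eq, A_inj.
  replace (vzero : H) with (y - (y - RtoC 0 * x'))%V by module.
  now apply A_sub.
Qed.

Lemma Rs_unique w x y : dom w -> A x (y - w * x)%V -> x = Rs w y.
Proof.
intros [->|Hw] Hx; [|now apply Rs_unique_pos].
apply minus_zero_eq, A_inj.
replace (vzero : H) with ((y - RtoC 0 * x) - (y - RtoC 0 * Rs (RtoC 0) y))%V by module.
apply A_sub; [exact Hx|apply Rs_spec; now left].
Qed.

Lemma Rs_0_bdd : exists c, 0 < c /\ bdd (Rs (RtoC 0)) c.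
Proof.
destruct A_surj as [c [Hc0 Hc]]; exists c; split; [exact Hc0|].
intros y; destruct (Hc y) as [x [Hx1 Hx2]].
rewrite <- (Rs_unique (RtoC 0) x y); [exact Hx2|now left|].
replace (y - RtoC 0 * x)%V with y by module; exact Hx1.
Qed.

Lemma Rs_lin w : dom w -> lin (Rs w).
Proof.
intros Hw.
assert (Hb : exists c, bdd (Rs w) c).
{ destruct Hw as [->|Hw]; [destruct Rs_0_bdd as [c [_ Hc]]; now exists c|].
  eexists; now apply Rs_bdd_pos. }
destruct Hb as [b Hb]; apply (bdd_lin _ b).
- intros x y; symmetry; apply Rs_unique; [exact Hw|].
  replace (x + y - w * (Rs w x + Rs w y))%V with
    ((x - w * Rs w x) + (y - w * Rs w y))%V by module.
  apply A_add; now apply Rs_spec.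
- intros c x; symmetry; apply Rs_unique; [exact Hw|].
  replace (c * x - w * (c * Rs w x))%V with (c * (x - w * Rs w x))%V by module.
  apply A_scal; now apply Rs_spec.
- exact Hb.
Qed.

Lemma Rs_comm_gen w L x :
  dom w -> lin L -> (forall t z, 0 <= t -> T t (L z) = L (T t z)) ->
  L (Rs w x) = Rs w (L x).
Proof.
intros Hw HL HLT; apply Rs_unique; [exact Hw|].
rewrite <- (lin_scal L HL), <- (lin_sub L _ _ HL).
now apply A_lin, Rs_spec.
Qed.

Lemma T_Rs w t x : dom w -> 0 <= t -> T t (Rs w x) = Rs w (T t x).
Proof.
intros Hw Ht; apply Rs_comm_gen; [exact Hw|now apply (bsg_lin T M HT)|].
intros s z Hs; now apply T_comm.
Qed.

Lemma Rs_comm w v x : dom w -> dom v -> Rs w (Rs v x) = Rs v (Rs w x).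
Proof.
intros Hw Hv; apply Rs_comm_gen; [exact Hv|now apply Rs_lin|].
intros t z Ht; now apply T_Rs.
Qed.

Lemma Rs_resolvent w v x :
  dom w -> dom v -> (Rs w x - Rs v x = (v - w)%C * Rs w (Rs v x))%V.
Proof.
intros Hw Hv.
assert (E : Rs v x = Rs w (x + (w - v)%C * Rs v x)%V).
{ apply Rs_unique; [exact Hw|].
  replace (x + (w - v)%C * Rs v x - w * Rs v x)%V with (x - v * Rs v x)%V by module.
  now apply Rs_spec. }
rewrite E at 1; rewrite (lin_add _ (Rs_lin w Hw)), (lin_scal _ (Rs_lin w Hw)); module.
Qed.

(** The closed sector of half-opening PI / 4: it contains - z for z on the contour, as well as the
    parameters e and 1/r of the real resolvents. *)
Definition sector (w : C) : Prop := w = 0 \/ (0 < fst w /\ Rabs (snd w) <= fst w).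

Lemma sector_dom w : sector w -> dom w.
Proof. intros [Hw|[Hw _]]; [now left|now right]. Qed.

Lemma Cmod_sector w : sector w -> Cmod w <= 2 * fst w.
Proof.
intros [->|[H1 H2]]; [rewrite Cmod_0; simpl; lra|].
apply Rle_trans with (1 := Cmod_le_sum w); rewrite (Rabs_pos_eq (fst w)); lra.
Qed.

(** Two bounds are added. The estimate 2 M / Re w and |w| <= 2 Re w give |w| |(w + A)^{-1}| <= 4 M;
    then (w + A)^{-1} = A^{-1} (1 - w (w + A)^{-1}) is bounded uniformly, also near w = 0. *)
Lemma Rs_sector : exists c, 1 <= c /\ forall w, sector w -> bdd (Rs w) (c / (1 + Cmod w)).
Proof.
destruct Rs_0_bdd as [b [Hb Bb]]; assert (HM := bsg_M T M HT).
exists (b * (1 + 4 * M) + 4 * M); split; [nra|]; intros w Hw x.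
assert (Hc := Cmod_ge_0 w); assert (Hx := vnorm_ge_0 x).
assert (B0 : bdd (Rs w) (b * (1 + 4 * M)) /\ Cmod w * |{Rs w x}| <= 4 * M * |{x}|).
{ assert (Hk : forall x, Cmod w * |{Rs w x}| <= 4 * M * |{x}|).
  { clear x Hx; intros x; assert (Hx := vnorm_ge_0 x); destruct Hw as [->|Hw].
    - rewrite Cmod_0, Rmult_0_l; apply Rmult_le_pos; lra.
    - assert (H1 := Rs_bdd_pos w (proj1 Hw) x).
      assert (H2 := Cmod_sector w (or_intror Hw)).
      apply Rle_trans with (2 * fst w * (2 * M / fst w * |{x}|)).
      + apply Rmult_le_compat; auto using vnorm_ge_0.
      + right; field; destruct Hw; lra. }
  split; [|apply Hk]; intros z.
  assert (E := Rs_resolvent w (RtoC 0) z (sector_dom w Hw) (or_introl eq_refl)).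
  replace (Rs w z) with (Rs (RtoC 0) (z - w * Rs w z)%V).
  - apply Rle_trans with (1 := Bb _).
    rewrite Rmult_assoc; apply Rmult_le_compat_l; [lra|].
    apply Rle_trans with (1 := norm_minus_le _ _).
    assert (H1 := norm_scal_C w (Rs w z)); specialize (Hk z); lra.
  - rewrite (lin_sub _ _ _ (Rs_lin (RtoC 0) (or_introl eq_refl))),
      (lin_scal _ (Rs_lin (RtoC 0) (or_introl eq_refl))).
    rewrite (Rs_comm (RtoC 0) w) by (now left) || now apply sector_dom.
    replace (Rs (RtoC 0) z - w * Rs w (Rs (RtoC 0) z))%V with
      (Rs (RtoC 0) z + (RtoC 0 - w)%C * Rs w (Rs (RtoC 0) z))%V by module.
    rewrite <- E; module. }
destruct B0 as [B0 B1]; specialize (B0 x).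
apply Rmult_le_reg_l with (1 + Cmod w); [lra|].
replace ((1 + Cmod w) * ((b * (1 + 4 * M) + 4 * M) / (1 + Cmod w) * |{x}|)) with
  ((b * (1 + 4 * M) + 4 * M) * |{x}|) by (field; lra).
lra.
Qed.

Lemma dom_R (e : R) : 0 <= e -> dom (RtoC e).
Proof. intros [He| <-]; [now right|now left]. Qed.

Definition commT (L : H -> H) : Prop := forall t x, 0 <= t -> T t (L x) = L (T t x).

Lemma commT_Rs w : dom w -> commT (Rs w).
Proof. intros Hw t x Ht; now apply T_Rs. Qed.

Lemma damped_comm w t L x :
  lin L -> commT L -> 0 <= t -> damped w t (L x) = L (damped w t x).
Proof. intros HL HLT Ht; unfold damped; now rewrite HLT, (lin_scal L HL). Qed.

(** * Lyapunov forms of the damped semigroup *)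

Section Damped.
Variable e : R.
Hypothesis He : 0 < e.
Notation S := (damped (RtoC e)).
Notation F := (Rs (RtoC e)).

Lemma dom_e : dom (RtoC e).
Proof. now right. Qed.

Lemma S_bsg : bsg S M.
Proof. apply (damped_bsg); simpl; lra. Qed.

Lemma S_lip x y s s' :
  A x y -> 0 <= s -> 0 <= s' ->
  |{S s' x - S s x}| <= M * M * |{y + RtoC e * x}| * Rabs (s' - s).
Proof.
intros Hxy; assert (HM := bsg_M T M HT).
assert (key : forall s s', 0 <= s -> s <= s' ->
  |{S s' x - S s x}| <= M * M * |{y + RtoC e * x}| * (s' - s)).
{ clear s s'; intros s s' Hs Hss.
  apply HA, (ngen_damped (RtoC e)) in Hxy.
  assert (E := orbit_int_ngen H S M S_bsg (s' - s) _ _ ltac:(lra) Hxy).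
  replace (S s' x - S s x)%V with (- S s (x - S (s' - s)%R x))%V.
  - rewrite norm_oppV, <- E.
    apply Rle_trans with (1 := bsg_bdd S M S_bsg s Hs _).
    rewrite !Rmult_assoc; apply Rmult_le_compat_l; [lra|].
    rewrite <- Rmult_assoc; unfold orbit_int.
    replace (s' - s) with (s' - s - 0) at 2 by ring.
    apply RI_norm_const; [lra|apply (orbit_cont H S M S_bsg)|].
    intros u _; apply (bsg_bdd S M S_bsg), Rmax_l.
  - rewrite (lin_sub _ _ _ (bsg_lin S M S_bsg s Hs)).
    rewrite <- (bsg_plus S M S_bsg) by lra.
    replace (s + (s' - s)) with s' by ring; module. }
intros Hs Hs'; destruct (Rle_dec s s') as [Hle|Hle].
- rewrite Rabs_pos_eq by lra; now apply key.
- rewrite norm_minus_sym, Rabs_minus_sym, Rabs_pos_eq by lra; apply key; lra.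
Qed.

(** The orbit of F z has derivative - S(s) z, and the Lipschitz bound on the orbit of z controls the
    remainder. The factor M serves s <= s'; exchanging the base point when s' < s adds the 1. *)
Lemma S_tayl z L s s' :
  0 <= L -> (forall s s', 0 <= s -> 0 <= s' -> |{S s' z - S s z}| <= L * Rabs (s' - s)) ->
  0 <= s -> 0 <= s' ->
  |{S s' (F z) - S s (F z) + RtoC (s' - s) * S s z}| <= (M + 1) * L * (s' - s) ^ 2.
Proof.
intros HL Hz; assert (HM := bsg_M T M HT).
assert (key : forall s s', 0 <= s -> s <= s' ->
  |{S s' (F z) - S s (F z) + RtoC (s' - s) * S s z}| <= M * L * (s' - s) ^ 2).
{ clear s s'; intros s s' Hs Hss.
  assert (Hxy := Rs_spec (RtoC e) z dom_e).
  apply HA, (ngen_damped (RtoC e)) in Hxy.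
  replace (z - RtoC e * F z + RtoC e * F z)%V with z in Hxy by module.
  set (h := s' - s) in *.
  assert (Hh : 0 <= h) by (unfold h; lra).
  assert (E := orbit_int_ngen H S M S_bsg h _ _ Hh Hxy).
  assert (LS := bsg_lin S M S_bsg s Hs).
  replace (S s' (F z) - S s (F z) + RtoC h * S s z)%V with
    (S s (RtoC h * z - orbit_int S h z))%V.
  - apply Rle_trans with (1 := bsg_bdd S M S_bsg s Hs _).
    rewrite !Rmult_assoc; apply Rmult_le_compat_l; [lra|].
    rewrite norm_minus_sym.
    replace (L * h ^ 2) with (L * h * (h - 0)) by ring.
    unfold orbit_int.
    replace (RtoC h * z)%V with (RtoC (h - 0) * orbit S z 0)%V.
    + apply RI_quad; [exact Hh|apply (orbit_cont H S M S_bsg)|].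
      intros u Hu; rewrite !orbit_eq by lra.
      apply Rle_trans with (1 := Hz 0 u ltac:(lra) ltac:(lra)).
      apply Rmult_le_compat_l; [exact HL|]; rewrite Rabs_pos_eq; lra.
    + rewrite orbit_eq, (bsg_0 S M S_bsg), Rminus_0_r by lra; reflexivity.
  - rewrite E, !(lin_sub _ _ _ LS), (lin_scal _ LS), <- (bsg_plus S M S_bsg) by lra.
    unfold h; replace (s + (s' - s)) with s' by ring; module. }
intros Hs Hs'.
assert (Hsq : 0 <= L * (s' - s) ^ 2) by (apply Rmult_le_pos; [exact HL|apply pow2_ge_0]).
destruct (Rle_dec s s') as [Hle|Hle].
- specialize (key s s' Hs Hle); lra.
- assert (K1 := key s' s Hs' ltac:(lra)); assert (K2 := Hz s s' Hs Hs').
  replace (S s' (F z) - S s (F z) + RtoC (s' - s) * S s z)%V with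
   (- (S s (F z) - S s' (F z) + RtoC (s - s') * S s' z) +
    RtoC (s - s') * (S s' z - S s z))%V by module.
  apply Rle_trans with (1 := norm_tri _ _).
  rewrite norm_oppV.
  assert (K3 := norm_scal_R (s - s') (S s' z - S s z)%V).
  rewrite Rabs_left in K2 by lra; rewrite Rabs_pos_eq in K3 by lra.
  assert ((s - s') * |{S s' z - S s z}| <= (s - s') * (L * - (s' - s)))
    by (apply Rmult_le_compat_l; lra).
  nra.
Qed.

(** K maps into the domain of A with A K bounded, so that s |-> S(s) K is Lipschitz in operator
    norm. Strong continuity would not pass to the adjoints. *)
Lemma damped_evolution K (k L N : R) (q : R -> R) :
  lin K -> commT K -> 0 <= k -> bdd K k ->
  (forall x, exists y, A (K x) y /\ |{y}| <= L * |{x}|) -> 0 <= L ->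
  0 <= N -> M * exp (- (N * e)) <= / 2 ->
  (forall s, 0 <= s <= N -> 0 <= q s /\ bdd (fun x => S s (K x)) (q s)) ->
  exists C, evolution (fun s x => S s (K x)) F (S N) N C q.
Proof.
intros HK HKT Hk Kb KL HL HN HNe Hq.
assert (HM := bsg_M T M HT).
set (L' := M * M * (L + e * k)).
assert (HMM : 0 <= M * M) by nra.
assert (Hek : 0 <= L + e * k) by nra.
assert (HL' : 0 <= L') by now apply Rmult_le_pos.
assert (lip : forall x s s', 0 <= s -> 0 <= s' ->
   |{S s' (K x) - S s (K x)}| <= L' * |{x}| * Rabs (s' - s)).
{ intros x s s' Hs Hs'; destruct (KL x) as [y [Hy1 Hy2]].
  apply Rle_trans with (1 := S_lip _ _ s s' Hy1 Hs Hs').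
  apply Rmult_le_compat_r; [apply Rabs_pos|].
  unfold L'; rewrite (Rmult_assoc (M * M)); apply Rmult_le_compat_l; [exact HMM|].
  apply Rle_trans with (1 := norm_tri _ _).
  assert (H1 := norm_scal_R e (K x)); rewrite Rabs_pos_eq in H1 by lra.
  specialize (Kb x); assert (e * |{K x}| <= e * (k * |{x}|)) by (apply Rmult_le_compat_l; lra).
  lra. }
assert (HC1 : M * k <= M * k + (M + 1) * L') by nra.
assert (HC2 : L' <= M * k + (M + 1) * L') by nra.
assert (HC3 : (M + 1) * L' <= M * k + (M + 1) * L') by nra.
assert (HFl := Rs_lin (RtoC e) dom_e).
exists (M * k + (M + 1) * L'); split; auto.
- nra.
- intros s [Hs _]; apply lin_rlin, lin_comp; [now apply (bsg_lin S M S_bsg)|exact HK].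
- now apply lin_rlin.
- now apply lin_rlin, (bsg_lin S M S_bsg).
- intros s [Hs _]; apply bdd_ge with (M * k); [exact HC1|].
  apply (bdd_comp (S s) K); [lra|now apply (bsg_bdd S M S_bsg)|exact Kb].
- intros s s' x [Hs _] [Hs' _]; apply Rle_trans with (1 := lip x s s' Hs Hs').
  assert (Hx := vnorm_ge_0 x); assert (Ha := Rabs_pos (s' - s)).
  replace (L' * |{x}| * Rabs (s' - s)) with (L' * (Rabs (s' - s) * |{x}|)) by ring.
  rewrite Rmult_assoc; apply Rmult_le_compat_r; [nra|exact HC2].
- intros s s' x [Hs _] [Hs' _].
  assert (Hx := vnorm_ge_0 x).
  rewrite (Rs_comm_gen (RtoC e) K x dom_e HK HKT).
  apply Rle_trans with ((M + 1) * (L' * |{x}|) * (s' - s) ^ 2).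
  + apply S_tayl; [now apply Rmult_le_pos| |exact Hs|exact Hs'].
    intros a b Ha Hb; now apply lip.
  + replace ((M + 1) * (L' * |{x}|) * (s' - s) ^ 2) with
      ((M + 1) * L' * ((s' - s) ^ 2 * |{x}|)) by ring.
    rewrite (Rmult_assoc _ ((s' - s) ^ 2)); apply Rmult_le_compat_r; [|exact HC3].
    apply Rmult_le_pos; [apply pow2_ge_0|exact Hx].
- intros s x [Hs _]; rewrite (Rs_comm_gen (RtoC e) K x dom_e HK HKT).
  apply damped_comm; [exact HFl|apply commT_Rs, dom_e|exact Hs].
- intros x; now rewrite (bsg_0 S M S_bsg).
- intros x; rewrite (bsg_0 S M S_bsg); now apply damped_comm.
- intros x; apply Rle_trans with (1 := damped_norm (RtoC e) N x HN).
  assert (Hx := vnorm_ge_0 x); simpl fst; nra.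
Qed.

(** The adjoint evolution has the same norm bound [q], so both forms have size the integral of q^2;
    S(0) = 1 reduces U_0 to K. *)
Lemma lyap_pair K (k L N Q : R) (q : R -> R) :
  lin K -> commT K -> 0 <= k -> bdd K k ->
  (forall x, exists y, A (K x) y /\ |{y}| <= L * |{x}|) -> 0 <= L ->
  0 <= N -> M * exp (- (N * e)) <= / 2 ->
  (forall s, 0 <= s <= N -> 0 <= q s /\ bdd (fun x => S s (K x)) (q s)) ->
  is_RInt (fun s => q s ^ 2) 0 N Q ->
  (exists p B, lyap H p F (fun x => K (F x)) B Q) /\
  (exists p B, lyap H p (adj F) (fun x => adj K (adj F x)) B Q).
Proof.
intros HK HKT Hk Kb KL HL HN HNe Hq HQ.
destruct (damped_evolution K k L N q HK HKT Hk Kb KL HL HN HNe Hq) as [C HE].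
assert (H0 : forall x, S 0 (K x) = K x) by (intros x; apply (bsg_0 S M S_bsg)).
split.
- destruct (lyap_of_evolution _ _ _ _ _ _ _ _ HE HQ) as [p [B [l1 l2 l3 l4 l5]]].
  exists p, B; split; try assumption.
  intros x; rewrite <- H0; apply l5.
- destruct (lyap_of_evolution _ _ _ _ _ _ _ _ (evolution_adj _ _ _ _ _ _ _ HE) HQ)
    as [p [B [l1 l2 l3 l4 l5]]].
  exists p, B; split; try assumption.
  intros x; rewrite (adj_ext K (fun x => S 0 (K x))); [apply l5|now apply lin_rlin|].
  intros z; now rewrite H0.
Qed.

End Damped.

(* [E_a(t)] and [E_b(t)] are compared along [E_b(t - s) E_a(s)]; the derivative
   pairs the two Lyapunov dissipations. *)
Lemma opexp_diff_le K (a b QQ t : R) x p1 B1 Q1 p2 B2 Q2 :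
  0 < b -> b <= a -> lin K -> commT K -> 0 <= t ->
  lyap H p1 (Rs a) (fun x => K (Rs a x)) B1 Q1 ->
  lyap H p2 (adj (Rs b)) (fun x => adj K (adj (Rs b) x)) B2 Q2 ->
  0 <= QQ -> Q1 <= QQ -> Q2 <= QQ ->
  |{K (K (opexp (Rs a) t x - opexp (Rs b) t x))}| <= 2 * ((a - b) * QQ) * |{x}|.
Proof.
intros Hb Hab HK HKT Ht L1 L2 HQ HQ1 HQ2.
assert (Da : dom (RtoC a)) by (right; simpl; lra).
assert (Db : dom (RtoC b)) by (right; simpl; lra).
assert (Fa := Rs_lin a Da); assert (Fb := Rs_lin b Db).
assert (Kr := lin_rlin H K HK); assert (Fbr := lin_rlin H _ Fb).
assert (Er : forall s, rlin (opexp (Rs b) s)) by (intros s; now apply lin_rlin, opexp_lin).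
apply norm_of_form.
- apply Rmult_le_pos; lra.
- intros r w.
  destruct (opexp_taylop H (Rs a) 0 t Fa) as [C1 T1].
  apply (tayl_of_op H) with (x := (RtoC r * x)%V) in T1.
  destruct (adj_opexp_tayl (Rs b) t w Fb) as [C2 T2].
  set (y := fun s => opexp (Rs a) s (RtoC r * x)%V) in *.
  set (z := fun s => adj (opexp (Rs b) (t - s)) w) in *.
  assert (KFb : forall v, K (Rs b v) = Rs b (K v)) by (intros v; now apply Rs_comm_gen).
  assert (KFa : forall v, K (Rs a v) = Rs a (K v)) by (intros v; now apply Rs_comm_gen).
  assert (Kb : forall v v', rin (Rs b (K (K v))) v' = rin (K v) (adj K (adj (Rs b) v'))).
  { intros v v'; now rewrite <- !adj_spec by assumption. }
  destruct (rin_tayl (fun v => K (K v)) y _ z _ 0 t _ _ (lin_comp K K HK HK) T1 T2)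
    as [C3 HC3].
  assert (HG := two_sided_energy H p1 p2 _ _ _ _ B1 B2 Q1 Q2 y z
    (fun s => rin (K (K (y s))) (z s)) _ C2 t (a - b) Ht ltac:(lra) L1 L2 T1 T2).
  cbn beta in HG.
  assert (Hy0 : y 0 = (RtoC r * x)%V) by (unfold y; now apply opexp_0).
  assert (HX : rin (K (K (y t))) (z t) - rin (K (K (y 0))) (z 0) <=
    (a - b) * (Q1 * |{y 0}| ^ 2 + Q2 * |{z t}| ^ 2)).
  { apply HG; exists C3; intros u v Hu Huv Hv.
    apply Rle_trans with (1 := HC3 u v ltac:(lra) ltac:(lra)); cbn beta.
    right; f_equal; f_equal.
    change (opexp (Rs a) u (RtoC r * x)%V) with (y u).
    rewrite <- (adj_spec H (Rs b)), <- Kb by assumption.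
    rewrite <- rin_add_l, <- rin_scal_l; f_equal.
    rewrite <- !KFb, <- (lin_scal K HK), <- (lin_scal K HK), <- !(lin_add K HK).
    f_equal; f_equal.
    (* F_b - F_a = (a - b) F_b F_a: this gives the factor a - b and leaves one resolvent for each
       side of the pairing, F_a on y and the adjoint of F_b on z, exactly the dissipated
       quantities. *)
    assert (E := Rs_resolvent (RtoC b) (RtoC a) (y u) Db Da).
    rewrite RtoC_minus, <- E; module. }
  assert (Hzt : z t = w).
  { unfold z; rewrite Rminus_diag; apply rin_ext; intros v.
    now rewrite <- adj_spec, opexp_0. }
  assert (Hz0 : rin (K (K (y 0))) (z 0) = r * rin (K (K (opexp (Rs b) t x))) w).
  { unfold z; rewrite Rminus_0_r, <- adj_spec, Hy0 by apply Er.
    rewrite !(lin_scal K HK), (lin_scal _ (opexp_lin H _ t Fb)), rin_scal_l.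
    rewrite <- !(opexp_comm H (Rs b) K) by (assumption || (intros v; symmetry; apply KFb)).
    reflexivity. }
  assert (Hyt : rin (K (K (y t))) (z t) = r * rin (K (K (opexp (Rs a) t x))) w).
  { rewrite Hzt; unfold y; rewrite (lin_scal _ (opexp_lin H _ t Fa)).
    now rewrite !(lin_scal K HK), rin_scal_l. }
  rewrite Hyt, Hz0, Hy0, Hzt, norm_scal_R_eq in HX.
  rewrite !(lin_sub K _ _ HK), rin_sub_l.
  rewrite Rpow_mult_distr, pow2_abs in HX.
  assert (0 <= |{w}| ^ 2) by apply pow2_ge_0.
  assert (0 <= r ^ 2 * |{x}| ^ 2) by (apply Rmult_le_pos; apply pow2_ge_0).
  assert (Q1 * (r ^ 2 * |{x}| ^ 2) <= QQ * (r ^ 2 * |{x}| ^ 2)) by now apply Rmult_le_compat_r.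
  assert (Q2 * |{w}| ^ 2 <= QQ * |{w}| ^ 2) by now apply Rmult_le_compat_r.
  assert ((a - b) * (Q1 * (r ^ 2 * |{x}| ^ 2) + Q2 * |{w}| ^ 2) <=
    (a - b) * (QQ * (r ^ 2 * |{x}| ^ 2) + QQ * |{w}| ^ 2))
    by (apply Rmult_le_compat_l; lra).
  lra.
Qed.

(** The case a = b of the same pairing. All the operators commute, so <K F y(s), K' F' z(s)>, with
    primes for adjoints, does not depend on s; it equals r g, and the energy bound applied to Gam(s)
    = s r g yields the factor t. *)
Lemma opexp_decay_le K (a QQ t : R) x p1 B1 p2 B2 :
  0 < a -> lin K -> commT K -> 0 <= t -> 0 <= QQ ->
  lyap H p1 (Rs a) (fun x => K (Rs a x)) B1 QQ ->
  lyap H p2 (adj (Rs a)) (fun x => adj K (adj (Rs a) x)) B2 QQ ->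
  t * |{K (K (Rs a (Rs a (opexp (Rs a) t x))))}| <= 2 * QQ * |{x}|.
Proof.
intros Ha HK HKT Ht HQ L1 L2.
assert (Da : dom (RtoC a)) by (right; simpl; lra).
assert (Fa := Rs_lin a Da).
assert (Kr := lin_rlin H K HK); assert (Far := lin_rlin H _ Fa).
assert (Er : forall s, rlin (opexp (Rs a) s)) by (intros s; now apply lin_rlin, opexp_lin).
rewrite <- (Rabs_pos_eq t) at 1 by exact Ht.
rewrite <- norm_scal_R_eq.
apply norm_of_form; [exact HQ|]; intros r w.
destruct (opexp_taylop H (Rs a) 0 t Fa) as [C1 T1].
apply (tayl_of_op H) with (x := (RtoC r * x)%V) in T1.
destruct (adj_opexp_tayl (Rs a) t w Fa) as [C2 T2].
set (y := fun s => opexp (Rs a) s (RtoC r * x)%V) in *.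
set (z := fun s => adj (opexp (Rs a) (t - s)) w) in *.
assert (KFa : forall v, K (Rs a v) = Rs a (K v)) by (intros v; now apply Rs_comm_gen).
set (g := rin (K (K (Rs a (Rs a (opexp (Rs a) t x))))) w).
assert (HG := two_sided_energy H p1 p2 _ _ _ _ B1 B2 QQ QQ y z
    (fun s => s * (r * g)) _ C2 t 1 Ht ltac:(lra) L1 L2 T1 T2).
cbn beta in HG.
assert (Hy0 : y 0 = (RtoC r * x)%V) by (unfold y; now apply opexp_0).
assert (Hzt : z t = w).
{ unfold z; rewrite Rminus_diag; apply rin_ext; intros v.
  now rewrite <- adj_spec, opexp_0. }
rewrite Hy0, Hzt, norm_scal_R_eq, Rpow_mult_distr, pow2_abs, Rmult_0_l in HG.
rewrite rin_scal_l; fold g.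
replace (r * (t * g)) with (t * (r * g) - 0) by ring.
replace (QQ * (r ^ 2 * |{x}| ^ 2 + |{w}| ^ 2)) with
  (1 * (QQ * (r ^ 2 * |{x}| ^ 2) + QQ * |{w}| ^ 2)) by ring.
apply HG; exists 0; intros u v Hu Huv Hv.
right; rewrite Rmult_0_l, Rplus_0_r, Rmult_1_l, <- Rmult_minus_distr_r; f_equal.
unfold z, y, g.
rewrite <- !adj_spec by auto.
rewrite <- rin_scal_l, <- !(lin_scal K HK), <- !(lin_scal _ Fa),
  <- (lin_scal _ (opexp_lin H _ t Fa)); f_equal.
assert (EF : forall s q, Rs a (opexp (Rs a) s q) = opexp (Rs a) s (Rs a q))
  by (intros s q; apply opexp_comm; auto).
assert (EK : forall s q, K (opexp (Rs a) s q) = opexp (Rs a) s (K q))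
  by (intros s q; apply opexp_comm; auto).
repeat rewrite ?EF, ?EK, ?KFa.
rewrite <- opexp_plus by exact Fa.
now replace (t - u + u) with t by ring.
Qed.

Variable c0 : R.
Hypothesis Hc0 : 1 <= c0.
Hypothesis Rs_sec : forall w, sector w -> bdd (Rs w) (c0 / (1 + Cmod w)).

(** * Estimates uniform in the resolvent parameter *)

Section UniformEstimates.

(* [(1 + r A)^{-1}] *)
Definition Kr (r : R) (x : H) : H := (RtoC (/ r) * Rs (RtoC (/ r)) x)%V.
Notation B := (Rs (RtoC 0)).

Lemma sector_R a : 0 <= a -> sector (RtoC a).
Proof.
intros [Ha| <-]; [right|now left]; simpl; rewrite Rabs_R0; lra.
Qed.

Lemma Rs_R a : 0 <= a -> bdd (Rs (RtoC a)) (c0 / (1 + a)).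
Proof.
intros Ha; rewrite <- (Rabs_pos_eq a Ha) at 2; rewrite <- Cmod_R.
now apply Rs_sec, sector_R.
Qed.

Lemma Rs_R' a : 0 <= a -> bdd (Rs (RtoC a)) c0.
Proof.
intros Ha; apply bdd_ge with (2 := Rs_R a Ha).
apply Rle_div_l; [lra|]; nra.
Qed.

Lemma Kr_lin r : 0 < r -> lin (Kr r).
Proof.
intros Hr; apply (lin_comp (fun x => RtoC (/ r) * x)%V); [apply lin_vscal|].
apply Rs_lin, dom_R; left; now apply Rinv_0_lt_compat.
Qed.

Lemma Kr_dom r : 0 < r -> dom (RtoC (/ r)).
Proof. intros Hr; apply dom_R; left; now apply Rinv_0_lt_compat. Qed.

Lemma Kr_bdd_div r : 0 < r -> bdd (Kr r) (c0 / (1 + r)).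
Proof.
intros Hr x; unfold Kr; apply Rle_trans with (1 := norm_scal_R _ _).
assert (Hi : 0 < / r) by now apply Rinv_0_lt_compat.
rewrite Rabs_pos_eq by lra.
apply Rle_trans with (/ r * (c0 / (1 + / r) * |{x}|)).
- apply Rmult_le_compat_l; [lra|apply Rs_R; lra].
- right; field; lra.
Qed.

Lemma Kr_bdd r : 0 < r -> bdd (Kr r) c0.
Proof.
intros Hr; apply bdd_ge with (2 := Kr_bdd_div r Hr).
apply Rle_div_l; [lra|]; nra.
Qed.

Lemma Kr_commT r : 0 < r -> commT (Kr r).
Proof.
intros Hr t x Ht; unfold Kr.
rewrite (lin_scal _ (bsg_lin T M HT t Ht)); f_equal.
now apply (T_Rs); [apply Kr_dom|].
Qed.

Lemma Kr_iter_commT r n : 0 < r -> commT (Nat.iter n (Kr r)).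
Proof.
intros Hr t x Ht; induction n as [|n IH]; simpl; [reflexivity|].
now rewrite (Kr_commT r Hr), IH.
Qed.

Lemma Kr_A r x : 0 < r -> exists y, A (Kr r x) y /\ |{y}| <= / r * (1 + c0) * |{x}|.
Proof.
intros Hr; exists (RtoC (/ r) * (x - Kr r x))%V; split.
- unfold Kr at 1; apply (A_scal); unfold Kr; now apply Rs_spec, Kr_dom.
- apply Rle_trans with (1 := norm_scal_R _ _).
  assert (Hi : 0 < / r) by now apply Rinv_0_lt_compat.
  rewrite Rabs_pos_eq, Rmult_assoc by lra; apply Rmult_le_compat_l; [lra|].
  apply Rle_trans with (1 := norm_minus_le _ _); assert (Hk := Kr_bdd r Hr x); lra.
Qed.

Lemma Kr_iter_A r n : 0 < r ->
  forall x, exists y, A (Nat.iter (S n) (Kr r) x) y /\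
    |{y}| <= / r * (1 + c0) * c0 ^ n * |{x}|.
Proof.
intros Hr x; destruct (Kr_A r (Nat.iter n (Kr r) x) Hr) as [y [Hy1 Hy2]].
exists y; split; [exact Hy1|].
apply Rle_trans with (1 := Hy2).
assert (Hi : 0 < / r) by now apply Rinv_0_lt_compat.
rewrite (Rmult_assoc (/ r * (1 + c0))); apply Rmult_le_compat_l; [nra|].
apply (bdd_iter (Kr r) c0 n); [lra|now apply Kr_bdd].
Qed.

(* [B (1 - K_r) = r K_r] *)
Lemma Kr_B r x : 0 < r -> Kr r x = (RtoC (/ r) * (B x - Kr r (B x)))%V.
Proof.
intros Hr; assert (E := Rs_resolvent (RtoC (/ r)) (RtoC 0) x (Kr_dom r Hr) (or_introl eq_refl)).
unfold Kr; f_equal.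
replace (RtoC (/ r) * Rs (RtoC (/ r)) (B x))%V with
  (- ((RtoC 0 - RtoC (/ r))%C * Rs (RtoC (/ r)) (B x)))%V by module.
rewrite <- E; module.
Qed.

(** With e = 1/t, B = F_e + e F_e B, and the second summand has norm at most c0^2 / t. Its
    exponential over time t is bounded by e^{c0^2}, so B may be replaced by F_{1/t} at the cost of a
    constant. *)
Lemma opexp_B_split t :
  0 < t -> forall x, exists z, opexp B t x = opexp (Rs (RtoC (/ t))) t z /\
    |{z}| <= exp (c0 * c0) * |{x}|.
Proof.
intros Ht x; assert (Hi : 0 < / t) by now apply Rinv_0_lt_compat.
assert (De : dom (RtoC (/ t))) by now right.
assert (D0 : dom (RtoC 0)) by now left.
set (D := fun y => (RtoC (/ t) * Rs (RtoC (/ t)) (B y))%V).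
assert (LD : lin D).
{ apply (lin_comp (fun y => RtoC (/ t) * y)%V); [apply lin_vscal|].
  apply lin_comp; now apply Rs_lin. }
assert (BD : bdd D (/ t * (c0 * c0))).
{ intros y; apply Rle_trans with (1 := norm_scal_R _ _).
  rewrite Rabs_pos_eq, Rmult_assoc by lra; apply Rmult_le_compat_l; [lra|].
  apply (bdd_comp (Rs (RtoC (/ t))) B); [lra| |]; apply Rs_R'; lra. }
exists (opexp D t x); split.
- rewrite <- opexp_add_gen; [|now apply Rs_lin|exact LD| |lra].
  + apply opexp_ext; [now apply Rs_lin|]; intros y.
    assert (E := Rs_resolvent (RtoC (/ t)) (RtoC 0) y De D0).
    unfold D; replace (RtoC (/ t) * Rs (RtoC (/ t)) (B y))%V with
      (- ((RtoC 0 - RtoC (/ t))%C * Rs (RtoC (/ t)) (B y)))%V by module.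
    rewrite <- E; module.
  + intros y; unfold D; rewrite (lin_scal _ (Rs_lin _ De)); do 2 f_equal.
    now apply Rs_comm.
- assert (Hk : 0 <= / t * (c0 * c0)) by (apply Rmult_le_pos; [lra|apply Rmult_le_pos; lra]).
  assert (Hb := opexp_bdd H D _ t LD Hk BD x).
  rewrite Rabs_pos_eq in Hb by lra.
  replace (t * (/ t * (c0 * c0))) with (c0 * c0) in Hb by (field; lra); exact Hb.
Qed.

Lemma damped_norm_R e s x : 0 < e -> 0 <= s ->
  |{damped (RtoC e) s x}| <= exp (- (s * e)) * |{T s x}|.
Proof.
intros He Hs; unfold damped; apply Rle_trans with (1 := norm_scal_C _ _).
rewrite Cmod_damp; simpl; lra.
Qed.

(** Only boundedness of T is used: q(s) = M c0 e^{-se}, whose square integrates to at most (M c0)^2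
    / (2 e), uniformly in r and in the horizon. *)
Lemma lyap_log e r : 0 < e -> 0 < r ->
  exists Q, 0 <= Q <= (M * c0) ^ 2 / (2 * e) /\
  (exists p b, lyap H p (Rs (RtoC e)) (fun x => Kr r (Rs (RtoC e) x)) b Q) /\
  (exists p b, lyap H p (adj (Rs (RtoC e)))
     (fun x => adj (Kr r) (adj (Rs (RtoC e)) x)) b Q).
Proof.
intros He Hr; assert (HM := bsg_M T M HT).
destruct (exp_horizon e He) as [N [HN HNe]].
exists ((M * c0) ^ 2 / (2 * e) * (1 - exp (- (N * (2 * e))))).
assert (Hp := exp_pos (- (N * (2 * e)))).
assert (Hq : exp (- (N * (2 * e))) <= 1) by (apply exp_neg_le_1; nra).
assert (Hm : 0 <= (M * c0) ^ 2 / (2 * e)).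
{ apply Rdiv_le_0_compat; [apply pow2_ge_0|lra]. }
split; [split; [apply Rmult_le_pos; lra|]|].
{ rewrite <- Rmult_1_r; apply Rmult_le_compat_l; lra. }
apply (lyap_pair e He (Kr r) c0 (/ r * (1 + c0)) N _
  (fun s => exp (- (s * e)) * (M * c0))); try assumption.
- now apply Kr_lin.
- now apply Kr_commT.
- lra.
- now apply Kr_bdd.
- intros x; now apply Kr_A.
- assert (Hi : 0 < / r) by (now apply Rinv_0_lt_compat); nra.
- intros s [Hs _]; assert (He' := exp_pos (- (s * e))).
  split; [apply Rmult_le_pos; nra|]; intros x.
  apply Rle_trans with (1 := damped_norm_R e s (Kr r x) He Hs).
  rewrite Rmult_assoc; apply Rmult_le_compat_l; [lra|].
  apply (bdd_comp (T s) (Kr r)); [lra|now apply (bsg_bdd T M HT)|now apply Kr_bdd].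
- apply (is_RInt_ext (fun s => exp (- (s * (2 * e))) * (M * c0) ^ 2)).
  + intros s _.
    replace (exp (- (s * (2 * e)))) with (exp (- (s * e)) * exp (- (s * e)))
      by (rewrite <- exp_plus; f_equal; ring).
    match goal with |- @eq _ ?a ?b => change (@eq R a b) end; ring.
  + apply is_RInt_exp_neg; lra.
Qed.

(** Passing from b to 2 b costs 2 (2 b - b) Q with Q = (M c0)^2 / (2 b), that is (M c0)^2 at every
    scale. Equal costs per doubling are the source of the logarithm. *)
Lemma dyadic_bound t r (n : nat) x : 0 < t -> 0 < r ->
  |{Kr r (Kr r (opexp (Rs (RtoC (/ t))) t x))}| <=
  |{Kr r (Kr r (opexp (Rs (RtoC (2 ^ n / t)%R)) t x))}| + INR n * (M * c0) ^ 2 * |{x}|.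
Proof.
intros Ht Hr; assert (Hi : 0 < / t) by now apply Rinv_0_lt_compat.
induction n as [|n IH].
- simpl INR; simpl pow; unfold Rdiv; rewrite Rmult_1_l; lra.
- apply Rle_trans with (1 := IH).
  set (b := 2 ^ n / t).
  assert (Hb : 0 < b) by (apply Rdiv_lt_0_compat; [apply pow_lt|]; lra).
  replace (2 ^ S n / t) with (2 * b) by (unfold b; simpl; field; lra).
  destruct (lyap_log (2 * b) r ltac:(lra) Hr) as [Q1 [HQ1 [[p1 [b1 L1]] _]]].
  destruct (lyap_log b r Hb Hr) as [Q2 [HQ2 [_ [p2 [b2 L2]]]]].
  assert (LK := Kr_lin r Hr).
  set (QQ := (M * c0) ^ 2 / (2 * b)) in *.
  assert (HQ : Q1 <= QQ).
  { apply Rle_trans with (1 := proj2 HQ1); unfold QQ.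
    assert (0 <= (M * c0) ^ 2) by apply pow2_ge_0.
    apply Rmult_le_compat_l; [assumption|]; apply Rinv_le_contravar; lra. }
  assert (HD := opexp_diff_le (Kr r) (2 * b) b QQ t x
    p1 b1 Q1 p2 b2 Q2 Hb ltac:(lra) LK (Kr_commT r Hr) (Rlt_le _ _ Ht) L1 L2
    ltac:(lra) HQ (proj2 HQ2)).
  replace (2 * ((2 * b - b) * QQ)) with ((M * c0) ^ 2) in HD by (unfold QQ; field; lra).
  rewrite !(lin_sub _ _ _ LK), norm_minus_sym in HD.
  rewrite S_INR.
  assert (Hn := norm_le_minus (Kr r (Kr r (opexp (Rs b) t x)))
    (Kr r (Kr r (opexp (Rs (RtoC (2 * b))) t x)))).
  lra.
Qed.

(** Doublings needed to go from 1/t to at least t; the 4 comes from ln 2 > 1/2. *)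
Lemma log_count t : 1 <= t -> exists n, t ^ 2 <= 2 ^ n /\ INR n <= 4 * ln t + 1.
Proof.
intros Ht.
assert (Hl : 0 <= ln t) by (rewrite <- ln_1; apply Rcomplements.ln_le; lra).
assert (H2 := ln_lt_2).
destruct (nfloor_ex (2 * ln t / ln 2)) as [n [Hn1 Hn2]].
{ apply Rdiv_le_0_compat; lra. }
exists (S n); split.
- rewrite <- (exp_ln (t ^ 2)) by (apply pow_lt; lra).
  rewrite <- (exp_ln (2 ^ S n)) by (apply pow_lt; lra).
  rewrite !ln_pow by lra.
  apply Rlt_div_l in Hn2; [|lra].
  assert (Hlt : INR 2 * ln t < INR (S n) * ln 2) by (change (INR 2) with (1 + 1); rewrite S_INR; lra).
  left; now apply exp_increasing.
- rewrite S_INR; apply Rplus_le_compat_r, Rle_trans with (1 := Hn1).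
  apply Rle_div_l; [lra|]; nra.
Qed.

(** At the top scale a >= t the exponent satisfies t |F_a| <= t c0 / (1 + a) <= c0, so that term is
    bounded outright; the doublings below it contribute the logarithm. *)
Lemma est_log : exists C, 0 < C /\ forall t r x, 1 <= t -> 0 < r ->
  |{Kr r (Kr r (opexp B t x))}| <= C * (1 + ln t) * |{x}|.
Proof.
assert (HM := bsg_M T M HT).
set (C1 := c0 * c0 * exp c0 + 4 * (M * c0) ^ 2).
assert (He : 0 < exp c0) by apply exp_pos.
assert (H4 : 0 < exp (c0 * c0)) by apply exp_pos.
assert (H5 : 0 <= (M * c0) ^ 2) by apply pow2_ge_0.
assert (H6 : 0 < c0 * c0 * exp c0) by (apply Rmult_lt_0_compat; nra).
assert (HC1 : 0 < C1) by (unfold C1; lra).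
exists (C1 * exp (c0 * c0)); split; [now apply Rmult_lt_0_compat|].
intros t r x Ht Hr.
assert (Hl : 0 <= ln t) by (rewrite <- ln_1; apply Rcomplements.ln_le; lra).
destruct (opexp_B_split t ltac:(lra) x) as [z [-> Hz]].
destruct (log_count t Ht) as [n [Hn1 Hn2]].
apply Rle_trans with (1 := dyadic_bound t r n z ltac:(lra) Hr).
set (a := 2 ^ n / t).
assert (Ha : t <= a) by (unfold a; apply Rle_div_r; [lra|]; lra).
assert (Hzz := vnorm_ge_0 z).
assert (Htop : |{Kr r (Kr r (opexp (Rs a) t z))}| <= c0 * c0 * exp c0 * |{z}|).
{ rewrite Rmult_assoc.
  apply Rle_trans with (c0 * c0 * |{opexp (Rs a) t z}|).
  - apply (bdd_comp (Kr r) (Kr r)); [lra| |]; now apply Kr_bdd.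
  - apply Rmult_le_compat_l; [nra|].
    assert (Hc : 0 <= c0 / (1 + a)) by (apply Rdiv_le_0_compat; lra).
    apply Rle_trans with (1 := opexp_bdd H (Rs a) _ t
      (Rs_lin _ (dom_R a ltac:(lra))) Hc (Rs_R a ltac:(lra)) z).
    apply Rmult_le_compat_r; [exact Hzz|].
    rewrite Rabs_pos_eq by lra.
    assert (Hle : t * (c0 / (1 + a)) <= c0).
    { replace (t * (c0 / (1 + a))) with (t * c0 / (1 + a)) by (field; lra).
      apply Rle_div_l; [lra|]; nra. }
    destruct Hle as [Hlt| ->]; [left; now apply exp_increasing|lra]. }
assert (Hs : INR n * (M * c0) ^ 2 * |{z}| <= (4 * ln t + 1) * (M * c0) ^ 2 * |{z}|).
{ apply Rmult_le_compat_r; [exact Hzz|]; now apply Rmult_le_compat_r. }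
apply Rle_trans with (C1 * (1 + ln t) * |{z}|).
- apply Rle_trans with ((c0 * c0 * exp c0 + (4 * ln t + 1) * (M * c0) ^ 2) * |{z}|); [lra|].
  apply Rmult_le_compat_r; [exact Hzz|]; unfold C1; nra.
- replace (C1 * exp (c0 * c0) * (1 + ln t) * |{x}|) with
    (C1 * (1 + ln t) * (exp (c0 * c0) * |{x}|)) by ring.
  apply Rmult_le_compat_l; [nra|exact Hz].
Qed.

(** * Estimates from polynomial stability *)

Variable beta : R.
Hypothesis Hbeta : 0 < beta.
Hypothesis Hpoly : exists C t1, forall t, t1 <= t ->
  bdd (fun x => T t (Rs (RtoC 1) x)) (C * Rpower t (- (1 / beta))).

Lemma poly_all : exists C, 0 < C /\ forall t, 0 < t ->
  bdd (fun x => T t (Rs (RtoC 1) x)) (C * Rpower t (- (1 / beta))).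
Proof.
assert (HM := bsg_M T M HT).
destruct Hpoly as [C [t1 HC]].
set (t2 := Rmax 1 t1).
assert (H1 : 1 <= t2) by apply Rmax_l; assert (H2 : t1 <= t2) by apply Rmax_r.
assert (Hib : 0 < 1 / beta) by (apply Rdiv_lt_0_compat; lra).
assert (Hp2 : 0 < Rpower t2 (1 / beta)) by apply exp_pos.
(* The second summand covers t < t2, where only the bound M c0 is available. *)
exists (Rmax C 0 + M * c0 * Rpower t2 (1 / beta)); split.
- assert (0 <= Rmax C 0) by apply Rmax_r.
  assert (0 < M * c0 * Rpower t2 (1 / beta)) by (apply Rmult_lt_0_compat; nra); lra.
- intros t Ht; assert (Hp : 0 < Rpower t (- (1 / beta))) by apply exp_pos.
  assert (Hm0 : 0 <= Rmax C 0) by apply Rmax_r; assert (HmC : C <= Rmax C 0) by apply Rmax_l.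
  assert (HmM : 0 <= M * c0 * Rpower t2 (1 / beta)) by (apply Rmult_le_pos; nra).
  destruct (Rle_dec t2 t) as [Hle|Hle].
  + apply bdd_ge with (2 := HC t ltac:(lra)).
    apply Rmult_le_compat_r; lra.
  + apply bdd_ge with (M * c0).
    * apply Rle_trans with (M * c0 * Rpower t2 (1 / beta) * Rpower t (- (1 / beta))).
      -- rewrite Rmult_assoc; rewrite <- (Rmult_1_r (M * c0)) at 1.
         apply Rmult_le_compat_l; [nra|].
         rewrite Rpower_Ropp.
         apply Rmult_le_reg_r with (Rpower t (1 / beta)); [apply exp_pos|].
         rewrite Rmult_assoc, Rinv_l, Rmult_1_l, Rmult_1_r by (apply Rgt_not_eq, exp_pos).
         apply Rle_Rpower_l; lra.
      -- apply Rmult_le_compat_r; lra.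
    * apply (bdd_comp (T t) (Rs (RtoC 1))); [lra| |apply Rs_R'; lra].
      apply (bsg_bdd T M HT); lra.
Qed.

Lemma Rpower_scale t r : 0 < t -> 0 < r ->
  Rpower t (- (1 / beta)) / r = Rpower (t * Rpower r beta) (- (1 / beta)).
Proof.
intros Ht Hr; rewrite <- Rpower_mult_distr by (assumption || apply exp_pos).
rewrite Rpower_mult; replace (beta * - (1 / beta)) with (- (1)) by (field; lra).
now rewrite (Rpower_Ropp r 1), Rpower_1.
Qed.

(** The resolvent identity gives K_r = r^{-1} (1 + A)^{-1} (1 + (1 - 1/r) (1/r + A)^{-1}), whose
    last factor is at most 1 + c0 for every r. The product r^{-1} t^{-1/beta} depends on t r^beta
    alone: the time scale attached to r is r^{-beta}. *)
Lemma T_Kr : exists C, 0 < C /\ forall t r, 0 < t -> 0 < r ->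
  bdd (fun x => T t (Kr r x)) (C * Rpower (t * Rpower r beta) (- (1 / beta))).
Proof.
destruct poly_all as [C [HC Hp]].
exists (C * (1 + c0)); split; [apply Rmult_lt_0_compat; lra|].
intros t r Ht Hr x.
assert (Hi : 0 < / r) by now apply Rinv_0_lt_compat.
assert (D1 : dom (RtoC 1)) by (apply dom_R; lra).
assert (Dr := Kr_dom r Hr).
assert (L1 := Rs_lin _ D1).
set (w := RtoC (/ r)) in *.
assert (E : Kr r x = (RtoC (/ r) * Rs (RtoC 1) (x + (RtoC 1 - w)%C * Rs w x))%V).
{ unfold Kr; fold w; f_equal.
  assert (E := Rs_resolvent w (RtoC 1) x Dr D1).
  rewrite (lin_add _ L1), (lin_scal _ L1), (Rs_comm (RtoC 1) w) by assumption.
  rewrite <- E; module. }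
rewrite E, (lin_scal _ (bsg_lin T M HT t (Rlt_le _ _ Ht))).
apply Rle_trans with (1 := norm_scal_R _ _).
rewrite Rabs_pos_eq by lra.
set (y := (x + (RtoC 1 - w)%C * Rs w x)%V).
assert (Hx := vnorm_ge_0 x).
assert (Hy : |{y}| <= (1 + c0) * |{x}|).
{ apply Rle_trans with (1 := norm_tri _ _).
  assert (H1 : |{(RtoC 1 - w)%C * Rs w x}| <= c0 * |{x}|); [|lra].
  apply Rle_trans with (1 := norm_scal_C _ _).
  assert (Hw : Cmod (RtoC 1 - w) <= 1 + / r).
  { unfold w; rewrite <- RtoC_minus, Cmod_R; apply Rabs_le; lra. }
  assert (HR := Rs_R (/ r) ltac:(lra) x); fold w in HR.
  apply Rle_trans with ((1 + / r) * (c0 / (1 + / r) * |{x}|)).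
  - apply Rmult_le_compat; auto using Cmod_ge_0, vnorm_ge_0.
  - right; field; lra. }
assert (Hty := Hp t Ht y); cbn beta in Hty.
rewrite <- Rpower_scale by assumption.
assert (Hpp : 0 < Rpower t (- (1 / beta))) by apply exp_pos.
apply Rle_trans with (/ r * (C * Rpower t (- (1 / beta)) * ((1 + c0) * |{x}|))).
- apply Rmult_le_compat_l; [lra|]; apply Rle_trans with (1 := Hty).
  apply Rmult_le_compat_l; [nra|exact Hy].
- right; unfold Rdiv; ring.
Qed.

(** T(t) K^n = (T(t/n) K)^n decays like v^{-n/beta} with v = (t/n) r^beta, hence at least like 1/v
    for v >= 1 since n >= beta; for v <= 1 boundedness suffices. Decay of order 1 makes the square
    integrable in time. *)
Lemma T_Kr_iter (n : nat) : beta <= INR n -> (1 <= n)%nat ->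
  exists C, 0 < C /\ forall t r, 0 <= t -> 0 < r ->
  bdd (fun x => T t (Nat.iter n (Kr r) x)) (C / (1 + t * (Rpower r beta / INR n))).
Proof.
intros Hn1 Hn; destruct T_Kr as [C [HC HK]]; assert (HM := bsg_M T M HT).
assert (HnR : 1 <= INR n) by (now apply (le_INR 1)).
assert (Hcn : 0 < c0 ^ n) by (apply pow_lt; lra).
assert (HCn : 0 < C ^ n) by (now apply pow_lt).
exists (2 * (C ^ n + M * c0 ^ n)); split; [nra|].
intros t r Ht Hr x.
assert (Hrho : 0 < Rpower r beta) by apply exp_pos.
set (v := t * (Rpower r beta / INR n)).
assert (Hq : 0 < Rpower r beta / INR n) by (apply Rdiv_lt_0_compat; lra).
assert (Hv : 0 <= v) by (apply Rmult_le_pos; lra).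
assert (Hx := vnorm_ge_0 x).
assert (HMc : 0 < M * c0 ^ n) by (apply Rmult_lt_0_compat; lra).
destruct (Rle_dec v 1) as [Hv1|Hv1].
- apply Rle_trans with (M * c0 ^ n * |{x}|).
  + apply (bdd_comp (T t) (Nat.iter n (Kr r))); [lra|now apply (bsg_bdd T M HT)|].
    apply bdd_iter; [lra|now apply Kr_bdd].
  + apply Rmult_le_compat_r; [exact Hx|].
    set (P := M * c0 ^ n) in *.
    apply Rmult_le_reg_r with (1 + v); [lra|].
    replace (2 * (C ^ n + P) / (1 + v) * (1 + v)) with (2 * (C ^ n + P)) by (field; lra).
    assert (P * (1 + v) <= P * 2) by (apply Rmult_le_compat_l; lra); lra.
- set (c := C * Rpower v (- (1 / beta))).
  assert (Hk : forall k, |{T (INR k * (t / INR n)) (Nat.iter k (Kr r) x)}| <= c ^ k * |{x}|).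
  { assert (Htn : 0 < t / INR n).
    { apply Rdiv_lt_0_compat; [|lra]; destruct Ht as [Ht|Ht]; [exact Ht|exfalso].
      unfold v in Hv1; rewrite <- Ht, Rmult_0_l in Hv1; lra. }
    induction k as [|k IH].
    - simpl; rewrite Rmult_0_l, (bsg_0 T M HT); lra.
    - assert (Hk0 : 0 <= INR k * (t / INR n)) by (apply Rmult_le_pos; [apply pos_INR|lra]).
      rewrite S_INR, Rmult_plus_distr_r, Rmult_1_l, Rplus_comm.
      rewrite (bsg_plus T M HT) by lra; simpl Nat.iter.
      rewrite (Kr_commT r Hr) by exact Hk0.
      assert (HKt := HK (t / INR n) r Htn Hr (T (INR k * (t / INR n)) (Nat.iter k (Kr r) x))).
      cbn beta in HKt.
      replace (t / INR n * Rpower r beta) with v in HKt by (unfold v; field; lra).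
      fold c in HKt; apply Rle_trans with (1 := HKt).
      simpl pow; rewrite Rmult_assoc; apply Rmult_le_compat_l; [|exact IH].
      unfold c; apply Rmult_le_pos; [lra|apply Rlt_le, exp_pos]. }
  specialize (Hk n); replace (INR n * (t / INR n)) with t in Hk by (field; lra).
  apply Rle_trans with (1 := Hk), Rmult_le_compat_r; [exact Hx|].
  unfold c; rewrite Rpow_mult_distr.
  assert (Hpv : Rpower v (- (1 / beta)) ^ n <= / v).
  { rewrite <- Rpower_pow by apply exp_pos.
    rewrite Rpower_mult.
    replace (/ v) with (Rpower v (- (1))) by (rewrite Rpower_Ropp, Rpower_1; lra).
    apply Rle_Rpower; [lra|].
    apply Rmult_le_reg_r with beta; [exact Hbeta|].
    replace (- (1 / beta) * INR n * beta) with (- INR n) by (field; lra); lra. }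
  apply Rle_trans with (C ^ n * / v); [apply Rmult_le_compat_l; lra|].
  apply Rmult_le_reg_r with (1 + v); [lra|].
  replace (2 * (C ^ n + M * c0 ^ n) / (1 + v) * (1 + v)) with (2 * (C ^ n + M * c0 ^ n))
    by (field; lra).
  replace (C ^ n * / v * (1 + v)) with (C ^ n * (/ v + 1)) by (field; lra).
  assert (/ v <= 1) by (rewrite <- Rinv_1; apply Rinv_le_contravar; lra).
  nra.
Qed.

(** The majorant C / sqrt(1 + v^2) of C / (1 + v) is chosen because its square has an arctangent as
    primitive, bounded uniformly in the horizon. *)
Lemma is_RInt_atan C rho N : 0 < rho ->
  is_RInt (fun s => (C / sqrt (1 + (s * rho) ^ 2)) ^ 2) 0 N (C ^ 2 / rho * atan (N * rho)).
Proof.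
intros Hr.
assert (Hs : forall s, 0 < 1 + (s * rho) ^ 2)
  by (intros s; assert (0 <= (s * rho) ^ 2) by apply pow2_ge_0; lra).
apply (is_RInt_ext (fun s => C ^ 2 / (1 + (s * rho) ^ 2))).
- intros s _.
  match goal with |- @eq _ ?a ?b => change (@eq R a b) end.
  specialize (Hs s).
  unfold Rdiv; rewrite (Rpow_mult_distr C), pow_inv, pow2_sqrt by lra; reflexivity.
- replace (C ^ 2 / rho * atan (N * rho)) with
   (minus (C ^ 2 / rho * atan (N * rho)) (C ^ 2 / rho * atan (0 * rho))).
  + apply (@is_RInt_derive R_CompleteNormedModule (fun s => C ^ 2 / rho * atan (s * rho))
      (fun s => C ^ 2 / (1 + (s * rho) ^ 2))).
    * intros s _; specialize (Hs s); auto_derive; [trivial|].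
      unfold Rsqr; field; split; [simpl in Hs; rewrite Rmult_1_r in Hs; lra|lra].
    * intros s _; specialize (Hs s).
      apply (@ex_derive_continuous R_AbsRing R_NormedModule).
      auto_derive; simpl in Hs; lra.
  + rewrite Rmult_0_l, atan_0; unfold minus, plus, opp; simpl; ring.
Qed.

(** For K = K_r^n the forms have size Q <= 2 C^2 / rho with rho = r^beta / n, whatever e and N are,
    so [opexp_decay_le] bounds K^2 F^2 e^{-tF} by 2 Q / t. The 2 n factors in 2 n + 2 are K^2; the
    other two K_r supply F^2 with the gain r^{-2}. The four bounded factors left over, each at most
    1 + c0 because e <= 1, give (1 + c0)^4. *)
Lemma est_decay (n : nat) : beta <= INR n -> (1 <= n)%nat ->
  exists C, 0 < C /\ forall t r, 1 <= t -> 0 < r ->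
  bdd (fun x => Nat.iter (2 * n + 2) (Kr r) (opexp B t x)) (C / (Rpower r beta * r ^ 2 * t)).
Proof.
intros Hn1 Hn; destruct (T_Kr_iter n Hn1 Hn) as [C [HC HK]].
assert (HM := bsg_M T M HT).
assert (HnR : 1 <= INR n) by (now apply (le_INR 1)).
assert (He : 0 < exp (c0 * c0)) by apply exp_pos.
exists ((1 + c0) ^ 4 * (4 * C ^ 2 * INR n) * exp (c0 * c0)); split.
{ repeat apply Rmult_lt_0_compat; try lra; apply pow_lt; lra. }
intros t r Ht Hr x.
assert (Hrho : 0 < Rpower r beta) by apply exp_pos.
set (rho := Rpower r beta / INR n).
assert (Hq : 0 < rho) by (apply Rdiv_lt_0_compat; lra).
destruct (opexp_B_split t ltac:(lra) x) as [z [-> Hz]].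
set (e := / t); assert (He0 : 0 < e) by (apply Rinv_0_lt_compat; lra).
assert (He1 : e <= 1) by (unfold e; rewrite <- Rinv_1; apply Rinv_le_contravar; lra).
set (F := Rs (RtoC e)); set (K := Nat.iter n (Kr r)).
assert (De : dom (RtoC e)) by now right.
assert (D0 : dom (RtoC 0)) by now left.
assert (LF : lin F) by now apply Rs_lin.
assert (LKr := Kr_lin r Hr).
assert (LK : lin K) by now apply lin_iter.
assert (BK : bdd K (c0 ^ n)) by (apply bdd_iter; [lra|now apply Kr_bdd]).
destruct (exp_horizon e He0) as [N [HN HNe]].
destruct n as [|n]; [lia|].
set (L := / r * (1 + c0) * c0 ^ n).
assert (HL : 0 <= L).
{ unfold L; assert (0 < / r) by now apply Rinv_0_lt_compat.
  apply Rmult_le_pos; [nra|apply pow_le; lra]. }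
set (Q := C ^ 2 / rho * atan (N * rho)).
destruct (lyap_pair e He0 K (c0 ^ S n) L N Q
  (fun s => C / sqrt (1 + (s * rho) ^ 2)) LK (Kr_iter_commT r (S n) Hr)
  ltac:(apply pow_le; lra) BK (fun x => Kr_iter_A r n Hr x) HL HN HNe)
  as [[p1 [b1 L1]] [p2 [b2 L2]]].
{ intros s [Hs _].
  assert (Hsq : 0 < 1 + (s * rho) ^ 2) by (assert (0 <= (s * rho) ^ 2) by apply pow2_ge_0; lra).
  assert (Hsr : 0 <= s * rho) by (apply Rmult_le_pos; lra).
  assert (Hss := sqrt_lt_R0 _ Hsq).
  split; [apply Rdiv_le_0_compat; lra|]; intros y.
  apply Rle_trans with (1 := damped_norm_R e s (K y) He0 Hs).
  assert (Hes : exp (- (s * e)) <= 1) by (apply exp_neg_le_1; nra).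
  apply Rle_trans with (1 * |{T s (K y)}|).
  - apply Rmult_le_compat_r; [apply vnorm_ge_0|exact Hes].
  - rewrite Rmult_1_l; apply Rle_trans with (1 := HK s r Hs Hr y).
    apply Rmult_le_compat_r; [apply vnorm_ge_0|]; fold rho.
    apply Rmult_le_compat_l; [lra|]; apply Rinv_le_contravar; [exact Hss|].
    apply Rsqr_incr_0; [|lra|lra].
    rewrite Rsqr_sqrt by lra; unfold Rsqr; nra. }
{ now apply is_RInt_atan. }
assert (HQ : 0 <= Q <= 2 * C ^ 2 / rho).
{ assert (Hat : 0 <= atan (N * rho) <= 2).
  { split.
    - rewrite <- atan_0; assert (H0 : 0 <= N * rho) by (apply Rmult_le_pos; lra).
      destruct H0 as [H0| <-]; [left; now apply atan_increasing|lra].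
    - destruct (atan_bound (N * rho)) as [_ Hu]; assert (Hpi := PI_4); lra. }
  assert (Hc2 : 0 <= C ^ 2 / rho) by (apply Rdiv_le_0_compat; [apply pow2_ge_0|lra]).
  unfold Q; split; [apply Rmult_le_pos; lra|].
  replace (2 * C ^ 2 / rho) with (C ^ 2 / rho * 2) by (field; lra).
  now apply Rmult_le_compat_l. }
assert (HD := opexp_decay_le K e Q t z p1 b1 p2 b2 He0 LK
  (Kr_iter_commT r (S n) Hr) ltac:(lra) (proj1 HQ) L1 L2).
fold F in HD; fold F.
set (g := opexp F t z) in *.
(* [K_r = r^{-1} (1 - K_r) (1 + e B) F] *)
set (P := fun y => (y - Kr r y)%V).
set (W := fun y => (y + RtoC e * B y)%V).
assert (LB : lin B) by now apply Rs_lin.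
assert (LP : lin P) by (apply lin_vsub; [apply lin_id|exact LKr]).
assert (LW : lin W).
{ apply lin_vadd; [apply lin_id|]; apply (lin_comp (fun y => RtoC e * y)%V);
  [apply lin_vscal|exact LB]. }
assert (BP : bdd P (1 + c0)).
{ intros y; apply Rle_trans with (1 := norm_minus_le _ _).
  assert (Hk := Kr_bdd r Hr y); lra. }
assert (BW : bdd W (1 + c0)).
{ intros y; apply Rle_trans with (1 := norm_tri _ _).
  assert (Hb := Rs_R' 0 (Rle_refl 0) y); assert (Hs := norm_scal_R e (B y)).
  rewrite Rabs_pos_eq in Hs by lra; assert (Hv := vnorm_ge_0 (B y)); nra. }
assert (BF : forall y, B y = W (F y)).
{ intros y; assert (E := Rs_resolvent (RtoC e) (RtoC 0) y De D0).
  unfold W; rewrite (Rs_comm (RtoC 0) (RtoC e)) by assumption.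
  fold F in E; fold F.
  replace (F y + RtoC e * F (B y))%V with (F y - (RtoC 0 - RtoC e)%C * F (B y))%V by module.
  rewrite <- E; module. }
assert (KE : forall y, Kr r y = (RtoC (/ r) * P (W (F y)))%V).
{ intros y; rewrite <- BF; now apply Kr_B. }
assert (KF : forall y, Kr r (F y) = F (Kr r y)).
{ intros y; apply Rs_comm_gen; [exact De|exact LKr|apply Kr_commT, Hr]. }
assert (KB : forall y, Kr r (B y) = B (Kr r y)).
{ intros y; apply Rs_comm_gen; [exact D0|exact LKr|apply Kr_commT, Hr]. }
assert (BFc : forall y, B (F y) = F (B y)) by (intros y; now apply Rs_comm).
assert (KP : forall y, Kr r (P y) = P (Kr r y)).
{ intros y; unfold P; now rewrite (lin_sub _ _ _ LKr). }
assert (KW : forall y, Kr r (W y) = W (Kr r y)).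
{ intros y; unfold W; now rewrite (lin_add _ LKr), (lin_scal _ LKr), KB. }
assert (FP : forall y, F (P y) = P (F y)).
{ intros y; unfold P; now rewrite (lin_sub _ _ _ LF), KF. }
assert (FW : forall y, F (W y) = W (F y)).
{ intros y; unfold W; now rewrite (lin_add _ LF), (lin_scal _ LF), BFc. }
assert (K2 : Kr r (Kr r g) = (RtoC (/ r * / r) * P (W (P (W (F (F g))))))%V).
{ rewrite (KE (Kr r g)), (KE g), (lin_scal _ LF), FP, FW, (lin_scal _ LW), (lin_scal _ LP).
  module. }
assert (I1 : forall L', (forall y, Kr r (L' y) = L' (Kr r y)) ->
  forall y, K (L' y) = L' (K y)) by (intros L' HL' y; now apply iter_comm).
assert (E2 : Nat.iter (2 * S n + 2) (Kr r) g =
  (RtoC (/ r * / r) * P (W (P (W (K (K (F (F g))))))))%V).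
{ replace (2 * S n + 2)%nat with (S n + (S n + 2))%nat by lia.
  rewrite !iter_add; fold K; change (Nat.iter 2 (Kr r) g) with (Kr r (Kr r g)).
  rewrite K2, !(lin_scal _ LK).
  now rewrite !(I1 P KP), !(I1 W KW), !(I1 P KP), !(I1 W KW). }
rewrite E2; apply Rle_trans with (1 := norm_scal_R _ _).
assert (Hi : 0 < / r) by now apply Rinv_0_lt_compat.
rewrite Rabs_pos_eq by nra.
set (h := K (K (F (F g)))) in *.
assert (BPW : bdd (fun y => P (W (P (W y)))) ((1 + c0) ^ 4)).
{ apply bdd_ge with ((1 + c0) * ((1 + c0) * ((1 + c0) * (1 + c0)))); [right; ring|].
  apply (bdd_comp P (fun y => W (P (W y)))); [lra|exact BP|].
  apply (bdd_comp W (fun y => P (W y))); [lra|exact BW|].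
  now apply (bdd_comp P W); [lra| |]. }
specialize (BPW h); cbn beta in BPW.
assert (Hh : |{h}| <= 4 * C ^ 2 * INR (S n) / (Rpower r beta * t) * (exp (c0 * c0) * |{x}|)).
{ apply Rmult_le_reg_l with t; [lra|].
  apply Rle_trans with (1 := HD).
  replace (t * (4 * C ^ 2 * INR (S n) / (Rpower r beta * t) * (exp (c0 * c0) * |{x}|)))
   with (2 * (2 * C ^ 2 / rho) * (exp (c0 * c0) * |{x}|)) by (unfold rho; field; lra).
  apply Rmult_le_compat; [lra|apply vnorm_ge_0|lra|exact Hz]. }
assert (H4 : 0 < (1 + c0) ^ 4) by (apply pow_lt; lra).
apply Rle_trans with (/ r * / r * ((1 + c0) ^ 4 * (4 * C ^ 2 * INR (S n) /
   (Rpower r beta * t) * (exp (c0 * c0) * |{x}|)))).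
- apply Rmult_le_compat_l; [nra|]; apply Rle_trans with (1 := BPW).
  apply Rmult_le_compat_l; lra.
- right; field; lra.
Qed.

(** Split e^{-tB} into m factors e^{-(t/m)B}, each with its own block of resolvents; this gives as
    much decay in r as large alpha demands. *)
Lemma est_decay_pow (n m : nat) : beta <= INR n -> (1 <= n)%nat -> (1 <= m)%nat ->
  exists C, 0 < C /\ forall t r, INR m <= t -> 0 < r ->
  bdd (fun x => Nat.iter (m * (2 * n + 2)) (Kr r) (opexp B t x))
    (C / (Rpower r beta * r ^ 2 * t) ^ m).
Proof.
intros Hn1 Hn Hm; destruct (est_decay n Hn1 Hn) as [C [HC HK]].
assert (HmR : 1 <= INR m) by (now apply (le_INR 1)).
exists ((C * INR m) ^ m); split; [apply pow_lt; nra|].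
intros t r Ht Hr x.
assert (Hrho : 0 < Rpower r beta) by apply exp_pos.
assert (D0 : dom (RtoC 0)) by now left.
assert (Hd : 0 < Rpower r beta * r ^ 2 * t).
{ repeat apply Rmult_lt_0_compat; try lra; apply pow_lt; lra. }
replace t with (INR m * (t / INR m)) at 1 by (field; lra).
rewrite (opexp_mult H B m) by now apply Rs_lin.
rewrite iter_mult.
set (s := t / INR m).
assert (Hs : 1 <= s) by (unfold s; apply Rle_div_r; lra).
rewrite <- iter_comm2.
- replace ((C * INR m) ^ m / (Rpower r beta * r ^ 2 * t) ^ m) with
    ((C / (Rpower r beta * r ^ 2 * s)) ^ m).
  + apply (bdd_iter (fun y => Nat.iter (2 * n + 2) (Kr r) (opexp B s y))).
    * apply Rdiv_le_0_compat; [lra|].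
      apply Rmult_lt_0_compat; [apply Rmult_lt_0_compat; [lra|apply pow_lt; lra]|lra].
    * now apply HK.
  + unfold Rdiv; rewrite <- pow_inv, <- Rpow_mult_distr; f_equal.
    unfold s; field; repeat split; lra.
- intros y; apply opexp_comm; [now apply Rs_lin|now apply lin_iter, Kr_lin|].
  intros v; symmetry; apply iter_comm; intros v'.
  apply Rs_comm_gen; [exact D0|now apply Kr_lin|apply Kr_commT, Hr].
Qed.

End UniformEstimates.

(** * The contour integral *)

Lemma sector_cexp u w : - (PI / 4) <= w <= PI / 4 -> sector (cexp (u, w)).
Proof.
intros Hw; right; unfold cexp; simpl; assert (He := exp_pos u); assert (HPI := PI_RGT_0).
assert (Hc : 0 < cos w) by (apply cos_gt_0; lra).
split; [now apply Rmult_lt_0_compat|].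
rewrite Rabs_mult, Rabs_pos_eq by lra; apply Rmult_le_compat_l; [lra|].
assert (key : forall w, 0 <= w <= PI / 4 -> Rabs (sin w) <= cos w).
{ clear w Hw Hc; intros w Hw; rewrite Rabs_pos_eq by (apply sin_ge_0; lra).
  apply Rle_trans with (sin (PI / 4)); [apply sin_incr_1; lra|].
  rewrite sin_cos_PI4; apply cos_decr_1; lra. }
destruct (Rle_dec 0 w) as [H0|H0]; [apply key; lra|].
rewrite <- (Rabs_Ropp (sin w)), <- sin_neg, <- cos_neg; apply key; lra.
Qed.

(* [w] is the logarithm of [- z]. *)
Definition Y (x : H) (w : C) : H := (cexp w * Rs (cexp w) x)%V.

Lemma Y_bound x u w : - (PI / 4) <= w <= PI / 4 ->
  |{Y x (u, w)}| <= c0 * (exp u / (1 + exp u)) * |{x}|.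
Proof.
intros Hw; unfold Y; apply Rle_trans with (1 := norm_scal_C _ _).
rewrite Cmod_cexp; simpl fst; assert (He := exp_pos u).
assert (Hr := Rs_sec _ (sector_cexp u w Hw) x); rewrite Cmod_cexp in Hr; simpl fst in Hr.
apply Rle_trans with (exp u * (c0 / (1 + exp u) * |{x}|)).
- apply Rmult_le_compat_l; lra.
- right; field; lra.
Qed.

(** The difference is (w' - w) (w + A)^{-1} (1 - w' (w' + A)^{-1}). Being relative to 1 + |w|, the
    bound becomes a uniform Lipschitz bound in the coordinate log w ([Y_lip]). *)
Lemma wRs_diff w w' x : sector w -> sector w' ->
  |{w' * Rs w' x - w * Rs w x}| <= Cmod (w' - w) / (1 + Cmod w) * (c0 * (1 + c0)) * |{x}|.
Proof.
intros Hw Hw'; assert (Dw := sector_dom w Hw); assert (Dw' := sector_dom w' Hw').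
assert (Lw := Rs_lin w Dw).
assert (E : (w' * Rs w' x - w * Rs w x)%V = ((w' - w)%C * Rs w (x - w' * Rs w' x))%V).
{ rewrite (lin_sub _ _ _ Lw), (lin_scal _ Lw).
  assert (E := Rs_resolvent w w' x Dw Dw').
  replace ((w' - w)%C * (Rs w x - w' * Rs w (Rs w' x)))%V with
    ((w' - w)%C * Rs w x - w' * ((w' - w)%C * Rs w (Rs w' x)))%V by module.
  rewrite <- E; module. }
rewrite E; apply Rle_trans with (1 := norm_scal_C _ _).
assert (Hc := Cmod_ge_0 w); assert (Hc' := Cmod_ge_0 w'); assert (Hx := vnorm_ge_0 x).
replace (Cmod (w' - w) / (1 + Cmod w) * (c0 * (1 + c0)) * |{x}|) with
  (Cmod (w' - w) * (c0 / (1 + Cmod w) * ((1 + c0) * |{x}|))) by (field; lra).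
apply Rmult_le_compat_l; [apply Cmod_ge_0|].
apply Rle_trans with (1 := Rs_sec w Hw _).
apply Rmult_le_compat_l; [apply Rdiv_le_0_compat; lra|].
apply Rle_trans with (1 := norm_minus_le _ _).
assert (H1 : |{w' * Rs w' x}| <= c0 * |{x}|); [|lra].
apply Rle_trans with (1 := norm_scal_C _ _).
apply Rle_trans with (Cmod w' * (c0 / (1 + Cmod w') * |{x}|)).
- apply Rmult_le_compat_l; [exact Hc'|now apply Rs_sec].
- apply Rmult_le_reg_r with (1 + Cmod w'); [lra|].
  replace (Cmod w' * (c0 / (1 + Cmod w') * |{x}|) * (1 + Cmod w')) with
    (Cmod w' * (c0 * |{x}|)) by (field; lra).
  assert (0 <= c0 * |{x}|) by (apply Rmult_le_pos; lra); nra.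
Qed.

Definition L0 : R := exp 1 * (c0 * (1 + c0)).

Lemma L0_pos : 0 <= L0.
Proof. unfold L0; assert (H1 := exp_pos 1); repeat apply Rmult_le_pos; lra. Qed.

Lemma Y_lip x u u' w : - (PI / 4) <= w <= PI / 4 -> Rabs (u' - u) <= 1 ->
  |{Y x (u', w) - Y x (u, w)}| <= L0 * Rabs (u' - u) * |{x}|.
Proof.
intros Hw Hu; unfold Y.
apply Rle_trans with (1 := wRs_diff _ _ x (sector_cexp u w Hw) (sector_cexp u' w Hw)).
assert (Hx := vnorm_ge_0 x); assert (He := exp_pos u).
apply Rmult_le_compat_r; [exact Hx|].
unfold L0; replace (exp 1 * (c0 * (1 + c0)) * Rabs (u' - u)) with
  (Rabs (u' - u) * exp 1 * (c0 * (1 + c0))) by ring.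
apply Rmult_le_compat_r; [nra|].
rewrite (Cmod_cexp (u, w)); simpl fst.
replace (cexp (u', w) - cexp (u, w))%C with (RtoC (exp (u' - u) - 1) * cexp (u, w))%C.
- rewrite Cmod_mult, Cmod_R, Cmod_cexp; simpl fst.
  replace (Rabs (exp (u' - u) - 1) * exp u / (1 + exp u)) with
    (Rabs (exp (u' - u) - 1) * (exp u / (1 + exp u))) by (field; lra).
  destruct (ratio_le_1 u) as [R1 R2].
  apply Rle_trans with (Rabs (exp (u' - u) - 1) * 1).
  + apply Rmult_le_compat_l; [apply Rabs_pos|exact R2].
  + rewrite Rmult_1_r; apply Rle_trans with (1 := exp_taylor1 _).
    apply Rmult_le_compat_l; [apply Rabs_pos|now apply exp_le].
- assert (E1 : cexp (u', w) = (cexp (RtoC (u' - u)) * cexp (u, w))%C).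
  { rewrite <- cexp_plus; f_equal; apply injective_projections; simpl; ring. }
  rewrite E1; replace (cexp (RtoC (u' - u))) with (RtoC (exp (u' - u))).
  + rewrite RtoC_minus; ring.
  + unfold cexp; simpl; rewrite cos_0, sin_0; apply injective_projections; simpl; ring.
Qed.

(* The boundary ray of argument [t] for [z] is the ray of argument [w] for [- z]. *)
Definition side (t w : R) : Prop :=
  (t = - tp /\ w = PI / 4) \/ (t = tp /\ w = - (PI / 4)).

Lemma side_t t w : side t w -> - tp <= t <= tp.
Proof. assert (Hp := tp_pos); intros [[-> _]|[-> _]]; lra. Qed.

Lemma side_w t w : side t w -> - (PI / 4) <= w <= PI / 4.
Proof. assert (Hp := PI_RGT_0); intros [[_ ->]|[_ ->]]; lra. Qed.

Lemma side_cexp t w u : side t w -> cexp (u, t) = (- cexp (u, w))%C.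
Proof.
intros Hs; assert (E : cos t = - cos w /\ sin t = - sin w).
{ destruct Hs as [[-> ->]|[-> ->]]; unfold tp.
  - replace (- (3 * PI / 4)) with (- PI + PI / 4) by field.
    replace (- PI + PI / 4) with (- (PI - PI / 4)) by ring.
    rewrite cos_neg, sin_neg, Rtrigo_facts.cos_pi_minus, Rtrigo_facts.sin_pi_minus; lra.
  - replace (3 * PI / 4) with (PI - PI / 4) by field.
    rewrite cos_neg, sin_neg, Rtrigo_facts.cos_pi_minus, Rtrigo_facts.sin_pi_minus; lra. }
destruct E as [E1 E2]; unfold cexp; simpl; rewrite E1, E2.
apply injective_projections; simpl; ring.
Qed.

(** Local Lipschitz continuity along the two boundary rays. It is weaker than [holo] and admits
    integrands such as [hh] below, given by an integral over a parameter. *)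
Definition lc (p : C -> C) : Prop := forall t w u, side t w ->
  exists K, forall y, Rabs (y - u) < 1 -> Cmod (p (y, t) - p (u, t)) <= K * Rabs (y - u).

Lemma holo_lc p : holo p -> lc p.
Proof.
intros [p' Hp] t w u Hs; assert (Ht := side_t t w Hs).
destruct (CQ_lip C_CompleteNormedModule _ _ _ (Hp (Rabs u + 1))) as [K [HK Kp]].
exists K; intros y Hy.
assert (Hy' : Rabs y <= Rabs u + 1).
{ replace y with (u + (y - u)) by ring.
  apply Rle_trans with (1 := Rabs_triang _ _); lra. }
assert (E := Kp (u, t) (y, t) ltac:(split; simpl; lra) ltac:(split; simpl; lra)).
change (Cmod (p (y, t) - p (u, t)) <= K * Cmod ((y, t) - (u, t))) in E.
replace ((y, t) - (u, t))%C with (RtoC (y - u)) in E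
  by (apply injective_projections; simpl; ring).
now rewrite Cmod_R in E.
Qed.

Lemma lc_mult p r : lc p -> lc r -> lc (fun w => p w * r w)%C.
Proof.
intros Hp Hr t w u Hs; destruct (Hp t w u Hs) as [K HK]; destruct (Hr t w u Hs) as [L HL].
exists (K * (Cmod (r (u, t)) + Rabs L) + Cmod (p (u, t)) * L); intros y Hy.
specialize (HK y Hy); specialize (HL y Hy); assert (Ha := Rabs_pos (y - u)).
replace (p (y, t) * r (y, t) - p (u, t) * r (u, t))%C with
  ((p (y, t) - p (u, t)) * (r (u, t) + (r (y, t) - r (u, t))) +
   p (u, t) * (r (y, t) - r (u, t)))%C by ring.
apply Rle_trans with (1 := Cmod_triangle _ _); rewrite !Cmod_mult.
assert (H1 : Cmod (r (u, t) + (r (y, t) - r (u, t))) <= Cmod (r (u, t)) + Rabs L).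
{ apply Rle_trans with (1 := Cmod_triangle _ _); apply Rplus_le_compat_l.
  apply Rle_trans with (1 := HL); assert (H2 := Rle_abs L); assert (H3 := Rabs_pos L); nra. }
assert (H2 := Cmod_ge_0 (p (y, t) - p (u, t))).
assert (H4 : Cmod (p (y, t) - p (u, t)) * Cmod (r (u, t) + (r (y, t) - r (u, t))) <=
  K * Rabs (y - u) * (Cmod (r (u, t)) + Rabs L)).
{ apply Rmult_le_compat; auto using Cmod_ge_0. }
assert (H5 : Cmod (p (u, t)) * Cmod (r (y, t) - r (u, t)) <= Cmod (p (u, t)) * (L * Rabs (y - u))).
{ apply Rmult_le_compat_l; [apply Cmod_ge_0|exact HL]. }
lra.
Qed.

Lemma lc_sub p r : lc p -> lc r -> lc (fun w => p w - r w)%C.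
Proof.
intros Hp Hr t w u Hs; destruct (Hp t w u Hs) as [K HK]; destruct (Hr t w u Hs) as [L HL].
exists (K + L); intros y Hy; specialize (HK y Hy); specialize (HL y Hy).
replace (p (y, t) - r (y, t) - (p (u, t) - r (u, t)))%C with
  ((p (y, t) - p (u, t)) + - (r (y, t) - r (u, t)))%C by ring.
apply Rle_trans with (1 := Cmod_triangle _ _); rewrite Cmod_opp; lra.
Qed.

Definition J (p : C -> C) (x : H) (t w u : R) : H := (p (u, t) * Y x (u, w))%V.

Lemma J_cont p x t w (u : R) : lc p -> side t w -> continuous (J p x t w) u.
Proof.
intros Hp Hs; destruct (Hp t w u Hs) as [K HK]; assert (Hw := side_w t w Hs).
assert (Hl := L0_pos); assert (Hx := vnorm_ge_0 x).
apply (lip_cont H _ (Rabs K * (c0 * |{x}|) + Cmod (p (u, t)) * (L0 * |{x}|))).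
intros y Hy; specialize (HK y Hy); unfold J.
assert (HY := Y_lip x u y w Hw ltac:(lra)).
assert (Ha := Rabs_pos (y - u)).
apply Rle_trans with (|{(p (y, t) - p (u, t))%C * Y x (y, w) + p (u, t) * (Y x (y, w) - Y x (u, w))}|).
{ right; f_equal; module. }
apply Rle_trans with (1 := norm_tri _ _).
assert (H1 : |{(p (y, t) - p (u, t))%C * Y x (y, w)}| <= Rabs K * Rabs (y - u) * (c0 * |{x}|)).
{ apply Rle_trans with (1 := norm_scal_C _ _); apply Rmult_le_compat; auto using Cmod_ge_0, vnorm_ge_0.
  - apply Rle_trans with (1 := HK), Rmult_le_compat_r; [exact Ha|apply Rle_abs].
  - apply Rle_trans with (1 := Y_bound x y w Hw).
    destruct (ratio_le_1 y) as [R1 R2].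
    rewrite Rmult_assoc; apply Rmult_le_compat_l; [lra|]; nra. }
assert (H2 : |{p (u, t) * (Y x (y, w) - Y x (u, w))}| <=
  Cmod (p (u, t)) * (L0 * Rabs (y - u) * |{x}|)).
{ apply Rle_trans with (1 := norm_scal_C _ _), Rmult_le_compat_l; [apply Cmod_ge_0|exact HY]. }
lra.
Qed.

(* Admissible integrands: the weight is the size of [z (z - A)^{-1}]. *)
Definition good (p : C -> C) (K d : R) : Prop := lc p /\ 0 <= K /\ 0 < d /\
  forall t w u, side t w -> Cmod (p (u, t)) * (exp u / (1 + exp u)) <= K * dexp d 0 u.

Lemma J_bound p K d x t w u : good p K d -> side t w ->
  |{J p x t w u}| <= K * c0 * |{x}| * dexp d 0 u.
Proof.
intros [_ [HK [Hd Hp]]] Hs; unfold J; apply Rle_trans with (1 := norm_scal_C _ _).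
specialize (Hp t w u Hs); assert (Hx := vnorm_ge_0 x).
apply Rle_trans with (Cmod (p (u, t)) * (c0 * (exp u / (1 + exp u)) * |{x}|)).
- apply Rmult_le_compat_l; [apply Cmod_ge_0|apply Y_bound, (side_w t w Hs)].
- replace (Cmod (p (u, t)) * (c0 * (exp u / (1 + exp u)) * |{x}|)) with
   (Cmod (p (u, t)) * (exp u / (1 + exp u)) * (c0 * |{x}|)) by ring.
  replace (K * c0 * |{x}| * dexp d 0 u) with (K * dexp d 0 u * (c0 * |{x}|)) by ring.
  apply Rmult_le_compat_r; [apply Rmult_le_pos; lra|exact Hp].
Qed.

(* The contour integral of [p(log z) (z - A)^{-1} x dz], without the factor
   [(2 pi i)^{-1}]. *)
Definition Lam (p : C -> C) (x l : H) : Prop := exists l1 l2,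
  LI (J p x (- tp) (PI / 4)) l1 /\ LI (J p x tp (- (PI / 4))) l2 /\ l = (l1 - l2)%V.

Lemma side1 : side (- tp) (PI / 4).
Proof. left; auto. Qed.
Lemma side2 : side tp (- (PI / 4)).
Proof. right; auto. Qed.

Lemma Lam_ex p K d x : good p K d -> exists l, Lam p x l /\ |{l}| <= 4 * K * c0 / d * |{x}|.
Proof.
intros Hg; assert (Hg' := Hg); destruct Hg' as [Hc [HK [Hd Hp]]].
assert (Hx := vnorm_ge_0 x).
assert (HKx : 0 <= K * c0 * |{x}|) by (repeat apply Rmult_le_pos; lra).
destruct (LI_ex H (J p x (- tp) (PI / 4)) (K * c0 * |{x}|) d 0) as [l1 [H1 N1]]; auto.
{ intros u; apply J_cont; [exact Hc|apply side1]. }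
{ intros u; apply J_bound; [exact Hg|apply side1]. }
destruct (LI_ex H (J p x tp (- (PI / 4))) (K * c0 * |{x}|) d 0) as [l2 [H2 N2]]; auto.
{ intros u; apply J_cont; [exact Hc|apply side2]. }
{ intros u; apply J_bound; [exact Hg|apply side2]. }
exists (l1 - l2)%V; split; [now exists l1, l2|].
apply Rle_trans with (1 := norm_minus_le _ _).
replace (4 * K * c0 / d * |{x}|) with (2 * (K * c0 * |{x}|) / d + 2 * (K * c0 * |{x}|) / d)
  by (field; lra).
lra.
Qed.

Lemma Lam_unique p x l l' : Lam p x l -> Lam p x l' -> l = l'.
Proof.
intros [a [b [Ha [Hb ->]]]] [a' [b' [Ha' [Hb' ->]]]].
now rewrite (LI_unique H _ a a' Ha Ha'), (LI_unique H _ b b' Hb Hb').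
Qed.

Lemma Lam_norm p K d x l : good p K d -> Lam p x l -> |{l}| <= 4 * K * c0 / d * |{x}|.
Proof.
intros Hg Hl; destruct (Lam_ex p K d x Hg) as [l' [H1 H2]].
now rewrite (Lam_unique p x l l' Hl H1).
Qed.

Lemma Lam_ext p r x l : (forall t w u, side t w -> p (u, t) = r (u, t)) -> Lam p x l -> Lam r x l.
Proof.
intros Hpr [a [b [Ha [Hb ->]]]]; exists a, b; repeat split.
- apply (LI_ext H) with (2 := Ha); intros u; unfold J; now rewrite (Hpr _ _ u side1).
- apply (LI_ext H) with (2 := Hb); intros u; unfold J; now rewrite (Hpr _ _ u side2).
Qed.

Lemma Lam_sub p r x l l' : lc p -> lc r -> Lam p x l -> Lam r x l' ->
  Lam (fun w => p w - r w)%C x (l - l')%V.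
Proof.
intros Hp Hr [a [b [Ha [Hb ->]]]] [a' [b' [Ha' [Hb' ->]]]].
exists (a - a')%V, (b - b')%V; repeat split; [| |module].
- apply (LI_ext H) with (fun u => J p x (- tp) (PI / 4) u - J r x (- tp) (PI / 4) u)%V.
  + intros u; unfold J; module.
  + apply LI_sub; try assumption; intros u; apply J_cont; auto using side1.
- apply (LI_ext H) with (fun u => J p x tp (- (PI / 4)) u - J r x tp (- (PI / 4)) u)%V.
  + intros u; unfold J; module.
  + apply LI_sub; try assumption; intros u; apply J_cont; auto using side2.
Qed.

Lemma Y_lin w : sector (cexp w) -> lin (fun x => Y x w).
Proof.
intros Hw; apply (lin_comp (fun x => cexp w * x)%V); [apply lin_vscal|].
now apply Rs_lin, sector_dom.
Qed.

Lemma Lam_sub_x p x x' l l' : lc p -> Lam p x l -> Lam p x' l' -> Lam p (x - x')%V (l - l')%V.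
Proof.
intros Hp [a [b [Ha [Hb ->]]]] [a' [b' [Ha' [Hb' ->]]]].
exists (a - a')%V, (b - b')%V; repeat split; [| |module].
- apply (LI_ext H) with (fun u => J p x (- tp) (PI / 4) u - J p x' (- tp) (PI / 4) u)%V.
  + intros u; unfold J.
    rewrite (lin_sub _ _ _ (Y_lin _ (sector_cexp u _ (side_w _ _ side1)))); module.
  + apply LI_sub; try assumption; intros u; apply J_cont; auto using side1.
- apply (LI_ext H) with (fun u => J p x tp (- (PI / 4)) u - J p x' tp (- (PI / 4)) u)%V.
  + intros u; unfold J.
    rewrite (lin_sub _ _ _ (Y_lin _ (sector_cexp u _ (side_w _ _ side2)))); module.
  + apply LI_sub; try assumption; intros u; apply J_cont; auto using side2.
Qed.

Lemma Lam_scal p c x l : lc p -> Lam p x l -> Lam p (c * x)%V (c * l)%V.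
Proof.
intros Hp [a [b [Ha [Hb ->]]]].
exists (c * a)%V, (c * b)%V; repeat split; [| |module].
- apply (LI_ext H) with (fun u => c * J p x (- tp) (PI / 4) u)%V.
  + intros u; unfold J.
    rewrite (lin_scal _ (Y_lin _ (sector_cexp u _ (side_w _ _ side1)))); module.
  + apply (LI_lin (fun v => c * v)%V); [apply lin_vscal| |exact Ha].
    intros u; apply J_cont; auto using side1.
- apply (LI_ext H) with (fun u => c * J p x tp (- (PI / 4)) u)%V.
  + intros u; unfold J.
    rewrite (lin_scal _ (Y_lin _ (sector_cexp u _ (side_w _ _ side2)))); module.
  + apply (LI_lin (fun v => c * v)%V); [apply lin_vscal| |exact Hb].
    intros u; apply J_cont; auto using side2.
Qed.

Lemma Lam_scal_p p c x l : lc p -> Lam p x l -> Lam (fun w => c * p w)%C x (c * l)%V.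
Proof.
intros Hp [a [b [Ha [Hb ->]]]].
exists (c * a)%V, (c * b)%V; repeat split; [| |module].
- apply (LI_ext H) with (fun u => c * J p x (- tp) (PI / 4) u)%V; [intros u; unfold J; module|].
  apply (LI_lin (fun v => c * v)%V); [apply lin_vscal| |exact Ha].
  intros u; apply J_cont; auto using side1.
- apply (LI_ext H) with (fun u => c * J p x tp (- (PI / 4)) u)%V; [intros u; unfold J; module|].
  apply (LI_lin (fun v => c * v)%V); [apply lin_vscal| |exact Hb].
  intros u; apply J_cont; auto using side2.
Qed.

(* [(1 + rho z) (z - A)^{-1} (1 + rho A)^{-1} = (z - A)^{-1} + rho (1 + rho A)^{-1}] *)
Lemma Y_Kr v x t w u : side t w ->
  Y (Kr (exp v) x) (u, w) =
  (sig (v + u, t)%R * Y x (u, w) + (sig (v + u, t)%R * cexp (v + u, t)%R)%C * Kr (exp v) x)%V.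
Proof.
intros Hs; assert (Hw := side_w t w Hs); assert (Ht := side_t t w Hs).
assert (Hsec := sector_cexp u w Hw); assert (Dw := sector_dom _ Hsec).
assert (He := exp_pos v); assert (Dr := Kr_dom _ He).
assert (Hz : cexp (v + u, t) = (RtoC (exp v) * - cexp (u, w))%C).
{ rewrite <- (side_cexp t w u Hs).
  replace (v + u, t) with (RtoC v + (u, t))%C by (apply injective_projections; simpl; ring).
  rewrite cexp_plus; f_equal; unfold cexp; simpl.
  rewrite cos_0, sin_0; apply injective_projections; simpl; ring. }
assert (Hn := sig_nz (v + u) t Ht).
unfold Y, Kr, sig; rewrite Hz in *; set (W := cexp (u, w)) in *.
rewrite (lin_scal _ (Rs_lin _ Dw)).
assert (E := Rs_resolvent W (RtoC (/ exp v)) x Dw Dr).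
set (a := Rs W (Rs (RtoC (/ exp v)) x)) in *.
assert (Hr : RtoC (exp v) <> 0) by (intros E'; apply RtoC_inj in E'; lra).
rewrite RtoC_inv in * by lra.
set (rho := RtoC (exp v)) in *.
set (k := Rs (/ rho)%C x) in *; set (b := Rs W x) in *.
replace (W * (/ rho * a))%V with
  ((/ (1 + rho * - W))%C * (W * ((/ rho - W)%C * a)))%V.
- rewrite <- E; module; field; auto.
- module; field; auto.
Qed.

Lemma Lam_Kr p v x l K d :
  holo p -> 0 <= K -> 0 < d ->
  (forall u t, - tp <= t <= tp ->
    Cmod (p (u, t) * (sig (v + u, t) * cexp (v + u, t))) <= K * dexp d 0 u) ->
  Lam (fun w => p w * sig (v + w))%C x l -> Lam p (Kr (exp v) x) l.
Proof.
intros Hp HK Hd Hb [a [b [Ha [Hb' ->]]]].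
assert (Hlc : lc (fun w => p w * sig (v + w))%C)
  by (apply lc_mult; apply holo_lc; [exact Hp|apply holo_sig_shift]).
assert (Hvu : forall u t, (RtoC v + (u, t))%C = (v + u, t)%R)
  by (intros u t; apply injective_projections; simpl; ring).
set (ph := fun w => (p w * (sig (v + w) * cexp (v + w)))%C).
assert (Hph : holo ph).
{ apply holo_mult; [exact Hp|]; apply holo_mult; [apply holo_sig_shift|].
  apply holo_ext with (fun w => cexp v * cexp w)%C.
  - intros u t _; now rewrite cexp_plus.
  - apply holo_mult; [apply holo_const|apply holo_cexp]. }
assert (Htp := tp_pos).
destruct (holo_rotation ph (- Kr (exp v) x)%V K d (- tp) tp) as [m [M1 M2]]; auto; try lra.
{ intros u t Ht; unfold ph; rewrite Hvu; now apply Hb. }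
assert (Hc : forall t w u, side t w -> continuous (fun u => ph (u, t) * - Kr (exp v) x)%V u).
{ intros t w u Hs; apply holo_cont; [apply (side_t t w Hs)|exact Hph]. }
exists (a - m)%V, (b - m)%V; repeat split; [| |module].
- apply (LI_ext H) with (2 := LI_sub H _ _ _ _ (fun u => J_cont _ x _ _ u Hlc side1)
    (fun u => Hc _ _ u side1) Ha M1).
  intros u; unfold J, ph; cbv beta; rewrite (Y_Kr v x _ _ u side1), !Hvu; module.
- apply (LI_ext H) with (2 := LI_sub H _ _ _ _ (fun u => J_cont _ x _ _ u Hlc side2)
    (fun u => Hc _ _ u side2) Hb' M2).
  intros u; unfold J, ph; cbv beta; rewrite (Y_Kr v x _ _ u side2), !Hvu; module.
Qed.

(** * Injectivity of the regularizer *)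

Lemma Rs_inj w x : dom w -> Rs w x = vzero -> x = vzero.
Proof.
intros Hw E; assert (Hs := Rs_spec w x Hw); rewrite E in Hs.
replace (x - w * vzero)%V with x in Hs by module.
assert (H0 := A_scal (RtoC 0) _ _ Hs).
replace (RtoC 0 * (vzero : H))%V with (vzero : H) in H0 by module.
replace (RtoC 0 * x)%V with (vzero : H) in H0 by module.
exact (A_unique _ _ _ Hs H0).
Qed.

Lemma good_pow_mult n r B : (1 <= n)%nat -> lc r -> 0 <= B ->
  (forall t w u, side t w -> Cmod (r (u, t)) <= B) ->
  good (fun w => Cpow (qq w) n * r w)%C (16 ^ n * B) 1.
Proof.
intros Hn Hr HB Hb.
assert (H16 : 0 < 16 ^ n) by (apply pow_lt; lra).
split; [apply lc_mult; [apply holo_lc, holo_pow, holo_qq|exact Hr]|].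
split; [nra|]; split; [lra|]; intros t w u Hs.
rewrite Cmod_mult; assert (Hq := qq_pow_bound n u t Hn (side_t t w Hs)).
assert (Hd := dexp_pos 1 0 u); destruct (ratio_le_1 u) as [R1 R2].
apply Rle_trans with (16 ^ n * dexp 1 0 u * B * 1); [|lra].
apply Rmult_le_compat; auto using Cmod_ge_0, Rmult_le_pos.
apply Rmult_le_compat; auto using Cmod_ge_0; now apply (Hb t w).
Qed.

Lemma sig_shift v u t : sig (RtoC v + (u, t))%C = sig (v + u, t).
Proof. f_equal; apply injective_projections; simpl; ring. Qed.

Lemma sigpow_bound v m u t : - tp <= t <= tp -> Cmod (Cpow (sig (RtoC v + (u, t))%C) m) <= 4 ^ m.
Proof.
intros Ht; rewrite Cmod_pow, sig_shift; apply pow_incr; split; [apply Cmod_ge_0|].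
now apply sig_bound4.
Qed.

Lemma sig_cexp_bound a t : - tp <= t <= tp -> Cmod (sig (a, t) * cexp (a, t)) <= 4.
Proof.
intros Ht; rewrite Cmult_comm; apply Rle_trans with (1 := cexp_sig_bound a t Ht).
destruct (ratio_le_1 a); lra.
Qed.

Lemma Lam_Kr_pow n (v : R) (m : nat) : (1 <= n)%nat -> forall (i : nat) x l,
  Lam (fun w => Cpow (qq w) n * Cpow (sig (v + w)) (m + i))%C x l ->
  Lam (fun w => Cpow (qq w) n * Cpow (sig (v + w)) i)%C (Nat.iter m (Kr (exp v)) x) l.
Proof.
intros Hn; induction m as [|m IH]; intros i x l Hl; [exact Hl|].
change (Nat.iter (S m) (Kr (exp v)) x) with (Kr (exp v) (Nat.iter m (Kr (exp v)) x)).
rewrite <- iter_comm by reflexivity.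
apply IH.
apply (Lam_Kr _ v x l (16 ^ n * (4 ^ (m + i) * 4)) 1); [| |lra| |].
- apply holo_mult; [apply holo_pow, holo_qq|apply holo_pow, holo_sig_shift].
- assert (0 < 16 ^ n) by (apply pow_lt; lra); assert (0 < 4 ^ (m + i)) by (apply pow_lt; lra); nra.
- intros u t Ht; rewrite !Cmod_mult, <- (Cmod_mult (sig _) (cexp _)).
  assert (Hq := qq_pow_bound n u t Hn Ht).
  assert (Hs := sigpow_bound v (m + i) u t Ht).
  assert (Hc := sig_cexp_bound (v + u) t Ht).
  apply Rle_trans with (16 ^ n * dexp 1 0 u * 4 ^ (m + i) * 4); [|lra].
  repeat apply Rmult_le_compat; auto using Cmod_ge_0, Rmult_le_pos.
- apply (Lam_ext) with (2 := Hl); intros t w u _; simpl; ring.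
Qed.

Notation K1 := (Kr (exp 0)).

Lemma sig0 w : sig (RtoC 0 + w)%C = sig w.
Proof. f_equal; ring. Qed.

Lemma qq_sig u t : - tp <= t <= tp -> qq (u, t) = (sig (u, t) * (1 - sig (u, t)))%C.
Proof. intros Ht; unfold qq; rewrite cexp_sig by exact Ht; ring. Qed.

Lemma qq_pow_bound16 j u t : - tp <= t <= tp -> Cmod (Cpow (qq (u, t)) j) <= 16 ^ j.
Proof.
intros Ht; rewrite Cmod_pow; apply pow_incr; split; [apply Cmod_ge_0|].
apply Rle_trans with (1 := qq_bound u t Ht).
assert (Hd := dexp_le_1 1 0 u ltac:(lra)); lra.
Qed.

(** At least one factor 1 / (1 + z) is always kept: it ensures decay at infinity even for j = 0,
    where no regularizer is left. *)
Definition sq (j k : nat) (w : C) : C := (Cpow (sig w) (S k) * Cpow (qq w) j)%C.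

Lemma sq_holo j k : holo (sq j k).
Proof. apply holo_mult; [apply holo_pow, holo_sig|apply holo_pow, holo_qq]. Qed.

Lemma sq_bound j k u t : - tp <= t <= tp ->
  Cmod (sq j k (u, t)) <= 4 / (1 + exp u) * 4 ^ k * 16 ^ j.
Proof.
intros Ht; unfold sq; rewrite Cmod_mult; apply Rmult_le_compat; auto using Cmod_ge_0.
- simpl; rewrite Cmod_mult; apply Rmult_le_compat; auto using Cmod_ge_0.
  + now apply sig_bound.
  + rewrite Cmod_pow; apply pow_incr; split; [apply Cmod_ge_0|now apply sig_bound4].
- now apply qq_pow_bound16.
Qed.

Lemma ratio2_dexp u (c : R) : 0 <= c ->
  4 / (1 + exp u) * c * (exp u / (1 + exp u)) <= 4 * c * dexp 1 0 u.
Proof.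
intros Hc; assert (He := exp_pos u); assert (Hr := ratio_dexp u).
replace (4 / (1 + exp u) * c * (exp u / (1 + exp u))) with
  (4 * c * (exp u / (1 + exp u) ^ 2)) by (field; lra).
apply Rmult_le_compat_l; lra.
Qed.

Lemma sq_good j k : good (sq j k) (4 * (4 ^ k * 16 ^ j)) 1.
Proof.
assert (H4 : 0 < 4 ^ k) by (apply pow_lt; lra); assert (H16 : 0 < 16 ^ j) by (apply pow_lt; lra).
split; [apply holo_lc, sq_holo|]; split; [nra|]; split; [lra|]; intros t w u Hs.
apply Rle_trans with (2 := ratio2_dexp u (4 ^ k * 16 ^ j) ltac:(nra)).
destruct (ratio_le_1 u) as [R1 R2]; apply Rmult_le_compat_r; [exact R1|].
apply Rle_trans with (1 := sq_bound j k u t (side_t t w Hs)); lra.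
Qed.

Lemma Lam_sq_K j k x l : Lam (sq j (S k)) x l -> Lam (sq j k) (K1 x) l.
Proof.
intros Hl; assert (H4 : 0 < 4 ^ k) by (apply pow_lt; lra).
assert (H16 : 0 < 16 ^ j) by (apply pow_lt; lra).
apply (Lam_Kr _ 0 x l (16 * (4 ^ k * 16 ^ j)) 1); [apply sq_holo|nra|lra| |].
- intros u t Ht; rewrite Rplus_0_l.
  replace (sq j k (u, t) * (sig (u, t) * cexp (u, t)))%C with
    (sq j k (u, t) * (cexp (u, t) * sig (u, t)))%C by ring.
  rewrite Cmod_mult.
  apply Rle_trans with (4 / (1 + exp u) * (4 ^ k * 16 ^ j) * (4 * (exp u / (1 + exp u)))).
  + apply Rmult_le_compat; auto using Cmod_ge_0.
    * apply Rle_trans with (1 := sq_bound j k u t Ht); lra.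
    * now apply cexp_sig_bound.
  + assert (Hr := ratio2_dexp u (4 ^ k * 16 ^ j) ltac:(nra)); lra.
- apply (Lam_ext) with (2 := Hl); intros t w u _; rewrite sig0; unfold sq; simpl; ring.
Qed.

(** Here z / (1 + z)^2 = s (1 - s) with s = 1 / (1 + z), and s corresponds to K1; removing one
    factor of the regularizer multiplies the vector by K1 (1 - K1). *)
Lemma Lam_sq_step j x l :
  Lam (sq (S j) 0) x l -> Lam (sq j 0) (K1 (x - K1 x))%V l.
Proof.
intros Hl.
destruct (Lam_ex _ _ _ x (sq_good j 1)) as [la [Ha _]].
destruct (Lam_ex _ _ _ x (sq_good j 2)) as [lb [Hb _]].
replace l with (la - lb)%V.
- rewrite (lin_sub _ _ _ (Kr_lin (exp 0) (exp_pos 0))).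
  apply Lam_sub_x; [apply holo_lc, sq_holo|now apply Lam_sq_K|].
  now apply Lam_sq_K, Lam_sq_K.
- apply (Lam_unique (sq (S j) 0) x); [|exact Hl].
  apply (Lam_ext) with (fun w => sq j 1 w - sq j 2 w)%C.
  + intros t w u Hs; unfold sq; simpl Cpow.
    rewrite (qq_sig u t (side_t t w Hs)); ring.
  + apply Lam_sub; auto; apply holo_lc, sq_holo.
Qed.

(** From the first factor s (1 - s) only 1 - s is moved to the vector, so that one s stays under the
    integral for [Lam_sig_inj]. *)
Lemma Lam_sq_first j x l :
  Lam (fun w => Cpow (qq w) (S j)) x l -> Lam (sq j 0) (x - K1 x)%V l.
Proof.
intros Hl.
destruct (Lam_ex _ _ _ x (sq_good j 0)) as [la [Ha _]].
destruct (Lam_ex _ _ _ x (sq_good j 1)) as [lb [Hb _]].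
replace l with (la - lb)%V.
- apply Lam_sub_x; [apply holo_lc, sq_holo|exact Ha|now apply Lam_sq_K].
- apply (Lam_unique (fun w => Cpow (qq w) (S j)) x); [|exact Hl].
  apply (Lam_ext) with (fun w => sq j 0 w - sq j 1 w)%C.
  + intros t w u Hs; unfold sq; simpl Cpow.
    rewrite (qq_sig u t (side_t t w Hs)); ring.
  + apply Lam_sub; auto; apply holo_lc, sq_holo.
Qed.

Lemma Lam_sq_iter j x l : Lam (sq j 0) x l ->
  Lam (sq 0 0) (Nat.iter j (fun y => K1 (y - K1 y))%V x) l.
Proof.
revert x; induction j as [|j IH]; intros x Hl; [exact Hl|].
rewrite Nat.iter_succ_r.
apply IH, Lam_sq_step, Hl.
Qed.

(** The derivative and the remainder both come from the resolvent identity, used once for the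
    first-order term and again to replace W' by W in it. *)
Lemma CQ_Rs x : forall N, CQ (box N (- (PI / 4)) (PI / 4)) (fun w => Rs (cexp w) x)
  (fun w => - (cexp w * Rs (cexp w) (Rs (cexp w) x)))%V.
Proof.
intros N; set (D := box N (- (PI / 4)) (PI / 4)).
assert (Hc : CQs D cexp cexp).
{ apply (CQ_ext C_CompleteNormedModule D (fun w => cexp (1 * w)) (fun w => 1 * cexp (1 * w))%C).
  - intros z _; replace (1 * z)%C with z by ring; reflexivity.
  - intros z _; replace (1 * z)%C with z by ring; exact (Cmult_1_l _).
  - apply CQs_cexp. }
destruct (CQ_lip C_CompleteNormedModule D _ _ Hc) as [P [HP Pc]].
destruct Hc as [K [HK Kc]].
assert (Hx := vnorm_ge_0 x).
assert (Rb : forall w, D w -> bdd (Rs (cexp w)) c0).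
{ intros [u w] [_ Hw]; apply bdd_ge with (2 := Rs_sec _ (sector_cexp u w Hw)).
  rewrite Cmod_cexp; assert (He := exp_pos (fst (u, w))).
  apply Rmult_le_reg_r with (1 + exp (fst (u, w))); [lra|].
  replace (c0 / (1 + exp (fst (u, w))) * (1 + exp (fst (u, w)))) with c0 by (field; lra).
  rewrite <- (Rmult_1_r c0) at 1; apply Rmult_le_compat_l; lra. }
assert (Dd : forall w, D w -> dom (cexp w)).
{ intros [u w] [_ Hw]; apply sector_dom, sector_cexp, Hw. }
assert (X1 : 0 <= c0 * |{x}|) by (apply Rmult_le_pos; lra).
assert (X2 : 0 <= K * c0 * (c0 * |{x}|)) by (apply Rmult_le_pos; nra).
assert (X3 : 0 <= P * P * c0 * c0 * (c0 * |{x}|)).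
{ replace (P * P * c0 * c0) with ((P * c0) * (P * c0)) by ring; apply Rmult_le_pos; [nra|exact X1]. }
exists (c0 * |{x}| + K * c0 * (c0 * |{x}|) + P * P * c0 * c0 * (c0 * |{x}|)).
split; [lra|]; intros z z' Hz Hz'.
destruct (Kc z z' Hz Hz') as [C1 [_ C2]].
change (Cmod (cexp z) <= K) in C1.
change (Cmod (cexp z' - cexp z - (z' - z) * cexp z) <= K * Cmod (z' - z) ^ 2) in C2.
specialize (Pc z z' Hz Hz'); change (Cmod (cexp z' - cexp z) <= P * Cmod (z' - z)) in Pc.
set (W := cexp z) in *; set (W' := cexp z') in *; set (h := (z' - z)%C) in *.
assert (B1 := Rb z Hz); assert (B2 := Rb z' Hz'); fold W in B1; fold W' in B2.
assert (LW := Rs_lin W (Dd z Hz)); assert (LW' := Rs_lin W' (Dd z' Hz')).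
assert (N1 := B1 x); assert (N2 := B1 (Rs W x)).
assert (N3 : |{Rs W (Rs W x)}| <= c0 * (c0 * |{x}|)).
{ apply Rle_trans with (1 := N2), Rmult_le_compat_l; lra. }
assert (Hh2 : 0 <= Cmod h ^ 2) by apply pow2_ge_0.
assert (Hh := Cmod_ge_0 h).
repeat split.
- lra.
- rewrite norm_oppV; apply Rle_trans with (1 := norm_scal_C _ _).
  assert (Cmod W * |{Rs W (Rs W x)}| <= K * (c0 * (c0 * |{x}|)))
    by (apply Rmult_le_compat; auto using Cmod_ge_0, vnorm_ge_0).
  lra.
- assert (E1 := Rs_resolvent W' W x (Dd z' Hz') (Dd z Hz)).
  assert (E2 := Rs_resolvent W' W (Rs W x) (Dd z' Hz') (Dd z Hz)).
  rewrite E1.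
  replace ((W - W')%C * Rs W' (Rs W x) - h * - (W * Rs W (Rs W x)))%V with
   (- ((W' - W - h * W)%C * Rs W (Rs W x)) +
     (W - W')%C * (Rs W' (Rs W x) - Rs W (Rs W x)))%V by module.
  rewrite E2.
  apply Rle_trans with (1 := norm_tri _ _); rewrite norm_oppV.
  assert (Q1 : |{(W' - W - h * W)%C * Rs W (Rs W x)}| <= K * Cmod h ^ 2 * (c0 * (c0 * |{x}|))).
  { apply Rle_trans with (1 := norm_scal_C _ _).
    apply Rmult_le_compat; auto using Cmod_ge_0, vnorm_ge_0. }
  assert (Hw : Cmod (W - W') <= P * Cmod h).
  { replace (W - W')%C with (- (W' - W))%C by ring; now rewrite Cmod_opp. }
  assert (Q2 : |{(W - W')%C * ((W - W')%C * Rs W' (Rs W (Rs W x)))}| <=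
     P * Cmod h * (P * Cmod h * (c0 * (c0 * (c0 * |{x}|))))).
  { apply Rle_trans with (1 := norm_scal_C _ _).
    apply Rmult_le_compat; auto using Cmod_ge_0, vnorm_ge_0.
    apply Rle_trans with (1 := norm_scal_C _ _).
    apply Rmult_le_compat; auto using Cmod_ge_0, vnorm_ge_0.
    apply Rle_trans with (1 := B2 _), Rmult_le_compat_l; lra. }
  replace (P * Cmod h * (P * Cmod h * (c0 * (c0 * (c0 * |{x}|))))) with
    (P * P * c0 * c0 * (c0 * |{x}|) * Cmod h ^ 2) in Q2 by ring.
  replace (K * Cmod h ^ 2 * (c0 * (c0 * |{x}|))) with
    (K * c0 * (c0 * |{x}|) * Cmod h ^ 2) in Q1 by ring.
  nra.
Qed.

Lemma dexp1_cases u : exp u / (1 + exp u) <= dexp 1 0 u \/ 1 / (1 + exp u) <= dexp 1 0 u.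
Proof.
assert (He := exp_pos u); unfold dexp; rewrite Rminus_0_r, Rmult_1_l.
destruct (Rle_dec 0 u) as [H0|H0].
- right; rewrite Rabs_pos_eq, exp_Ropp by lra.
  apply Rmult_le_reg_r with (exp u * (1 + exp u)); [nra|].
  field_simplify; lra.
- left; rewrite Rabs_left, Ropp_involutive by lra.
  apply Rmult_le_reg_r with (1 + exp u); [lra|].
  field_simplify; [|lra]; nra.
Qed.

(* With [k = (1 + A)^{-1} v] and [W = - z],
   [W (W + A)^{-1} v / (1 - W) =
    (W (W + A)^{-1} k - W k / (1 + W)) + 2 W k / (1 - W^2)];
   the first term is holomorphic for [Re W > 0] and cancels by rotation,
   the last term is explicit and positive after taking the difference of the rays. *)
Lemma Lam_sig_inj v : Lam sig v vzero -> v = vzero.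
Proof.
intros [l1 [l2 [H1 [H2 E]]]].
assert (Hpi := PI_RGT_0); assert (Hw4 : - (PI / 4) <= PI / 4) by lra.
assert (D1 : dom (RtoC 1)) by (right; simpl; lra).
set (ka := Rs (RtoC 1) v).
set (Phi := fun w => (Y ka w - (cexp w * sig w)%C * ka)%V).
assert (Hsub : - (PI / 4) >= - tp /\ PI / 4 <= tp) by (unfold tp; lra).
assert (HCQ : exists Phi', forall N, CQ (box N (- (PI / 4)) (PI / 4)) Phi Phi').
{ destruct (holo_mult _ _ holo_cexp holo_sig) as [p' Hp].
  destruct holo_cexp as [e' He'].
  assert (Hbox : forall N z, box N (- (PI / 4)) (PI / 4) z -> box N (- tp) tp z)
    by (intros N z [Z1 Z2]; split; lra).
  eexists; intros N; unfold Phi; apply CQ_sub.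
  - unfold Y; apply CQ_mult; [|apply (CQ_Rs ka)].
    apply (CQ_mono _ _ _ _ (Hbox N)), He'.
  - apply CQ_mult; [|apply CQ_const].
    apply (CQ_mono _ _ _ _ (Hbox N)), Hp. }
destruct HCQ as [Phi' HPhi].
set (K := (c0 + 4) * (|{ka}| + |{v}|)).
assert (Hk0 := vnorm_ge_0 ka); assert (Hv0 := vnorm_ge_0 v).
assert (HK : 0 <= K) by (unfold K; nra).
assert (HB : forall u t, - (PI / 4) <= t <= PI / 4 -> |{Phi (u, t)}| <= K * dexp 1 0 u).
{ intros u t Ht; assert (He := exp_pos u); assert (Hts : - tp <= t <= tp) by lra.
  (* Towards - oo both terms of [Phi] are small separately; towards + oo they cancel, and [Phi] is
     rewritten as a sum of two terms of size 1 / (1 + e^u). *)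
  destruct (dexp1_cases u) as [Hd|Hd].
  - apply Rle_trans with (1 := norm_minus_le _ _).
    assert (B1 := Y_bound ka u t Ht).
    assert (B2 := cexp_sig_bound u t Hts).
    assert (B3 := norm_scal_C (cexp (u, t) * sig (u, t))%C ka).
    assert (B4 : Cmod (cexp (u, t) * sig (u, t)) * |{ka}| <= 4 * (exp u / (1 + exp u)) * |{ka}|)
      by (apply Rmult_le_compat_r; lra).
    apply Rle_trans with ((c0 + 4) * |{ka}| * (exp u / (1 + exp u))); [lra|].
    destruct (ratio_le_1 u) as [R1 _].
    unfold K; apply Rmult_le_compat; [nra|exact R1| |exact Hd]; nra.
  - replace (Phi (u, t)) with (sig (u, t) * ka + Rs (cexp (u, t)) (ka - v))%V.
    + apply Rle_trans with (1 := norm_tri _ _).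
      assert (B1 := Rs_sec _ (sector_cexp u t Ht) (ka - v)%V).
      rewrite Cmod_cexp in B1; simpl fst in B1.
      assert (B2 := norm_minus_le ka v).
      assert (B3 := norm_scal_C (sig (u, t)) ka).
      assert (B4 := sig_bound u t Hts).
      assert (B5 : Cmod (sig (u, t)) * |{ka}| <= 4 / (1 + exp u) * |{ka}|)
        by (apply Rmult_le_compat_r; lra).
      assert (B6 : c0 / (1 + exp u) * |{ka - v}| <= c0 / (1 + exp u) * (|{ka}| + |{v}|)).
      { apply Rmult_le_compat_l; [apply Rdiv_le_0_compat; lra|exact B2]. }
      apply Rle_trans with ((c0 * (|{ka}| + |{v}|) + 4 * |{ka}|) * (1 / (1 + exp u))).
      * replace ((c0 * (|{ka}| + |{v}|) + 4 * |{ka}|) * (1 / (1 + exp u))) with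
          (c0 / (1 + exp u) * (|{ka}| + |{v}|) + 4 / (1 + exp u) * |{ka}|) by (field; lra).
        lra.
      * unfold K; apply Rmult_le_compat; [nra|apply Rdiv_le_0_compat; lra|nra|exact Hd].
    + unfold Phi, Y.
      rewrite (cexp_sig u t Hts).
      assert (Ds := sector_dom _ (sector_cexp u t Ht)).
      assert (Er := Rs_resolvent (cexp (u, t)) (RtoC 1) v Ds D1); fold ka in Er.
      rewrite (lin_sub _ _ _ (Rs_lin _ Ds)).
      set (W := cexp (u, t)) in *.
      replace (Rs W v) with (ka + (RtoC 1 - W)%C * Rs W ka)%V by (rewrite <- Er; module).
      module. }
assert (Hline : forall t, - (PI / 4) <= t <= PI / 4 -> forall u : R, continuous (fun u => Phi (u, t)) u).
{ intros t Ht u; exact (CQ_line_cont H _ _ _ _ HPhi t u Ht). }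
assert (Ht1 : - (PI / 4) <= - (PI / 4) <= PI / 4) by lra.
assert (Ht2 : - (PI / 4) <= PI / 4 <= PI / 4) by lra.
destruct (LI_ex H (fun u => Phi (u, (- (PI / 4))%R)) K 1 0) as [m1 [M1 _]]; auto; try lra.
destruct (LI_ex H (fun u => Phi (u, PI / 4)) K 1 0) as [m2 [M2 _]]; auto; try lra.
assert (Em := rotation H _ _ _ _ HPhi K 1 m1 m2 Hw4 HK Rlt_0_1 HB M1 M2); subst m2.
set (s := cos (PI / 4)).
assert (Hs : 0 < s) by (apply cos_gt_0; lra).
assert (Hss : 2 * (s * s) = 1).
{ assert (H3 := sin2_cos2 (PI / 4)); rewrite sin_cos_PI4 in H3; unfold Rsqr in H3; fold s in H3; lra. }
(* On the two rays W = a (1 + i) and W = a (1 - i) with a = e^u s; the values of 2 W / (1 - W^2) are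
   conjugate and differ by 2 i g(u). *)
set (g := fun u => (2 * (exp u * s) + 4 * (exp u * s) ^ 3) / (1 + 4 * (exp u * s) ^ 4)).
assert (Hpos : forall u, 0 < exp u * s).
{ intros u; apply Rmult_lt_0_compat; [apply exp_pos|exact Hs]. }
assert (Hden : forall u, 0 < 1 + 4 * (exp u * s) ^ 4).
{ intros u; assert (H3 := pow_lt _ 4 (Hpos u)); lra. }
assert (Hz : ((RtoC 2 * Ci)%C * ka)%V = vzero).
{ apply (LI_pos g).
  - intros u; apply (ex_derive_continuous (V := R_NormedModule)); unfold g.
    auto_derive; specialize (Hden u); simpl in Hden; lra.
  - intros u; unfold g; apply Rdiv_lt_0_compat; [|apply Hden].
    assert (H3 := pow_lt _ 3 (Hpos u)); specialize (Hpos u); lra.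
  - assert (C1 := fun u => J_cont sig v _ _ u (holo_lc _ holo_sig) side1).
    assert (C2 := fun u => J_cont sig v _ _ u (holo_lc _ holo_sig) side2).
    assert (L1 := LI_sub H _ _ _ _ C1 (Hline _ Ht2) H1 M2).
    assert (L2 := LI_sub H _ _ _ _ C2 (Hline _ Ht1) H2 M1).
    assert (CC1 : forall u : R, continuous (fun u => J sig v (- tp) (PI / 4) u - Phi (u, PI / 4))%V u).
    { intros u; apply (@continuous_minus _ C_AbsRing H); [apply C1|now apply Hline]. }
    assert (CC2 : forall u : R, continuous (fun u => J sig v tp (- (PI / 4))%R u - Phi (u, (- (PI / 4))%R))%V u).
    { intros u; apply (@continuous_minus _ C_AbsRing H); [apply C2|now apply Hline]. }
    assert (L3 := LI_sub H _ _ _ _ CC1 CC2 L1 L2).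
    replace (l1 - m1 - (l2 - m1))%V with (l1 - l2)%V in L3 by module.
    rewrite <- E in L3; apply (LI_ext H) with (2 := L3); intros u.
    assert (key : forall t w, side t w -> (J sig v t w u - Phi (u, w))%V =
      ((cexp (u, w) * / (1 - cexp (u, w)) + cexp (u, w) * / (1 + cexp (u, w)))%C * ka)%V).
    { intros t w Hside; assert (Hw := side_w t w Hside).
      assert (Ds := sector_dom _ (sector_cexp u w Hw)).
      assert (Er := Rs_resolvent (cexp (u, w)) (RtoC 1) v Ds D1); fold ka in Er.
      assert (Hn := sig_nz u t (side_t t w Hside)); assert (Hn' := sig_nz u w ltac:(lra)).
      unfold J, Phi, Y, sig; rewrite (side_cexp t w u Hside) in *.
      set (W := cexp (u, w)) in *.
      replace (Rs W v) with (ka + (RtoC 1 - W)%C * Rs W ka)%V by (rewrite <- Er; module).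
      module; field; split; [exact Hn'|exact Hn]. }
    apply (eq_trans (f_equal2 vsub (key _ _ side1) (key _ _ side2))); clear key.
    assert (N1 := sig_nz u _ (side_t _ _ side1)); rewrite (side_cexp _ _ u side1) in N1.
    assert (N2 := sig_nz u _ (side_t _ _ side2)); rewrite (side_cexp _ _ u side2) in N2.
    assert (N3 := sig_nz u (PI / 4) ltac:(lra)); assert (N4 := sig_nz u (- (PI / 4)) ltac:(lra)).
    assert (W1 : cexp (u, PI / 4) = (RtoC (exp u * s) * (1 + Ci))%C).
    { unfold cexp; simpl; rewrite sin_cos_PI4; fold s; apply injective_projections; simpl; ring. }
    assert (W2 : cexp (u, - (PI / 4)) = (RtoC (exp u * s) * (1 - Ci))%C).
    { unfold cexp; simpl; rewrite sin_neg, cos_neg, sin_cos_PI4; fold s.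
      apply injective_projections; simpl; ring. }
    rewrite W1, W2 in *; unfold g; specialize (Hden u); set (a := exp u * s) in *.
    assert (Hd0 : RtoC (1 + 4 * a ^ 4) <> 0) by (intros E'; apply RtoC_inj in E'; lra).
    assert (Hj : (Ci * Ci = - (1))%C) by (apply injective_projections; simpl; ring).
    rewrite RtoC_div by lra.
    rewrite !RtoC_plus, !RtoC_mult, !RtoC_pow in *.
    (* With z and j opaque the identity becomes one of rational functions, in which [field] uses j^2
       = - 1 as a rewriting rule. *)
    set (z := RtoC a) in *; set (j := Ci) in *; clearbody z j; clear - Hd0 Hj N1 N2 N3 N4.
    replace (1 + - (z * (1 + j)))%C with (1 - z * (1 + j))%C in N1 by ring.
    replace (1 + - (z * (1 - j)))%C with (1 - z * (1 - j))%C in N2 by ring.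
    module; simpl Cpow in *; field [Hj]; repeat split; try assumption.
    now rewrite Cmult_1_r in Hd0. }
assert (Hk : ka = vzero).
{ replace ka with (/ (2 * Ci) * ((RtoC 2 * Ci)%C * ka))%V; [rewrite Hz; module|].
  assert (HC : Ci <> 0) by (intros E'; inversion E'; lra).
  module; field; exact HC. }
exact (Rs_inj _ v D1 Hk).
Qed.

Lemma K1_B x : K1 x = Rs (RtoC 0) (x - K1 x)%V.
Proof.
assert (D0 : dom (RtoC 0)) by now left.
assert (D1 := Kr_dom _ (exp_pos 0)).
rewrite (Kr_B _ _ (exp_pos 0)) at 1.
rewrite (lin_sub _ _ _ (Rs_lin _ D0)); unfold Kr.
rewrite (lin_scal _ (Rs_lin _ D0)), (Rs_comm _ _ x D1 D0).
replace (RtoC (/ exp 0)) with (RtoC 1) by (rewrite exp_0; f_equal; field); module.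
Qed.

Lemma K1_inj x : K1 x = vzero -> x = vzero.
Proof.
unfold Kr; intros E; assert (He := exp_pos 0).
assert (Hr : RtoC (/ exp 0) <> 0).
{ intros E'; apply RtoC_inj in E'; assert (H1 := Rinv_0_lt_compat _ He); lra. }
apply (Rs_inj (RtoC (/ exp 0))); [now apply Kr_dom|].
replace (Rs (RtoC (/ exp 0)) x) with (/ RtoC (/ exp 0) * (RtoC (/ exp 0) * Rs (RtoC (/ exp 0)) x))%V.
- rewrite E; module.
- module; field; exact Hr.
Qed.

Lemma one_K1_inj x : (x - K1 x)%V = vzero -> x = vzero.
Proof.
intros E; assert (E1 := K1_B x); rewrite E in E1.
rewrite (lin_zero _ (Rs_lin (RtoC 0) (or_introl eq_refl))) in E1.
rewrite E1 in E; rewrite <- E; module.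
Qed.

(** The integral equals that of s applied to (K1 (1 - K1))^j (1 - K1) x; [Lam_sig_inj] kills this
    vector, and K1 and 1 - K1 are injective because A and its resolvent are. *)
Lemma Lam_qq_inj j x : Lam (fun w => Cpow (qq w) (S j)) x vzero -> x = vzero.
Proof.
intros Hl.
apply (Lam_sq_first) in Hl.
apply (Lam_sq_iter) in Hl.
apply one_K1_inj.
set (y := (x - K1 x)%V) in *; clearbody y.
assert (E : Nat.iter j (fun y => K1 (y - K1 y))%V y = vzero).
{ apply Lam_sig_inj; apply (Lam_ext) with (2 := Hl).
  intros t w u _; unfold sq; simpl; ring. }
clear Hl; induction j as [|j IH]; [exact E|].
now apply IH, one_K1_inj, K1_inj.
Qed.

(** The n factors z / (1 + z)^2 absorb a singularity |z|^{-n} at 0; the weight of z (z - A)^{-1}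
    then still gives decay there. This admits z^{-al} and the truncation errors of its integral
    representation. *)
Lemma good_pow_weight n r B : (1 <= n)%nat -> lc r -> 0 <= B ->
  (forall t w u, side t w -> Cmod (r (u, t)) <= B * (1 + exp (- (INR n * u)))) ->
  good (fun w => Cpow (qq w) n * r w)%C (2 * 16 ^ n * B) 1.
Proof.
intros Hn Hr HB Hb.
assert (H16 : 0 < 16 ^ n) by (apply pow_lt; lra).
split; [apply lc_mult; [apply holo_lc, holo_pow, holo_qq|exact Hr]|].
split; [nra|]; split; [lra|]; intros t w u Hs.
assert (Ht := side_t t w Hs).
rewrite Cmod_mult; specialize (Hb t w u Hs).
assert (He := exp_pos u).
assert (Hq : Cmod (Cpow (qq (u, t)) n) <= 16 ^ n * (exp u / (1 + exp u) ^ 2) ^ n).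
{ rewrite Cmod_pow, <- Rpow_mult_distr; apply pow_incr; split; [apply Cmod_ge_0|].
  unfold qq; rewrite Cmod_mult.
  assert (S1 := cexp_sig_bound u t Ht); assert (S2 := sig_bound u t Ht).
  apply Rle_trans with (4 * (exp u / (1 + exp u)) * (4 / (1 + exp u))).
  - apply Rmult_le_compat; auto using Cmod_ge_0.
  - right; field; lra. }
assert (Hr1 := ratio_dexp u).
assert (key : (exp u / (1 + exp u) ^ 2) ^ n * (1 + exp (- (INR n * u))) * (exp u / (1 + exp u))
   <= 2 * dexp 1 0 u).
{ rewrite Rmult_plus_distr_l, Rmult_1_r, Rmult_plus_distr_r.
  destruct n as [|k]; [lia|].
  assert (Hrat : 0 <= exp u / (1 + exp u) ^ 2) by (apply Rdiv_le_0_compat; [lra|nra]).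
  assert (Hrat1 : exp u / (1 + exp u) ^ 2 <= 1).
  { apply Rle_trans with (1 := Hr1), dexp_le_1; lra. }
  destruct (ratio_le_1 u) as [R1 R2].
  assert (P1 : (exp u / (1 + exp u) ^ 2) ^ S k * (exp u / (1 + exp u)) <= dexp 1 0 u).
  { rewrite <- tech_pow_Rmult.
    assert (Hk : 0 <= (exp u / (1 + exp u) ^ 2) ^ k <= 1).
    { split; [now apply pow_le|]; apply Rle_trans with (1 ^ k); [apply pow_incr; lra|rewrite pow1; lra]. }
    apply Rle_trans with (dexp 1 0 u * 1 * 1); [|lra].
    assert (Hd := dexp_pos 1 0 u).
    apply Rmult_le_compat; try lra; [apply Rmult_le_pos; lra|].
    apply Rmult_le_compat; lra. }
  assert (P2 : (exp u / (1 + exp u) ^ 2) ^ S k * exp (- (INR (S k) * u)) * (exp u / (1 + exp u))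
    <= dexp 1 0 u); [|lra].
  replace (- (INR (S k) * u)) with (INR (S k) * (- u)) by ring.
  rewrite <- exp_INR_mult, exp_Ropp, <- Rpow_mult_distr.
  replace (exp u / (1 + exp u) ^ 2 * / exp u) with (/ (1 + exp u) ^ 2) by (field; lra).
  assert (Hi : 0 <= / (1 + exp u) ^ 2 <= 1).
  { split; [apply Rlt_le, Rinv_0_lt_compat; nra|].
    rewrite <- Rinv_1; apply Rinv_le_contravar; nra. }
  assert (Hk : 0 <= (/ (1 + exp u) ^ 2) ^ k <= 1).
  { split; [now apply pow_le|]; apply Rle_trans with (1 ^ k); [apply pow_incr; lra|rewrite pow1; lra]. }
  rewrite <- tech_pow_Rmult.
  apply Rle_trans with (1 * (exp u / (1 + exp u) ^ 2)); [|lra].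
  replace (/ (1 + exp u) ^ 2 * (/ (1 + exp u) ^ 2) ^ k * (exp u / (1 + exp u))) with
    ((/ (1 + exp u) ^ 2) ^ k * / (1 + exp u) * (exp u / (1 + exp u) ^ 2)) by (field; lra).
  apply Rmult_le_compat_r; [exact Hrat|].
  assert (Hj : 0 < / (1 + exp u) <= 1).
  { split; [apply Rinv_0_lt_compat; lra|rewrite <- Rinv_1; apply Rinv_le_contravar; lra]. }
  apply Rle_trans with (1 * 1); [apply Rmult_le_compat; lra|lra]. }
destruct (ratio_le_1 u) as [R1 R2].
apply Rle_trans with (16 ^ n * (exp u / (1 + exp u) ^ 2) ^ n * (B * (1 + exp (- (INR n * u)))) *
  (exp u / (1 + exp u))).
- apply Rmult_le_compat_r; [exact R1|].
  apply Rmult_le_compat; auto using Cmod_ge_0.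
- replace (16 ^ n * (exp u / (1 + exp u) ^ 2) ^ n * (B * (1 + exp (- (INR n * u)))) *
    (exp u / (1 + exp u))) with (16 ^ n * B * ((exp u / (1 + exp u) ^ 2) ^ n *
    (1 + exp (- (INR n * u))) * (exp u / (1 + exp u)))) by ring.
  replace (2 * 16 ^ n * B * dexp 1 0 u) with (16 ^ n * B * (2 * dexp 1 0 u)) by ring.
  apply Rmult_le_compat_l; [nra|exact key].
Qed.

Lemma Kr_Y x v : Y x (RtoC (- v)) = Kr (exp v) x.
Proof.
unfold Y, Kr; replace (cexp (RtoC (- v))) with (RtoC (/ exp v)); [reflexivity|].
rewrite <- exp_Ropp; unfold cexp; simpl; rewrite cos_0, sin_0.
apply injective_projections; simpl; ring.
Qed.

(** K_{e^v} is [Y] on the positive axis at the point e^{-v}, so [Y_lip] applies to nearby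
    parameters; distant ones are covered by uniform boundedness. *)
Lemma Kr_lip v v' x : |{Kr (exp v') x - Kr (exp v) x}| <= L0 * Rabs (v' - v) * |{x}|.
Proof.
assert (HPI := PI_RGT_0); assert (Hx := vnorm_ge_0 x).
destruct (Rle_dec (Rabs (v' - v)) 1) as [H1|H1].
- rewrite <- !Kr_Y; unfold RtoC.
  replace (Rabs (v' - v)) with (Rabs (- v' - - v)) in *
    by (replace (- v' - - v) with (- (v' - v)) by ring; apply Rabs_Ropp).
  apply (Y_lip); [lra|exact H1].
- apply Rle_trans with (1 := norm_minus_le _ _).
  assert (B1 := Kr_bdd (exp v) (exp_pos v) x).
  assert (B2 := Kr_bdd (exp v') (exp_pos v') x).
  apply Rle_trans with (2 * c0 * |{x}|); [lra|].
  apply Rmult_le_compat_r; [exact Hx|]; unfold L0.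
  assert (He := exp_ineq1_le 1).
  assert (H2 : 1 * (c0 * (1 + c0)) <= exp 1 * (c0 * (1 + c0))) by (apply Rmult_le_compat_r; nra).
  nra.
Qed.

Lemma good_ext p r K d : (forall w, p w = r w) -> good p K d -> good r K d.
Proof.
intros E [Hl [HK [Hd Hb]]]; split; [|split; [exact HK|split; [exact Hd|]]].
- intros t w u Hs; destruct (Hl t w u Hs) as [L HL]; exists L; intros y; rewrite <- !E; apply HL.
- intros t w u; rewrite <- E; apply Hb.
Qed.

Lemma good_sub p r K K' d : good p K d -> good r K' d -> good (fun w => p w - r w)%C (K + K') d.
Proof.
intros [Hl [HK [Hd Hb]]] [Hl' [HK' [_ Hb']]].
split; [now apply lc_sub|split; [lra|split; [exact Hd|]]].
intros t w u Hs; specialize (Hb t w u Hs); specialize (Hb' t w u Hs).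
assert (Ht := Cmod_triangle (p (u, t)) (- r (u, t))); rewrite Cmod_opp in Ht.
destruct (ratio_le_1 u) as [R1 _].
apply Rle_trans with ((Cmod (p (u, t)) + Cmod (r (u, t))) * (exp u / (1 + exp u))); [|lra].
now apply Rmult_le_compat_r.
Qed.

Lemma good_scal (c : C) p K d : good p K d -> good (fun w => c * p w)%C (Cmod c * K) d.
Proof.
intros [Hl [HK [Hd Hb]]]; assert (Hc := Cmod_ge_0 c).
split; [apply lc_mult; [apply holo_lc, holo_const|exact Hl]|split; [now apply Rmult_le_pos|split; [exact Hd|]]].
intros t w u Hs; rewrite Cmod_mult, !Rmult_assoc; apply Rmult_le_compat_l; [exact Hc|now apply (Hb t w u)].
Qed.

(** * Fractional powers as integrals over the real line *)

Section Exponent.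

Variables (al : R) (n m : nat).
Hypothesis Hal : 0 < al.
Hypothesis Haln : al < INR n.
Hypothesis Hnm : (n <= m)%nat.

(* [gs (log z)] and [gx] are the integrands representing [z^{-al}] and
   [A^{-al} x]. *)
Definition gs (w : C) (v : R) : C := (RtoC (exp (al * v)) * Cpow (sig (v + w)) m)%C.
Definition gx (x : H) (v : R) : H := (RtoC (exp (al * v)) * Nat.iter m (Kr (exp v)) x)%V.

(** Decay rate of e^{al v} (1 + e^v)^{-n}: al towards - oo and n - al towards + oo. *)
Definition de : R := Rmin al (INR n - al).

Lemma de_pos : 0 < de.
Proof. apply Rmin_glb_lt; lra. Qed.

Lemma n_ge_1 : (1 <= n)%nat.
Proof. apply (INR_lt 0 n); simpl; apply Rlt_trans with al; assumption. Qed.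

(** For v >= 0 only n of the m factors are used, through (1 + e^{v+u})^n >= e^{n(v+u)}. The price
    e^{-nu} of centring the majorant at v = 0 for every u is what [good_pow_weight] allows. *)
Lemma ratio_pow_dexp v u : exp (al * v) / (1 + exp (v + u)) ^ m <= (1 + exp (- (INR n * u))) * dexp de 0 v.
Proof.
assert (D1 : de <= al) by apply Rmin_l; assert (D2 : de <= INR n - al) by apply Rmin_r.
assert (D3 := de_pos); assert (He := exp_pos (v + u)); assert (Hn := exp_pos (- (INR n * u))).
assert (Ha := exp_pos (al * v)).
assert (Hp : 1 <= (1 + exp (v + u)) ^ m) by (apply pow_R1_Rle; lra).
unfold dexp; rewrite Rminus_0_r.
destruct (Rle_dec 0 v) as [H0|H0].
- assert (Hq : exp (INR n * (v + u)) <= (1 + exp (v + u)) ^ m).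
  { apply Rle_trans with ((1 + exp (v + u)) ^ n); [|apply Rle_pow; [lra|exact Hnm]].
    rewrite <- exp_INR_mult; apply pow_incr; lra. }
  apply Rle_trans with (exp (- (INR n * u)) * exp (- ((INR n - al) * v))).
  + apply Rmult_le_reg_r with ((1 + exp (v + u)) ^ m); [lra|].
    unfold Rdiv; rewrite Rmult_assoc, Rinv_l, Rmult_1_r by lra.
    apply Rle_trans with (exp (- (INR n * u)) * exp (- ((INR n - al) * v)) * exp (INR n * (v + u))).
    * right; rewrite <- !exp_plus; f_equal; ring.
    * apply Rmult_le_compat_l; [|exact Hq]; apply Rmult_le_pos; apply Rlt_le, exp_pos.
  + rewrite Rabs_pos_eq by lra; apply Rmult_le_compat; try apply Rlt_le, exp_pos; [lra|].
    apply exp_le, Ropp_le_contravar, Rmult_le_compat_r; lra.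
- apply Rle_trans with (1 * exp (al * v)).
  + rewrite Rmult_1_l; apply Rmult_le_reg_r with ((1 + exp (v + u)) ^ m); [lra|].
    unfold Rdiv; rewrite Rmult_assoc, Rinv_l, Rmult_1_r by lra; nra.
  + rewrite Rabs_left by lra; apply Rmult_le_compat; try lra.
    apply exp_le; nra.
Qed.

Lemma gs_bound v u t : - tp <= t <= tp ->
  Cmod (gs (u, t) v) <= 4 ^ m * (1 + exp (- (INR n * u))) * dexp de 0 v.
Proof.
intros Ht; unfold gs; rewrite sig_shift, Cmod_mult, Cmod_R, Rabs_pos_eq, Cmod_pow
  by apply Rlt_le, exp_pos.
assert (He := exp_pos (v + u)).
apply Rle_trans with (exp (al * v) * (4 / (1 + exp (v + u))) ^ m).
- apply Rmult_le_compat_l; [apply Rlt_le, exp_pos|]; apply pow_incr; split; [apply Cmod_ge_0|].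
  now apply sig_bound.
- unfold Rdiv; rewrite Rpow_mult_distr, pow_inv.
  assert (Hr := ratio_pow_dexp v u).
  replace (exp (al * v) * (4 ^ m * / (1 + exp (v + u)) ^ m)) with
    (4 ^ m * (exp (al * v) / (1 + exp (v + u)) ^ m)) by (unfold Rdiv; ring).
  rewrite Rmult_assoc; apply Rmult_le_compat_l; [apply pow_le; lra|exact Hr].
Qed.

Lemma gx_bound x v : |{gx x v}| <= 2 * c0 ^ m * |{x}| * dexp de 0 v.
Proof.
unfold gx; apply Rle_trans with (1 := norm_scal_R _ _).
rewrite Rabs_pos_eq by apply Rlt_le, exp_pos; assert (He := exp_pos v).
assert (Hc := Rdiv_le_0_compat c0 (1 + exp v) ltac:(lra) ltac:(lra)).
assert (B := bdd_iter _ _ m Hc (Kr_bdd_div (exp v) He) x).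
assert (Hr := ratio_pow_dexp v 0); assert (Hx := vnorm_ge_0 x).
rewrite Rplus_0_r, Rmult_0_r, Ropp_0, exp_0 in Hr.
apply Rle_trans with (exp (al * v) * ((c0 / (1 + exp v)) ^ m * |{x}|)).
- apply Rmult_le_compat_l; [apply Rlt_le, exp_pos|exact B].
- unfold Rdiv; rewrite Rpow_mult_distr, pow_inv.
  replace (exp (al * v) * (c0 ^ m * / (1 + exp v) ^ m * |{x}|)) with
    (c0 ^ m * |{x}| * (exp (al * v) / (1 + exp v) ^ m)) by (unfold Rdiv; ring).
  replace (2 * c0 ^ m * |{x}| * dexp de 0 v) with (c0 ^ m * |{x}| * ((1 + 1) * dexp de 0 v)) by ring.
  apply Rmult_le_compat_l; [|exact Hr].
  apply Rmult_le_pos; [apply pow_le; lra|exact Hx].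
Qed.

(* Lipschitz constants on [-N, N]: [Ls] of [gs], [Lx] of [gx]. *)
Definition eN N : R := exp (al * N) * (al * exp (al * (2 * N))).
Definition Ls N : R := eN N * 4 ^ m + exp (al * N) * (INR m * 4 ^ m * (16 * exp 1)).
Definition Lx N : R := eN N * c0 ^ m + exp (al * N) * (INR m * c0 ^ m * L0).

Lemma eN_pos N : 0 <= eN N.
Proof. unfold eN; assert (H1 := exp_pos (al * N)); assert (H2 := exp_pos (al * (2 * N))); repeat apply Rmult_le_pos; lra. Qed.

Lemma Ls_pos N : 0 <= Ls N.
Proof.
unfold Ls; assert (H1 := eN_pos N); assert (H2 := exp_pos (al * N)); assert (H3 := exp_pos 1).
assert (H4 : 0 < 4 ^ m) by (apply pow_lt; lra); assert (H5 := pos_INR m).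
apply Rplus_le_le_0_compat; repeat first [lra|apply Rmult_le_pos].
Qed.

Lemma Lx_pos N : 0 <= Lx N.
Proof.
unfold Lx; assert (H1 := eN_pos N); assert (H2 := exp_pos (al * N)).
assert (H4 : 0 < c0 ^ m) by (apply pow_lt; lra); assert (H5 := pos_INR m).
assert (H3 := L0_pos).
apply Rplus_le_le_0_compat; repeat first [lra|apply Rmult_le_pos].
Qed.

Lemma gs_lip N v v' u t : - tp <= t <= tp -> - N <= v <= N -> - N <= v' <= N ->
  Cmod (gs (u, t) v' - gs (u, t) v) <= Ls N * Rabs (v' - v).
Proof.
intros Ht Hv Hv'; unfold gs.
replace (RtoC (exp (al * v')) * Cpow (sig (v' + (u, t))) m - RtoC (exp (al * v)) * Cpow (sig (v + (u, t))) m)%C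
 with ((RtoC (exp (al * v')) - RtoC (exp (al * v))) * Cpow (sig (v' + (u, t))) m +
  RtoC (exp (al * v)) * (Cpow (sig (v' + (u, t))) m - Cpow (sig (v + (u, t))) m))%C by ring.
apply Rle_trans with (1 := Cmod_triangle _ _); rewrite !Cmod_mult, <- RtoC_minus, !Cmod_R.
rewrite (Rabs_pos_eq (exp _)) by apply Rlt_le, exp_pos.
assert (B1 := exp_scal_lip al N v v' ltac:(lra) Hv Hv'); fold (eN N) in B1.
assert (B2 := sigpow_bound v' m u t Ht).
assert (B3 := sigpow_lip (v + u) (v' + u) t m Ht).
rewrite <- !sig_shift in B3; replace (v' + u - (v + u)) with (v' - v) in B3 by ring.
assert (B4 : exp (al * v) <= exp (al * N)) by (apply exp_le, Rmult_le_compat_l; lra).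
assert (P1 := Rmult_le_compat _ _ _ _ (Rabs_pos _) (Cmod_ge_0 _) B1 B2).
assert (P2 := Rmult_le_compat _ _ _ _ (Rlt_le _ _ (exp_pos _)) (Cmod_ge_0 _) B4 B3).
unfold Ls; lra.
Qed.

Lemma gx_lip N v v' x : - N <= v <= N -> - N <= v' <= N ->
  |{gx x v' - gx x v}| <= Lx N * |{x}| * Rabs (v' - v).
Proof.
intros Hv Hv'; unfold gx.
set (a := Nat.iter m (Kr (exp v)) x); set (a' := Nat.iter m (Kr (exp v')) x).
replace (RtoC (exp (al * v')) * a' - RtoC (exp (al * v)) * a)%V with
 (RtoC (exp (al * v') - exp (al * v)) * a' + RtoC (exp (al * v)) * (a' - a))%V by module.
apply Rle_trans with (1 := norm_tri _ _); rewrite !norm_scal_R_eq.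
rewrite (Rabs_pos_eq (exp (al * v))) by apply Rlt_le, exp_pos.
assert (Hx := vnorm_ge_0 x); assert (Hl := L0_pos); assert (Hr := Rabs_pos (v' - v)).
assert (B1 := exp_scal_lip al N v v' ltac:(lra) Hv Hv'); fold (eN N) in B1.
assert (B2 := bdd_iter _ c0 m ltac:(lra) (Kr_bdd (exp v') (exp_pos v')) x); fold a' in B2.
assert (B3 := iter_diff (Kr (exp v')) (Kr (exp v)) c0 (L0 * Rabs (v' - v)) m x
  (Kr_lin _ (exp_pos _)) Hc0 ltac:(nra) (Kr_bdd _ (exp_pos v'))
  (Kr_bdd _ (exp_pos v))
  (Kr_lip v v')); fold a a' in B3.
assert (B4 : exp (al * v) <= exp (al * N)) by (apply exp_le, Rmult_le_compat_l; lra).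
assert (P1 := Rmult_le_compat _ _ _ _ (Rabs_pos _) (vnorm_ge_0 _) B1 B2).
assert (P2 := Rmult_le_compat _ _ _ _ (Rlt_le _ _ (exp_pos _)) (vnorm_ge_0 _) B4 B3).
unfold Lx; lra.
Qed.

Lemma gs_cont u t (v : R) : - tp <= t <= tp -> continuous (fun v => gs (u, t) v : VC) v.
Proof.
intros Ht; apply (lip_cont VC _ (Ls (Rabs v + 1))); intros y Hy.
change (Cmod (gs (u, t) y - gs (u, t) v) <= Ls (Rabs v + 1) * Rabs (y - v)).
assert (H1 := Rabs_le_between v (Rabs v)); destruct (proj1 H1 (Rle_refl _)).
apply Rabs_lt_between in Hy; apply gs_lip; [exact Ht|lra|lra].
Qed.

Lemma gx_cont x (v : R) : continuous (gx x) v.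
Proof.
apply (lip_cont H _ (Lx (Rabs v + 1) * |{x}|)); intros y Hy.
assert (H1 := Rabs_le_between v (Rabs v)); destruct (proj1 H1 (Rle_refl _)).
apply Rabs_lt_between in Hy; apply gx_lip; lra.
Qed.

Lemma gs_lip_u N v u u' t : - tp <= t <= tp -> - N <= v <= N ->
  Cmod (gs (u', t) v - gs (u, t) v) <= Ls N * Rabs (u' - u).
Proof.
intros Ht Hv; unfold gs.
replace (RtoC (exp (al * v)) * Cpow (sig (v + (u', t))) m - RtoC (exp (al * v)) * Cpow (sig (v + (u, t))) m)%C
 with (RtoC (exp (al * v)) * (Cpow (sig (v + (u', t))) m - Cpow (sig (v + (u, t))) m))%C by ring.
rewrite Cmod_mult, Cmod_R, Rabs_pos_eq by apply Rlt_le, exp_pos.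
assert (B3 := sigpow_lip (v + u) (v + u') t m Ht).
rewrite <- !sig_shift in B3; replace (v + u' - (v + u)) with (u' - u) in B3 by ring.
assert (B4 : exp (al * v) <= exp (al * N)) by (apply exp_le, Rmult_le_compat_l; lra).
assert (P2 := Rmult_le_compat _ _ _ _ (Rlt_le _ _ (exp_pos _)) (Cmod_ge_0 _) B4 B3).
assert (P1 : 0 <= eN N * 4 ^ m * Rabs (u' - u)).
{ apply Rmult_le_pos; [|apply Rabs_pos]; apply Rmult_le_pos; [apply eN_pos|apply pow_le; lra]. }
unfold Ls; lra.
Qed.

(** Truncation of the scalar integral representing a multiple of z^{-al}; the upper limit is
    separate because [EE_exchange] varies it. *)
Definition hh (N b : R) (w : C) : C := RI (V := VC) (gs w) (- N) b.

Lemma hh_lc N b : - N <= b <= N -> lc (hh N b).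
Proof.
intros Hb t w u Hs; assert (Ht := side_t t w Hs).
exists (Ls N * (b - - N)); intros y Hy; unfold hh.
change (|{RI (V := VC) (gs (y, t)) (- N) b - RI (V := VC) (gs (u, t)) (- N) b}| <=
  Ls N * (b - - N) * Rabs (y - u)).
rewrite <- (RI_minus VC) by (intros v; now apply gs_cont).
replace (Ls N * (b - - N) * Rabs (y - u)) with (Ls N * Rabs (y - u) * (b - - N)) by ring.
apply (RI_norm_const VC); [lra| |].
- intros v; apply (@continuous_minus _ C_AbsRing VC); now apply gs_cont.
- intros v Hv; exact (gs_lip_u N v u y t Ht ltac:(lra)).
Qed.

Notation qn w := (Cpow (qq w) n).

(** Up to the factor 2 pi i, the operator (e p)(A) with e the regularizer of order n. *)
Definition EE (p : C -> C) (x : H) : H := iota (fun l => Lam (fun w => qn w * p w)%C x l).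

Lemma EE_spec p K x : good (fun w => qn w * p w)%C K 1 -> Lam (fun w => qn w * p w)%C x (EE p x).
Proof.
intros Hg; unfold EE; apply (@iota_correct C_AbsRing H).
destruct (Lam_ex _ _ _ x Hg) as [l [Hl _]]; exists l; split; [exact Hl|].
intros l' Hl'; exact (Lam_unique _ _ _ _ Hl Hl').
Qed.

Lemma EE_unique p x l : Lam (fun w => qn w * p w)%C x l -> EE p x = l.
Proof.
intros Hl; unfold EE; apply (@iota_unique C_AbsRing H); [|exact Hl].
intros l' Hl'; exact (Lam_unique _ _ _ _ Hl' Hl).
Qed.

Lemma good_one : good (fun w => qn w * 1)%C (16 ^ n * 1) 1.
Proof.
apply good_pow_mult; [apply n_ge_1|apply holo_lc, holo_const|lra|].
intros; rewrite Cmod_1; lra.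
Qed.

Lemma EE_lin : lin (EE (fun _ => 1)).
Proof.
set (S := fun x => EE_spec _ _ x good_one).
assert (Hc : lc (fun w => qn w * 1)%C) by apply good_one.
assert (Hsub : forall x y, EE (fun _ => 1) (x - y)%V = (EE (fun _ => 1) x - EE (fun _ => 1) y)%V).
{ intros x y; apply EE_unique; exact (Lam_sub_x _ _ _ _ _ Hc (S x) (S y)). }
assert (Hsc : forall c x, EE (fun _ => 1) (c * x)%V = (c * EE (fun _ => 1) x)%V).
{ intros c x; apply EE_unique; exact (Lam_scal _ c _ _ Hc (S x)). }
split.
- intros x y; replace (x + y)%V with (x - (- RtoC 1)%C * y)%V by module.
  rewrite Hsub, Hsc; module.
- exact Hsc.
- assert (H16 : 0 < 16 ^ n) by (apply pow_lt; lra).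
  exists (4 * (16 ^ n * 1) * c0 / 1); split; [unfold Rdiv; rewrite Rinv_1; repeat first [lra|apply Rmult_lt_0_compat]|].
  intros x; apply (Lam_norm _ _ _ _ _ good_one (S x)).
Qed.

Lemma EE_norm p K x : good (fun w => qn w * p w)%C K 1 -> |{EE p x}| <= 4 * K * c0 * |{x}|.
Proof.
intros Hg; assert (Hn := Lam_norm _ _ _ _ _ Hg (EE_spec p K x Hg)).
unfold Rdiv in Hn; now rewrite Rinv_1, Rmult_1_r in Hn.
Qed.

Lemma lc_gs v : lc (fun w => gs w v).
Proof.
apply holo_lc, holo_mult; [apply holo_const|apply holo_pow, holo_sig_shift].
Qed.

Lemma gs_good v : exists K, good (fun w => qn w * gs w v)%C K 1.
Proof.
exists (16 ^ n * (exp (al * v) * 4 ^ m)).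
assert (H4 : 0 < 4 ^ m) by (apply pow_lt; lra); assert (He := exp_pos (al * v)).
apply good_pow_mult; [apply n_ge_1|apply lc_gs|nra|].
intros t w u Hs; unfold gs; rewrite Cmod_mult, Cmod_R, Rabs_pos_eq by lra.
apply Rmult_le_compat_l; [lra|]; apply sigpow_bound, (side_t t w Hs).
Qed.

(** For fixed v, [Lam_Kr] used m times moves (1 + e^v z)^{-m} from the multiplier to the vector. *)
Lemma EE_gs v x : EE (fun w => gs w v) x = EE (fun _ => 1) (gx x v).
Proof.
destruct (gs_good v) as [K HK]; assert (Hn := n_ge_1).
unfold gx; rewrite (lin_scal _ EE_lin).
assert (Hp : lc (fun w => qn w * Cpow (sig (v + w)) (m + 0))%C)
  by (apply holo_lc, holo_mult; [apply holo_pow, holo_qq|apply holo_pow, holo_sig_shift]).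
assert (G : good (fun w => qn w * Cpow (sig (v + w)) (m + 0))%C (16 ^ n * 4 ^ m) 1).
{ apply good_pow_mult; [exact Hn| |apply pow_le; lra|].
  - apply holo_lc, holo_pow, holo_sig_shift.
  - intros t w u Hs; rewrite Nat.add_0_r; apply sigpow_bound, (side_t t w Hs). }
destruct (Lam_ex _ _ _ x G) as [l [Hl _]].
assert (H1 := Lam_Kr_pow n v m Hn 0%nat x l Hl).
rewrite (EE_unique (fun _ => 1) (Nat.iter m (Kr (exp v)) x) l).
- apply EE_unique; apply (Lam_ext) with (2 := Lam_scal_p _ (RtoC (exp (al * v))) _ _ Hp Hl).
  intros t w u _; unfold gs; rewrite Nat.add_0_r; ring.
- apply (Lam_ext) with (2 := H1); intros t w u _; simpl; ring.
Qed.

Lemma hh_good N b : - N <= b <= N -> exists K, good (fun w => qn w * hh N b w)%C K 1.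
Proof.
intros Hb; exists (16 ^ n * (exp (al * N) * 4 ^ m * (b - - N))).
assert (H4 : 0 < 4 ^ m) by (apply pow_lt; lra); assert (He := exp_pos (al * N)).
apply good_pow_mult; [apply n_ge_1|now apply hh_lc|repeat first [lra|apply Rmult_le_pos]|].
intros t w u Hs; assert (Ht := side_t t w Hs); unfold hh.
change (|{RI (V := VC) (gs (u, t)) (- N) b}| <= exp (al * N) * 4 ^ m * (b - - N)).
apply (RI_norm_const VC); [lra|intros v; now apply gs_cont|].
intros v Hv; change (Cmod (gs (u, t) v) <= exp (al * N) * 4 ^ m).
unfold gs; rewrite Cmod_mult, Cmod_R, Rabs_pos_eq by (apply Rlt_le, exp_pos).
apply Rmult_le_compat; auto using Cmod_ge_0, Rlt_le, exp_pos.
- apply exp_le, Rmult_le_compat_l; lra.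
- now apply sigpow_bound.
Qed.

Lemma EE_sub p r K K' x : lc p -> lc r ->
  good (fun w => qn w * p w)%C K 1 -> good (fun w => qn w * r w)%C K' 1 ->
  EE (fun w => p w - r w)%C x = (EE p x - EE r x)%V.
Proof.
intros Hp Hr Gp Gr; apply EE_unique.
apply (Lam_ext) with (fun w => qn w * p w - qn w * r w)%C; [intros; ring|].
apply Lam_sub; [apply Gp|apply Gr|apply (EE_spec _ _ _ Gp)|apply (EE_spec _ _ _ Gr)].
Qed.

Lemma EE_scal_p (c : C) p K x : good (fun w => qn w * p w)%C K 1 ->
  EE (fun w => c * p w)%C x = (c * EE p x)%V.
Proof.
intros Gp; apply EE_unique.
apply (Lam_ext) with (fun w => c * (qn w * p w))%C; [intros; ring|].
apply Lam_scal_p; [apply Gp|apply (EE_spec _ _ _ Gp)].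
Qed.

(* Both sides have the same derivative in [b], by [EE_gs]. *)
Lemma EE_exchange N b x : - N <= b <= N ->
  EE (hh N b) x = EE (fun _ => 1) (RI (gx x) (- N) b).
Proof.
intros Hb; assert (Hx := vnorm_ge_0 x).
assert (H16 : 0 < 16 ^ n) by (apply pow_lt; lra).
destruct (lin_bdd _ EE_lin) as [ce [Hce Bce]]; apply Rlt_le in Hce.
apply minus_zero_eq.
transitivity ((fun b => EE (hh N b) x - EE (fun _ => 1) (RI (gx x) (- N) b))%V (- N)).
- apply (quad_const (fun b => EE (hh N b) x - EE (fun _ => 1) (RI (gx x) (- N) b))%V (- N) b
    (4 * (16 ^ n * Ls N) * c0 * |{x}| + ce * (Lx N * |{x}|))); [lra|].
  intros u v Hu Huv Hv.
  destruct (hh_good N u) as [K1 G1]; [lra|]; destruct (hh_good N v) as [K2 G2]; [lra|].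
  destruct (gs_good u) as [K3 G3].
  assert (L1 := hh_lc N u ltac:(lra)); assert (L2 := hh_lc N v ltac:(lra)); assert (L3 := lc_gs u).
  (* First-order remainder of [hh] in its upper limit: it is quadratic in v - u uniformly on the
     contour, so [EE_norm] makes [EE rho x] quadratically small. *)
  set (rho := fun w => (hh N v w - hh N u w - RtoC (v - u) * gs w u)%C).
  assert (Lr : lc rho).
  { apply lc_sub; [now apply lc_sub|]; apply lc_mult; [apply holo_lc, holo_const|exact L3]. }
  assert (Hrho : good (fun w => qn w * rho w)%C (16 ^ n * (Ls N * (v - u) ^ 2)) 1).
  { apply good_pow_mult; [apply n_ge_1|exact Lr| |].
    - apply Rmult_le_pos; [apply Ls_pos|apply pow2_ge_0].
    - intros t w y Hs; assert (Ht := side_t t w Hs); unfold rho, hh.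
      assert (Hc : forall v : R, continuous (fun v => gs (y, t) v : VC) v) by (intros; now apply gs_cont).
      assert (E : (RI (V := VC) (gs (y, t)) (- N) u + RI (V := VC) (gs (y, t)) u v)%C =
        RI (V := VC) (gs (y, t)) (- N) v) by exact (RI_Chasles VC _ (- N) u v Hc).
      replace (RI (V := VC) (gs (y, t)) (- N) v - RI (V := VC) (gs (y, t)) (- N) u - RtoC (v - u) * gs (y, t) u)%C
       with (RI (V := VC) (gs (y, t)) u v - RtoC (v - u) * gs (y, t) u)%C.
      + replace (Ls N * (v - u) ^ 2) with (Ls N * (v - u) * (v - u)) by ring.
        apply (RI_quad VC (gs (y, t)) u v); [exact Huv|exact Hc|].
        intros z Hz; apply Rle_trans with (1 := gs_lip N u z y t Ht ltac:(lra) ltac:(lra)).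
        rewrite Rabs_pos_eq by lra; apply Rmult_le_compat_l; [apply Ls_pos|lra].
      + rewrite <- E; ring. }
  assert (E1 : EE rho x = (EE (hh N v) x - EE (hh N u) x - RtoC (v - u) * EE (fun w => gs w u) x)%V).
  { assert (G4 : good (fun w => qn w * (hh N v w - hh N u w))%C (K2 + K1) 1).
    { apply good_ext with (2 := good_sub _ _ _ _ _ G2 G1); intros; ring. }
    assert (G5 : good (fun w => qn w * (RtoC (v - u) * gs w u))%C (Cmod (RtoC (v - u)) * K3) 1).
    { apply good_ext with (2 := good_scal (RtoC (v - u)) _ _ _ G3); intros; ring. }
    unfold rho; rewrite (EE_sub (fun w => hh N v w - hh N u w)%C _ _ _ x) with (3 := G4) (4 := G5).
    - now rewrite (EE_sub _ _ _ _ x L2 L1 G2 G1), (EE_scal_p _ _ _ x G3).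
    - now apply lc_sub.
    - apply lc_mult; [apply holo_lc, holo_const|exact L3]. }
  assert (B1 := EE_norm _ _ x Hrho).
  set (r2 := (RI (gx x) u v - RtoC (v - u) * gx x u)%V).
  assert (B2 : |{r2}| <= Lx N * |{x}| * (v - u) * (v - u)).
  { apply (RI_quad H); [exact Huv|intros; apply gx_cont|].
    intros z Hz; apply Rle_trans with (1 := gx_lip N u z x ltac:(lra) ltac:(lra)).
    rewrite Rabs_pos_eq by lra; apply Rmult_le_compat_l; [|lra].
    apply Rmult_le_pos; [apply Lx_pos|exact Hx]. }
  assert (E := RI_Chasles H _ (- N) u v (gx_cont x)).
  replace (EE (hh N v) x - EE (fun _ => 1) (RI (gx x) (- N) v) -
   (EE (hh N u) x - EE (fun _ => 1) (RI (gx x) (- N) u)))%V with (EE rho x - EE (fun _ => 1) r2)%V.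
  + apply Rle_trans with (1 := norm_minus_le _ _).
    assert (B3 := Bce r2); assert (B4 := Rmult_le_compat_l ce _ _ Hce B2); nra.
  + unfold r2; rewrite E1, <- E, (lin_sub _ _ _ EE_lin), (lin_add _ EE_lin), (lin_scal _ EE_lin), EE_gs.
    module.
- cbv beta; rewrite RI_point, (lin_zero _ EE_lin).
  replace (EE (hh N (- N)) x) with (@vzero H); [module|].
  symmetry; apply EE_unique.
  replace (@vzero H) with (RtoC 0 * EE (fun _ => 1) x)%V by module.
  apply (Lam_ext) with (fun w => 0 * (qn w * 1))%C.
  + intros t w u _; unfold hh; rewrite RI_point; change (@vzero VC) with (RtoC 0); ring.
  + apply Lam_scal_p; [apply good_one|apply (EE_spec _ _ _ good_one)].
Qed.

(** Scaling profile of the kernel: up to the factor z^{-al}, [gs] depends on v and log z only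
    through their sum ([gs_Phi]). *)
Definition Phi (w : C) : C := (cexp (al * w) * Cpow (sig w) m)%C.

Lemma Phi_holo : holo Phi.
Proof. apply holo_mult; [apply holo_cexp_scale|apply holo_pow, holo_sig]. Qed.

Lemma cexp_al u t : cexp (al * (u, t)) = (RtoC (exp (al * u)) * cexp (al * (0, t)))%C.
Proof.
replace (RtoC (exp (al * u))) with (cexp (RtoC (al * u))).
- rewrite <- cexp_plus; f_equal; apply injective_projections; simpl; ring.
- unfold cexp; simpl; rewrite cos_0, sin_0; apply injective_projections; simpl; ring.
Qed.

Lemma Cmod_cexp_al u t : Cmod (cexp (al * (u, t))) = exp (al * u).
Proof. rewrite Cmod_cexp; simpl; f_equal; ring. Qed.

Lemma Phi_bound u t : - tp <= t <= tp -> Cmod (Phi (u, t)) <= 4 ^ m * 2 * dexp de 0 u.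
Proof.
intros Ht; assert (Hb := gs_bound u 0 t Ht).
rewrite Rmult_0_r, Ropp_0, exp_0 in Hb.
apply Rle_trans with (2 := Hb); right; unfold Phi, gs.
rewrite !Cmod_mult, Cmod_cexp_al, Cmod_R, Rabs_pos_eq by apply Rlt_le, exp_pos.
now rewrite sig_shift, Rplus_0_r.
Qed.

(** Rotation to angle 0 shows that both rays give the same constant, the Beta integral of e^{al u}
    (1 + e^u)^{-m}, whose integrand is positive on the real line. *)
Lemma Phi_LI : exists c : C, c <> 0 /\ forall t w, side t w ->
  LI (V := VC) (fun u => Phi (u, t)) c.
Proof.
assert (H4 : 0 < 4 ^ m) by (apply pow_lt; lra); assert (Htp := tp_pos).
assert (Hd := de_pos).
assert (LI1 : forall t l, LI (V := VC) (fun u => Phi (u, t) * (RtoC 1 : VC))%V l -> LI (V := VC) (fun u => Phi (u, t)) l).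
{ intros t l Hl; apply (LI_ext VC) with (2 := Hl); intros u; exact (Cmult_1_r _). }
destruct (holo_rotation Phi (RtoC 1 : VC) (4 ^ m * 2) de (- tp) 0) as [c [C1 C2]]; try lra.
{ exact Phi_holo. }
{ exact Phi_bound. }
destruct (holo_rotation Phi (RtoC 1 : VC) (4 ^ m * 2) de 0 tp) as [c' [C3 C4]]; try lra.
{ exact Phi_holo. }
{ exact Phi_bound. }
assert (E := LI_unique VC _ _ _ C2 C3); subst c'.
exists c; split.
- intros E; rewrite E in C2.
  set (g := fun u => exp (al * u) * (/ (1 + exp u)) ^ m).
  assert (H1 : (RtoC 1 : VC) = vzero).
  { apply (LI_pos g).
    - intros u; apply (ex_derive_continuous (V := R_NormedModule)); unfold g.
      auto_derive; assert (He := exp_pos u); lra.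
    - intros u; apply Rmult_lt_0_compat; [apply exp_pos|]; apply pow_lt, Rinv_0_lt_compat.
      assert (He := exp_pos u); lra.
    - apply (LI_ext VC) with (2 := C2); intros u; f_equal; unfold Phi, g, sig.
      assert (He := exp_pos u).
      rewrite RtoC_mult, RtoC_pow, RtoC_inv, RtoC_plus by lra; f_equal; [|do 3 f_equal];
      unfold cexp; simpl; rewrite ?Rmult_0_l, ?Rmult_0_r, ?Rplus_0_r, ?cos_0, ?sin_0;
      apply injective_projections; simpl; rewrite ?Rmult_0_l, ?Rmult_0_r, ?Rminus_0_r, ?Rmult_1_r; reflexivity. }
  apply R1_neq_R0; exact (f_equal fst H1).
- intros t w [[-> _]|[-> _]]; apply LI1; assumption.
Qed.

(* [z^{- alpha}] for [z = exp w] *)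
Definition zp (w : C) : C := cexp (- al * w).

Lemma gs_Phi u t v : gs (u, t) v = (Phi ((v + u)%R, t) * zp (u, t))%C.
Proof.
unfold gs, Phi, zp; rewrite sig_shift.
replace (cexp (al * ((v + u)%R, t))) with (RtoC (exp (al * v)) * cexp (al * (u, t)))%C.
- replace (cexp (al * (u, t))) with (/ cexp (- al * (u, t)))%C.
  + field; intros E; assert (H1 : Cmod (cexp (- al * (u, t))) = 0) by (rewrite E; apply Cmod_0).
    rewrite Cmod_cexp in H1; assert (H2 := exp_pos (fst (- al * (u, t))%C)); lra.
  + assert (E : (cexp (- al * (u, t)) * cexp (al * (u, t)))%C = 1).
    { rewrite <- cexp_plus; replace (- al * (u, t) + al * (u, t))%C with (RtoC 0) by ring.
      unfold cexp; simpl; rewrite exp_0, cos_0, sin_0; apply injective_projections; simpl; ring. }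
    assert (Hn : cexp (- al * (u, t)) <> 0).
    { intros E'; rewrite E', Cmult_0_l in E; apply RtoC_inj in E; lra. }
    apply (f_equal (fun z => / cexp (- al * (u, t)) * z)%C) in E.
    rewrite Cmult_assoc, Cinv_l, Cmult_1_l, Cmult_1_r in E by exact Hn; now rewrite E.
- rewrite (cexp_al (v + u)), (cexp_al u), Rmult_plus_distr_l, exp_plus, RtoC_mult; ring.
Qed.

Lemma zp_holo : holo zp.
Proof.
apply holo_ext with (fun w => cexp (RtoC (- al) * w)); [|apply holo_cexp_scale].
intros u t _; unfold zp; now rewrite RtoC_opp.
Qed.

Lemma Cmod_zp u t : Cmod (zp (u, t)) = exp (- (al * u)).
Proof. unfold zp; rewrite Cmod_cexp; simpl; f_equal; ring. Qed.

Lemma zp_good : good (fun w => Cpow (qq w) n * zp w)%C (2 * 16 ^ n * 1) 1.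
Proof.
apply good_pow_weight; [exact (n_ge_1)|apply holo_lc, zp_holo|lra|].
intros t w u _; rewrite Cmod_zp, Rmult_1_l.
assert (H1 := exp_pos (- (INR n * u))).
destruct (Rle_dec 0 u) as [H0|H0].
- apply Rle_trans with 1; [|lra]; rewrite <- exp_0; apply exp_le; nra.
- apply Rle_trans with (exp (- (INR n * u))); [|lra]; apply exp_le; nra.
Qed.

(** By [EE_exchange] the truncated integral of [gx] corresponds to the multiplier [hh N N]. Shifting
    [Phi_LI] by u gives [hh N N] -> c z^{-al} on both rays, with error a multiple of (1 + e^{-nu})
    e^{-de N}, so [good_pow_weight] lets the limit pass through the contour integral. *)
Lemma balakrishnan : exists c : C, c <> 0 /\ forall x y,
  LI (gx x) y -> EE (fun _ => RtoC 1) y = (c * EE zp x)%V.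
Proof.
destruct Phi_LI as [c [Hc Hl]]; exists c; split; [exact Hc|]; intros x y Hy.
assert (H4 : 0 < 4 ^ m) by (apply pow_lt; lra); assert (H16 : 0 < 16 ^ n) by (apply pow_lt; lra).
assert (Hd := de_pos); assert (Hx := vnorm_ge_0 x).
assert (Hlin := EE_lin).
destruct (lin_bdd _ Hlin) as [ce [Hce Bce]].
assert (Hgs : forall t w u, side t w -> LI (V := VC) (gs (u, t)) (c * zp (u, t))%C).
{ intros t w u Hs; assert (Ht := side_t t w Hs).
  assert (Hc1 : forall u : R, continuous (fun u => Phi (u, t) : VC) u).
  { intros y1; apply continuous_ext with (fun u => (Phi (u, t) * (RtoC 1 : VC))%V).
    - intros z; exact (Cmult_1_r _).
    - apply (holo_cont (V := VC)); [exact Ht|exact Phi_holo]. }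
  assert (Hs1 := LI_shift VC _ _ u Hc1 (Hl t w Hs)).
  assert (Hc2 : forall v : R, continuous (fun v => Phi ((v + u)%R, t) : VC) v).
  { intros v; apply (continuous_comp (fun v : R => v + u) (fun v : R => Phi (v, t) : VC)); [|apply Hc1].
    apply (ex_derive_continuous (V := R_NormedModule)); auto_derive; trivial. }
  assert (Hs2 := LI_lin (V := VC) (W := VC) (fun s => zp (u, t) * s)%V _ _ (lin_vscal _) Hc2 Hs1).
  replace (c * zp (u, t))%C with (zp (u, t) * c)%C by ring.
  apply (LI_ext VC) with (2 := Hs2); intros v; rewrite gs_Phi; exact (Cmult_comm _ _). }
set (Q := 4 * 4 ^ m / de).
assert (HQ : 0 <= Q) by (apply Rlt_le, Rdiv_lt_0_compat; lra).
set (P := 4 * (2 * 16 ^ n) * c0 * |{x}|).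
assert (HP : 0 <= P) by (unfold P; repeat first [lra|apply Rmult_le_pos]).
assert (key : forall N, 0 <= N ->
  |{EE (hh N N) x - c * EE zp x}| <= P * (Q * exp (- (de * N)))).
{ intros N HN.
  destruct (hh_good N N) as [K1 G1]; [lra|].
  assert (L1 := hh_lc N N ltac:(lra)).
  assert (G2 : good (fun w => Cpow (qq w) n * (c * zp w))%C (Cmod c * (2 * 16 ^ n * 1)) 1).
  { apply good_ext with (2 := good_scal c _ _ _ zp_good); intros; ring. }
  assert (L2 : lc (fun w => c * zp w)%C) by (apply lc_mult; [apply holo_lc, holo_const|apply holo_lc, zp_holo]).
  rewrite <- (EE_scal_p c zp _ x zp_good).
  rewrite <- (EE_sub _ _ _ _ x L1 L2 G1 G2).
  assert (G3 : good (fun w => Cpow (qq w) n * (hh N N w - c * zp w))%C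
    (2 * 16 ^ n * (Q * exp (- (de * N)))) 1).
  { apply good_pow_weight; [exact (n_ge_1)|now apply lc_sub| |].
    - apply Rmult_le_pos; [exact HQ|apply Rlt_le, exp_pos].
    - intros t w u Hs; assert (Ht := side_t t w Hs).
      assert (He := exp_pos (- (INR n * u))).
      assert (E := LI_tail (gs (u, t) : R -> VC) _ (4 ^ m * (1 + exp (- (INR n * u)))) de N
        (fun v => gs_cont u t v Ht) ltac:(nra) Hd
        (fun v => gs_bound v u t Ht) HN (Hgs t w u Hs)).
      apply Rle_trans with (1 := E); right; unfold Q; field; lra. }
  apply Rle_trans with (1 := EE_norm _ _ x G3).
  right; unfold P; ring. }
apply norm_unique_eps; intros e He.
destruct (Hy (e / (2 * ce))) as [N1 HN1]; [apply Rdiv_lt_0_compat; lra|].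
destruct (exp_small de (e / (2 * (P * Q + 1)))) as [N2 [HN2 HN2']]; [exact Hd|apply Rdiv_lt_0_compat; nra|].
set (N := Rmax N1 N2); assert (M1 := Rmax_l N1 N2); assert (M2 := Rmax_r N1 N2); fold N in M1, M2.
specialize (HN1 (- N) N ltac:(lra) M1); specialize (HN2' N M2); specialize (key N ltac:(lra)).
assert (Ex := EE_exchange N N x ltac:(lra)).
set (X := RI (gx x) (- N) N) in *.
replace (EE (fun _ => RtoC 1) y - c * EE zp x)%V with
  (- EE (fun _ => RtoC 1) (X - y)%V + (EE (hh N N) x - c * EE zp x))%V.
- apply Rle_trans with (1 := norm_tri _ _); rewrite norm_oppV.
  assert (B1 := Bce (X - y)%V); assert (B2 := Rmult_le_compat_l ce _ _ (Rlt_le _ _ Hce) HN1).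
  replace (ce * (e / (2 * ce))) with (e / 2) in B2 by (field; lra).
  assert (B3 : P * (Q * exp (- (de * N))) <= e / 2); [|lra].
  apply Rle_trans with ((P * Q + 1) * (e / (2 * (P * Q + 1)))).
  + assert (HPQ : 0 <= P * Q) by now apply Rmult_le_pos.
    assert (Hx1 := exp_pos (- (de * N))); nra.
  + right; field; nra.
- rewrite Ex, (lin_sub _ _ _ Hlin); module.
Qed.

End Exponent.

(** * Identification with the fractional powers of the statement *)

Lemma resolvent_Rs W z x : dom W -> z = (- W)%C -> resolvent A z x = (- Rs W x)%V.
Proof.
intros HW ->; unfold resolvent, op_inv.
assert (En := lin_neg _ x (Rs_lin W HW)).
 apply (@iota_unique C_AbsRing H).
- intros y [w [Hw E]]; rewrite <- En; apply (Rs_unique); [exact HW|].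
  replace (- x - W * y)%V with w; [exact Hw|].
  rewrite E; change (w = (- (- W * y - w) - W * y)%V); module.
- exists (- W * - Rs W x - x)%V; split.
  + assert (E := Rs_spec W (- x)%V HW); rewrite En in E.
    replace (- W * - Rs W x - x)%V with (- x - W * - Rs W x)%V by module; exact E.
  + change (x = (- W * - Rs W x - (- W * - Rs W x - x))%V); module.
Qed.

(** With r = e^u, dz = z du, and z (z - A)^{-1} = W (W + A)^{-1} for W = - z: the two signs cancel,
    which is why [Y] carries none. *)
Lemma ray_integral_J f p x t w l : side t w -> lc p ->
  (forall u, f (cexp (u, t)) = p (u, t)) -> LI (J p x t w) l ->
  ray_integral A f t x = l.
Proof.
intros Hs Hp Hf Hl; unfold ray_integral.
apply (@is_RInt_gen_unique (real_CompleteNormedModule H)).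
{ apply Proper_StrongProper, at_right_proper_filter. }
{ apply Proper_StrongProper, Rbar_locally_filter. }
apply (LI_is_RInt_gen (J p x t w)); [|exact Hl|].
{ intros u; now apply (J_cont). }
intros r Hr; cbv zeta; unfold J, Y.
assert (HW := sector_dom _ (sector_cexp (ln r) w (side_w t w Hs))).
assert (E := side_cexp t w (ln r) Hs); rewrite cexp_ln in E by exact Hr.
rewrite (resolvent_Rs (cexp (ln r, w))) by assumption.
rewrite <- Hf, (cexp_ln r t) by exact Hr.
change ((f (RtoC r * cis t) * cis t)%C * - Rs (cexp (ln r, w)) x =
  RtoC (/ r) * (f (RtoC r * cis t)%C * (cexp (ln r, w) * Rs (cexp (ln r, w)) x)))%V.
replace (cexp (ln r, w)) with (- (RtoC r * cis t))%C at 2 by (rewrite E; ring).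
rewrite RtoC_inv by lra; module; field.
intros E'; apply RtoC_inj in E'; lra.
Qed.

Lemma sectorial_Lam f p x l : lc p ->
  (forall t w u, side t w -> f (cexp (u, t)) = p (u, t)) -> Lam p x l ->
  sectorial_integral A f x = (/ (RtoC (2 * PI) * Ci) * l)%V.
Proof.
intros Hp Hf [l1 [l2 [H1 [H2 ->]]]]; unfold sectorial_integral.
rewrite (ray_integral_J f p x _ _ l1 side1 Hp (fun u => Hf _ _ u side1) H1
  : ray_integral A f (- (3 * PI / 4)) x = l1).
rewrite (ray_integral_J f p x _ _ l2 side2 Hp (fun u => Hf _ _ u side2) H2
  : ray_integral A f (3 * PI / 4) x = l2).
reflexivity.
Qed.

Lemma up_nat a : 0 < a -> a < INR (Z.to_nat (up a)).
Proof.
intros Ha; destruct (archimed a) as [H1 _].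
assert (H2 : (0 < up a)%Z) by (apply lt_IZR; lra).
rewrite INR_IZR_INZ, Z2Nat.id; [lra|lia].
Qed.

(** By [balakrishnan] the vector y / c solves the equation e(A) y' = (e f)(A) x that defines the
    power; injectivity of e(A) makes it the value returned by [iota]. *)
Lemma neg_frac_power_LI (al : R) (m : nat) :
  0 < al -> (Z.to_nat (up al) <= m)%nat ->
  exists c : C, c <> 0 /\ forall x y, LI (gx al m x) y -> neg_frac_power A al x = (/ c * y)%V.
Proof.
intros Hal Hm; set (n := Z.to_nat (up al)).
assert (Haln : al < INR n) by now apply up_nat.
destruct (balakrishnan al n m Hal Haln Hm) as [c [Hc Hb]].
exists c; split; [exact Hc|]; intros x y Hy; specialize (Hb x y Hy).
assert (Hpi : - PI < - tp /\ tp < PI) by (assert (H1 := PI_RGT_0); unfold tp; lra).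
set (k := (/ (RtoC (2 * PI) * Ci))%C).
assert (Hk : k <> 0).
{ assert (HP := PI_RGT_0); intros E; assert (H1 : (RtoC (2 * PI) * Ci * k)%C = 1).
  { unfold k; apply Cinv_r; intros E'; inversion E'; lra. }
  rewrite E, Cmult_0_r in H1; apply RtoC_inj in H1; lra. }
assert (S1 : forall z, sectorial_integral A (regularizer n) z = (k * EE n (fun _ => RtoC 1) z)%V).
{ intros z; apply (sectorial_Lam _ (fun w => Cpow (qq w) n * 1)%C).
  - apply (good_one al n Hal Haln).
  - intros t w u Hs; rewrite regularizer_cexp by apply (side_t t w Hs); ring.
  - apply (EE_spec n _ _ z (good_one al n Hal Haln)). }
assert (S2 : sectorial_integral A (fun z => Cmult (regularizer n z) (cpower z (- al))) x =
  (k * EE n (zp al) x)%V).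
{ apply (sectorial_Lam _ (fun w => Cpow (qq w) n * zp al w)%C).
  - apply (zp_good al n Hal Haln).
  - intros t w u Hs; assert (Ht := side_t t w Hs).
    rewrite regularizer_cexp, cpower_cexp by lra; reflexivity.
  - apply (EE_spec n _ _ x (zp_good al n Hal Haln)). }
assert (Hlin := EE_lin al n Hal Haln).
assert (E0 : EE n (fun _ => RtoC 1) (/ c * y)%V = EE n (zp al) x).
{ rewrite (lin_scal _ Hlin), Hb; module; field; exact Hc. }
unfold neg_frac_power; fold n; apply (@iota_unique C_AbsRing H).
- intros z; rewrite S1, S2; intros E.
  apply minus_zero_eq.
  assert (Hz : EE n (fun _ => RtoC 1) (z - / c * y)%V = vzero).
  { rewrite (lin_sub _ _ _ Hlin), E0.
    replace (EE n (fun _ => RtoC 1) z) with (EE n (zp al) x); [module|].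
    replace (EE n (zp al) x) with (/ k * (k * EE n (zp al) x))%V by (module; field; exact Hk).
    rewrite <- E; module; field; exact Hk. }
  assert (Hs := EE_spec n _ _ (z - / c * y)%V (good_one al n Hal Haln)).
  rewrite Hz in Hs; destruct n as [|j]; [simpl in Haln; lra|].
  apply (Lam_qq_inj j).
  apply (Lam_ext) with (2 := Hs); intros; apply Cmult_1_r.
- rewrite S1, S2, E0; reflexivity.
Qed.

(** * Splitting the integral and the decay rate *)

Section Decay.

Variable beta : R.
Hypothesis Hbeta : 0 < beta.
Hypothesis Hpoly : exists C t1 : R, forall t, t1 <= t ->
  bdd (fun x => T t (Rs (RtoC 1) x)) (C * Rpower t (- (1 / beta))).
Notation B := (Rs (RtoC 0)).

Let D0 : dom (RtoC 0) := or_introl eq_refl.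

Lemma opexp_Kr_iter t r m x : 0 < r ->
  opexp B t (Nat.iter m (Kr r) x) = Nat.iter m (Kr r) (opexp B t x).
Proof.
intros Hr; assert (HB := Rs_lin _ D0); assert (HK := Kr_lin r Hr).
assert (Dr := Kr_dom r Hr).
induction m as [|m IH]; [reflexivity|].
change (opexp B t (Kr r (Nat.iter m (Kr r) x)) = Kr r (Nat.iter m (Kr r) (opexp B t x))).
rewrite <- IH; symmetry; apply opexp_comm; [exact HB|exact HK|].
intros y; unfold Kr; rewrite (lin_scal _ HB); f_equal; now apply Rs_comm.
Qed.

Lemma opexp_gx al m t x v : opexp B t (gx al m x v) = gx al m (opexp B t x) v.
Proof.
unfold gx; rewrite (lin_scal _ (opexp_lin H B t (Rs_lin _ D0))).
f_equal; apply opexp_Kr_iter, exp_pos.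
Qed.

Lemma gx_decay al : 0 < al -> exists (m : nat) (K t1 : R),
  (Z.to_nat (up al) <= m)%nat /\ 0 < K /\ forall t x v, t1 <= t -> 1 <= t /\
  |{gx al m (opexp B t x) v}| <=
    K * (1 + ln t) / Rpower t (al / (2 + beta)) * |{x}| * dexp al (- (ln t / (2 + beta))) v.
Proof.
intros Hal; set (mu := Z.to_nat (up al)).
assert (Hmu : al < INR mu) by now apply up_nat.
assert (Hmu1 : (1 <= mu)%nat) by (apply (INR_lt 0 mu); simpl; lra).
set (j := Z.to_nat (up beta)).
assert (Hj : beta < INR j) by now apply up_nat.
assert (Hj1 : (1 <= j)%nat) by (apply (INR_lt 0 j); simpl; lra).
destruct (est_log) as [C1 [HC1 E1]].
destruct (est_decay_pow beta Hbeta Hpoly j mu ltac:(lra) Hj1 Hmu1)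
  as [C2 [HC2 E2]].
set (m := (mu * (2 * j + 2))%nat) in *.
(* [est_log] consumes two of the m resolvents; the other q are bounded by c0^q. *)
assert (Hm2 : exists q, m = (q + 2)%nat) by (exists (m - 2)%nat; unfold m; nia).
destruct Hm2 as [q Hq].
assert (Hcq : 1 <= c0 ^ q) by (apply pow_R1_Rle; exact Hc0).
exists m, (c0 ^ q * C1 + C2), (Rmax 1 (INR mu)).
split; [unfold m; nia|]; split; [nra|]; intros t x v Ht.
assert (Ht1 := Rmax_l 1 (INR mu)); assert (Ht2 := Rmax_r 1 (INR mu)).
assert (Ht3 : 1 <= t) by lra; split; [exact Ht3|].
assert (Hln : 0 <= ln t) by (rewrite <- ln_1; apply ln_le; lra).
assert (Hx := vnorm_ge_0 x); assert (Hev := exp_pos v).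
(* The logarithm of the crossover r^{2+beta} t = 1, and the centre of the majorant. *)
set (vs := - (ln t / (2 + beta))).
assert (Hvs : (2 + beta) * vs = - ln t) by (unfold vs; field; lra).
replace ((c0 ^ q * C1 + C2) * (1 + ln t) / Rpower t (al / (2 + beta))) with
  ((c0 ^ q * C1 + C2) * (1 + ln t) * exp (al * vs)).
2: { unfold Rdiv at 1; f_equal; unfold Rpower; rewrite <- exp_Ropp; f_equal; unfold vs; field; lra. }
unfold gx; apply Rle_trans with (1 := norm_scal_R _ _); rewrite Rabs_pos_eq by apply Rlt_le, exp_pos.
unfold dexp.
assert (Hcase : exists E, |{Nat.iter m (Kr (exp v)) (opexp B t x)}| <= E * |{x}| /\ 0 <= E /\
  exp (al * v) * E <= (c0 ^ q * C1 + C2) * (1 + ln t) * exp (al * vs) * exp (- (al * Rabs (v - vs)))).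
{ assert (HC0 : 0 <= c0 ^ q * C1) by nra.
  destruct (Rle_dec v vs) as [Hv|Hv].
  - exists (c0 ^ q * (C1 * (1 + ln t))); split; [|split; [nra|]].
    + rewrite Hq, iter_add, Rmult_assoc.
      apply Rle_trans with (1 := bdd_iter _ c0 q ltac:(lra) (Kr_bdd _ Hev) _).
      apply Rmult_le_compat_l; [lra|]; now apply E1.
    + rewrite Rabs_left1, Rmult_assoc, <- exp_plus by lra.
      replace (al * vs + - (al * - (v - vs))) with (al * v) by ring.
      assert (He := exp_pos (al * v)).
      rewrite (Rmult_comm (exp (al * v))); apply Rmult_le_compat_r; [lra|nra].
  - exists (C2 * exp (- (INR mu * ((2 + beta) * (v - vs))))); split; [|split].
    + apply Rle_trans with (1 := E2 t (exp v) ltac:(lra) Hev x).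
      apply Rmult_le_compat_r; [exact Hx|]; right.
      unfold Rdiv; f_equal; rewrite exp_Ropp; f_equal.
      rewrite <- exp_INR_mult; f_equal.
      rewrite Rmult_minus_distr_l, Hvs; unfold Rpower; rewrite ln_exp.
      replace ((2 + beta) * v - - ln t) with (beta * v + (v + v) + ln t) by ring.
      rewrite !exp_plus, exp_ln by lra; simpl; ring.
    + apply Rmult_le_pos; [lra|apply Rlt_le, exp_pos].
    + rewrite Rabs_pos_eq by lra.
      replace (exp (al * v) * (C2 * exp (- (INR mu * ((2 + beta) * (v - vs)))))) with
        (C2 * (exp (al * vs) * exp (al * (v - vs) - INR mu * ((2 + beta) * (v - vs))))).
      * rewrite (Rmult_assoc _ (exp _)); apply Rmult_le_compat; [lra| |nra|].
        -- apply Rmult_le_pos; apply Rlt_le, exp_pos.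
        -- apply Rmult_le_compat_l; [apply Rlt_le, exp_pos|]; apply exp_le.
           (* Since mu > al, the decay e^{-mu (2+beta) (v - vs)} beats the growth e^{al v} with at
              least rate al to spare, so the same rate al holds on both sides of [vs]. *)
           assert (H1 : 2 * al <= INR mu * (2 + beta)) by nra.
           assert (H2 : 2 * al * (v - vs) <= INR mu * (2 + beta) * (v - vs)) by (apply Rmult_le_compat_r; lra).
           lra.
      * rewrite <- exp_plus, (Rmult_comm (exp (al * v))), Rmult_assoc, <- exp_plus.
        f_equal; f_equal; ring. }
destruct Hcase as [E [HE1 [HE2 HE3]]].
apply Rle_trans with (exp (al * v) * (E * |{x}|)).
- apply Rmult_le_compat_l; [apply Rlt_le, exp_pos|exact HE1].
- rewrite <- Rmult_assoc.
  replace ((c0 ^ q * C1 + C2) * (1 + ln t) * exp (al * vs) * |{x}| * exp (- (al * Rabs (v - vs)))) with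
   ((c0 ^ q * C1 + C2) * (1 + ln t) * exp (al * vs) * exp (- (al * Rabs (v - vs))) * |{x}|) by ring.
  now apply Rmult_le_compat_r.
Qed.

(** e^{-tB} passes under the integral and commutes with K_r, so it acts on x inside [gx]; the
    majorant centred at the crossover integrates to its height times 2 / al. *)
Lemma neg_frac_decay al : 0 < al -> exists K t1 : R, 0 < K /\ forall t, t1 <= t -> 1 <= t /\
  bdd (fun x => opexp B t (neg_frac_power A al x)) (K * (1 + ln t) / Rpower t (al / (2 + beta))).
Proof.
intros Hal; destruct (gx_decay al Hal) as [m [K [t1 [Hm [HK Hdec]]]]].
assert (Haln := up_nat al Hal).
destruct (neg_frac_power_LI al m Hal Hm) as [c [Hc Hfrac]].
assert (Hci := Cmod_ge_0 (/ c)).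
exists ((Cmod (/ c) + 1) * (2 * K / al)), t1; split.
{ apply Rmult_lt_0_compat; [lra|apply Rdiv_lt_0_compat; lra]. }
intros t Ht; destruct (Hdec t vzero 0 Ht) as [Ht1 _]; split; [exact Ht1|]; intros x.
assert (Hcont := gx_cont al m Hal).
assert (Hx := vnorm_ge_0 x).
assert (Hpm : 0 < c0 ^ m) by (apply pow_lt; lra).
destruct (LI_ex H (gx al m x) (2 * c0 ^ m * |{x}|) (de al (Z.to_nat (up al))) 0) as [y [Hy _]].
{ exact (Hcont x). }
{ repeat first [lra|apply Rmult_le_pos]. }
{ now apply de_pos. }
{ intros u; now apply gx_bound. }
rewrite (Hfrac x y Hy).
assert (Hlin := opexp_lin H B t (Rs_lin _ D0)).
rewrite (lin_scal _ Hlin).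
assert (Hy2 := LI_lin (opexp B t) _ _ Hlin (Hcont x) Hy).
assert (Hy3 : LI (gx al m (opexp B t x)) (opexp B t y)).
{ apply (LI_ext H) with (2 := Hy2); intros u; apply opexp_gx. }
assert (Hln : 0 <= ln t) by (rewrite <- ln_1; apply ln_le; lra).
assert (HR : 0 < Rpower t (al / (2 + beta))) by apply exp_pos.
assert (HP : 0 <= K * (1 + ln t) / Rpower t (al / (2 + beta)) * |{x}|).
{ apply Rmult_le_pos; [apply Rdiv_le_0_compat; [nra|exact HR]|exact Hx]. }
assert (Hn := LI_norm_le H _ _ _ al (- (ln t / (2 + beta))) (Hcont (opexp B t x)) HP Hal
  (fun v => proj2 (Hdec t x v Ht)) Hy3).
apply Rle_trans with (1 := norm_scal_C _ _).
set (Q := K * (1 + ln t) / Rpower t (al / (2 + beta)) * |{x}|) in *.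
replace ((Cmod (/ c) + 1) * (2 * K / al) * (1 + ln t) / Rpower t (al / (2 + beta)) * |{x}|) with
  ((Cmod (/ c) + 1) * (2 * Q / al)) by (unfold Q; field; split; lra).
apply Rmult_le_compat; [exact Hci|apply vnorm_ge_0|lra|exact Hn].
Qed.

End Decay.

End StableSemigroup.

Arguments Rs {H} A w y.

(** * Hypotheses and conclusion in terms of the original definitions *)

Lemma semigroup_bsg (H : HilbertSpace) (T : R -> H -> H) :
  C0_semigroup T -> (exists M : R, forall t, 0 <= t -> Rbar_le (op_norm (T t)) M) ->
  exists M, bsg T M.
Proof.
intros [Hl H0 Hp Hc] [M HM]; exists (Rmax 1 M); split.
- apply Rmax_l.
- intros t Ht; now apply is_linear_lin, Hl.
- exact H0.
- exact Hp.
- intros t Ht; apply bdd_ge with M; [apply Rmax_r|].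
  apply op_norm_bdd; [now apply is_linear_lin, Hl|now apply HM].
- intros x; apply filterlim_at_right_norm, Hc.
Qed.

Lemma generator_ngen (H : HilbertSpace) (T : R -> H -> H) (A : operator H) :
  is_generator T (op_opp A) -> forall x y, A x y <-> ngen T x y.
Proof.
intros HG x y.
assert (HG' : A x y <-> filterlim (fun t => scal (RtoC (/ t)) (minus (T t x) x)) (at_right 0) (locally (opp y))).
{ rewrite <- (HG x (opp y)); unfold op_opp; now rewrite opp_opp. }
apply (iff_trans HG').
apply (iff_trans (filterlim_at_right_norm (V := H) (fun t => RtoC (/ t) * (T t x - x))%V (- y)%V)).
assert (E : forall h, |{RtoC (/ h) * (x - T h x) - y}| =
  |{RtoC (/ h) * (T h x - x) - - y}|).
{ intros h; rewrite <- norm_oppV; f_equal.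
  module. }
split; intros Hf e He.
- destruct (Hf e He) as [d [Hd Hh]]; exists d; split; [exact Hd|]; intros h Hh'.
  rewrite E; now apply Rlt_le, Hh.
- destruct (Hf (e / 2)) as [d [Hd Hh]]; [lra|]; exists d; split; [exact Hd|]; intros h Hh'.
  rewrite <- E; apply Rle_lt_trans with (1 := Hh h Hh'); lra.
Qed.

Theorem theorem4p4 :
  forall (H : HilbertSpace) (T : R -> H -> H) (A : operator H) (beta : R),
    0 < beta ->
    C0_semigroup T ->
    is_generator T (op_opp A) ->
    polynomially_stable T A beta ->
    forall alpha : R, 0 < alpha ->
      let k := Int_part (2 * alpha / (2 + beta)) in
      bigO (fun t => op_norm (fun x =>
              exp_op (fun y => scal (RtoC (- t)) (op_inv A y))
                     (neg_frac_power A alpha x)))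
           (fun t => powerRZ (ln t) (k + 1) / Rpower t (alpha / (2 + beta))).
Proof.
intros H T A beta Hbeta HC0 HG [Hbound [C [t0 [HC Hdec]]]] al Hal k.
destruct (semigroup_bsg H T HC0 Hbound) as [M HT].
assert (HA := generator_ngen H T A HG).
assert (D1 : 0 < fst (RtoC 1)) by (simpl; lra).
assert (HR : forall y, op_inv (op_one_plus A) y = Rs A (RtoC 1) y).
{ intros y; unfold op_inv; apply (@iota_unique C_AbsRing H).
  - intros x [w [Hw E]]; apply (Rs_unique_pos H T A M HT HA); [exact D1|].
    replace (y - RtoC 1 * x)%V with w; [exact Hw|].
    rewrite E; change (w = (x + w) - RtoC 1 * x)%V; module.
  - exists (y - RtoC 1 * Rs A (RtoC 1) y)%V; split; [now apply (Rs_spec_pos H T A M HT HA)|].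
    change (y = Rs A (RtoC 1) y + (y - RtoC 1 * Rs A (RtoC 1) y))%V; module. }
(* The maximum with 1 keeps t nonnegative, where [T t] is known to be linear. *)
assert (Hpoly : forall t, Rmax t0 1 <= t ->
  bdd (fun x => T t (Rs A (RtoC 1) x)) (C * Rpower t (- (1 / beta)))).
{ intros t Ht; assert (Ht0 := Rmax_l t0 1); assert (Ht1 := Rmax_r t0 1).
  apply op_norm_bdd.
  - apply (lin_comp (T t)); [apply (bsg_lin T M HT); lra|now apply (Rs_lin_pos H T A M HT HA)].
  - assert (E : (fun x => T t (Rs A (RtoC 1) x)) = (fun x => T t (op_inv (op_one_plus A) x))).
    { apply FunctionalExtensionality.functional_extensionality; intros x; now rewrite HR. }
    rewrite E; apply Hdec; lra. }
assert (decay : exists t, 0 <= t /\ bdd (fun x => T t (Rs A (RtoC 1) x)) (/ 2)).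
(* For t >= s^beta the bound C t^{-1/beta} is at most C / (2 C + 1) < 1/2. *)
{ set (s := 2 * C + 1); set (t := Rmax (Rmax t0 1) (Rpower s beta)).
  assert (T1 := Rmax_l (Rmax t0 1) (Rpower s beta)); assert (T2 := Rmax_r (Rmax t0 1) (Rpower s beta)).
  assert (T3 := Rmax_r t0 1); fold t in T1, T2.
  exists t; split; [lra|]; apply bdd_ge with (2 := Hpoly t T1).
  assert (Hs : Rpower t (- (1 / beta)) <= / s).
  { rewrite Rpower_Ropp; apply Rinv_le_contravar; [unfold s; lra|].
    replace s with (Rpower (Rpower s beta) (1 / beta)).
    - apply Rle_Rpower_l; [apply Rlt_le, Rdiv_lt_0_compat; lra|split; [apply exp_pos|exact T2]].
    - rewrite Rpower_mult; replace (beta * (1 / beta)) with 1 by (field; lra).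
      apply Rpower_1; unfold s; lra. }
  apply Rle_trans with (C * / s); [apply Rmult_le_compat_l; lra|].
  apply Rmult_le_reg_r with (2 * s); [unfold s; lra|].
  field_simplify; [unfold s; lra|unfold s; lra]. }
destruct (Rs_sector H T A M HT HA decay) as [c0 [Hc0 Hsec]].
destruct (neg_frac_decay H T A M HT HA decay c0 Hc0 Hsec beta Hbeta
  (ex_intro _ C (ex_intro _ _ Hpoly)) al Hal) as [K [t1 [HK Hfin]]].
assert (D0 : dom (RtoC 0)) by now left.
assert (HB : forall y, op_inv A y = Rs A (RtoC 0) y).
{ intros y; unfold op_inv; apply (@iota_unique C_AbsRing H).
  - intros x Hx; apply (Rs_unique H T A M HT HA decay); [exact D0|].
    replace (y - RtoC 0 * x)%V with y by module; exact Hx.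
  - assert (E := Rs_spec H T A M HT HA decay _ y D0).
    replace (y - RtoC 0 * Rs A (RtoC 0) y)%V with y in E by module; exact E. }
assert (Hk : (0 <= k)%Z).
{ destruct (base_Int_part (2 * al / (2 + beta))) as [_ Hip]; fold k in Hip.
  assert (H1 : 0 < 2 * al / (2 + beta)) by (apply Rdiv_lt_0_compat; lra).
  assert (H2 : (-1 < k)%Z) by (apply lt_IZR; lra); lia. }
(* For t >= e, ln t >= 1, so 1 + ln t <= 2 ln t, and ln t <= (ln t)^{k+1} because k >= 0. *)
exists (2 * K), (Rmax t1 (exp 1)); split; [lra|]; intros t Ht.
assert (M1 := Rmax_l t1 (exp 1)); assert (M2 := Rmax_r t1 (exp 1)).
destruct (Hfin t ltac:(lra)) as [Ht1 Hb].
assert (Hln : 1 <= ln t) by (rewrite <- (ln_exp 1); apply ln_le; [apply exp_pos|lra]).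
assert (HRp : 0 < Rpower t (al / (2 + beta))) by apply exp_pos.
assert (Hpw : ln t <= powerRZ (ln t) (k + 1)).
{ rewrite <- (Z2Nat.id (k + 1)) by lia; rewrite <- pow_powerRZ.
  replace (Z.to_nat (k + 1)) with (S (Z.to_nat k)) by lia.
  assert (H1 := pow_R1_Rle (ln t) (Z.to_nat k) Hln); simpl; nra. }
assert (E : (fun x => exp_op (fun y => scal (RtoC (- t)) (op_inv A y)) (neg_frac_power A al x)) =
  (fun x => opexp (Rs A (RtoC 0)) t (neg_frac_power A al x))).
{ replace (op_inv A) with (Rs A (RtoC 0)); [reflexivity|].
  apply FunctionalExtensionality.functional_extensionality; intros y; now rewrite HB. }
rewrite E; apply bdd_op_norm.
- apply Rmult_le_pos; [lra|]; apply Rdiv_le_0_compat; lra.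
- apply bdd_ge with (2 := Hb).
  unfold Rdiv; rewrite <- Rmult_assoc; apply Rmult_le_compat_r; [apply Rlt_le, Rinv_0_lt_compat, HRp|].
  nra.
Qed.
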